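(* For all $\beta\ge3$ the bilinear form $a^s:U\times U\to\mathbb R$ is coercive, $$|||\boldsymbol u|||^2\le C_1\,a^s(\boldsymbol u,\boldsymbol u)\quad\text{for all }\boldsymbol u\in U,$$ and bounded, $$|a^s(\boldsymbol u,\boldsymbol v)|\le C_2\,|||\boldsymbol u|||\,|||\boldsymbol v|||\quad\text{for all }\boldsymbol u,\boldsymbol v\in U.$$ The constants $C_1,C_2>0$ do not depend on $\Omega$, $\mathcal T$, or $\varepsilon$; $C_1$ is independent of $\beta$ but $C_2$ is not. Furthermore, there are constants $c,C>0$ independent of $\mathcal T$ and $\varepsilon$ such that $$c\,\|\boldsymbol u\|_{U,1}\le|||\boldsymbol u|||\le C\,\|\boldsymbol u\|_{U,2}\quad\text{for all }\boldsymbol u\in U.$$ The variational inequality $$\text{find }\boldsymbol u\in K^s:\qquad a^s(\boldsymbol u,\boldsymbol v-\boldsymbol u)\ge F(\boldsymbol v-\boldsymbol u)\quad\text{for all }\boldsymbol v\in K^s\qquad(\mathrm{VI})$$ is uniquely solvable and equivalent to the problem $$-\varepsilon\Delta u+u=f\ \text{in }\Omega,\qquad u\ge0,\quad\frac{\partial u}{\partial\boldsymbol n}\ge0,\quad u\frac{\partial u}{\partial\boldsymbol n}=0\ \text{on }\Gamma\qquad(\mathrm{SP})$$ in the following sense: if $u\in H^1(\Omega)$ solves (SP), then $\boldsymbol u=(u,\boldsymbol\sigma,\rho,\widehat u^a,\widehat u^b,\widehat\sigma^a,\widehat\sigma^b)\in K^s$ with $\boldsymbol\sigma:=\varepsilon^{1/4}\nabla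 u$, $\rho:=\mathrm{div}\,\boldsymbol\sigma$, $\widehat u^\star|_{\partial T}:=u|_{\partial T}$, $\widehat\sigma^\star|_{\partial T}:=\boldsymbol\sigma\cdot\boldsymbol n_T|_{\partial T}$ for all $T\in\mathcal T$ ($\star\in\{a,b\}$) solves (VI). On the other hand, if $\boldsymbol u=(u,\boldsymbol\sigma,\rho,\widehat u^a,\widehat u^b,\widehat\sigma^a,\widehat\sigma^b)\in K^s$ solves (VI), then $u\in H^1(\Omega)$ solves (SP). Moreover, the unique solution $\boldsymbol u\in K^s$ of (VI) satisfies $$b(\boldsymbol u,\Theta_\beta\boldsymbol w)=F(\boldsymbol w)\quad\text{for all }\boldsymbol w\in U.$$
   Context: Domain and mesh. $0<\varepsilon\le1$. $\Omega\subset\mathbb R^d$ ($d\in\{2,3\}$) is a bounded simply connected Lipschitz domain with boundary $\Gamma=\partial\Omega$ and outer unit normal $\boldsymbol n=\boldsymbol n_\Omega$; $f\in L^2(\Omega)$. $(\cdot,\cdot)$ and $\|\cdot\|$ are the $L^2(\Omega)$ inner product and norm; $\langle\cdot,\cdot\rangle_{\partial\omega}$ is the (extended) $L^2(\partial\omega)$ duality. $\mathcal T$ is a finite disjoint partition of $\Omega$ into open Lipschitz sets $T$ with $\bigcup_{T\in\mathcal T}\overline T=\overline\Omega$; $\boldsymbol n_T$ is the outer unit normal on $\partial T$; $\mathcal S=\{\partial T:T\in\mathcal T\}$. $\nabla_{\mathcal T},\mathrm{div}_{\mathcal T},\Delta_{\mathcal T}$ are the $\mathcal T$-piecewise gradient,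 divergence, Laplacian. Skeleton spaces. $H^{1/2}(\mathcal S)$ is the set of $\widehat u\in\prod_TH^{1/2}(\partial T)$ for which there is $w\in H^1(\Omega)$ with $\widehat u|_{\partial T}=w|_{\partial T}$ for all $T$; $H^{-1/2}(\mathcal S)$ is the set of $\widehat\sigma\in\prod_TH^{-1/2}(\partial T)$ for which there is $\boldsymbol q\in\boldsymbol H(\mathrm{div},\Omega)$ with $\widehat\sigma|_{\partial T}=(\boldsymbol q\cdot\boldsymbol n_T)|_{\partial T}$ for all $T$. Norms: $\|\widehat u\|_{1/2,\mathcal S}$ is the infimum of $(\|w\|^2+\varepsilon^{1/2}\|\nabla w\|^2)^{1/2}$ over all such $w$; $\|\widehat\sigma\|_{-1/2,\mathcal S}$ is the infimum of $(\|\boldsymbol q\|^2+\varepsilon\|\mathrm{div}\,\boldsymbol q\|^2)^{1/2}$ over all such $\boldsymbol q$. Restrictions: $\widehat u|_\Gamma:=w|_\Gamma\in H^{1/2}(\Gamma)$, $\widehat\sigma|_\Gamma:=(\boldsymbol q\cdot\boldsymbol n_\Omega)|_\Gamma\in H^{-1/2}(\Gamma)$ (independent of the chosen $w,\boldsymbol q$). $\langle\widehat u,\boldsymbol\tau\cdot\boldsymbol n\rangle_{\mathcal S}=\sum_T\langle\widehat u|_{\partial T},\boldsymbol\tau\cdot\boldsymbol n_T\rangle_{\partial T}$, $\langle\widehat\sigma,v\rangle_{\mathcal S}=\sum_T\langle\widehat\sigma|_{\partial T},v\rangle_{\partial T}$. For $\widehat v\in H^{1/2}(\Gamma)$, $\|\widehat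 v\|_{H^{1/2}(\Gamma)}=\inf\{(\|w\|^2+\varepsilon\|\nabla w\|^2)^{1/2}:w\in H^1(\Omega),w|_\Gamma=\widehat v\}$. Trial and test spaces. $U$ is the set of $\boldsymbol u=(u,\boldsymbol\sigma,\rho,\widehat u^a,\widehat u^b,\widehat\sigma^a,\widehat\sigma^b)\in L^2(\Omega)\times L^2(\Omega)^d\times L^2(\Omega)\times H^{1/2}(\mathcal S)\times H^{1/2}(\mathcal S)\times H^{-1/2}(\mathcal S)\times H^{-1/2}(\mathcal S)$ with $\widehat u^a|_\Gamma=\widehat u^b|_\Gamma$. Norms: $\|\boldsymbol u\|_{U,1}^2=\|u\|^2+\|\boldsymbol\sigma\|^2+\varepsilon\|\rho\|^2+\varepsilon^{3/2}\|\widehat u^a\|_{1/2,\mathcal S}^2+\varepsilon\|\widehat u^b\|_{1/2,\mathcal S}^2+\varepsilon^{3/2}\|\widehat\sigma^a\|_{-1/2,\mathcal S}^2+\varepsilon^{5/2}\|\widehat\sigma^b\|_{-1/2,\mathcal S}^2$, $\|\boldsymbol u\|_{U,2}^2=\|u\|^2+\|\boldsymbol\sigma\|^2+\varepsilon\|\rho\|^2+\|\widehat u^a\|_{1/2,\mathcal S}^2+\varepsilon^{-1/2}\|\widehat u^b\|_{1/2,\mathcal S}^2+\|\widehat\sigma^a\|_{-1/2,\mathcal S}^2+\varepsilon^{1/2}\|\widehat\sigma^b\|_{-1/2,\mathcal S}^2$. $V=H^1(\mathcal T)\times\boldsymbol H(\mathrm{div},\mathcal T)\times H^1(\Delta,\mathcal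 T)$, where $H^1(\mathcal T)$, $\boldsymbol H(\mathrm{div},\mathcal T)$ are the spaces of $L^2$ functions (fields) that are in $H^1(T)$, resp. $\boldsymbol H(\mathrm{div},T)$, on each $T$, and $H^1(\Delta,\mathcal T)=\{w\in H^1(\mathcal T):\Delta w|_T\in L^2(T)\ \forall T\}$; for $\boldsymbol v=(\mu,\boldsymbol\tau,v)\in V$, $\|\boldsymbol v\|_V^2=\varepsilon^{-1}\|\mu\|^2+\|\nabla_{\mathcal T}\mu\|^2+\varepsilon^{-1/2}\|\boldsymbol\tau\|^2+\|\mathrm{div}_{\mathcal T}\boldsymbol\tau\|^2+\|v\|^2+(\varepsilon^{1/2}+\varepsilon)\|\nabla_{\mathcal T}v\|^2+\varepsilon^{3/2}\|\Delta_{\mathcal T}v\|^2$, induced by the inner product $(\cdot,\cdot)_V$. Forms. For $\boldsymbol u\in U$, $\boldsymbol v=(\mu,\boldsymbol\tau,v)\in V$: $b(\boldsymbol u,\boldsymbol v)=(\rho,\mu)+(\boldsymbol\sigma,\nabla_{\mathcal T}\mu)-\langle\widehat\sigma^a,\mu\rangle_{\mathcal S}+\varepsilon^{-1/4}(\boldsymbol\sigma,\boldsymbol\tau)+(u,\mathrm{div}_{\mathcal T}\boldsymbol\tau)-\langle\widehat u^a,\boldsymbol\tau\cdot\boldsymbol n\rangle_{\mathcal S}+\varepsilon^{3/4}(\boldsymbol\sigma,\nabla_{\mathcal T}v)-\varepsilon^{3/4}\langle\widehat\sigma^b,v\rangle_{\mathcal S}+(u,v)+\varepsilon^{5/4}(\rho,\Delta_{\mathcal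 T}v)+\varepsilon^{1/4}(\boldsymbol\sigma,\nabla_{\mathcal T}v)-\varepsilon^{1/2}\langle\widehat u^b,\nabla_{\mathcal T}v\cdot\boldsymbol n\rangle_{\mathcal S}$, $L(\boldsymbol v)=(f,v-\varepsilon^{1/2}\Delta_{\mathcal T}v)$. $B:U\to V'$, $(B\boldsymbol u)(\boldsymbol v)=b(\boldsymbol u,\boldsymbol v)$; $\Theta:U\to V$ is defined by $(\Theta\boldsymbol u,\boldsymbol v)_V=b(\boldsymbol u,\boldsymbol v)$ for all $\boldsymbol v\in V$; $\Theta_\beta=\beta\Theta$. Traces: $\gamma_0\boldsymbol u=\widehat u^a|_\Gamma$, $\gamma_{\boldsymbol n}\boldsymbol u=\widehat\sigma^a|_\Gamma$. Then $a^s(\boldsymbol u,\boldsymbol v)=b(\boldsymbol u,\Theta_\beta\boldsymbol v)+\tfrac12\varepsilon^{1/4}(\langle\gamma_{\boldsymbol n}\boldsymbol u,\gamma_0\boldsymbol v\rangle_\Gamma+\langle\gamma_{\boldsymbol n}\boldsymbol v,\gamma_0\boldsymbol u\rangle_\Gamma)$ and $F(\boldsymbol v)=L(\Theta_\beta\boldsymbol v)$ for $\boldsymbol u,\boldsymbol v\in U$. Energy-based norm: $|||\boldsymbol u|||^2=\|B\boldsymbol u\|_{V'}^2+\varepsilon^{-1/2}\|\gamma_0\boldsymbol u\|_{H^{1/2}(\Gamma)}^2$, with $\|\cdot\|_{V'}$ the dual norm of $\|\cdot\|_V$. Orderings and cone. $\widehat v\ge0$ in $H^{1/2}(\Gamma)$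 means that $\widehat v$ is the weak $H^{1/2}(\Gamma)$-limit of a sequence of non-negative Lipschitz continuous functions on $\Gamma$. $\widehat\sigma\ge0$ in $H^{-1/2}(\Gamma)$ means $\langle\widehat\sigma,\widehat v\rangle_\Gamma\ge0$ for all $\widehat v\in H^{1/2}(\Gamma)$, $\widehat v\ge0$. $K^s=\{\boldsymbol u\in U:\gamma_0\boldsymbol u\ge0,\gamma_{\boldsymbol n}\boldsymbol u\ge0\}$. In (SP), $u|_\Gamma$ is the trace, $\partial u/\partial\boldsymbol n\in H^{-1/2}(\Gamma)$ is defined by duality, and the last condition means $\langle\partial u/\partial\boldsymbol n,u\rangle_\Gamma=0$. *)

(* Defs.v *)
From HB Require Import structures.
From mathcomp Require Import all_boot all_order all_algebra.
From mathcomp Require Import all_classical all_reals all_analysis.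
Set Implicit Arguments.
Unset Strict Implicit.
Unset Printing Implicit Defensive.
Import Order.TTheory GRing.Theory Num.Theory numFieldNormedType.Exports.
Local Open Scope classical_set_scope.
Local Open Scope ring_scope.

(* The product (Borel) sigma-algebra on row vectors, generated by the
   coordinate maps as for tuples. *)
Section measurable_row.
Context (R : realType) (d : nat).

Let coors : 'I_d -> 'rV[R]_d -> R := fun i x => x 0 i.

Let rV_set0 : g_sigma_preimage coors set0.
Proof. exact: sigma_algebra0. Qed.

Let rV_setC A : g_sigma_preimage coors A -> g_sigma_preimage coors (~` A).
Proof. exact: sigma_algebraC. Qed.

Let rV_bigcup (F : (set 'rV[R]_d)^nat) :
  (forall i, g_sigma_preimage coors (F i)) ->
  g_sigma_preimage coors (\bigcup_i F i).
Proof. exact: sigma_algebra_bigcup. Qed.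

HB.instance Definition _ := @isMeasurable.Build default_measure_display
  'rV[R]_d (g_sigma_preimage coors) rV_set0 rV_setC rV_bigcup.

End measurable_row.

Section lebesgue_row.
Context {R : realType}.

Lemma measurable_coord d (i : 'I_d) :
  measurable_fun setT (fun x : 'rV[R]_d => x 0 i).
Proof.
move=> _ Y mY; rewrite setTI; apply: sub_sigma_algebra.
rewrite -bigcup_seq/=; exists i => /=; first by rewrite mem_index_enum.
by exists Y => //; rewrite setTI.
Qed.

Lemma measurable_fun_row d' (S : measurableType d') d (f : S -> 'rV[R]_d) :
  (forall i, measurable_fun setT (fun s => f s 0 i)) -> measurable_fun setT f.
Proof.
move=> mf.
apply: (@measurability _ _ _ _ _ f (\big[setU/set0]_(i < d)
  preimage_set_system setT (fun x : 'rV[R]_d => x 0 i) measurable)) => //.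
move=> _ [A + <-]; rewrite -bigcup_seq => -[i _] [B mB <-]; rewrite setTI.
exact: mf.
Qed.

Definition cons_row d (p : R * 'rV[R]_d) : 'rV[R]_d.+1 :=
  @row_mx R 1 1 d (p.1)%:M p.2.

Definition uncons_row d (x : 'rV[R]_d.+1) : R * 'rV[R]_d :=
  (@lsubmx R 1 1 d x 0 0, @rsubmx R 1 1 d x).

Lemma cons_rowK d : cancel (@uncons_row d) (@cons_row d).
Proof.
move=> x; rewrite /cons_row /uncons_row /=.
by rewrite -mx11_scalar hsubmxK.
Qed.

Lemma uncons_rowK d : cancel (@cons_row d) (@uncons_row d).
Proof.
move=> [t y]; rewrite /cons_row /uncons_row /= row_mxKl row_mxKr.
by rewrite mxE eqxx mulr1n.
Qed.

Lemma measurable_cons_row d : measurable_fun setT (@cons_row d).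
Proof.
apply: measurable_fun_row => i.
case: (@split_ordP 1 d i) => j ->.
  rewrite (_ : (fun s => _) = fst) ?measurable_fst//; apply/funext => s.
  by apply: etrans (row_mxEl _ _ _ _) _; rewrite mxE (ord1 j) eqxx mulr1n.
rewrite (_ : (fun s => _) = (fun x : 'rV[R]_d => x 0 j) \o snd).
  exact: measurableT_comp (measurable_coord j) measurable_snd.
by apply/funext => s; exact: row_mxEr.
Qed.

Lemma measurable_uncons_row d : measurable_fun setT (@uncons_row d).
Proof.
apply: measurable_fun_pair.
  rewrite (_ : (fun x => _) = (fun x : 'rV[R]_d.+1 => x 0 (@lshift 1 d 0))).
    exact: measurable_coord.
  by apply/funext => x; rewrite mxE.
apply: measurable_fun_row => i.
rewrite (_ : (fun x => _) = (fun x : 'rV[R]_d.+1 => x 0 (@rshift 1 d i))).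
  exact: measurable_coord.
by apply/funext => x; rewrite mxE.
Qed.

Section lebesgue_cons.
Context d (mu : {sigma_finite_measure set 'rV[R]_d -> \bar R}).

Definition lebesgue_cons : set 'rV[R]_d.+1 -> \bar R :=
  pushforward (@lebesgue_measure R \x mu)%E (@cons_row d).

Let lebesgue_cons0 : lebesgue_cons set0 = 0%E.
Proof. by rewrite /lebesgue_cons /pushforward preimage_set0 measure0. Qed.

Let lebesgue_cons_ge0 A : (0 <= lebesgue_cons A)%E.
Proof. exact: (measure_ge0 (@lebesgue_measure R \x mu)%E). Qed.

Let lebesgue_cons_sigma_additive : semi_sigma_additive lebesgue_cons.
Proof.
have mc := @measurable_cons_row d.
move=> F mF tF mUF; rewrite /lebesgue_cons /pushforward preimage_bigcup.
apply: measure_semi_sigma_additive.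
- by move=> k; rewrite -[X in measurable X]setTI; exact: mc.
- apply/trivIsetP => /= i j _ _ ij; rewrite -preimage_setI.
  by move/trivIsetP : tF => /(_ _ _ _ _ ij) ->//; rewrite preimage_set0.
- by rewrite -preimage_bigcup -[X in measurable X]setTI; exact: mc.
Qed.

HB.instance Definition _ := isMeasure.Build _ _ _ lebesgue_cons
  lebesgue_cons0 lebesgue_cons_ge0 lebesgue_cons_sigma_additive.

Let lebesgue_cons_sigma_finite : sigma_finite setT lebesgue_cons.
Proof.
have /sigma_finiteP[F [TF ndF Foo]] := sigma_finiteT (@lebesgue_measure R).
have /sigma_finiteP[G [TG ndG Goo]] := sigma_finiteT mu.
exists (fun k => @uncons_row d @^-1` (F k `*` G k)).
  rewrite -preimage_bigcup -[LHS](preimage_setT (@uncons_row d)).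
  congr (_ @^-1` _); rewrite -setXTT TF TG predeqE => -[x y]; split.
    move=> [/= [n _ Fnx] [k _ Gky]]; exists (maxn n k) => //; split.
    - by move: x Fnx; exact/subsetPset/ndF/leq_maxl.
    - by move: y Gky; exact/subsetPset/ndG/leq_maxr.
  by move=> [n _ []/= ? ?]; split; exists n.
move=> k; have [mF oF] := Foo k; have [mG oG] := Goo k; split.
  rewrite -[X in measurable X]setTI; apply: measurable_uncons_row => //.
  exact: measurableX.
rewrite /lebesgue_cons /pushforward (_ : _ @^-1` _ = F k `*` G k).
  by rewrite product_measure1E// lte_mul_pinfty// ge0_fin_numE.
by rewrite -comp_preimage (_ : _ \o _ = id)//; apply/funext/uncons_rowK.
Qed.

HB.instance Definition _ := Measure_isSigmaFinite.Build _ _ _ lebesgue_cons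
  lebesgue_cons_sigma_finite.

End lebesgue_cons.

(* The Lebesgue measure on the Borel sets of R^d. *)
Fixpoint lebesgue_row d : {sigma_finite_measure set 'rV[R]_d -> \bar R} :=
  if d is d'.+1 then lebesgue_cons (lebesgue_row d') else dirac (0 : 'rV[R]_0).

End lebesgue_row.

Section sobolev.
Context {R : realType} {d : nat}.
Implicit Types (w : set 'rV[R]_d).
Local Notation leb := (@lebesgue_row R d).
Local Notation sfun := ('rV[R]_d -> R).
Local Notation vfun := ('rV[R]_d -> 'rV[R]_d).

Definition dot (x y : 'rV[R]_d) : R := \sum_i x 0 i * y 0 i.

Definition bdry w : set 'rV[R]_d := closure w `\` interior w.

(* Near each boundary point, w lies below the graph of a Lipschitz function
   psi of the coordinates orthogonal to some unit vector e; only the values of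
   psi on the hyperplane orthogonal to e matter. *)
Definition lipschitz_open w : Prop :=
  [/\ open w, bounded_set w &
    forall x, bdry w x ->
      exists (r k : R) (e : 'rV[R]_d) (psi : sfun),
        [/\ 0 < r, dot e e = 1, k.-lipschitz psi &
          forall z, ball x r z ->
            (w z <-> dot z e < psi (z - dot z e *: e))]].

Definition simply_connected w : Prop :=
  let I : set R := `[0, 1]%classic in
  connected w /\
  forall g : R -> 'rV[R]_d,
    {within I, continuous g} -> g @` I `<=` w -> g 0 = g 1 ->
    exists h : R * R -> 'rV[R]_d,
      [/\ {within I `*` I, continuous h}, h @` (I `*` I) `<=` w,
          forall t, I t -> h (0, t) = g t,
          forall t, I t -> h (1, t) = g 0 &
          forall s, I s -> h (s, 0) = g 0 /\ h (s, 1) = g 0].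

Definition simply_connected_lipschitz_domain w : Prop :=
  [/\ w !=set0, lipschitz_open w & simply_connected w].

(* Functions on w are represented by total functions on R^d, of which only the
   values on w matter, up to null sets. *)

Definition L2 w (f : sfun) : Prop :=
  measurable_fun w f /\ leb.-integrable w (EFin \o (fun x => f x ^+ 2)).

Definition L2v w (q : vfun) : Prop := forall i, L2 w (fun x => q x 0 i).

Definition ip w (f g : sfun) : R := \int[leb]_(x in w) (f x * g x).

Definition ipv w (p q : vfun) : R := \int[leb]_(x in w) dot (p x) (q x).

Definition pderiv (i : 'I_d) (f : sfun) : sfun := fun x => 'D_('e_i) f x.

Fixpoint Ck (k : nat) (f : sfun) : Prop :=
  if k is k'.+1 then
    continuous f /\
    forall i, (forall x, derivable f x 'e_i) /\ Ck k' (pderiv i f)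
  else continuous f.

Definition test_function w (f : sfun) : Prop :=
  (forall k, Ck k f) /\
  exists K, [/\ compact K, K `<=` w & forall x, ~ K x -> f x = 0].

Definition cgrad (f : sfun) : vfun := fun x => \row_i pderiv i f x.

Definition weak_grad w (f : sfun) (g : vfun) : Prop :=
  L2v w g /\ forall phi, test_function w phi -> forall i,
    ip w f (pderiv i phi) = - ip w (fun x => g x 0 i) phi.

Definition weak_div w (q : vfun) (g : sfun) : Prop :=
  L2 w g /\ forall phi, test_function w phi ->
    ipv w q (cgrad phi) = - ip w g phi.

(* Weak derivatives are unique up to null sets; [grad] and [div] select one. *)
Definition H1 w (f : sfun) : Prop := L2 w f /\ exists g, weak_grad w f g.
Definition grad w (f : sfun) : vfun := xget (cst 0) (weak_grad w f).

Definition Hdiv w (q : vfun) : Prop := L2v w q /\ exists g, weak_div w q g.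
Definition div w (q : vfun) : sfun := xget (cst 0) (weak_div w q).

Definition lap w (f : sfun) : sfun := div w (grad w f).

(* Closure of the test functions in H^1(w). *)
Definition H10 w (f : sfun) : Prop :=
  H1 w f /\ exists phi : sfun^nat,
    [/\ forall k, test_function w (phi k),
        ip w (f - phi k) (f - phi k) @[k --> \oo] --> (0 : R) &
        ipv w (grad w f - cgrad (phi k)) (grad w f - cgrad (phi k))
          @[k --> \oo] --> (0 : R)].

(* H^{1/2}(bd w) is realized as the quotient H^1(w) / H^1_0(w), H^1_0(w) being the
   kernel of the trace operator of a Lipschitz set w: the trace of f is the set
   of all functions of H^1(w) with the same boundary values as f. The inf over
   all lifts below is then the quotient norm. *)
Definition bvalue := set sfun.

Definition trace w (f : sfun) : bvalue := [set g | H1 w g /\ H10 w (g - f)].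

Definition Hhalf w (g : bvalue) : Prop := exists2 f, H1 w f & g = trace w f.

Definition Hhalf_norm (eps : R) w (g : bvalue) : R :=
  inf [set Num.sqrt (ip w f f + eps * ipv w (grad w f) (grad w f)) |
       f in [set f | H1 w f /\ trace w f = g]].

(* H^{-1/2}(bd w) is the dual of H^{1/2}(bd w); its elements are extended by 0
   off H^{1/2}(bd w) so as to be determined by their values on that space. *)
Definition Hmhalf w (s : bvalue -> R) : Prop :=
  [/\ forall f g (k : R), H1 w f -> H1 w g ->
        s (trace w (k *: f + g)) = k * s (trace w f) + s (trace w g),
      exists C, forall g, Hhalf w g -> `|s g| <= C * Hhalf_norm 1 w g &
      forall g, ~ Hhalf w g -> s g = 0].

(* <q.n, g>, by Green's formula with an arbitrary lift f of g. *)
Definition normal_trace w (q : vfun) : bvalue -> R := fun g =>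
  if `[< Hhalf w g >] then
    let f := xget 0 g in ipv w q (grad w f) + ip w (div w q) f
  else 0.

(* g is the element of H^{1/2}(bd w) given by the Lipschitz function phi on bd w;
   phi has a Lipschitz extension f, and any two of them have the same trace. *)
Definition lipschitz_bvalue w (phi : sfun) (g : bvalue) : Prop :=
  exists2 f, exists k : R, k.-lipschitz f &
    {in bdry w, f =1 phi} /\ g = trace w f.

Definition Hhalf_ge0 w (g : bvalue) : Prop :=
  Hhalf w g /\ exists (phi : sfun^nat) (v : bvalue^nat),
    [/\ forall k, exists c : R, c.-lipschitz_(bdry w) (phi k),
        forall k x, bdry w x -> 0 <= phi k x,
        forall k, lipschitz_bvalue w (phi k) (v k) &
        forall s, Hmhalf w s -> s (v k) @[k --> \oo] --> s g].

Definition Hmhalf_ge0 w (s : bvalue -> R) : Prop :=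
  forall g, Hhalf_ge0 w g -> 0 <= s g.

End sobolev.

Section dpg.
Context {R : realType} {d : nat}.
Local Notation leb := (@lebesgue_row R d).
Local Notation sfun := ('rV[R]_d -> R).
Local Notation vfun := ('rV[R]_d -> 'rV[R]_d).

Definition mesh_of (Omega : set 'rV[R]_d) (N : nat)
    (T : 'I_N -> set 'rV[R]_d) : Prop :=
  [/\ forall i, T i !=set0 /\ lipschitz_open (T i),
      forall i, T i `<=` Omega,
      forall i j, i != j -> T i `&` T j = set0 &
      closure Omega = \bigcup_i closure (T i)].

Context (Omega : set 'rV[R]_d) {N : nat} (T : 'I_N -> set 'rV[R]_d).

(* Piecewise operators, defined on the union of the mesh elements, which covers
   Omega up to a null set. *)
Definition pgrad (f : sfun) : vfun :=
  fun x => \sum_i \1_(T i) x *: grad (T i) f x.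
Definition pdiv (q : vfun) : sfun :=
  fun x => \sum_i \1_(T i) x * div (T i) q x.
Definition plap (f : sfun) : sfun :=
  fun x => \sum_i \1_(T i) x * lap (T i) f x.

Definition skel_half := 'I_N -> @bvalue R d.
Definition skel_mhalf := 'I_N -> @bvalue R d -> R.

Definition lifts_half (uh : skel_half) : set sfun :=
  [set w | H1 Omega w /\ forall i, uh i = trace (T i) w].
Definition lifts_mhalf (sh : skel_mhalf) : set vfun :=
  [set q | Hdiv Omega q /\ forall i, sh i = normal_trace (T i) q].

Definition HhalfS (uh : skel_half) : Prop := lifts_half uh !=set0.
Definition HmhalfS (sh : skel_mhalf) : Prop := lifts_mhalf sh !=set0.

Definition HhalfS_norm (eps : R) (uh : skel_half) : R :=
  inf [set Num.sqrt (ip Omega w w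
         + eps `^ (1 / 2) * ipv Omega (grad Omega w) (grad Omega w)) |
       w in lifts_half uh].
Definition HmhalfS_norm (eps : R) (sh : skel_mhalf) : R :=
  inf [set Num.sqrt (ipv Omega q q
         + eps * ip Omega (div Omega q) (div Omega q)) |
       q in lifts_mhalf sh].

(* Restrictions to the boundary of Omega, computed from an arbitrary lift. *)
Definition restr_half (uh : skel_half) : bvalue :=
  trace Omega (xget (cst 0) (lifts_half uh)).
Definition restr_mhalf (sh : skel_mhalf) : bvalue -> R :=
  normal_trace Omega (xget (cst 0) (lifts_mhalf sh)).

Definition dual_half (uh : skel_half) (tau : vfun) : R :=
  \sum_i normal_trace (T i) tau (uh i).
Definition dual_mhalf (sh : skel_mhalf) (v : sfun) : R :=
  \sum_i sh i (trace (T i) v).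

Record trial := Trial {
  tr_u : sfun; tr_sigma : vfun; tr_rho : sfun;
  tr_ua : skel_half; tr_ub : skel_half;
  tr_sa : skel_mhalf; tr_sb : skel_mhalf }.

Record test := Test { te_mu : sfun; te_tau : vfun; te_v : sfun }.
HB.instance Definition _ := gen_eqMixin test.
HB.instance Definition _ := gen_choiceMixin test.

Implicit Types (u w : trial) (x y : test) (eps beta : R).

Definition spaceU u : Prop :=
  [/\ L2 Omega (tr_u u), L2v Omega (tr_sigma u) & L2 Omega (tr_rho u)] /\
  [/\ HhalfS (tr_ua u), HhalfS (tr_ub u), HmhalfS (tr_sa u),
      HmhalfS (tr_sb u) & restr_half (tr_ua u) = restr_half (tr_ub u)].

(* On cosets of H^1_0, the pointwise combinations [k * a + b] form the coset of
   the combined boundary value. *)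
Definition comb_half (k : R) (g h : skel_half) : skel_half :=
  fun i => [set k *: a + b | a in g i & b in h i].

(* k u + w *)
Definition comb (k : R) u w : trial :=
  Trial (k *: tr_u u + tr_u w) (k *: tr_sigma u + tr_sigma w)
    (k *: tr_rho u + tr_rho w)
    (comb_half k (tr_ua u) (tr_ua w)) (comb_half k (tr_ub u) (tr_ub w))
    (fun i => k *: tr_sa u i + tr_sa w i) (fun i => k *: tr_sb u i + tr_sb w i).

Definition eqU u w : Prop :=
  [/\ {ae leb, forall z, Omega z -> tr_u u z = tr_u w z},
      {ae leb, forall z, Omega z -> tr_sigma u z = tr_sigma w z} &
      {ae leb, forall z, Omega z -> tr_rho u z = tr_rho w z}] /\
  [/\ tr_ua u = tr_ua w, tr_ub u = tr_ub w,
      tr_sa u = tr_sa w & tr_sb u = tr_sb w].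

Definition normU1 eps u : R :=
  Num.sqrt (ip Omega (tr_u u) (tr_u u) + ipv Omega (tr_sigma u) (tr_sigma u)
    + eps * ip Omega (tr_rho u) (tr_rho u)
    + eps `^ (3 / 2) * HhalfS_norm eps (tr_ua u) ^+ 2
    + eps * HhalfS_norm eps (tr_ub u) ^+ 2
    + eps `^ (3 / 2) * HmhalfS_norm eps (tr_sa u) ^+ 2
    + eps `^ (5 / 2) * HmhalfS_norm eps (tr_sb u) ^+ 2).

Definition normU2 eps u : R :=
  Num.sqrt (ip Omega (tr_u u) (tr_u u) + ipv Omega (tr_sigma u) (tr_sigma u)
    + eps * ip Omega (tr_rho u) (tr_rho u)
    + HhalfS_norm eps (tr_ua u) ^+ 2
    + eps `^ (- (1 / 2)) * HhalfS_norm eps (tr_ub u) ^+ 2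
    + HmhalfS_norm eps (tr_sa u) ^+ 2
    + eps `^ (1 / 2) * HmhalfS_norm eps (tr_sb u) ^+ 2).

Definition spaceV x : Prop :=
  [/\ L2 Omega (te_mu x) /\ forall i, H1 (T i) (te_mu x),
      L2v Omega (te_tau x) /\ forall i, Hdiv (T i) (te_tau x) &
      L2 Omega (te_v x) /\
      forall i, H1 (T i) (te_v x) /\ Hdiv (T i) (grad (T i) (te_v x))].

Definition ipV eps x y : R :=
  eps^-1 * ip Omega (te_mu x) (te_mu y)
  + ipv Omega (pgrad (te_mu x)) (pgrad (te_mu y))
  + eps `^ (- (1 / 2)) * ipv Omega (te_tau x) (te_tau y)
  + ip Omega (pdiv (te_tau x)) (pdiv (te_tau y))
  + ip Omega (te_v x) (te_v y)
  + (eps `^ (1 / 2) + eps) * ipv Omega (pgrad (te_v x)) (pgrad (te_v y))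
  + eps `^ (3 / 2) * ip Omega (plap (te_v x)) (plap (te_v y)).

Definition normV eps x : R := Num.sqrt (ipV eps x x).

Definition formb eps u x : R :=
  ip Omega (tr_rho u) (te_mu x) + ipv Omega (tr_sigma u) (pgrad (te_mu x))
  - dual_mhalf (tr_sa u) (te_mu x)
  + eps `^ (- (1 / 4)) * ipv Omega (tr_sigma u) (te_tau x)
  + ip Omega (tr_u u) (pdiv (te_tau x)) - dual_half (tr_ua u) (te_tau x)
  + eps `^ (3 / 4) * ipv Omega (tr_sigma u) (pgrad (te_v x))
  - eps `^ (3 / 4) * dual_mhalf (tr_sb u) (te_v x)
  + ip Omega (tr_u u) (te_v x)
  + eps `^ (5 / 4) * ip Omega (tr_rho u) (plap (te_v x))
  + eps `^ (1 / 4) * ipv Omega (tr_sigma u) (pgrad (te_v x))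
  - eps `^ (1 / 2) * dual_half (tr_ub u) (pgrad (te_v x)).

Definition formL eps (f : sfun) x : R :=
  ip Omega f (te_v x - eps `^ (1 / 2) *: plap (te_v x)).

Definition normB eps u : R :=
  sup [set `|formb eps u x| | x in [set x | spaceV x /\ normV eps x <= 1]].

Definition Theta eps u : test :=
  xget (Test 0 0 0)
    [set x | spaceV x /\ forall y, spaceV y -> ipV eps x y = formb eps u y].

Definition ThetaB eps beta u : test :=
  let x := Theta eps u in
  Test (beta *: te_mu x) (beta *: te_tau x) (beta *: te_v x).

Definition gamma0 u : bvalue := restr_half (tr_ua u).
Definition gamman u : bvalue -> R := restr_mhalf (tr_sa u).

Definition forma eps beta u w : R :=
  formb eps u (ThetaB eps beta w)
  + 1 / 2 * eps `^ (1 / 4) * (gamman u (gamma0 w) + gamman w (gamma0 u)).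

Definition formF eps beta (f : sfun) w : R := formL eps f (ThetaB eps beta w).

Definition energy eps u : R :=
  Num.sqrt (normB eps u ^+ 2
    + eps `^ (- (1 / 2)) * Hhalf_norm eps Omega (gamma0 u) ^+ 2).

Definition coneK u : Prop :=
  [/\ spaceU u, Hhalf_ge0 Omega (gamma0 u) & Hmhalf_ge0 Omega (gamman u)].

Definition solves_VI eps beta (f : sfun) u : Prop :=
  coneK u /\ forall w, coneK w ->
    formF eps beta f (comb (-1) u w) <= forma eps beta u (comb (-1) u w).

(* With [- eps * lap u + u = f] in L2, the Laplacian of u is square integrable,
   so that the normal derivative of u is defined by duality. *)
Definition solves_SP eps (f u : sfun) : Prop :=
  [/\ H1 Omega u /\ Hdiv Omega (grad Omega u),
      {ae leb, forall z, Omega z -> - eps * lap Omega u z + u z = f z},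
      Hhalf_ge0 Omega (trace Omega u),
      Hmhalf_ge0 Omega (normal_trace Omega (grad Omega u)) &
      normal_trace Omega (grad Omega u) (trace Omega u) = 0].

Definition trial_of eps (u : sfun) : trial :=
  let sigma := eps `^ (1 / 4) *: grad Omega u in
  Trial u sigma (div Omega sigma)
    (fun i => trace (T i) u) (fun i => trace (T i) u)
    (fun i => normal_trace (T i) sigma) (fun i => normal_trace (T i) sigma).

End dpg.

(* Main.v *)
Require Import Defs.
From HB Require Import structures.
From mathcomp Require Import all_boot all_order all_algebra.
From mathcomp Require Import all_classical all_reals all_analysis.
From mathcomp Require Import measurable_realfun ring lra.
Set Implicit Arguments.
Unset Strict Implicit.
Unset Printing Implicit Defensive.
Import Order.TTheory GRing.Theory Num.Theory numFieldNormedType.Exports.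
Local Open Scope classical_set_scope.
Local Open Scope ring_scope.

(* Write Theta u = (mu, tau, v). Testing its definition with elements of V supported in one
   mesh element shows that the skeleton components of u have liftings to Omega for which the
   seven L2 coefficients of b(u, .) are exactly the weighted components of Theta u and of its
   piecewise derivatives. Hence all components of u are explicit combinations of those and of
   the H^1 lifts w_a, w_b of its two traces, where e = w_a - w_b is in H^1_0. By Green's formula
   with e the weighted H^1 norm of e is at most 2 |Bu|. The boundary term <gamma_n u, gamma_0 u>
   is then the squared weighted H^1 norm of w_b up to a cross term with a constant below
   sqrt 12, which gives coercivity for beta >= 3; the same formula with arbitrary lifts bounds
   the form, and the explicit combinations give the norm bounds.
   A solution u0 of (SP) is the H^1 projection of f on a cone, and it satisfies b(u0, .) = L on
   all of V, so that (VI) for u0 only expresses the signs of the boundary terms. Coercivity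
   makes the solution unique, and (VI) => (SP) follows. *)

(** * L2 spaces and projection on convex cones *)

(** All exponents of eps are multiples of 1/4, so the estimates are carried out with eps = r^4 and 0
    < r <= 1, where every weight is an integer power of r. Sobolev objects are handled as relations
    ([wg], [wd], [h0]) that pass to limits, since the derivatives chosen by [grad] and [div] are
    determined only up to null sets. H^{1/2} is a quotient by H^1_0 and normal traces are given by
    Green's formula, so statements on skeleton data become gluing statements on the mesh; Lipschitz
    boundaries enter as null sets, which lets integrals over Omega split over the elements. The
    obstacle to coercivity is that [tr_ua] and [tr_ub] agree on Gamma only while [tr_sa] and [tr_sb]
    are not tied at all: the jump of the lifts has to be controlled by |Bu| alone, and the energy
    contains an infimum over all lifts of gamma_0 u instead of the norm of w_b. The latter gap
    closes because the pairing of gamma_n u with gamma_0 u has the same value for every lift.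
    Existence for (VI) is read off from (SP), so that the completeness at work is that of L2. *)

Section L2_theory.
Context {R : realType} {d : nat}.
Local Notation leb := (@lebesgue_row R d).
Local Notation sfun := ('rV[R]_d -> R).
Variable w : set 'rV[R]_d.
Hypothesis mw : measurable w.
Implicit Types (f g h : sfun) (k : R).

(** The product is dominated by f^2 + g^2. *)
Lemma L2_intM f g : L2 w f -> L2 w g -> leb.-integrable w (EFin \o (fun x => f x * g x)).
Proof.
move=> [mf if2] [mg ig2].
apply: (@le_integrable _ _ _ _ _ mw _ (EFin \o (fun x => f x ^+ 2 + g x ^+ 2))).
- by apply/measurable_EFinP; exact: measurable_funM.
- move=> x wx; rewrite /= lee_fin (@ger0_norm _ (f x ^+ 2 + _)); last by rewrite addr_ge0// sqr_ge0.
  rewrite ler_norml; apply/andP; split; nra.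
- have -> : EFin \o (fun x => f x ^+ 2 + g x ^+ 2) =
     (EFin \o (fun x => f x ^+ 2)) \+ (EFin \o (fun x => g x ^+ 2)) by [].
  exact: integrableD.
Qed.

Lemma L20 : L2 w 0.
Proof.
split; first exact: measurable_cst.
rewrite (_ : _ \o _ = cst 0%E); first exact: integrable0.
by apply/funext => x /=; rewrite expr0n.
Qed.

Lemma L2Z k f : L2 w f -> L2 w (k *: f).
Proof.
move=> [mf if2]; split.
  by rewrite (_ : k *: f = (cst k) \* f)//; exact: measurable_funM.
rewrite (_ : _ \o _ = (fun x => (k ^+ 2)%:E * (f x ^+ 2)%:E)%E).
  exact: integrableZl.
by apply/funext => x /=; rewrite -EFinM /GRing.scale/= /GRing.scale/= exprMn.
Qed.

Lemma L2D f g : L2 w f -> L2 w g -> L2 w (f + g).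
Proof.
move=> Lf Lg; have [mf if2] := Lf; have [mg ig2] := Lg; split.
  exact: measurable_funD.
have ifg := L2_intM Lf Lg.
have ifg2 : leb.-integrable w (fun x => 2%:E * (EFin \o (fun x => (f x * g x)%R)) x)%E.
  exact: integrableZl.
have := integrableD mw if2 (integrableD mw ifg2 ig2).
apply: eq_integrable => // x _ /=; rewrite -EFinM -!EFinD; congr EFin.
by rewrite fctE; ring.
Qed.

Lemma L2N f : L2 w f -> L2 w (- f).
Proof. by rewrite -scaleN1r; exact: L2Z. Qed.

Lemma L2B f g : L2 w f -> L2 w g -> L2 w (f - g).
Proof. by move=> ? /L2N; exact: L2D. Qed.

Lemma L2_sum (I : Type) (s : seq I) (P : pred I) (F : I -> sfun) :
  (forall i, P i -> L2 w (F i)) -> L2 w (\sum_(i <- s | P i) F i).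
Proof. by move=> LF; apply: big_ind => //; [exact: L20|exact: L2D]. Qed.

Lemma ipC f g : ip w f g = ip w g f.
Proof. by apply: eq_Rintegral => x _; rewrite mulrC. Qed.

Lemma ipDl f g h : L2 w f -> L2 w g -> L2 w h ->
  ip w (f + g) h = ip w f h + ip w g h.
Proof.
move=> Lf Lg Lh; rewrite /ip -RintegralD//; [|exact: L2_intM..].
by apply: eq_Rintegral => x _; rewrite /GRing.add/= mulrDl.
Qed.

Lemma ipZl k f g : L2 w f -> L2 w g -> ip w (k *: f) g = k * ip w f g.
Proof.
move=> Lf Lg; rewrite /ip -RintegralZl//; last exact: L2_intM.
by apply: eq_Rintegral => x _; rewrite mulrA.
Qed.

Lemma ip0l g : ip w 0 g = 0.
Proof.
rewrite /ip (@eq_Rintegral _ _ _ _ _ (cst 0)); first by rewrite Rintegral_cst// mul0r.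
by move=> x _; rewrite mul0r.
Qed.

Lemma ip0r g : ip w g 0 = 0. Proof. by rewrite ipC ip0l. Qed.

Lemma ipNl f g : L2 w f -> L2 w g -> ip w (- f) g = - ip w f g.
Proof. by move=> Lf Lg; rewrite -scaleN1r ipZl// mulN1r. Qed.

Lemma ipBl f g h : L2 w f -> L2 w g -> L2 w h ->
  ip w (f - g) h = ip w f h - ip w g h.
Proof. by move=> ? ? ?; rewrite ipDl ?ipNl//; exact: L2N. Qed.

Lemma ipZr k f g : L2 w f -> L2 w g -> ip w f (k *: g) = k * ip w f g.
Proof. by move=> ? ?; rewrite ipC ipZl// ipC. Qed.

Lemma ipNr f g : L2 w f -> L2 w g -> ip w f (- g) = - ip w f g.
Proof. by move=> ? ?; rewrite ipC ipNl// ipC. Qed.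

Lemma ipBr f g h : L2 w f -> L2 w g -> L2 w h ->
  ip w h (f - g) = ip w h f - ip w h g.
Proof. by move=> ? ? ?; rewrite ipC ipBl// !(ipC h). Qed.

Lemma ip_suml (I : Type) (s : seq I) (P : pred I) (F : I -> sfun) g :
  (forall i, P i -> L2 w (F i)) -> L2 w g ->
  ip w (\sum_(i <- s | P i) F i) g = \sum_(i <- s | P i) ip w (F i) g.
Proof.
move=> LF Lg.
suff : L2 w (\sum_(i <- s | P i) F i) /\
  ip w (\sum_(i <- s | P i) F i) g = \sum_(i <- s | P i) ip w (F i) g by case.
apply: (big_ind2 (fun a b => L2 w a /\ ip w a g = b)) => //.
- by split; [exact: L20|rewrite ip0l].
- by move=> a b a' b' [La <-] [La' <-]; split; [exact: L2D|rewrite ipDl].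
- by move=> i Pi; split => //; exact: LF.
Qed.

Lemma ip_ge0 f : 0 <= ip w f f.
Proof. by apply: Rintegral_ge0 => x _; rewrite -expr2 sqr_ge0. Qed.

Lemma eq_ip f f' g g' : (forall x, w x -> f x = f' x) ->
  (forall x, w x -> g x = g' x) -> ip w f g = ip w f' g'.
Proof.
by move=> ff gg; apply: eq_Rintegral => x; rewrite inE => wx; rewrite ff// gg.
Qed.

Lemma eq_L2 f g : (forall x, w x -> f x = g x) -> L2 w f -> L2 w g.
Proof.
move=> fg [mf if2]; split.
  by apply: eq_measurable_fun mf => x; rewrite inE => /fg.
by apply: eq_integrable if2 => // x; rewrite inE => /fg /= ->.
Qed.

Lemma ip_ae f f' g g' : L2 w f -> L2 w f' -> L2 w g -> L2 w g' ->
  {ae leb, forall x, w x -> f x = f' x} ->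
  {ae leb, forall x, w x -> g x = g' x} -> ip w f g = ip w f' g'.
Proof.
move=> Lf Lf' Lg Lg' ff gg; congr fine; apply: ae_eq_integral => //.
- by apply/measurable_EFinP; apply: measurable_funM; [case: Lf|case: Lg].
- by apply/measurable_EFinP; apply: measurable_funM; [case: Lf'|case: Lg'].
- by move: ff gg; apply: filterS2 => x e1 e2 wx; rewrite e1// e2.
Qed.

Lemma ip_eq0 f : L2 w f -> ip w f f = 0 -> {ae leb, forall x, w x -> f x = 0}.
Proof.
move=> Lf; have i2 := L2_intM Lf Lf.
rewrite /ip /Rintegral => /eqP; rewrite fine_eq0; last exact: integrable_fin_num.
move=> /eqP i0.
have : ae_eq leb w (EFin \o (fun x => f x * f x)) (cst 0%E).
  apply/ae_eq_integral_abs => //.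
    by apply/measurable_EFinP; apply: measurable_funM; case: Lf.
  rewrite -[RHS]i0; apply: eq_integral => x _ /=.
  by rewrite ger0_norm// -expr2 sqr_ge0.
apply: filterS => x /[swap] wx /(_ wx) /= [] /eqP.
by rewrite mulf_eq0 orbb => /eqP.
Qed.

Definition nrm f := Num.sqrt (ip w f f).

Lemma nrm_ge0 f : 0 <= nrm f. Proof. exact: sqrtr_ge0. Qed.
Lemma nrm2 f : nrm f ^+ 2 = ip w f f. Proof. by rewrite sqr_sqrtr// ip_ge0. Qed.

End L2_theory.

Lemma archi_pow2 {R : realType} (e : R) : 0 < e -> exists n, 2^-1 ^+ n < e.
Proof.
move=> e0; have : (fun n => (2^-1 : R) ^+ n) @ \oo --> (0 : R).
  by apply: cvg_expr; rewrite ger0_norm ?invr_ge0// invf_lt1// ltr1n.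
move=> /cvgrPdist_lt /(_ e e0) [n _ /(_ n (leqnn n))]; rewrite sub0r normrN.
by rewrite ger0_norm ?exprn_ge0 ?invr_ge0// => ?; exists n.
Qed.

(** * Semi-inner products on a subspace and projection on a convex cone *)

Section semi_inner.
Context {R : realType} (E : lmodType R) (D : set E) (B : E -> E -> R).
Hypothesis D0 : D 0.
Hypothesis DZD : forall k x y, D x -> D y -> D (k *: x + y).
Hypothesis BC : forall x y, B x y = B y x.
Hypothesis BZD : forall k x y z, D x -> D y -> D z ->
  B (k *: x + y) z = k * B x z + B y z.
Hypothesis B_ge0 : forall x, D x -> 0 <= B x x.

Lemma siDZ k x : D x -> D (k *: x).
Proof. by move=> Dx; rewrite -[_ *: _]addr0; exact: DZD. Qed.
Lemma siDD x y : D x -> D y -> D (x + y).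
Proof. by move=> Dx Dy; rewrite -[x]scale1r; exact: DZD. Qed.
Lemma siDB x y : D x -> D y -> D (x - y).
Proof. by move=> Dx Dy; rewrite -scaleN1r addrC; exact: DZD. Qed.

Lemma siB0l z : D z -> B 0 z = 0.
Proof.
move=> Dz; have := @BZD 1 0 0 z D0 D0 Dz; rewrite scaler0 addr0 mul1r => /eqP.
by rewrite -subr_eq subrr => /eqP.
Qed.
Lemma siBZl k x z : D x -> D z -> B (k *: x) z = k * B x z.
Proof. by move=> ? ?; rewrite -[_ *: _]addr0 BZD// siB0l// addr0. Qed.
Lemma siBDl x y z : D x -> D y -> D z -> B (x + y) z = B x z + B y z.
Proof. by move=> ? ? ?; rewrite -{1}[x]scale1r BZD// mul1r. Qed.
Lemma siBBl x y z : D x -> D y -> D z -> B (x - y) z = B x z - B y z.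
Proof. by move=> ? ? ?; rewrite -scaleN1r addrC BZD// mulN1r addrC. Qed.
Lemma siBZr k x z : D x -> D z -> B z (k *: x) = k * B z x.
Proof. by move=> ? ?; rewrite BC siBZl// BC. Qed.
Lemma siBDr x y z : D x -> D y -> D z -> B z (x + y) = B z x + B z y.
Proof. by move=> ? ? ?; rewrite BC siBDl// !(BC z). Qed.
Lemma siBBr x y z : D x -> D y -> D z -> B z (x - y) = B z x - B z y.
Proof. by move=> ? ? ?; rewrite BC siBBl// !(BC z). Qed.

Lemma siB_expand t x y : D x -> D y ->
  B (t *: x + y) (t *: x + y) = t ^+ 2 * B x x + 2 * t * B x y + B y y.
Proof.
move=> Dx Dy; have Dt := siDZ t Dx; have Ds := siDD Dt Dy.
rewrite siBDl// !siBDr// !siBZl// !siBZr//.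
by rewrite (BC y x); ring.
Qed.

Lemma si_CS x y : D x -> D y -> B x y ^+ 2 <= B x x * B y y.
Proof.
move=> Dx Dy; have H t : 0 <= t ^+ 2 * B x x + 2 * t * B x y + B y y.
  by rewrite -siB_expand//; apply: B_ge0; exact: DZD.
have [xx|xx] := eqVneq (B x x) 0.
  have [-> | xy] := eqVneq (B x y) 0; first by rewrite expr0n/= xx mul0r.
  (* At this t the polynomial, affine because B x x = 0, takes the value -1. *)
  have := H (- (B y y + 1) / (2 * B x y)); rewrite xx mulr0 add0r.
  have -> : 2 * (- (B y y + 1) / (2 * B x y)) * B x y = - (B y y + 1) by field.
  by move=> h; exfalso; lra.
have xx0 : 0 < B x x by rewrite lt_def xx B_ge0.
(* This t minimizes the quadratic polynomial. *)
have := H (- B x y / B x x).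
have -> : (- B x y / B x x) ^+ 2 * B x x + 2 * (- B x y / B x x) * B x y + B y y
  = (B x x * B y y - B x y ^+ 2) / B x x by field.
by rewrite pmulr_lge0 ?invr_gt0// subr_ge0.
Qed.

Definition siN x := Num.sqrt (B x x).
Lemma siN_ge0 x : 0 <= siN x. Proof. exact: sqrtr_ge0. Qed.
Lemma siN2 x : D x -> siN x ^+ 2 = B x x. Proof. by move=> Dx; rewrite sqr_sqrtr// B_ge0. Qed.

Lemma si_CSN x y : D x -> D y -> `|B x y| <= siN x * siN y.
Proof.
move=> Dx Dy; rewrite -[leLHS]sqrtr_sqr /siN -sqrtrM ?B_ge0//.
by rewrite ler_wsqrtr// si_CS.
Qed.

Lemma siN_triangle x y : D x -> D y -> siN (x + y) <= siN x + siN y.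
Proof.
move=> Dx Dy; rewrite -(ler_pXn2r (n := 2))// ?nnegrE ?addr_ge0 ?siN_ge0//.
rewrite siN2; last exact: siDD.
rewrite -{1 2}[x]scale1r siB_expand// sqrrD !siN2//.
have := si_CSN Dx Dy; rewrite ler_norml => /andP[_]; lra.
Qed.

Lemma siNZ k x : D x -> siN (k *: x) = `|k| * siN x.
Proof.
move=> Dx; rewrite /siN siBZl//; last exact: siDZ.
by rewrite siBZr// mulrA -expr2 sqrtrM ?sqr_ge0// sqrtr_sqr.
Qed.

Lemma siN_triangleB x y z : D x -> D y -> D z -> siN (x - z) <= siN (x - y) + siN (y - z).
Proof.
move=> Dx Dy Dz; rewrite [X in siN X](_ : x - z = (x - y) + (y - z)).
  by apply: siN_triangle; exact: siDB.
by rewrite addrA subrK.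
Qed.

Lemma siNC x y : D x -> D y -> siN (x - y) = siN (y - x).
Proof.
move=> Dx Dy; rewrite -[x - y]opprB -[- (y - x)]scaleN1r.
by rewrite siNZ ?normrN1 ?mul1r//; exact: siDB.
Qed.

(** Only rapidly Cauchy sequences are considered: minimizing sequences can be chosen rapid, and in
    L2 the geometric rate makes the increments summable almost everywhere. *)
Definition si_complete := forall x : nat -> E, (forall n, D (x n)) ->
  (exists K, forall n, siN (x n.+1 - x n) <= K * 2^-1 ^+ n) ->
  exists2 u, D u & siN (u - x n) @[n --> \oo] --> (0 : R).

Hypothesis cmpl : si_complete.

Section projection.
Variables (C : set E) (p : E).
Hypothesis CD : C `<=` D.
Hypothesis C0 : C 0.
Hypothesis CD2 : forall x y, C x -> C y -> C (x + y).
Hypothesis CZ : forall k x, 0 <= k -> C x -> C (k *: x).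
Hypothesis Dp : D p.

Let S := [set B (x - p) (x - p) | x in C].
Let del := inf S.

Let Sinf : has_inf S.
Proof.
split; first by exists (B (0 - p) (0 - p)), 0.
by exists 0 => _ [x Cx <-]; apply/B_ge0/siDB => //; exact: CD.
Qed.

Let del_le x : C x -> del <= B (x - p) (x - p).
Proof. by move=> Cx; apply: ge_inf; [case: Sinf|exists x]. Qed.

(** The error is the square of 2^-n, so that the parallelogram identity bounds the increments of the
    minimizing sequence by 2 * 2^-n. *)
Let min_seq n : exists x, C x /\ B (x - p) (x - p) <= del + (2^-1 ^+ n) ^+ 2.
Proof.
have e0 : 0 < (2^-1 ^+ n) ^+ 2 :> R by rewrite !exprn_gt0// invr_gt0.
have [_ [x Cx <-] H] := inf_adherent e0 Sinf.
by exists x; split => //; exact: ltW.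
Qed.

(** C is not assumed closed, so u is a limit of points of C and its minimality is used against
    limits of such points. Perturbing u to u + s c gives the inequality, perturbing it to (1 - s) u
    gives half of the equality, and u being a limit of points of C gives the other half. *)
Lemma cone_projection : exists u, [/\ D u,
  exists2 x : nat -> E, forall n, C (x n) & siN (u - x n) @[n --> \oo] --> (0 : R),
  forall c, C c -> 0 <= B (u - p) c & B (u - p) u = 0].
Proof.
have [x Hx] := choice min_seq.
have Cx n : C (x n) by case: (Hx n).
have Dx n : D (x n) by exact: CD.
have fast n : siN (x n.+1 - x n) <= 2 * 2^-1 ^+ n.
  rewrite -(ler_pXn2r (n := 2))// ?nnegrE ?siN_ge0 ?mulr_ge0 ?exprn_ge0 ?invr_ge0//.
  rewrite siN2; last exact: siDB.
  (* The midpoint stays in the cone, so its squared distance to p is at least [del]. *)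
  have Cm : C (2^-1 *: (x n.+1 + x n)) by apply: CZ; [rewrite invr_ge0|exact: CD2].
  have Da := siDB (Dx n.+1) Dp; have Da' := siDB (Dx n) Dp.
  have -> : x n.+1 - x n = (-1) *: (x n - p) + (x n.+1 - p).
    by rewrite scaleN1r opprB [RHS]addrC addrA subrK.
  rewrite siB_expand//.
  have := del_le Cm.
  have -> : 2^-1 *: (x n.+1 + x n) - p = 2^-1 *: (1 *: (x n - p) + (x n.+1 - p)).
    rewrite scale1r addrACA -opprD scalerBr [x n + _]addrC; congr (_ - _).
    by rewrite -[in RHS](scale1r p) -scalerDl scalerA mulVf ?scale1r// pnatr_eq0.
  have Dab := DZD 1 Da' Da.
  rewrite siBZl ?siBZr ?siB_expand//; last exact: siDZ.
  have [_ h1] := Hx n; have [_ h2] := Hx n.+1.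
  have h3 : (2^-1 ^+ n.+1 : R) ^+ 2 <= (2^-1 ^+ n) ^+ 2.
    rewrite ler_pXn2r// ?nnegrE ?exprn_ge0 ?invr_ge0//.
    by rewrite exprS ler_piMl ?exprn_ge0 ?invr_ge0// invf_le1// ler1n.
  move: h1 h2 h3; rewrite exprMn.
  set a := B _ _; set b := B _ _; set c := B _ (x n.+1 - p); set q := _ ^+ 2; lra.
have [u Du ux] := cmpl Dx (ex_intro _ 2 fast).
have eps_le (a b : R) : (forall e, 0 < e -> a <= b + e) -> a <= b by move=> /ler_addgt0Pr.
(* The bound by [del] extends from C to limits of sequences of C. *)
have lim_le z (y : nat -> E) : D z -> (forall n, C (y n)) ->
    siN (z - y n) @[n --> \oo] --> (0 : R) -> del <= B (z - p) (z - p).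
  move=> Dz Cy zy; have Dy n : D (y n) by exact: CD.
  have Dzp := siDB Dz Dp.
  suff H : Num.sqrt del <= siN (z - p).
    rewrite -siN2//; have [d0|d0] := leP 0 del; last by rewrite (le_trans (ltW d0))// sqr_ge0.
    by rewrite -(sqr_sqrtr d0) ler_pXn2r// ?nnegrE ?siN_ge0// sqrtr_ge0.
  apply: eps_le => e e0; move/cvgrPdist_lt : zy => /(_ e e0) [n _ /(_ n (leqnn n))].
  rewrite sub0r normrN ger0_norm ?siN_ge0// => ze.
  apply: (@le_trans _ _ (siN (y n - p))); first by apply: ler_wsqrtr; exact: del_le.
  rewrite [leRHS]addrC; apply: le_trans (siN_triangleB (Dy n) Dz Dp) _.
  by rewrite siNC// lerD2r ltW.
have upd : B (u - p) (u - p) <= del.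
  have del0 : 0 <= del.
    by apply: lb_le_inf; [case: Sinf|move=> _ [z Cz <-]; apply/B_ge0/siDB => //; exact: CD].
  rewrite -siN2; last exact: siDB.
  rewrite -(sqr_sqrtr del0) ler_pXn2r// ?nnegrE ?siN_ge0 ?sqrtr_ge0//.
  apply: eps_le => e e0; have e2 : 0 < e / 2 by rewrite divr_gt0.
  move/cvgrPdist_lt : ux => /(_ _ e2) [n1 _ H1].
  have [n2 H2] := archi_pow2 e2.
  pose n := maxn n1 n2.
  apply: le_trans (siN_triangleB Du (Dx n) Dp) _.
  have := H1 n (leq_maxl _ _); rewrite sub0r normrN ger0_norm ?siN_ge0// => h1.
  have h2 : siN (x n - p) <= Num.sqrt del + 2^-1 ^+ n.
    rewrite -(ler_pXn2r (n := 2))// ?nnegrE ?siN_ge0 ?addr_ge0 ?sqrtr_ge0 ?exprn_ge0 ?invr_ge0//.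
    rewrite siN2; last exact: siDB.
    have [_ /le_trans] := Hx n; apply; rewrite sqrrD sqr_sqrtr// lerD2r lerDl.
    by rewrite mulrn_wge0// mulr_ge0 ?sqrtr_ge0 ?exprn_ge0 ?invr_ge0.
  have h3 : (2^-1 ^+ n : R) <= 2^-1 ^+ n2.
    by apply: ler_wiXn2l; rewrite ?invr_ge0// ?invf_le1 ?ler1n// leq_maxr.
  lra.
have Dup := siDB Du Dp.
have scale_lim s c : 0 <= s -> C c -> 0 <= 2 * s * B (u - p) c + s ^+ 2 * B c c.
  move=> s0 Cc; have Dc := CD Cc.
  have : del <= B (u + s *: c - p) (u + s *: c - p).
    apply: (@lim_le _ (fun n => x n + s *: c)).
    - by apply: siDD => //; exact: siDZ.
    - by move=> n; apply: CD2 => //; exact: CZ.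
    - by under eq_fun do rewrite opprD addrACA subrr addr0.
  rewrite addrAC addrC siB_expand// (BC c) => /(le_trans upd).
  by rewrite addrC -[in X in X -> _]subr_ge0 addrK [_ + 2 * _ * _]addrC -!mulrA.
have ge0 c : C c -> 0 <= B (u - p) c.
  move=> Cc; have Dc := CD Cc; rewrite leNgt; apply/negP => b0.
  have c0 := B_ge0 Dc.
  (* The vertex of the parabola in s, with B c c + 1 in place of B c c, which may vanish. *)
  have s0 : 0 <= - B (u - p) c / (B c c + 1).
    by rewrite mulr_ge0 ?oppr_ge0 ?ltW// invr_gt0; lra.
  have := scale_lim _ _ s0 Cc; set b := B (u - p) c; set q := B c c.
  have q1 : 0 < q + 1 by rewrite /q; lra.
  have -> : 2 * (- b / (q + 1)) * b + (- b / (q + 1)) ^+ 2 * q =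
     - (b ^+ 2 * (q + 2)) / (q + 1) ^+ 2 by field; rewrite gt_eqF.
  rewrite pmulr_lge0 ?invr_gt0 ?exprn_gt0// oppr_ge0 leNgt => /negP; apply.
  apply: mulr_gt0; last lra.
  by rewrite exprn_even_gt0//= lt_eqF.
exists u; split => //; first by exists x.
apply/eqP; rewrite eq_le; apply/andP; split; last first.
  (* B (u - p) u is the limit of the values at x n, which are nonnegative by [ge0]. *)
  have CS y := @si_CSN _ y Dup; set b := B (u - p) u.
  apply: (@eps_le 0 b) => e e0.
  have k0 : 0 < siN (u - p) + 1 by rewrite ltr_wpDl ?siN_ge0.
  have ek : 0 < e / (siN (u - p) + 1) by rewrite divr_gt0.
  move/cvgrPdist_lt : ux => /(_ _ ek) [n _ /(_ n (leqnn n))].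
  rewrite sub0r normrN ger0_norm ?siN_ge0// ltr_pdivlMr// => h1.
  have := CS _ (siDB Du (Dx n)); rewrite siBBr// -/b ler_norml => /andP[h2 _].
  have := ge0 _ (Cx n); have := siN_ge0 (u - x n); have := siN_ge0 (u - p); rewrite -/b.
  move: h1 h2; set q1 := siN (u - x n); set q2 := siN (u - p); set q3 := B (u - p) (x n).
  rewrite mulrDr mulr1 (mulrC q1); set q4 := q2 * q1; lra.
rewrite leNgt; apply/negP => b0; have u0 := B_ge0 Du.
set b := B (u - p) u in b0; set q := B u u in u0.
(* Shrinking u to (1 - s) u stays in the closure of the cone only for s <= 1. *)
have key s : 0 <= s <= 1 -> 0 <= - (2 * s * b) + s ^+ 2 * q.
  move=> /andP[s0 s1].
  have : del <= B ((1 - s) *: u - p) ((1 - s) *: u - p).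
    apply: (@lim_le _ (fun n => (1 - s) *: x n)).
    - exact: siDZ.
    - by move=> n; apply: CZ => //; rewrite subr_ge0.
    - rewrite (_ : (fun _ => _) = (fun n => `|1 - s| * siN (u - x n))); last first.
        by apply/funext => n; rewrite -scalerBr siNZ//; exact: siDB.
      by rewrite -[X in _ --> X](mulr0 `|1 - s|); apply: cvgM => //; exact: cvg_cst.
  rewrite scalerBl scale1r addrAC addrC -scaleNr siB_expand// (BC u) -/b -/q => /(le_trans upd).
  lra.
have bq : 0 < q + b by lra.
(* This s lies in [0, 1] and makes the expression of [key] negative as soon as b > 0. *)
have /key : 0 <= b / (q + b) <= 1.
  by rewrite ler_pdivrMr// mul1r lerDr u0 andbT divr_ge0// ltW.
have -> : - (2 * (b / (q + b)) * b) + (b / (q + b)) ^+ 2 * q = - (b ^+ 2 * (q + 2 * b)) / (q + b) ^+ 2.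
  by field; rewrite gt_eqF.
rewrite pmulr_lge0 ?invr_gt0 ?exprn_gt0// oppr_ge0 leNgt => /negP; apply.
by rewrite mulr_gt0 ?exprn_gt0//; lra.
Qed.
End projection.
End semi_inner.

(** * Completeness of L2 *)

Section L2_complete.
Context {R : realType} {d : nat}.
Local Notation leb := (@lebesgue_row R d).
Local Notation sfun := ('rV[R]_d -> R).
Variable w : set 'rV[R]_d.
Hypothesis mw : measurable w.
Implicit Types (f g h : sfun) (k : R).

Lemma ipZD k f g h : L2 w f -> L2 w g -> L2 w h ->
  ip w (k *: f + g) h = k * ip w f h + ip w g h.
Proof. by move=> ? ? ?; rewrite ipDl ?ipZl//; exact: L2Z. Qed.

Lemma L2ZD k f g : L2 w f -> L2 w g -> L2 w (k *: f + g).
Proof. by move=> ? ?; apply: L2D => //; exact: L2Z. Qed.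

Definition ip_CS := si_CSN (@L20 R d w) L2ZD (@ipC R d w) ipZD (fun f _ => ip_ge0 w f).
Definition ip_triangle := siN_triangle (@L20 R d w) L2ZD (@ipC R d w) ipZD (fun f _ => ip_ge0 w f).

Lemma ip_intE f : L2 w f -> (ip w f f)%:E = (\int[leb]_(x in w) (f x ^+ 2)%:E)%E.
Proof.
move=> Lf; have i2 := L2_intM mw Lf Lf.
rewrite /ip /Rintegral fineK; last exact: integrable_fin_num.
by apply: eq_integral => x _; rewrite expr2.
Qed.

Lemma L2_abs f : L2 w f -> L2 w (fun x => `|f x|).
Proof.
move=> [mf if2]; split; first exact: measurableT_comp.
by apply: eq_integrable if2 => // x _ /=; rewrite real_normK// num_real.
Qed.

Lemma ip_abs f : ip w (fun x => `|f x|) (fun x => `|f x|) = ip w f f.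
Proof. by apply: eq_Rintegral => x _; rewrite -expr2 real_normK ?num_real// expr2. Qed.

Lemma L2_mono_int (h : nat -> sfun) K : (forall n, L2 w (h n)) ->
  (forall n x, 0 <= h n x <= h n.+1 x) -> (forall n, ip w (h n) (h n) <= K) ->
  (\int[leb]_(x in w) limn (fun n => (h n x ^+ 2)%:E) <= K%:E)%E.
Proof.
move=> Lh h01 hK.
rewrite monotone_convergence//.
- apply: lime_le.
    apply: ereal_nondecreasing_is_cvgn; apply/nondecreasing_seqP => n.
    apply: ge0_le_integral => //.
    + by move=> x _; rewrite lee_fin sqr_ge0.
    + by apply/measurable_EFinP; apply: measurable_funX; case: (Lh n).
    + by apply/measurable_EFinP; apply: measurable_funX; case: (Lh n.+1).
    + move=> x _; have /andP[h0 h1] := h01 n x.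
      by rewrite lee_fin ler_pXn2r ?nnegrE// (le_trans h0).
  by apply: nearW => n; rewrite -ip_intE// lee_fin.
- by move=> n; apply/measurable_EFinP; apply: measurable_funX; case: (Lh n).
- by move=> n x _; rewrite lee_fin sqr_ge0.
- move=> x _; apply/nondecreasing_seqP => n; have /andP[h0 h1] := h01 n x.
  by rewrite lee_fin ler_pXn2r ?nnegrE// (le_trans h0).
Qed.

Lemma L2_mono_meas (h : nat -> sfun) : (forall n, L2 w (h n)) ->
  (forall n x, 0 <= h n x <= h n.+1 x) ->
  measurable_fun w (fun x => limn (fun n => (h n x ^+ 2)%:E)).
Proof.
move=> Lh h01; apply: (emeasurable_fun_cvg (fun n x => (h n x ^+ 2)%:E)).
  by move=> n; apply/measurable_EFinP; apply: measurable_funX; case: (Lh n).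
move=> x _; apply: ereal_nondecreasing_is_cvgn; apply/nondecreasing_seqP => n.
have /andP[h0 h1] := h01 n x.
by rewrite lee_fin ler_pXn2r ?nnegrE// (le_trans h0).
Qed.

Lemma L2_le_int g (H : 'rV[R]_d -> \bar R) K : measurable_fun w g ->
  measurable_fun w H -> (forall x, (0 <= H x)%E) ->
  {ae leb, forall x, w x -> ((g x ^+ 2)%:E <= H x)%E} ->
  (\int[leb]_(x in w) H x <= K%:E)%E -> L2 w g /\ ip w g g <= K.
Proof.
move=> mg mH H0 gH HK.
have mg2 : measurable_fun w (fun x => (g x ^+ 2)%:E).
  by apply/measurable_EFinP; exact: measurable_funX.
have le : (\int[leb]_(x in w) (g x ^+ 2)%:E <= K%:E)%E.
  apply: le_trans HK; apply: ae_ge0_le_integral => //.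
  by move=> x _; rewrite lee_fin sqr_ge0.
have Lg : L2 w g.
  split => //; apply/integrableP; split => //.
  under eq_integral do rewrite gee0_abs ?lee_fin ?sqr_ge0//.
  exact: le_lt_trans le (ltry _).
by split => //; rewrite -lee_fin ip_intE.
Qed.

(** Riesz-Fischer argument: by monotone convergence the sum of the absolute increments is square
    integrable, so the sequence converges off a null set, and the tail sums dominate the distance to
    the limit both pointwise and in norm. *)
Lemma L2_complete : si_complete (L2 w) (ip w).
Proof.
move=> f Lf [K fK].
have K0 : 0 <= K.
  by have := fK 0%N; rewrite expr0 mulr1; apply: le_trans; exact: sqrtr_ge0.
pose a m x := `|f m.+1 x - f m x|.
have La m : L2 w (a m) by apply: L2_abs; exact: L2B.
pose h n N x := \sum_(n <= m < n + N) a m x.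
have Lh n N : L2 w (h n N).
  rewrite (_ : h n N = \sum_(n <= m < n + N) a m); first exact: L2_sum.
  by apply/funext => x; rewrite /h fct_sumE.
have hE n N : h n N = \sum_(n <= m < n + N) a m.
  by apply/funext => x; rewrite /h fct_sumE.
have h01 n N x : 0 <= h n N x <= h n N.+1 x.
  apply/andP; split; first by apply: sumr_ge0 => m _; exact: normr_ge0.
  by rewrite /h addnS big_nat_recr ?leq_addr//= lerDl; exact: normr_ge0.
(* The factor 1 - 2^-N turns the geometric sum into a claim that is stable under induction on N. *)
have hb n N : siN (ip w) (h n N) <= 2 * K * 2^-1 ^+ n * (1 - 2^-1 ^+ N).
  elim: N => [|N IH].
    by rewrite hE addn0 big_geq// expr0 subrr mulr0 /siN ip0l// sqrtr0.
  rewrite hE addnS big_nat_recr ?leq_addr//= -hE.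
  apply: le_trans (ip_triangle _ _) _ => //.
  have -> : siN (ip w) (a (n + N)%N) = siN (ip w) (f (n + N).+1 - f (n + N)%N).
    by rewrite /siN; congr Num.sqrt; exact: ip_abs.
  apply: le_trans (lerD IH (fK _)) _.
  rewrite exprD exprS; set p := _ ^+ n; set q := _ ^+ N.
  by rewrite le_eqVlt; apply/orP; left; apply/eqP; field.
have p0 n : 0 <= 2 * K * 2^-1 ^+ n by rewrite !mulr_ge0// exprn_ge0// invr_ge0.
have hK n N : ip w (h n N) (h n N) <= (2 * K * 2^-1 ^+ n) ^+ 2.
  rewrite -nrm2 ler_pXn2r ?nnegrE ?nrm_ge0 ?p0//.
  apply: le_trans (hb n N) _; apply: ler_piMr; first exact: p0.
  by rewrite gerBl exprn_ge0 ?invr_ge0.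
pose H n x := limn (fun N => (h n N x ^+ 2)%:E).
have ndH n x : nondecreasing_seq (fun N => (h n N x ^+ 2)%:E).
  apply/nondecreasing_seqP => N; have /andP[h0 h1] := h01 n N x.
  by rewrite lee_fin ler_pXn2r ?nnegrE// (le_trans h0).
have cH n x : cvgn (fun N => (h n N x ^+ 2)%:E) by exact: ereal_nondecreasing_is_cvgn.
have H0 n x : (0 <= H n x)%E.
  by apply: lime_ge => //; apply: nearW => N; rewrite lee_fin sqr_ge0.
have HN n N x : ((h n N x ^+ 2)%:E <= H n x)%E.
  by apply: lime_ge => //; exists N => // N' /= ?; exact: ndH.
have mH n : measurable_fun w (H n) by exact: L2_mono_meas.
have HK n : (\int[leb]_(x in w) H n x <= ((2 * K * 2^-1 ^+ n) ^+ 2)%:E)%E.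
  exact: L2_mono_int.
have : leb.-integrable w (H 0%N).
  apply/integrableP; split => //.
  under eq_integral do rewrite gee0_abs//.
  exact: le_lt_trans (HK 0%N) (ltry _).
move=> /(integrable_ae mw) [Z [mZ Z0 Zsub]].
have Hfin x : w x -> ~ Z x -> exists k, forall N, h 0%N N x <= k.
  move=> wx nZ; have : H 0%N x \is a fin_num.
    by apply: contrapT => nf; apply: nZ; apply: Zsub => /(_ wx).
  move=> /fineK Hx; exists (Num.sqrt (fine (H 0%N x))) => N.
  have := HN 0%N N x; rewrite -Hx lee_fin => le.
  have /andP[h0 _] := h01 0%N N x.
  by rewrite -[leLHS]ger0_norm// -sqrtr_sqr ler_wsqrtr.
have tele x n N : f (n + N)%N x - f n x = \sum_(n <= m < n + N) (f m.+1 x - f m x).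
  by rewrite telescope_sumr// leq_addr.
have fcvg x : w x -> ~ Z x -> cvgn (f ^~ x).
  move=> wx nZ; have [k hk] := Hfin x wx nZ.
  have : cvgn [normed series (fun m => f m.+1 x - f m x)].
    apply: nondecreasing_is_cvgn.
      by apply/nondecreasing_seqP => N; rewrite [leRHS]seriesSr/= lerDl.
    by exists k => _ [N _ <-]; exact: hk.
  move=> /normed_cvg cs.
  have -> : f ^~ x = (fun n => series (fun m => f m.+1 x - f m x) n + f 0%N x).
    by apply/funext => n; rewrite /series/= telescope_sumr// subrK.
  by apply: is_cvgD => //; exact: is_cvg_cst.
(* The limit is cut off on the null set Z, where the sequence may diverge; this makes g a pointwise
   limit of measurable functions on all of w. *)
pose g x := limn (f ^~ x) * \1_(~` Z) x.
have mg : measurable_fun w g.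
  apply: (measurable_fun_cvg (h := fun n x => f n x * \1_(~` Z) x)).
    move=> n; apply: measurable_funM; first by case: (Lf n).
    by apply: measurable_indic; exact: measurableC.
  move=> x wx; rewrite /g indicE; have [xZ|xZ] := boolP (x \in ~` Z).
    by rewrite mulr1; under eq_fun do rewrite mulr1; apply: fcvg => //; exact: set_mem.
  by rewrite mulr0; under eq_fun do rewrite mulr0; exact: cvg_cst.
have gle n x : w x -> ~ Z x -> (((g x - f n x) ^+ 2)%:E <= H n x)%E.
  move=> wx nZ; have gx : f ^~ x @ \oo --> g x.
    by rewrite /g indicE mem_set// mulr1; exact: fcvg.
  case: (H n x) (H0 n x) (HN n ^~ x) => [r| |]; last 2 first.
  - by move=> _ _; rewrite leey.
  - by rewrite leeNy_eq.
  rewrite lee_fin => r0 Hr; rewrite lee_fin -(sqr_sqrtr r0) -[leLHS]real_normK ?num_real//.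
  rewrite ler_pXn2r ?nnegrE ?sqrtr_ge0//.
  have cg : `|f (n + N)%N x - f n x| @[N --> \oo] --> `|g x - f n x|.
    apply: cvg_norm; apply: cvgB; last exact: cvg_cst.
    exact: (cvg_comp _ _ (cvg_addnl n) gx).
  rewrite -(cvg_lim (@Rhausdorff R) cg); apply: limr_le; first exact: (cvgP _ cg).
  apply: nearW => N; rewrite tele; apply: le_trans (ler_norm_sum _ _ _) _.
  have h0 : 0 <= h n N x by case/andP : (h01 n N x).
  by rewrite -[leLHS]ger0_norm// -sqrtr_sqr ler_wsqrtr// -lee_fin; exact: Hr.
have gf n : L2 w (g - f n) /\ ip w (g - f n) (g - f n) <= (2 * K * 2^-1 ^+ n) ^+ 2.
  apply: (L2_le_int (H := H n)) => //.
    by apply: measurable_funB => //; case: (Lf n).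
  exists Z; split => // x /=; apply: contra_notP => nZ wx; exact: gle.
exists g.
  have [Lg _] := gf 0%N; rewrite -(subrK (f 0%N) g); exact: L2D.
apply: (@squeeze_cvgr _ _ _ _ (fun=> 0) (fun n => 2 * K * 2^-1 ^+ n)).
- apply: nearW => n; rewrite sqrtr_ge0/= -[leRHS]ger0_norm ?p0//.
  by rewrite -sqrtr_sqr ler_wsqrtr//; case: (gf n).
- exact: cvg_cst.
- rewrite -[X in _ --> X](mulr0 (2 * K)); apply: cvgM; first exact: cvg_cst.
  by apply: cvg_expr; rewrite ger0_norm ?invr_ge0// invf_lt1// ltr1n.
Qed.

End L2_complete.

(** * Lebesgue measure and test functions *)

Section boxes.
Context {R : realType} {d : nat}.
Local Notation leb := (@lebesgue_row R d).
Implicit Types (a b x y : 'rV[R]_d).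

Definition box a b : set 'rV[R]_d := [set x | forall i, a 0 i < x 0 i < b 0 i].
Definition cbox a b : set 'rV[R]_d := [set x | forall i, a 0 i <= x 0 i <= b 0 i].

Lemma box_cbox a b : box a b `<=` cbox a b.
Proof. by move=> x h i; have /andP[? ?] := h i; rewrite !ltW. Qed.

Lemma measurable_coord_set (i : 'I_d) (Y : set R) : measurable Y ->
  measurable [set x : 'rV[R]_d | Y (x 0 i)].
Proof.
move=> mY; have := @measurable_coord R d i measurableT Y mY.
by rewrite setTI.
Qed.

Lemma box_bigcap a b : box a b = \bigcap_(i in [set: 'I_d]) [set x | `]a 0 i, b 0 i[%classic (x 0 i)].
Proof.
apply/seteqP; split => x /= h i; first by move=> _ /=; rewrite in_itv/=; exact: h.
by have /= := h i I; rewrite in_itv.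
Qed.

Lemma cbox_bigcap a b : cbox a b = \bigcap_(i in [set: 'I_d]) [set x | `[a 0 i, b 0 i]%classic (x 0 i)].
Proof.
apply/seteqP; split => x /= h i; first by move=> _ /=; rewrite in_itv/=; exact: h.
by have /= := h i I; rewrite in_itv.
Qed.

Lemma measurable_box a b : measurable (box a b).
Proof.
rewrite box_bigcap; apply: fin_bigcap_measurable => // i _.
by apply: measurable_coord_set; exact: measurable_itv.
Qed.

Lemma measurable_cbox a b : measurable (cbox a b).
Proof.
rewrite cbox_bigcap; apply: fin_bigcap_measurable => // i _.
by apply: measurable_coord_set; exact: measurable_itv.
Qed.

Definition ratv (a : 'rV[rat]_d) : 'rV[R]_d := map_mx ratr a.

(** Rational corners make the family of boxes countable. *)
Lemma open_rat_box (U : set 'rV[R]_d) x : open U -> U x ->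
  exists a b : 'rV[rat]_d, box (ratv a) (ratv b) x /\ cbox (ratv a) (ratv b) `<=` U.
Proof.
move=> oU Ux.
have /nbhs_ballP[e /= e0 eU] : nbhs x U by exact: open_nbhs_nbhs.
have /choice[a Ha] : forall i : 'I_d, exists q : rat, ratr q \in `]x 0 i - e, x 0 i[%R.
  by move=> i; apply: rat_in_itvoo; rewrite ltrBlDr ltrDl.
have /choice[b Hb] : forall i : 'I_d, exists q : rat, ratr q \in `]x 0 i, x 0 i + e[%R.
  by move=> i; apply: rat_in_itvoo; rewrite ltrDl.
exists (\row_i a i), (\row_i b i); split.
  move=> i; rewrite !mxE; move: (Ha i) (Hb i); rewrite !in_itv/=.
  by move=> /andP[_ ->] /andP[-> _].
move=> y hy; apply: eU; split => // i j; rewrite (ord1 i) -ball_normE/=.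
have := hy j; rewrite !mxE => /andP[h1 h2].
move: (Ha j) (Hb j); rewrite !in_itv/= => /andP[h3 _] /andP[_ h4].
by rewrite ltr_norml; apply/andP; split; lra.
Qed.

Lemma measurable_open (U : set 'rV[R]_d) : open U -> measurable U.
Proof.
move=> oU.
pose F (p : 'rV[rat]_d * 'rV[rat]_d) : set 'rV[R]_d :=
  if `[< cbox (ratv p.1) (ratv p.2) `<=` U >] then box (ratv p.1) (ratv p.2) else set0.
have -> : U = \bigcup_p F p.
  apply/seteqP; split => x.
    move=> Ux; have [a [b [h1 h2]]] := open_rat_box oU Ux.
    by exists (a, b) => //; rewrite /F asboolT.
  by move=> [p _]; rewrite /F; case: ifPn => // /asboolP h /box_cbox /h.
apply: countable_bigcupT_measurable; first exact: countableP.
by move=> p; rewrite /F; case: ifP => _ //; exact: measurable_box.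
Qed.

Lemma measurable_closed (U : set 'rV[R]_d) : closed U -> measurable U.
Proof.
by move=> /closed_openC/measurable_open/measurableC; rewrite setCK.
Qed.

(** Lindelof argument: every point of A lies in a rational box that meets A in a null set, and there
    are countably many such boxes. *)
Lemma negligible_local (A : set 'rV[R]_d) :
  (forall x, A x -> exists U, [/\ open U, U x & leb.-negligible (A `&` U)]) ->
  leb.-negligible A.
Proof.
move=> H.
pose F (n : nat) : set 'rV[R]_d :=
  if @unpickle ('rV[rat]_d * 'rV[rat]_d)%type n is Some p then
    if `[< leb.-negligible (A `&` box (ratv p.1) (ratv p.2)) >] then A `&` box (ratv p.1) (ratv p.2)
    else set0 else set0.
have -> : A = \bigcup_n F n.
  apply/seteqP; split => x.
    move=> Ax; have [U [oU Ux nU]] := H x Ax.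
    have [a [b [h1 h2]]] := open_rat_box oU Ux.
    exists (pickle (a, b)) => //; rewrite /F pickleK asboolT//.
    by apply: negligibleS nU; apply: setIS => y /box_cbox /h2.
  by move=> [n _]; rewrite /F; case: unpickle => // p; case: ifP => // _ [].
apply: negligible_bigcup => n; rewrite /F; case: unpickle => [p|]; last exact: negligible_set0.
by case: ifPn => [/asboolP //|_]; exact: negligible_set0.
Qed.

Lemma measurable_fun_continuous (f : 'rV[R]_d -> R) : continuous f -> measurable_fun setT f.
Proof.
move=> cf; apply: (measurability _ (RGenOpens.measurableE R)).
move=> _ [_ [a [b ->] <-]]; rewrite setTI; apply: measurable_open.
by apply: open_comp => //; exact: interval_open.
Qed.

End boxes.

(** * Translation invariance of the Lebesgue measure *)

Section translation.
Context {R : realType}.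

Definition trans1 (h : R) : measurableTypeR R -> measurableTypeR R := fun x => x + h.

Lemma measurable_trans1 h : measurable_fun setT (trans1 h).
Proof. by apply: measurable_funD => //. Qed.

HB.instance Definition _ h := isMeasurableFun.Build _ _ _ _ (trans1 h) (measurable_trans1 h).

Lemma lebesgue_trans1 h (A : set R) : measurable A ->
  lebesgue_measure (trans1 h @^-1` A) = lebesgue_measure A.
Proof.
move=> mA; rewrite -[LHS]/(pushforward lebesgue_measure (trans1 h) A).
apply/esym/lebesgue_measure_unique => //= _ [[a b]] _ <-.
rewrite /pushforward /=.
have -> : trans1 h @^-1` `]a, b]%classic = `]a - h, b - h]%classic.
  apply/seteqP; split => x /=; rewrite /trans1 !in_itv/= => /andP[h1 h2];
    by apply/andP; split; lra.
rewrite !lebesgue_measure_itv/= !lte_fin ltrD2r.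
by case: ifP => // _; rewrite -!EFinB; congr EFin; lra.
Qed.

Definition transv d (h : 'rV[R]_d) : 'rV[R]_d -> 'rV[R]_d := fun x => x + h.

Lemma measurable_transv d (h : 'rV[R]_d) : measurable_fun setT (transv h).
Proof.
apply: measurable_fun_row => i; under eq_fun do rewrite mxE.
by apply: measurable_funD => //; exact: measurable_coord.
Qed.

HB.instance Definition _ d (h : 'rV[R]_d) :=
  isMeasurableFun.Build _ _ _ _ (transv h) (measurable_transv h).

Definition transp d (h : R * 'rV[R]_d) : measurableTypeR R * 'rV[R]_d -> measurableTypeR R * 'rV[R]_d :=
  fun p => (trans1 h.1 p.1, transv h.2 p.2).

Lemma measurable_transp d (h : R * 'rV[R]_d) : measurable_fun setT (transp h).
Proof.
apply: measurable_fun_pair.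
  exact: measurableT_comp (measurable_trans1 h.1) measurable_fst.
exact: measurableT_comp (measurable_transv h.2) measurable_snd.
Qed.

HB.instance Definition _ d (h : R * 'rV[R]_d) :=
  isMeasurableFun.Build _ _ _ _ (transp h) (measurable_transp h).

Lemma cons_rowD d (p q : R * 'rV[R]_d) :
  cons_row p + cons_row q = cons_row (p.1 + q.1, p.2 + q.2).
Proof.
rewrite /cons_row /= raddfD; exact: (@add_row_mx _ 1 1 d).
Qed.

(** Induction on the dimension: the translated product measure agrees with the product measure on
    rectangles, where the one-dimensional case and the induction hypothesis apply to the two
    factors. *)
Lemma lebesgue_transv d (h : 'rV[R]_d) A : measurable A ->
  lebesgue_row d (transv h @^-1` A) = lebesgue_row d A.
Proof.
elim: d => [|d IH] in h A *.
  move=> _; congr (lebesgue_row 0 _); apply/seteqP.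
  by split => x; rewrite /transv /= [x]thinmx0 [0 + h]thinmx0 // [h]thinmx0.
move=> mA.
rewrite -[LHS]/((@lebesgue_measure R \x lebesgue_row d)%E (@cons_row R d @^-1` (transv h @^-1` A))).
rewrite -[RHS]/((@lebesgue_measure R \x lebesgue_row d)%E (@cons_row R d @^-1` A)).
have mcA : measurable (@cons_row R d @^-1` A).
  by rewrite -[X in measurable X]setTI; exact: measurable_cons_row.
have -> : @cons_row R d @^-1` (transv h @^-1` A) =
    transp (uncons_row h) @^-1` (@cons_row R d @^-1` A).
  have E p : transv h (cons_row p) = cons_row (transp (uncons_row h) p).
    by rewrite /transv -{1}(cons_rowK h) cons_rowD.
  by apply/seteqP; split => p /=; rewrite E.
rewrite -[LHS]/(pushforward (@lebesgue_measure R \x lebesgue_row d)%E (transp (uncons_row h)) (@cons_row R d @^-1` A)).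
apply/esym/product_measure_unique => // B C mB mC.
rewrite -[LHS]/((@lebesgue_measure R \x lebesgue_row d)%E
  ((trans1 (uncons_row h).1 @^-1` B) `*` (transv (uncons_row h).2 @^-1` C))).
rewrite product_measure1E//; last 2 first.
- by rewrite -[X in measurable X]setTI; exact: measurable_trans1.
- by rewrite -[X in measurable X]setTI; exact: measurable_transv.
by congr (_ * _)%E; [exact: lebesgue_trans1|exact: IH].
Qed.

Lemma cons_row_l d (p : R * 'rV[R]_d) j : cons_row p 0 (@lshift 1 d j) = p.1.
Proof. by apply: etrans (row_mxEl _ _ _ _) _; rewrite mxE (ord1 j) eqxx mulr1n. Qed.

Lemma cons_row_r d (p : R * 'rV[R]_d) j : cons_row p 0 (@rshift 1 d j) = p.2 0 j.
Proof. exact: row_mxEr. Qed.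

Lemma lebesgue_cbox_fin d (a b : 'rV[R]_d) : (lebesgue_row d (cbox a b) < +oo)%E.
Proof.
elim: d => [|d IH] in a b *.
  by rewrite /= diracE; case: (_ \in _); rewrite ltry.
rewrite -[X in (X < _)%E]/((@lebesgue_measure R \x lebesgue_row d)%E (@cons_row R d @^-1` (cbox a b))).
have -> : @cons_row R d @^-1` (cbox a b) =
   `[(uncons_row a).1, (uncons_row b).1]%classic `*` cbox (uncons_row a).2 (uncons_row b).2.
  apply/seteqP; split => -[t y] /=.
    move=> h; split => /=.
      by have := h (@lshift 1 d 0); rewrite in_itv /= cons_row_l !mxE.
    by move=> i; have := h (@rshift 1 d i); rewrite cons_row_r !mxE.
  move=> [/=]; rewrite in_itv/= => h1 h2 i; case: (@split_ordP 1 d i) => j ->.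
    by rewrite cons_row_l (ord1 j); move: h1; rewrite !mxE.
  by rewrite cons_row_r; have := h2 j; rewrite !mxE.
rewrite product_measure1E//; last exact: measurable_cbox.
apply: lte_mul_pinfty; [by []| |exact: IH].
have -> : lebesgue_measure `[(uncons_row a).1, (uncons_row b).1]%classic \is a fin_num.
  by rewrite lebesgue_measure_itv/=; case: ifP.
by [].
Qed.

End translation.

(** * Lipschitz boundaries are null sets *)

Section null_boundary.
Context {R : realType} {d : nat}.
Local Notation leb := (@lebesgue_row R d).
Implicit Types (x y z e : 'rV[R]_d).

Lemma dotDl x y z : dot (x + y) z = dot x z + dot y z.
Proof. by rewrite /dot -big_split; apply: eq_bigr => i _; rewrite mxE mulrDl. Qed.
Lemma dotZl (k : R) x y : dot (k *: x) y = k * dot x y.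
Proof. by rewrite /dot mulr_sumr; apply: eq_bigr => i _; rewrite mxE mulrA. Qed.
Lemma dotC x y : dot x y = dot y x.
Proof. by apply: eq_bigr => i _; rewrite mulrC. Qed.

Lemma continuous_coord (i : 'I_d) : continuous (fun x : 'rV[R]_d => x 0 i).
Proof. exact: coord_continuous. Qed.

Lemma continuous_dot e : continuous (dot ^~ e : 'rV[R]_d -> R).
Proof.
rewrite /dot; apply: continuous_big => [|i _]; first exact: add_continuous.
by move=> x; exact: (cvgM (@continuous_coord i x) (cvg_cst (e 0 i))).
Qed.

Lemma lipschitz_continuous (k : R) (f : 'rV[R]_d -> R) : k.-lipschitz f -> continuous f.
Proof.
move=> kf x; apply/(@cvgrPdist_lt _ _ _ (nbhs x) (nbhs_filter x)) => e e0.
have k1 : 0 < `|k| + 1 by rewrite ltr_wpDl.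
near=> y; have := kf (x, y) (conj I I) => /= /le_lt_trans; apply.
apply: (@le_lt_trans _ _ ((`|k| + 1) * `|x - y|)).
  by rewrite ler_wpM2r// (le_trans (ler_norm k))// lerDl.
rewrite mulrC -ltr_pdivlMr//; near: y.
have : 0 < e / (`|k| + 1) by rewrite divr_gt0.
by move/(@nbhsx_ballx _ _ x); rewrite -ball_normE.
Unshelve. all: by end_near. Qed.

Lemma coord_le_norm x (i : 'I_d) : `|x 0 i| <= `|x|.
Proof. by rewrite /Num.norm/= mx_normrE; apply/bigmax_geP; right; exists (0, i). Qed.

Lemma measurable_level (F : 'rV[R]_d -> R) : continuous F -> measurable [set z | F z = 0].
Proof.
move=> cF; have := @measurable_fun_continuous R d F cF measurableT [set 0] (measurable_set1 0).
by rewrite setTI.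
Qed.

(* A Lipschitz graph has infinitely many disjoint translates of the same measure in a box. *)
Lemma negligible_level (F : 'rV[R]_d -> R) e (W : set 'rV[R]_d) (M : R) : continuous F -> 0 < M ->
  (forall z t, F (z + t *: e) = F z + t) -> measurable W -> (forall z, W z -> `|z| <= M) ->
  leb (W `&` [set z | F z = 0]) = 0%E.
Proof.
move=> cF M0 Fe mW HM.
pose S := W `&` [set z | F z = 0].
have mS : measurable S.
  apply: measurableI => //; apply: measurable_closed.
  rewrite (_ : [set z | F z = 0] = F @^-1` [set 0])//.
  by apply: closed_comp; [move=> x _; exact: cF|exact: closed_eq].
(* The offsets are distinct, which makes the translates disjoint, and at most 1, which keeps all of
   them in one box. *)
pose t (n : nat) : R := n.+1%:R^-1.
have t1 n : `|t n| <= 1 by rewrite ger0_norm ?invr_ge0// invf_le1// ler1n.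
pose G n := transv (- t n *: e) @^-1` S.
have mG n : measurable (G n) by rewrite -[X in measurable X]setTI; exact: measurable_transv.
have FG n z : G n z -> F z = t n.
  by rewrite /G /transv /S /= Fe => -[_] /eqP; rewrite subr_eq0 => /eqP.
have tG : trivIset setT G.
  apply/trivIsetP => i j _ _ ij; apply/seteqP; split => // z [/FG zi /FG zj].
  move: zi; rewrite zj => /invr_inj/eqP; rewrite eqr_nat eqSS => /eqP ji.
  by rewrite ji eqxx in ij.
have [K [K0 GK]] : exists K : R, 0 < K /\ forall n, G n `<=` [set x | forall i, `|x 0 i| <= K].
  exists (M + \sum_i `|e 0 i|); split.
    by rewrite ltr_wpDr// sumr_ge0.
  move=> n z [/HM h _] i; have := le_trans (coord_le_norm _ i) h; rewrite /transv !mxE => hi.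
  rewrite -[z 0 i](subrK (t n * e 0 i)) -mulNr.
  apply: le_trans (ler_normD _ _) _; apply: lerD => //.
  rewrite normrM (bigD1 i)//= -[leLHS]addr0 lerD// ?sumr_ge0//.
  by rewrite ler_piMl.
pose c : 'rV[R]_d := const_mx K.
have sub : \bigcup_n G n `<=` cbox (- c) c.
  by move=> z [n _] /GK h i; rewrite !mxE -ler_norml.
have leG n : leb (G n) = leb S by exact: lebesgue_transv.
(* For every k, k copies of S fit into the box, whose measure is finite. *)
have SK k : (\sum_(0 <= i < k) leb S <= leb (cbox (- c) c))%E.
  rewrite (eq_bigr (fun n => leb (G n))) => [|n _]; last by rewrite leG.
  apply: (@le_trans _ _ (\sum_(0 <= i <oo) leb (G i))%E); first exact: nneseries_lim_ge.
  rewrite (_ : (\sum_(0 <= i <oo) _)%E = leb (\bigcup_n G n)); last first.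
    by rewrite measure_bigcup//; apply: eq_eseriesl => n; rewrite in_setT.
  by apply: le_measure => //; rewrite inE; [exact: bigcup_measurable|exact: measurable_cbox].
have cfin := lebesgue_cbox_fin (- c) c.
have := SK 1%N; rewrite big_nat1 => s_le.
have S0 := measure_ge0 leb S.
have sfin : leb S \is a fin_num by rewrite ge0_fin_numE// (le_lt_trans s_le).
have qfin : leb (cbox (- c) c) \is a fin_num by rewrite ge0_fin_numE.
apply/eqP; rewrite eq_le S0 andbT -(fineK sfin) lee_fin leNgt; apply/negP => s0.
have := SK (Num.bound (fine (leb (cbox (- c) c)) / fine (leb S))).+1.
rewrite -(fineK sfin) -(fineK qfin) sumEFin lee_fin big_mkord sumr_const card_ord /=.
apply/negP; rewrite -ltNge -mulr_natl -ltr_pdivrMr//.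
apply: lt_trans (_ : _ < (Num.bound (fine (leb (cbox (- c) c)) / fine (leb S)))%:R) _.
  apply: archi_boundP; apply: divr_ge0; exact: fine_ge0.
by rewrite ltr_nat.
Qed.

(** Near x the boundary lies in the zero set of F z = dot z e - psi (z - dot z e *: e): a point with
    F > 0 has a neighbourhood free of w, and a point with F < 0 is interior to w. Moving along the
    unit vector e leaves the argument of psi unchanged, so [negligible_level] applies to F. *)
Lemma negligible_bdry (w : set 'rV[R]_d) : lipschitz_open w -> leb.-negligible (bdry w).
Proof.
move=> [ow bw lw]; apply: negligible_local => x bx.
have [r [k [e [psi [r0 ee kpsi H]]]]] := lw x bx.
exists (ball x r); split; [exact: ball_open|exact: ballxx|].
pose F z := dot z e - psi (z - dot z e *: e).
have cF : continuous F.
  have c2 : continuous (fun z => z - dot z e *: e).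
    move=> z; apply: (@cvgB R _ _ (nbhs z) _ (fun z => z) (fun z => dot z e *: e)).
      exact: cvg_id.
    exact: (@cvgZr_tmp _ _ _ (nbhs z) _ (fun z => dot z e) _ e (@continuous_dot e z)).
  have c3 := lipschitz_continuous kpsi.
  move=> z; apply: (@cvgB R _ _ (nbhs z) _ (dot ^~ e) (fun z => psi (z - dot z e *: e))).
    exact: continuous_dot.
  exact: (@continuous_comp _ _ _ (fun z => z - dot z e *: e) psi z (c2 z) (c3 _)).
have Fe z t : F (z + t *: e) = F z + t.
  rewrite /F dotDl dotZl ee mulr1 scalerDl opprD addrACA subrr addr0; lra.
exists (ball x r `&` [set z | F z = 0]); split.
- apply: measurableI; first by apply: measurable_open; exact: ball_open.
  exact: measurable_level.
- apply: (@negligible_level _ e _ (`|x| + r)) => //.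
    by rewrite ltr_wpDl.
    by apply: measurable_open; exact: ball_open.
  move=> z; rewrite -ball_normE/= => zr; rewrite -[z](subrK x) addrC.
  by apply: le_trans (ler_normD _ _) _; rewrite lerD2l distrC ltW.
move=> z [[cz iz] zr]; split => //=; apply/eqP; rewrite eq_le; apply/andP; split.
- rewrite leNgt; apply/negP => F0.
  have [y [wy [ry Fy]]] : w `&` (ball x r `&` [set z | 0 < F z]) !=set0.
    apply: cz; apply: open_nbhs_nbhs; split => //.
    apply: openI; first exact: ball_open.
    rewrite (_ : [set z | 0 < F z] = F @^-1` [set t | 0 < t])//.
    by apply: open_comp; [move=> y _; exact: cF|exact: open_gt].
  by move/(H y ry) : wy; rewrite -subr_lt0 -/(F y) ltNge ltW.
- rewrite leNgt; apply/negP; rewrite subr_lt0 => h; apply: iz.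
  by apply: open_nbhs_nbhs; split => //; apply/(H z zr).
Qed.

End null_boundary.

(** * The flat function exp (- 1 / t) and its derivatives *)

Section flat.
Context {R : realType}.
Implicit Types (P : {poly R}).

(** The family is stable under derivation, P being replaced by X^2 (P - P'). All derivatives of exp
    (- 1 / t), extended by 0, are thus treated at once, without explicit formulas for them. *)
Definition flat P (t : R) : R := if 0 < t then P.[t^-1] * expR (- t^-1) else 0.

(** Follows from exp x = (exp (x / n))^n and exp y >= y. *)
Lemma pow_expR_le n (x : R) : 0 <= x -> x ^+ n * expR (- x) <= n%:R ^+ n.
Proof.
case: n => [|n] x0; first by rewrite !expr0 mul1r -expR0 ler_expR oppr_le0.
have n0 : 0 < n.+1%:R :> R by rewrite ltr0n.
rewrite expRN ler_pdivrMr ?expR_gt0//.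
have -> : expR x = expR (x / n.+1%:R) ^+ n.+1.
  by rewrite -expRM_natl mulrC divfK// pnatr_eq0.
suff H : x <= n.+1%:R * expR (x / n.+1%:R).
  by rewrite -exprMn; apply: lerXn2r => //; rewrite nnegrE// (le_trans x0).
rewrite -ler_pdivrMl// mulrC; apply: le_trans (expR_ge1Dx _).
by rewrite lerDr.
Qed.

Lemma poly_expR_bound P : exists C, forall x, 0 <= x -> `|P.[x] * expR (- x)| <= C.
Proof.
(* The extra power of x absorbs the factor X that the induction on P produces. *)
suff H : forall n, exists C, forall x, 0 <= x -> `|x ^+ n * P.[x] * expR (- x)| <= C.
  by have [C HC] := H 0%N; exists C => x /HC; rewrite expr0 mul1r.
elim/poly_ind: P => [|P c IH] n.
  by exists 0 => x _; rewrite horner0 mulr0 mul0r normr0.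
have [C1 H1] := IH n.+1.
exists (C1 + `|c| * n%:R ^+ n) => x x0.
rewrite hornerMXaddC mulrDr mulrDl; apply: le_trans (ler_normD _ _) _.
apply: lerD; first by have := H1 x x0; rewrite exprSr -!mulrA (mulrCA x).
rewrite mulrAC normrM mulrC ler_wpM2l// ger0_norm ?pow_expR_le//.
by rewrite mulr_ge0 ?exprn_ge0 ?expR_ge0.
Qed.

Lemma is_derive_flat P (t : R) : is_derive t 1 (flat P) (flat ('X^2 * (P - P^`())) t).
Proof.
have [t0|t0|t0] := ltgtP t 0.
- rewrite {2}/flat ltNge ltW//=; apply: (@near_eq_is_derive _ _ _ (cst 0)).
  by near=> y; rewrite /flat ltNge ltW//=; near: y; exact: lt_nbhsl.
- rewrite {2}/flat t0.
  have tn : t != 0 by rewrite gt_eqF.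
  have dV : is_derive t 1 (fun y : R => y^-1) (- t ^- 2 *: 1).
    exact: (@is_deriveV R id t 1 1 tn (is_derive_id _ _)).
  have d1 := is_derive1_comp (is_derive_poly P t^-1) dV.
  have dN : is_derive t 1 (fun y : R => - y^-1) (- (- t ^- 2 *: 1)) := is_deriveN dV.
  have d2 := @is_derive1_comp R expR (fun y => - y^-1) t _ _ (is_derive_expR (- t^-1)) dN.
  have d3 := is_deriveM d1 d2.
  have d4 : is_derive t 1 (fun y => P.[y^-1] * expR (- y^-1))
      (('X^2 * (P - P^`())).[t^-1] * expR (- t^-1)).
    apply: (is_derive_eq d3).
    by rewrite !hornerE /GRing.scale/=; field.
  apply: (near_eq_is_derive _ d4).
  by near=> y; rewrite /flat; suff -> : 0 < y by []; near: y; exact: lt_nbhsr.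
- rewrite {2}/flat t0 ltxx.
  (* At 0 the difference quotient is h times (1 / h)^2 P(1 / h) exp (- 1 / h), a bounded
     quantity. *)
  have [C HC] := poly_expR_bound ('X^2 * P).
  have C0 : 0 <= C by apply: le_trans (HC 0 (lexx _)).
  have lim0 : h^-1 *: ((flat P \o shift 0) (h *: 1) - flat P 0) @[h --> 0^'] --> (0 : R).
    apply/cvgrPdist_le => e e0.
    have C1 : 0 < C + 1 by lra.
    near=> h.
    have hC : `|h| <= e / (C + 1).
      near: h; apply: dnbhs0_le; exact: divr_gt0.
    rewrite sub0r normrN /flat /= /shift /= addr0 ltxx subr0 /GRing.scale/= mulr1.
    have [h0|h0] := ltP 0 h; last by rewrite mulr0 normr0 ltW.
    have h1 : 0 <= h^-1 by rewrite invr_ge0 ltW.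
    have := HC _ h1; rewrite hornerM hornerXn => H.
    have -> : h^-1 * (P.[h^-1] * expR (- h^-1)) = h * (h^-1 ^+ 2 * P.[h^-1] * expR (- h^-1)).
      by field; rewrite gt_eqF.
    rewrite normrM; apply: le_trans (ler_pM _ _ hC H) _ => //.
    rewrite mulrAC ler_pdivrMr// ler_pM2l//; lra.
  apply: DeriveDef; first exact: (cvgP _ lim0).
  exact: (cvg_lim (@Rhausdorff R) lim0).
Unshelve. all: by end_near. Qed.

Lemma is_derive_flat_affine P (c e t : R) :
  is_derive t 1 (fun s => flat P (c * s + e)) (c * flat ('X^2 * (P - P^`())) (c * t + e)).
Proof.
have dA : is_derive t 1 (fun s : R => c * s + e) c.
  have d1 := is_deriveD (is_deriveZ c (is_derive_id t (1 : R))) (is_derive_cst e t (1 : R)).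
  by apply: (is_derive_eq d1); rewrite addr0 /GRing.scale/= mulr1.
have d2 := @is_derive1_comp R (flat P) (fun s => c * s + e) t _ _ (is_derive_flat P (c * t + e)) dA.
by apply: (is_derive_eq d2); rewrite mulrC.
Qed.

Lemma flat1_ge0 (t : R) : 0 <= flat 1 t.
Proof. by rewrite /flat; case: ifP => // _; rewrite hornerC mul1r expR_ge0. Qed.

Lemma flat1_le1 (t : R) : flat 1 t <= 1.
Proof.
rewrite /flat; case: ifP => // t0; rewrite hornerC mul1r -expR0 ler_expR.
by rewrite oppr_le0 invr_ge0 ltW.
Qed.

Lemma flat1_lim (t : R) : flat 1 (n.+1%:R * t) @[n --> \oo] --> (if 0 < t then 1 else 0 : R).
Proof.
case: ifPn => t0; last first.
  rewrite (_ : (fun _ => _) = cst 0); first exact: cvg_cst.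
  by apply/funext => n; rewrite /flat pmulr_rgt0// (negPf t0).
rewrite (_ : (fun _ => _) = (fun n => expR (- (n.+1%:R^-1 * t^-1)))); last first.
  by apply/funext => n; rewrite /flat pmulr_rgt0// t0 hornerC mul1r invfM.
have h1 : - (n.+1%:R^-1 * t^-1) @[n --> \oo] --> (0 : R).
  rewrite -oppr0 -(mul0r t^-1); apply: cvgN.
  exact: (cvgM (@cvg_harmonic R) (cvg_cst t^-1)).
rewrite -[X in _ --> X](@expR0 R); apply: continuous_cvg h1.
exact: (@continuous_expR R 0).
Qed.

End flat.

(** * Functions of class C^k *)

Section Ck.
Context {R : realType} {d : nat}.
Local Notation sfun := ('rV[R]_d -> R).
Implicit Types (f g : sfun).

Lemma Ck_le k f : Ck k.+1 f -> Ck k f.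
Proof.
elim: k f => [|k IH] f; first by case.
move=> [cf df]; split => // i; have [d1 d2] := df i; split => //; exact: IH.
Qed.

Lemma pderiv_cst (c : R) i : pderiv i (cst c : sfun) = cst 0.
Proof. by apply/funext => x; exact: (@derive_cst R _ R c x 'e_i). Qed.

Lemma Ck_cst k (c : R) : Ck k (cst c : sfun).
Proof.
elim: k c => [|k IH] c /=; first exact: cst_continuous.
split; first exact: cst_continuous.
by move=> i; rewrite pderiv_cst; split => // x; exact: derivable_cst.
Qed.

Lemma pderivD f g i : (forall x, derivable f x 'e_i) -> (forall x, derivable g x 'e_i) ->
  pderiv i (f + g) = pderiv i f + pderiv i g.
Proof. by move=> df dg; apply/funext => x; rewrite /pderiv deriveD. Qed.

Lemma pderivM f g i : (forall x, derivable f x 'e_i) -> (forall x, derivable g x 'e_i) ->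
  pderiv i (f * g) = f * pderiv i g + g * pderiv i f.
Proof. by move=> df dg; apply/funext => x; rewrite /pderiv deriveM. Qed.

Lemma pderivZ (k : R) f i : (forall x, derivable f x 'e_i) ->
  pderiv i (k *: f) = k *: pderiv i f.
Proof. by move=> df; apply/funext => x; rewrite /pderiv deriveZ. Qed.

Lemma CkD k f g : Ck k f -> Ck k g -> Ck k (f + g).
Proof.
elim: k f g => [|k IH] f g.
  by move=> cf cg x; exact: (continuousD (cf x) (cg x)).
move=> [cf df] [cg dg]; split; first by move=> x; exact: (continuousD (cf x) (cg x)).
move=> i; have [f1 f2] := df i; have [g1 g2] := dg i; split.
  by move=> x; exact: derivableD.
by rewrite pderivD//; exact: IH.
Qed.

Lemma CkM k f g : Ck k f -> Ck k g -> Ck k (f * g).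
Proof.
elim: k f g => [|k IH] f g.
  by move=> cf cg x; exact: (continuousM (cf x) (cg x)).
move=> Cf Cg; have [cf df] := Cf; have [cg dg] := Cg.
split; first by move=> x; exact: (continuousM (cf x) (cg x)).
move=> i; have [f1 f2] := df i; have [g1 g2] := dg i; split.
  by move=> x; exact: derivableM.
by rewrite pderivM//; apply: CkD; apply: IH => //; exact: Ck_le.
Qed.

Lemma CkZ k (c : R) f : Ck k f -> Ck k (c *: f).
Proof.
move=> Cf; rewrite (_ : c *: f = cst c * f)//.
by apply: CkM => //; exact: Ck_cst.
Qed.

Lemma is_derive_coord (F : R -> R) (l : R) (x : 'rV[R]_d) (i j : 'I_d) :
  is_derive (x 0 i) 1 F l ->
  is_derive x ('e_j) (fun y : 'rV[R]_d => F (y 0 i)) (if i == j then l else 0).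
Proof.
case: eqVneq => [<-|ij] dF.
  have [dF1 dF2] := dF.
  have E : (fun h => h^-1 *: (((fun y : 'rV[R]_d => F (y 0 i)) \o shift x) (h *: 'e_i) - F (x 0 i))) =
      (fun h => h^-1 *: ((F \o shift (x 0 i)) (h *: (1 : R)) - F (x 0 i))).
    apply/funext => h /=; rewrite /shift !mxE !eqxx /=; congr (_ *: (F _ - _)).
  apply: DeriveDef; first by rewrite /derivable E.
  by rewrite /derive E.
have E : (fun h => h^-1 *: (((fun y : 'rV[R]_d => F (y 0 i)) \o shift x) (h *: 'e_j) - F (x 0 i))) =
    cst 0.
  apply/funext => h /=; rewrite /shift !mxE eqxx (negPf ij) /= mulr0 add0r.
  by rewrite subrr scaler0.
apply: DeriveDef; first by rewrite /derivable E; exact: is_cvg_cst.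
by rewrite /derive E; apply: lim_cst; exact: Rhausdorff.
Qed.

Lemma Ck_flat k P (c e : R) (i : 'I_d) : Ck k (fun x : 'rV[R]_d => flat P (c * x 0 i + e)).
Proof.
have cont P' : continuous (fun x : 'rV[R]_d => flat P' (c * x 0 i + e)).
  move=> x; apply: (@continuous_comp _ _ _ (fun x : 'rV[R]_d => x 0 i) (fun s => flat P' (c * s + e)) x).
    exact: coord_continuous.
  apply/differentiable_continuous/derivable1_diffP.
  by have [] := is_derive_flat_affine P' c e (x 0 i).
elim: k P => [|k IH] P; first exact: cont.
split; first exact: cont.
move=> j; have dd (x : 'rV[R]_d) := is_derive_coord j (is_derive_flat_affine P c e (x 0 i)).
split; first by move=> x; have [] := dd x.
rewrite (_ : pderiv j _ = (if i == j then c else 0) *: (fun x : 'rV[R]_d => flat ('X^2 * (P - P^`())) (c * x 0 i + e))).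
  exact: CkZ.
apply/funext => x; rewrite /pderiv; have [_ ->] := dd x.
by case: ifP => _ //; rewrite scale0r.
Qed.

End Ck.

(** * Test functions and the smooth approximation of boxes *)

Section test_functions.
Context {R : realType} {d : nat}.
Local Notation leb := (@lebesgue_row R d).
Local Notation sfun := ('rV[R]_d -> R).
Implicit Types (w A : set 'rV[R]_d) (f g phi : sfun).

Lemma ip_dct w g h phi (phin : nat -> sfun) : measurable w -> L2 w g -> L2 w h ->
  (forall n, measurable_fun w (phin n)) -> measurable_fun w phi ->
  (forall n x, w x -> `|phin n x| <= h x) ->
  (forall x, w x -> phin n x @[n --> \oo] --> phi x) ->
  ip w g (phin n) @[n --> \oo] --> ip w g phi.
Proof.
move=> mw Lg Lh mn mphi nh cv.
have [] := @dominated_convergence _ _ _ leb w mw (fun n x => (g x * phin n x)%:E)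
  (fun x => (g x * phi x)%:E) (fun x => (`|g x| * h x)%:E).
- by move=> n; apply/measurable_EFinP; apply: measurable_funM => //; case: Lg.
- by apply/measurable_EFinP; apply: measurable_funM => //; case: Lg.
- apply: aeW => x wx; apply: cvg_EFin; first by apply: nearW.
  by apply: cvgM; [exact: cvg_cst|exact: cv].
- exact: (L2_intM mw (L2_abs mw Lg) Lh).
- apply: aeW => x n wx; rewrite /= lee_fin normrM ler_wpM2l//; exact: nh.
move=> ig _ H; apply: fine_cvg; apply: cvg_trans H _.
rewrite fineK//; exact: integrable_fin_num.
Qed.

Lemma compact_sub_cbox (K : set 'rV[R]_d) : compact K ->
  exists c : 'rV[R]_d, K `<=` cbox (- c) c.
Proof.
move=> /compact_bounded [M [_ /(_ (Num.max (M + 1) 1))]].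
rewrite lt_max ltrDl ltr01 => /(_ isT) H.
exists (const_mx (Num.max (M + 1) 1)) => x /H/= xM i.
by rewrite !mxE -ler_norml; exact: le_trans (coord_le_norm x i) xM.
Qed.

Lemma L2_bounded w f (c : 'rV[R]_d) (M : R) : measurable w -> measurable_fun w f ->
  (forall x, `|f x| <= M) -> (forall x, ~ cbox (- c) c x -> f x = 0) -> L2 w f.
Proof.
move=> mw mf fM f0; split => //.
have mc := measurable_cbox (- c) c.
have ic : leb.-integrable w (EFin \o (fun x => M ^+ 2 * \1_(cbox (- c) c) x)).
  rewrite (_ : _ \o _ = (fun x => (M ^+ 2)%:E * (EFin \o \1_(cbox (- c) c)) x)%E)//.
  apply: integrableZl => //; apply/integrableP; split.
    by apply/measurable_EFinP; exact: measurable_indic.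
  under eq_integral do rewrite /= ger0_norm ?ler0n//.
  rewrite integral_indic//.
  apply: le_lt_trans (lebesgue_cbox_fin (- c) c); apply: le_measure.
  - by rewrite inE; exact: measurableI.
  - by rewrite inE.
  - by move=> x [].
apply: le_integrable ic => //.
  by apply/measurable_EFinP; exact: measurable_funX.
move=> x wx; have M0 : 0 <= M by exact: le_trans (normr_ge0 _) (fM x).
rewrite /= lee_fin ger0_norm ?sqr_ge0// ger0_norm ?mulr_ge0 ?sqr_ge0 ?ler0n//.
rewrite indicE; have [xc|xc] := boolP (x \in cbox (- c) c).
  by rewrite mulr1 -real_normK ?num_real// ler_pXn2r ?nnegrE.
by rewrite f0 ?expr0n ?mulr0//= => /mem_set; apply/negP.
Qed.

Lemma test_continuous w phi : test_function w phi -> continuous phi.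
Proof. by move=> [/(_ 0%N)]. Qed.

Lemma test_measurable w A phi : test_function w phi -> measurable_fun A phi.
Proof.
move=> /test_continuous/measurable_fun_continuous; exact: measurable_funS.
Qed.

Lemma test_bounded w phi : test_function w phi ->
  exists c M, (forall x, `|phi x| <= M) /\ (forall x, ~ cbox (- c) c x -> phi x = 0).
Proof.
move=> tphi; have cphi := test_continuous tphi.
have [_ [K [cK Kw K0]]] := tphi.
have [c Kc] := compact_sub_cbox cK.
have /compact_bounded [M [_ /(_ (Num.max (M + 1) 1))]] : compact (phi @` K).
  by apply: continuous_compact => //; exact: continuous_subspaceT.
rewrite lt_max ltrDl ltr01 => /(_ isT) H.
exists c, (Num.max (M + 1) 1); split => x.
  have [Kx|Kx] := pselect (K x); first by apply: H; exists x.
  by rewrite K0// normr0 le_max ler01 orbT.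
by move=> cx; apply: K0 => /Kc.
Qed.

Lemma test_L2 w A phi : measurable A -> test_function w phi -> L2 A phi.
Proof.
move=> mA tphi; have [c [M [h1 h2]]] := test_bounded tphi.
by apply: (L2_bounded (c := c) (M := M)) => //; exact: test_measurable tphi.
Qed.

Lemma test_sub w w' phi : w `<=` w' -> test_function w phi -> test_function w' phi.
Proof. by move=> ww [h [K [K1 K2 K3]]]; split => //; exists K; split => // x /K2/ww. Qed.

Lemma testZD w (k : R) f g : test_function w f -> test_function w g -> test_function w (k *: f + g).
Proof.
move=> [f1 [K [K1 K2 K3]]] [g1 [L [L1 L2 L3]]]; split.
  by move=> n; apply: CkD => //; exact: CkZ.
exists (K `|` L); split; first exact: compactU.
  by move=> x [/K2|/L2].
move=> x /not_orP[Kx Lx]; rewrite -[LHS]/(k * f x + g x) K3// L3//.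
by rewrite mulr0 addr0.
Qed.

Lemma test0 w : test_function w 0.
Proof.
split; first by move=> k; exact: Ck_cst.
by exists set0; split => //; exact: compact0.
Qed.

Lemma test_sum w (I : Type) (s : seq I) (F : I -> sfun) :
  (forall i, test_function w (F i)) -> test_function w (\sum_(i <- s) F i).
Proof.
move=> tF; apply: big_ind => //; first exact: test0.
by move=> f g tf tg; rewrite -[f]scale1r; exact: testZD.
Qed.

Lemma test_derivable w phi i x : test_function w phi -> derivable phi x 'e_i.
Proof. by move=> [/(_ 1%N) [_ /(_ i) [d1 _]] _]; exact: d1. Qed.

Lemma pderiv_supp (K : set 'rV[R]_d) phi i x : compact K -> (forall x, ~ K x -> phi x = 0) ->
  ~ K x -> pderiv i phi x = 0.
Proof.
move=> cK K0 Kx; rewrite /pderiv (@near_eq_derive _ _ _ _ (cst 0)) ?derive_cst//.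
have oK : open (~` K) by apply: closed_openC; exact: compact_closed.
have : nbhs x (~` K) by exact: open_nbhs_nbhs.
by apply: filterS => y /K0.
Qed.

Lemma test_pderiv w phi i : test_function w phi -> test_function w (pderiv i phi).
Proof.
move=> [h [K [K1 K2 K3]]]; split.
  by move=> k; have [_ /(_ i) []] := h k.+1.
by exists K; split => // x; exact: pderiv_supp.
Qed.

Lemma pderivZD w (k : R) f g i : test_function w f -> test_function w g ->
  pderiv i (k *: f + g) = k *: pderiv i f + pderiv i g.
Proof.
move=> tf tg; rewrite pderivD ?pderivZ//.
- by move=> x; exact: test_derivable tf.
- by move=> x; apply: derivableZ; exact: test_derivable tf.
- by move=> x; exact: test_derivable tg.
Qed.

(** Smooth functions that vanish off the open box and tend to its indicator as n grows; each
    coordinate contributes one factor per face. The arguments are expanded into the affine form that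
    [Ck_flat] covers, and [hatfE] restores the readable one. *)
Definition hatf (a b : 'rV[R]_d) (n : nat) : sfun :=
  \prod_(i < d) ((fun x => flat 1 (n.+1%:R * x 0 i + - (n.+1%:R * a 0 i))) *
                 (fun x => flat 1 (- n.+1%:R * x 0 i + n.+1%:R * b 0 i))).

Lemma hatfE a b n x : hatf a b n x =
  \prod_(i < d) (flat 1 (n.+1%:R * (x 0 i - a 0 i)) * flat 1 (n.+1%:R * (b 0 i - x 0 i))).
Proof.
rewrite /hatf fct_prodE; apply: eq_bigr => i _ /=.
by rewrite -[LHS]/(_ * _); congr (flat 1 _ * flat 1 _); ring.
Qed.

Lemma hatf_ge0 a b n x : 0 <= hatf a b n x.
Proof. by rewrite hatfE; apply: prodr_ge0 => i _; rewrite mulr_ge0// flat1_ge0. Qed.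

Lemma hatf_le1 a b n x : hatf a b n x <= 1.
Proof.
rewrite hatfE; apply: prodr_ile1 => i _; rewrite mulr_ge0 ?flat1_ge0//=.
by rewrite mulr_ile1 ?flat1_ge0 ?flat1_le1.
Qed.

Lemma hatf_out a b n x : ~ box a b x -> hatf a b n x = 0.
Proof.
move=> nb; rewrite hatfE; have [i ni] : exists i, ~~ (a 0 i < x 0 i < b 0 i).
  by apply/existsP; rewrite -negb_forall; apply/negP => /forallP h; exact: nb.
rewrite (bigD1 i)//= /flat !pmulr_rgt0// !subr_gt0.
move: ni; rewrite negb_and => /orP[/negPf ->|/negPf ->]; first by rewrite !mul0r.
by rewrite mulr0 mul0r.
Qed.

Lemma hatf_lim a b x : hatf a b n x @[n --> \oo] --> (\1_(box a b) x : R).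
Proof.
have -> : \1_(box a b) x = \prod_(i < d) ((if 0 < x 0 i - a 0 i then 1 else 0) *
    (if 0 < b 0 i - x 0 i then 1 else 0)) :> R.
  rewrite indicE; have [xb|xb] := boolP (x \in box a b).
    rewrite big1// => i _; have := set_mem xb i; rewrite !subr_gt0 => /andP[-> ->].
    by rewrite mulr1.
  have [i ni] : exists i, ~~ (a 0 i < x 0 i < b 0 i).
    apply/existsP; rewrite -negb_forall; apply/negP => /forallP h.
    by move/negP : xb; apply; apply/mem_set.
  rewrite (bigD1 i)//= !subr_gt0.
  move: ni; rewrite negb_and => /orP[/negPf ->|/negPf ->]; first by rewrite !mul0r.
  by rewrite mulr0 mul0r.
under eq_fun do rewrite hatfE.
apply: cvg_big => [|i _]; first exact: mul_continuous.
by apply: cvgM; exact: flat1_lim.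
Qed.

Lemma compact_cbox (a b : 'rV[R]_d) : compact (cbox a b).
Proof.
have := @rV_compact R d (fun i => `[a 0 i, b 0 i]%classic) (fun i => @segment_compact R (a 0 i) (b 0 i)).
congr compact; apply/seteqP; split => x /= h i; have := h i; rewrite in_itv//=.
Qed.

Lemma test_hatf w a b n : cbox a b `<=` w -> test_function w (hatf a b n).
Proof.
move=> abw; split.
  move=> k; rewrite /hatf; elim/big_ind: _ => [|f g|i _]; [exact: (Ck_cst k 1)|exact: CkM|].
  by apply: CkM; exact: Ck_flat.
exists (cbox a b); split => //; first exact: compact_cbox.
by move=> x nx; apply: hatf_out => /box_cbox.
Qed.

End test_functions.

(** * The fundamental lemma of the calculus of variations *)

Section fundamental_lemma.
Context {R : realType} {d : nat}.
Local Notation leb := (@lebesgue_row R d).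
Local Notation sfun := ('rV[R]_d -> R).
Implicit Types (w A : set 'rV[R]_d) (f g phi : sfun).

Definition boxes : set (set 'rV[R]_d) := [set A | exists a b, A = box a b].

Lemma box_setI (a b a' b' : 'rV[R]_d) : box a b `&` box a' b' =
  box (\row_i Num.max (a 0 i) (a' 0 i)) (\row_i Num.min (b 0 i) (b' 0 i)).
Proof.
apply/seteqP; split => x /=.
  move=> [h h'] i; rewrite !mxE gt_max lt_min.
  by have /andP[-> ->] := h i; have /andP[-> ->] := h' i.
move=> h; split => i; have := h i; rewrite !mxE gt_max lt_min => /andP[/andP[h1 h2] /andP[h3 h4]].
  by rewrite h1 h3.
by rewrite h2 h4.
Qed.

Lemma boxesI : setI_closed boxes.
Proof. by move=> _ _ [a [b ->]] [a' [b' ->]]; rewrite box_setI; do 2 eexists. Qed.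

Lemma measurable_boxes A : measurable A -> <<s boxes >> A.
Proof.
have sb : sigma_algebra setT <<s boxes >> by exact: smallest_sigma_algebra.
apply: smallest_sub => // B; rewrite -bigcup_seq => -[i _] [Y mY <-].
have : measurable_fun setT (fun x : g_sigma_algebraType boxes => (x : 'rV[R]_d) 0 i).
  apply: (measurability _ (RGenOpens.measurableE R)).
  move=> _ [_ [s [t ->] <-]]; rewrite setTI.
  (* An open slab in one coordinate is the union of the boxes whose other sides are ]-n, n[. *)
  rewrite (_ : _ @^-1` _ = \bigcup_n box (\row_j (if j == i then s else - n%:R))
                                         (\row_j (if j == i then t else n%:R))).
    apply: bigcup_measurable => n _; apply: sub_sigma_algebra.
    by exists (\row_j (if j == i then s else - n%:R)), (\row_j (if j == i then t else n%:R)).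
  apply/seteqP; split => x /=.
    rewrite in_itv/= => /andP[h1 h2]; exists (Num.bound (`|x|)) => //= j; rewrite !mxE.
    case: eqVneq => [->|_]; first by rewrite h1 h2.
    rewrite -ltr_norml; apply: le_lt_trans (coord_le_norm x j) _.
    exact: archi_boundP.
  move=> [n _ /(_ i)]; rewrite !mxE eqxx in_itv; exact.
move=> /(_ measurableT Y mY); exact.
Qed.

Lemma L2_indic w A a b : measurable w -> measurable A -> L2 w \1_(A `&` box a b).
Proof.
move=> mw mA; have [c Hc] := compact_sub_cbox (@compact_cbox R d a b).
apply: (L2_bounded (c := c) (M := 1)) => //.
- by apply: measurable_indic; apply: measurableI => //; exact: measurable_box.
- by move=> x; rewrite ger0_norm ?ler0n// indicE; case: (_ \in _).
- move=> x nx; rewrite indicE memNset//= => -[_ /box_cbox/Hc]; exact: nx.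
Qed.

Lemma open_box a b : open (box a b : set 'rV[R]_d).
Proof.
rewrite openE => x bx.
have : \forall y \near x, forall i : 'I_d, a 0 i < (y : 'rV[R]_d) 0 i < b 0 i.
  apply: (@filter_forall _ _ _ (nbhs x) (nbhs_filter x)) => i.
  have oI : open `]a 0 i, b 0 i[%classic by exact: interval_open.
  have : nbhs (x 0 i) `]a 0 i, b 0 i[%classic.
    by apply: open_nbhs_nbhs; split => //; rewrite /= in_itv/=; exact: bx.
  move=> /(@coord_continuous R 1 d 0 i x); apply: (@filterS _ (nbhs x) (nbhs_filter x)) => y.
  by rewrite /= in_itv.
exact: (@filterS _ (nbhs x) (nbhs_filter x)).
Qed.

(** Dominated convergence along [hatf] makes g orthogonal to the indicators of boxes, and the
    pi-lambda theorem extends this to all measurable subsets of a fixed box inside w. Hence g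
    vanishes almost everywhere in each such box, which is enough by [negligible_local]. *)
Lemma du_bois w g : open w -> L2 w g ->
  (forall phi, test_function w phi -> ip w g phi = 0) ->
  {ae leb, forall x, w x -> g x = 0}.
Proof.
move=> ow Lg g0; have mw := measurable_open ow.
have ipbox a b : cbox a b `<=` w -> ip w g \1_(box a b) = 0.
  move=> abw.
  have : ip w g (hatf a b n) @[n --> \oo] --> ip w g \1_(box a b).
    apply: (ip_dct (h := \1_(box a b))) => //.
    - by have := L2_indic a b mw measurableT; rewrite setTI.
    - by move=> n; apply: (@test_measurable _ _ w); exact: test_hatf.
    - by apply: measurable_indic; exact: measurable_box.
    - move=> n x _; rewrite ger0_norm ?hatf_ge0// indicE.
      have [xb|xb] := boolP (x \in box a b); first exact: hatf_le1.
      by rewrite hatf_out// => h; rewrite mem_set in xb.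
    - by move=> x _; exact: hatf_lim.
  rewrite (_ : (fun _ => _) = cst 0); last first.
    by apply/funext => n; apply: g0; exact: test_hatf.
  by move/(cvg_lim (@Rhausdorff R)); rewrite lim_cst.
suff : leb.-negligible [set x | w x /\ g x != 0].
  move=> [N [mN N0 sN]]; exists N; split => // x /= h; apply: sN.
  by split; apply: contrapT => h'; apply: h => // wx; move/negP: h'; rewrite negbK => /eqP.
apply: negligible_local => x [wx gx].
have [a [b [xab abw]]] := open_rat_box ow wx.
exists (box (ratv a) (ratv b)); split => //.
  exact: open_box.
set B := box (ratv a) (ratv b).
have mB : measurable B := measurable_box _ _.
have L2B A : measurable A -> L2 w \1_(A `&` B) by move=> mA; exact: L2_indic.
(* Sets are intersected with the fixed box B, so that all indicators are square integrable and the
   whole space belongs to the system. *)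
pose H := [set A | measurable A /\ ip w g \1_(A `&` B) = 0].
have lH : lambda_system setT H.
  split => //.
  - by split => //; rewrite setTI; exact: ipbox.
  - move=> A C CA [mA A0] [mC C0]; split; first exact: measurableD.
    rewrite (_ : \1_(_ `&` B) = \1_(A `&` B) - \1_(C `&` B) :> sfun).
      by rewrite ipBr ?A0 ?C0 ?subrr//; exact: L2B.
    apply/funext => y; rewrite -[RHS]/(\1_(A `&` B) y - \1_(C `&` B) y) !indicE.
    rewrite (in_setI _ (A `\` C)) in_setD !in_setI.
    have [yC|yC] := boolP (y \in C); last by rewrite andbT subr0.
    by rewrite (mem_set (CA _ (set_mem yC))) /= subrr.
  - move=> F ndF HF; have mF n : measurable (F n) by case: (HF n).
    have mUF : measurable (\bigcup_i F i) by exact: bigcup_measurable.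
    split => //.
    have : ip w g \1_(F n `&` B) @[n --> \oo] --> ip w g \1_(\bigcup_i F i `&` B).
      apply: (ip_dct (h := \1_(setT `&` B))) => //.
      + exact: L2B.
      + by move=> n; apply: measurable_indic; exact: measurableI.
      + by apply: measurable_indic; exact: measurableI.
      + move=> n y _; rewrite ger0_norm ?ler0n// !indicE !in_setI in_setT /=.
        by case: (y \in F n) => /=; rewrite ?ler0n.
      + move=> y _; have [[n _ Fny]|nFy] := pselect ((\bigcup_i F i) y).
          apply: cvg_near_cst; exists n => // m /= nm.
          have Fm : F m y by move: (ndF _ _ nm) => /subsetPset sub; exact: sub.
          have FU : (\bigcup_i F i) y by exists n.
          by rewrite !indicE !in_setI (mem_set Fm) (mem_set FU).
        apply: cvg_near_cst; apply: nearW => m; rewrite !indicE !in_setI.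
        have nFm : ~ F m y by move=> Fmy; apply: nFy; exists m.
        by rewrite (memNset nFy) (memNset nFm).
    rewrite (_ : (fun _ => _) = cst 0); last by apply/funext => n; case: (HF n).
    by move/(cvg_lim (@Rhausdorff R)); rewrite lim_cst.
have HA A : measurable A -> ip w g \1_(A `&` B) = 0.
  move=> mA; suff : H A by case.
  apply: (lambda_system_subset boxesI lH) (measurable_boxes mA) => //.
  move=> _ [a' [b' ->]]; split; first exact: measurable_box.
  rewrite box_setI; apply: ipbox; apply: subset_trans abw => y hy i.
  by have := hy i; rewrite !mxE ge_max le_min => /andP[/andP[_ ->] /andP[_ ->]].
have : ae_eq leb w (fun x => (g x * \1_(setT `&` B) x)%:E) (cst 0%E).
  apply: integral_ae_eq => //.
    by apply: L2_intM => //; exact: L2B.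
  move=> E Ew mE; rewrite integral_cst// mul0e.
  rewrite -(setIidr Ew) integral_mkcondr.
  have iE := L2_intM mw Lg (L2B _ mE).
  rewrite (eq_integral (fun x => (g x * \1_(E `&` B) x)%:E)).
    by rewrite -[LHS]fineK ?integrable_fin_num//; congr EFin; exact: HA.
  move=> y yw; rewrite patchE !indicE !in_setI in_setT /=.
  by case: (y \in E) => //=; rewrite mulr0.
move=> [N [mN N0 sN]]; exists N; split => // y [[wy gy] By]; apply: sN => /(_ wy).
rewrite indicE in_setI in_setT mem_set//= mulr1 => -[]; exact/eqP.
Qed.

End fundamental_lemma.

(** * Integration by parts for test functions *)

Section integration_by_parts.
Context {R : realType} {d : nat}.
Local Notation leb := (@lebesgue_row R d).
Local Notation sfun := ('rV[R]_d -> R).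
Implicit Types (w A : set 'rV[R]_d) (f g phi : sfun).

Lemma Rintegral_transv (f : sfun) (h : 'rV[R]_d) : measurable_fun setT f ->
  leb.-integrable setT (EFin \o (f \o transv h)) ->
  \int[leb]_x f (x + h) = \int[leb]_x f x.
Proof.
move=> mf ifh; congr fine.
have E A : measurable A -> pushforward leb (transv h) A = leb A by exact: lebesgue_transv.
rewrite -[RHS](@eq_measure_integral _ _ _ setT _ (pushforward leb (transv h))); last first.
  by move=> A mA _; first [exact: E | exact/esym/E].
rewrite [RHS](@integral_pushforward _ _ _ _ _ (transv h) (measurable_transv h) leb setT)//; last exact/measurable_EFinP.
Qed.

Lemma is_derive_line f (i : 'I_d) (x : 'rV[R]_d) (t : R) : (forall y, derivable f y 'e_i) ->
  is_derive t 1 (fun s : R => f (s *: 'e_i + x)) (pderiv i f (t *: 'e_i + x)).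
Proof.
move=> df.
have E : (fun h => h^-1 *: (((fun s : R => f (s *: 'e_i + x)) \o shift t) (h *: (1 : R)) - f (t *: 'e_i + x))) =
   (fun h => h^-1 *: ((f \o shift (t *: 'e_i + x)) (h *: 'e_i) - f (t *: 'e_i + x))).
  apply/funext => h /=; rewrite /shift; congr (_ *: (f _ - _)).
  by rewrite scalerDl addrA /GRing.scale/= mulr1.
apply: DeriveDef; first by rewrite /derivable E; exact: df.
by rewrite /derive E.
Qed.

Lemma pderiv_lip w f (i : 'I_d) : test_function w f ->
  exists M, 0 <= M /\ forall x h, 0 <= h -> `|f (h *: 'e_i + x) - f x| <= M * h.
Proof.
move=> tf; have [_ [M [HM _]]] := test_bounded (test_pderiv i tf).
exists M; split; first by exact: le_trans (normr_ge0 _) (HM 0).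
move=> x h h0.
have dl t := is_derive_line x t (fun y => @test_derivable _ _ _ _ i y tf).
have [] := @MVT_segment R (fun s => f (s *: 'e_i + x)) _ 0 h h0 (fun t _ => dl t).
  apply: derivable_within_continuous => t _; have [] := dl t; exact.
move=> c _; rewrite scale0r add0r subr0 => ->.
by rewrite normrM (ger0_norm h0) ler_wpM2r.
Qed.

(** The difference quotients have integral 0 by translation invariance. They are bounded by the mean
    value theorem and supported in one box, so they converge to the derivative under the
    integral. *)
Lemma int_pderiv0 w f (i : 'I_d) : test_function w f -> \int[leb]_x pderiv i f x = 0.
Proof.
move=> tf; have [c [M [fM f0]]] := test_bounded tf.
have [L [L0 HL]] := pderiv_lip i tf.
have mf := @test_measurable R d w setT f tf.
pose h n : R := n.+1%:R^-1.
have h0 n : 0 < h n by rewrite invr_gt0.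
(* The steps h n are at most 1, so enlarging the box of f by 1 catches the supports of all its
   shifts. *)
pose c1 := c + const_mx 1.
pose C := cbox (- c1) c1.
have mC : measurable C := measurable_cbox _ _.
have L2C : L2 setT (\1_C : sfun).
  apply: (L2_bounded (c := c1) (M := 1)) => //.
  - by move=> x; rewrite ger0_norm ?ler0n// indicE; case: (_ \in _).
  - by move=> x nx; rewrite indicE memNset.
have out n x : ~ C x -> f (h n *: 'e_i + x) = 0 /\ f x = 0.
  move=> Cx; split; apply: f0 => cx; apply: Cx => j; have := cx j; rewrite !mxE.
    rewrite eqxx /= -!ler_norml => H.
    rewrite -[x 0 j](addrK (h n * (j == i)%:R)) addrC.
    apply: le_trans (ler_normD _ _) _; rewrite addrC; apply: lerD.
      by rewrite addrC.
    rewrite normrN normrM normr_nat ger0_norm; last exact: ltW.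
    apply: mulr_ile1 => //; [exact: ltW|by rewrite invf_le1// ler1n|by case: (_ == _)].
  by move=> /andP[h1 h2]; apply/andP; split; lra.
have mfh n : measurable_fun setT (fun x => f (h n *: 'e_i + x)).
  rewrite (_ : (fun _ => _) = f \o transv (h n *: 'e_i)).
    exact: (measurableT_comp mf (measurable_transv _)).
  by apply/funext => x; rewrite /= /transv addrC.
pose D n : sfun := fun x => (h n)^-1 * (f (h n *: 'e_i + x) - f x).
have Dout n x : ~ C x -> D n x = 0.
  by move=> /(out n) [e1 e2]; rewrite /D e1 e2 subrr mulr0.
have DL n x : `|D n x| <= L.
  rewrite /D normrM gtr0_norm ?invr_gt0// mulrC ler_pdivrMr//.
  by apply: HL; exact: ltW.
have mD n : measurable_fun setT (D n).
  apply: measurable_funM => //; apply: measurable_funB => //.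
have mdf : measurable_fun setT (pderiv i f) by exact: test_measurable (test_pderiv i tf).
have cD x : D n x @[n --> \oo] --> pderiv i f x.
  have df := @test_derivable _ _ _ _ i x tf.
  have H : (fun t => t^-1 *: ((f \o shift x) (t *: 'e_i) - f x)) @ (0 : R)^' --> pderiv i f x by exact: df.
  have hl : h @ \oo --> (0 : R)^'.
    move=> P nP.
    have : \forall n \near \oo, h n != 0 -> P (h n) by exact: (@cvg_harmonic R _ nP).
    by apply: filterS => n; apply; rewrite gt_eqF.
  exact: (cvg_comp _ _ hl H).
have ipC1 g : (forall x, ~ C x -> g x = 0) -> ip setT \1_C g = \int[leb]_x g x.
  move=> g0; apply: eq_Rintegral => x _; rewrite indicE.
  by have [xC|xC] := boolP (x \in C); rewrite ?mul1r// g0 ?mulr0// => h'; rewrite mem_set in xC.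
have lim : ip setT \1_C (D n) @[n --> \oo] --> ip setT \1_C (pderiv i f).
  apply: (ip_dct (h := fun x => L * \1_C x)) => //.
  - by rewrite (_ : (fun _ => _) = L *: \1_C)//; exact: L2Z.
  - move=> n x _; rewrite indicE; have [xC|xC] := boolP (x \in C); first by rewrite mulr1.
    by rewrite Dout ?normr0 ?mulr0// => h'; rewrite mem_set in xC.
have pout x : ~ C x -> pderiv i f x = 0.
  move=> Cx; have := cD x; under eq_fun do rewrite Dout//.
  by move/(cvg_lim (@Rhausdorff R)); rewrite lim_cst.
rewrite -ipC1//.
move: lim; rewrite (_ : (fun _ => _) = cst 0).
  by move/(cvg_lim (@Rhausdorff R)); rewrite lim_cst.
apply/funext => n; rewrite ipC1//; last exact: Dout.
have Lf : L2 setT f by exact: test_L2 tf.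
have Lfh : L2 setT (fun x => f (h n *: 'e_i + x)).
  apply: (L2_bounded (c := c1) (M := M)) => //.
  by move=> x /(out n) [].
have int1 g : L2 setT g -> (forall x, ~ C x -> g x = 0) -> leb.-integrable setT (EFin \o g).
  move=> Lg g0; have := L2_intM measurableT L2C Lg.
  apply: eq_integrable => // x _ /=; congr EFin; rewrite indicE.
  by have [xC|xC] := boolP (x \in C); rewrite ?mul1r// g0 ?mulr0// => h'; rewrite mem_set in xC.
have i1 : leb.-integrable setT (EFin \o f) by apply: int1 => // x /(out 0%N) [].
have i2 : leb.-integrable setT (EFin \o (fun x => f (h n *: 'e_i + x))).
  by apply: int1 => // x /(out n) [].
rewrite /D RintegralZl//; last first.
  by have := integrableB measurableT i2 i1; apply: eq_integrable => // x _ /=; rewrite EFinB.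
rewrite RintegralB//.
have -> : \int[leb]_x f (h n *: 'e_i + x) = \int[leb]_x f x.
  rewrite -(@Rintegral_transv f (h n *: 'e_i)) //.
    by apply: eq_Rintegral => x _; rewrite addrC.
  by apply: eq_integrable i2 => // x _ /=; rewrite /transv addrC.
by rewrite subrr mulr0.
Qed.

Lemma testM w f g : test_function w f -> (forall k, Ck k g) -> test_function w (f * g).
Proof.
move=> [f1 [K [K1 K2 K3]]] g1; split; first by move=> k; exact: CkM.
by exists K; split => // x Kx; rewrite -[LHS]/(f x * g x) K3// mul0r.
Qed.

Lemma ip_setT w f g : measurable w -> (forall x, ~ w x -> f x = 0) -> ip w f g = ip setT f g.
Proof.
move=> mw f0; rewrite /ip [LHS]Rintegral_mkcond; apply: eq_Rintegral => x _.
rewrite patchE; case: ifPn => // xw; rewrite f0 ?mul0r// => h.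
by rewrite mem_set in xw.
Qed.

(** As f vanishes off w, the integrals extend to the whole space, where the derivative of the
    product f g has integral 0. *)
Lemma test_ibp w w' f g i : measurable w -> test_function w f -> test_function w' g ->
  ip w f (pderiv i g) = - ip w (pderiv i f) g.
Proof.
move=> mw tf tg.
have [_ [K [K1 K2 K3]]] := tf.
have s1 x : ~ w x -> f x = 0 by move=> nw; apply: K3 => /K2.
have s2 x : ~ w x -> pderiv i f x = 0 by move=> nw; apply: (@pderiv_supp _ _ K) => // /K2.
rewrite !(ip_setT _ mw)//.
have tfg := testM tf (proj1 tg).
have := int_pderiv0 i tfg; rewrite pderivM; last 2 first.
- by move=> x; exact: test_derivable tf.
- by move=> x; exact: test_derivable tg.
have Lf := test_L2 measurableT tf; have Lg := test_L2 measurableT tg.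
have Ldf := test_L2 measurableT (test_pderiv i tf).
have Ldg := test_L2 measurableT (test_pderiv i tg).
rewrite RintegralD//; [|exact: L2_intM|exact: L2_intM].
rewrite -/(ip setT f (pderiv i g)) -/(ip setT g (pderiv i f)) => /eqP.
by rewrite addr_eq0 (ipC _ g) => /eqP.
Qed.

End integration_by_parts.

(** * Square integrable vector fields *)

Section L2v_theory.
Context {R : realType} {d : nat}.
Local Notation leb := (@lebesgue_row R d).
Local Notation sfun := ('rV[R]_d -> R).
Local Notation vfun := ('rV[R]_d -> 'rV[R]_d).
Variable w : set 'rV[R]_d.
Hypothesis mw : measurable w.
Implicit Types (f g h : sfun) (p q r : vfun) (k : R).

Definition cmp p (i : 'I_d) : sfun := fun x => p x 0 i.

Lemma cmpZD k p q i : cmp (k *: p + q) i = k *: cmp p i + cmp q i.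
Proof. by apply/funext => x; rewrite /cmp !mxE. Qed.
Lemma cmpD p q i : cmp (p + q) i = cmp p i + cmp q i.
Proof. by apply/funext => x; rewrite /cmp !mxE. Qed.
Lemma cmpN p i : cmp (- p) i = - cmp p i.
Proof. by apply/funext => x; rewrite /cmp !mxE. Qed.
Lemma cmpB p q i : cmp (p - q) i = cmp p i - cmp q i.
Proof. by rewrite cmpD cmpN. Qed.
Lemma cmp_0 i : cmp 0 i = 0.
Proof. by apply/funext => x; rewrite /cmp !mxE. Qed.

Lemma L2v0 : L2v w 0.
Proof. by move=> i; rewrite -/(cmp 0 i) cmp_0; exact: L20. Qed.
Lemma L2vZD k p q : L2v w p -> L2v w q -> L2v w (k *: p + q).
Proof.
by move=> Lp Lq i; rewrite -/(cmp _ i) cmpZD; apply: L2ZD => //; [exact: Lp|exact: Lq].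
Qed.
Lemma L2vZ k p : L2v w p -> L2v w (k *: p).
Proof. by move=> Lp; rewrite -[_ *: _]addr0; apply: L2vZD => //; exact: L2v0. Qed.
Lemma L2vD p q : L2v w p -> L2v w q -> L2v w (p + q).
Proof. by move=> Lp Lq; rewrite -[p]scale1r; exact: L2vZD. Qed.
Lemma L2vN p : L2v w p -> L2v w (- p).
Proof. by rewrite -scaleN1r; exact: L2vZ. Qed.
Lemma L2vB p q : L2v w p -> L2v w q -> L2v w (p - q).
Proof. by move=> ? /L2vN; exact: L2vD. Qed.

Lemma ipvE p q : L2v w p -> L2v w q -> ipv w p q = \sum_i ip w (cmp p i) (cmp q i).
Proof.
move=> Lp Lq; rewrite /ipv.
(* Integrability of the partial sums is part of the claim, because the additivity of the integral
   needs it at each step. *)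
have H (s : seq 'I_d) : leb.-integrable w (EFin \o (fun x => \sum_(i <- s) cmp p i x * cmp q i x)) /\
  \int[leb]_(x in w) (\sum_(i <- s) cmp p i x * cmp q i x) = \sum_(i <- s) ip w (cmp p i) (cmp q i).
  elim: s => [|i s [IH1 IH2]].
    split.
      by apply: eq_integrable (integrable0 leb w) => // x _ /=; rewrite big_nil.
    by under eq_Rintegral do rewrite big_nil; rewrite big_nil Rintegral_cst// mul0r.
  have ii := L2_intM mw (Lp i) (Lq i).
  split.
    have := integrableD mw ii IH1.
    by apply: eq_integrable => // x _ /=; rewrite big_cons EFinD.
  by under eq_Rintegral do rewrite big_cons; rewrite RintegralD// IH2 big_cons.
by have [_] := H (index_enum 'I_d).
Qed.

Lemma ipvC p q : ipv w p q = ipv w q p.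
Proof. by apply: eq_Rintegral => x _; rewrite dotC. Qed.

Lemma ipvZD k p q r : L2v w p -> L2v w q -> L2v w r ->
  ipv w (k *: p + q) r = k * ipv w p r + ipv w q r.
Proof.
move=> Lp Lq Lr; rewrite !ipvE//; last exact: L2vZD.
rewrite mulr_sumr -big_split; apply: eq_bigr => i _ /=.
by rewrite cmpZD ipZD//; [exact: Lp|exact: Lq|exact: Lr].
Qed.

Lemma ipv_ge0 p : 0 <= ipv w p p.
Proof. by apply: Rintegral_ge0 => x _; apply: sumr_ge0 => i _; rewrite -expr2 sqr_ge0. Qed.

Definition ipv_CS := si_CSN L2v0 L2vZD ipvC ipvZD (fun p _ => ipv_ge0 p).
Definition ipvDl := siBDl ipvZD.
Definition ipvBl := siBBl ipvZD.
Definition ipvBr := siBBr ipvC ipvZD.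
Definition ipvZl := siBZl L2v0 ipvZD.
Definition ipvZr := siBZr L2v0 ipvC ipvZD.
Definition ipv0l := siB0l L2v0 ipvZD.

Lemma ipv0r p : L2v w p -> ipv w p 0 = 0.
Proof. by move=> Lp; rewrite ipvC ipv0l. Qed.

Lemma eq_ipv p p' q q' : (forall x, w x -> p x = p' x) ->
  (forall x, w x -> q x = q' x) -> ipv w p q = ipv w p' q'.
Proof.
by move=> ff gg; apply: eq_Rintegral => x; rewrite inE => wx; rewrite ff// gg.
Qed.

Lemma eq_L2v p q : (forall x, w x -> p x = q x) -> L2v w p -> L2v w q.
Proof. by move=> pq Lp i; apply: (eq_L2 mw _ (Lp i)) => x wx; rewrite pq. Qed.

Lemma ipv_cmp_le p i : L2v w p -> ip w (cmp p i) (cmp p i) <= ipv w p p.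
Proof.
move=> Lp; rewrite ipvE// (bigD1 i)//= lerDl.
by apply: sumr_ge0 => j _; exact: ip_ge0.
Qed.

Lemma L2v_complete : si_complete (L2v w) (ipv w).
Proof.
move=> p Lp [K HK].
have H i : exists u : sfun, L2 w u /\ siN (ip w) (u - cmp (p n) i) @[n --> \oo] --> (0 : R).
  have [||u Lu cu] := @L2_complete R d w mw (fun n => cmp (p n) i).
  - by move=> n; exact: Lp.
  - exists K => n; apply: le_trans (HK n); rewrite -cmpB ler_wsqrtr//.
    by apply: ipv_cmp_le; exact: L2vB.
  - by exists u.
have [u Hu] := choice H.
pose U : vfun := fun x => \row_i u i x.
have cU i : cmp U i = u i by apply/funext => x; rewrite /cmp mxE.
have LU : L2v w U by move=> i; rewrite -/(cmp U i) cU; case: (Hu i).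
exists U => //.
rewrite (_ : (fun _ => _) = (fun n => Num.sqrt (\sum_i (siN (ip w) (u i - cmp (p n) i)) ^+ 2))); last first.
  have LUp n : L2v w (U - p n) by exact: L2vB.
  apply/funext => n; rewrite /siN ipvE//.
  by congr Num.sqrt; apply: eq_bigr => i _; rewrite cmpB cU sqr_sqrtr// ip_ge0.
rewrite -[X in _ --> X]sqrtr0; apply: continuous_cvg; first exact: sqrt_continuous.
rewrite -[X in _ --> X](_ : \sum_(i < d) (0 : R) = 0); last by rewrite big1.
apply: cvg_big => [|i _]; first exact: add_continuous.
rewrite -[X in _ --> X](mulr0 0).
by under eq_fun do rewrite expr2; apply: cvgM; case: (Hu i).
Qed.

Lemma ip_lim (fn : nat -> sfun) f g : L2 w f -> (forall n, L2 w (fn n)) -> L2 w g ->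
  ip w (f - fn n) (f - fn n) @[n --> \oo] --> (0 : R) ->
  ip w (fn n) g @[n --> \oo] --> ip w f g.
Proof.
move=> Lf Lfn Lg cf; apply/cvgrPdist_le => e e0.
have c0 : 0 < nrm w g + 1 by rewrite ltr_wpDl ?nrm_ge0.
have e1 : 0 < (e / (nrm w g + 1)) ^+ 2 by rewrite exprn_gt0// divr_gt0.
move/cvgrPdist_le : cf => /(_ _ e1); apply: filterS => n.
have Ld : L2 w (f - fn n) by exact: L2B.
have q0 : 0 <= e / (nrm w g + 1) by rewrite ltW// divr_gt0.
rewrite sub0r normrN ger0_norm ?ip_ge0// -nrm2 ler_pXn2r ?nnegrE ?nrm_ge0// => h.
rewrite -ipBl//; apply: le_trans (ip_CS mw Ld Lg) _; rewrite -/(nrm w _) -/(nrm w _).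
move: h; rewrite ler_pdivlMr//; apply: le_trans.
by rewrite ler_wpM2l ?nrm_ge0// lerDl.
Qed.

Lemma ipv_lim (pn : nat -> vfun) p q : L2v w p -> (forall n, L2v w (pn n)) -> L2v w q ->
  ipv w (p - pn n) (p - pn n) @[n --> \oo] --> (0 : R) ->
  ipv w (pn n) q @[n --> \oo] --> ipv w p q.
Proof.
move=> Lp Lpn Lq cp; rewrite ipvE//.
rewrite (_ : (fun _ => _) = (fun n => \sum_i ip w (cmp (pn n) i) (cmp q i))); last first.
  by apply/funext => n; rewrite ipvE.
apply: cvg_big => [|i _]; first exact: add_continuous.
apply: ip_lim; [exact: Lp|by move=> n; exact: Lpn|exact: Lq|].
apply: (@squeeze_cvgr _ _ _ _ (fun=> 0) (fun n => ipv w (p - pn n) (p - pn n))) => //.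
  apply: nearW => n; rewrite ip_ge0/= -cmpB; apply: ipv_cmp_le; exact: L2vB.
exact: cvg_cst.
Qed.

Lemma ipv_eq0 p : L2v w p -> ipv w p p = 0 -> {ae leb, forall x, w x -> p x = 0}.
Proof.
move=> Lp p0.
have H i : {ae leb, forall x, w x -> cmp p i x = 0}.
  apply: ip_eq0; first exact: mw. exact: Lp.
  by apply/eqP; rewrite eq_le ip_ge0 andbT -p0 ipv_cmp_le.
have : {ae leb, forall x, forall i : 'I_d, w x -> cmp p i x = 0}.
  exact: filter_forall.
by apply: filterS => x h wx; apply/rowP => i; rewrite mxE; exact: h.
Qed.

Lemma ipv_ae p p' q q' : L2v w p -> L2v w p' -> L2v w q -> L2v w q' ->
  {ae leb, forall x, w x -> p x = p' x} ->
  {ae leb, forall x, w x -> q x = q' x} -> ipv w p q = ipv w p' q'.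
Proof.
move=> Lp Lp' Lq Lq' pp qq; rewrite !ipvE//; apply: eq_bigr => i _.
apply: ip_ae; [exact: mw|exact: Lp|exact: Lp'|exact: Lq|exact: Lq'| |].
- by move: pp; apply: filterS => x h wx; rewrite /cmp h.
- by move: qq; apply: filterS => x h wx; rewrite /cmp h.
Qed.

End L2v_theory.

(** * Weak derivatives and Riesz representation *)

Lemma cvg0_comb {R : realType} (c e : R) (u a b : nat -> R) :
  (forall n, 0 <= u n <= c * a n + e * b n) -> a @ \oo --> (0 : R) -> b @ \oo --> (0 : R) ->
  u @ \oo --> (0 : R).
Proof.
move=> h ca cb; apply: (@squeeze_cvgr _ _ _ _ (fun=> 0) (fun n => c * a n + e * b n)).
- exact: nearW.
- exact: cvg_cst.
- rewrite -[X in _ --> X](_ : c * 0 + e * 0 = 0); last by rewrite !mulr0 addr0.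
  exact: (cvgD (cvgM (cvg_cst c) ca) (cvgM (cvg_cst e) cb)).
Qed.

(** * Weak gradients, weak divergences and H^1_0 *)

Section sobolev_basics.
Context {R : realType} {d : nat}.
Local Notation leb := (@lebesgue_row R d).
Local Notation sfun := ('rV[R]_d -> R).
Local Notation vfun := ('rV[R]_d -> 'rV[R]_d).
Variable w : set 'rV[R]_d.
Hypothesis ow : open w.
Let mw : measurable w := measurable_open ow.
Implicit Types (f g h phi : sfun) (p q F G : vfun) (k : R).

(** Relational forms of [H1] and [Hdiv] that name a derivative instead of selecting one. Linear
    combinations and limits of derivatives are again derivatives in this sense, whereas [grad] and
    [div] commute with them only almost everywhere. *)
Definition wg f F := L2 w f /\ weak_grad w f F.
Definition wd q r := L2v w q /\ weak_div w q r.

Lemma H1P f : H1 w f <-> exists F, wg f F.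
Proof.
split; first by move=> [Lf [F gF]]; exists F.
by move=> [F [Lf gF]]; split => //; exists F.
Qed.

Lemma HdivP q : Hdiv w q <-> exists r, wd q r.
Proof.
split; first by move=> [Lf [F gF]]; exists F.
by move=> [F [Lf gF]]; split => //; exists F.
Qed.

Lemma wg_L2 f F : wg f F -> L2 w f. Proof. by case. Qed.
Lemma wg_L2v f F : wg f F -> L2v w F. Proof. by move=> [_ []]. Qed.
Lemma wd_L2v q r : wd q r -> L2v w q. Proof. by case. Qed.
Lemma wd_L2 q r : wd q r -> L2 w r. Proof. by move=> [_ []]. Qed.

Lemma wg_grad f : H1 w f -> wg f (grad w f).
Proof. by move=> [Lf [F gF]]; split => //; exact: (xgetPex (cst 0) (ex_intro _ F gF)). Qed.

Lemma wd_div q : Hdiv w q -> wd q (div w q).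
Proof. by move=> [Lq [r gr]]; split => //; exact: (xgetPex (cst 0) (ex_intro _ r gr)). Qed.

Lemma testL2 phi : test_function w phi -> L2 w phi.
Proof. exact: test_L2. Qed.
Lemma testdL2 phi i : test_function w phi -> L2 w (pderiv i phi).
Proof. by move=> /(test_pderiv i); exact: test_L2. Qed.

Lemma cgrad_cmp phi i : cmp (cgrad phi) i = pderiv i phi.
Proof. by apply/funext => x; rewrite /cmp mxE. Qed.

Lemma cgradL2 phi : test_function w phi -> L2v w (cgrad phi).
Proof. by move=> tp i; rewrite -/(cmp _ i) cgrad_cmp; exact: testdL2. Qed.

Lemma wgZD k f F g G : wg f F -> wg g G -> wg (k *: f + g) (k *: F + G).
Proof.
move=> [Lf [LF hF]] [Lg [LG hG]]; split; first exact: L2ZD.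
split; first exact: L2vZD.
move=> phi tp i; have LFi : L2 w (cmp F i) := LF i; have LGi : L2 w (cmp G i) := LG i.
have tL := testL2 tp; have dL := testdL2 i tp.
by rewrite -/(cmp _ i) cmpZD !(ipZD mw)// hF// hG// opprD mulrN.
Qed.

Lemma wdZD k p f q g : wd p f -> wd q g -> wd (k *: p + q) (k *: f + g).
Proof.
move=> [Lp [Lf hp]] [Lq [Lg hq]]; split; first exact: L2vZD.
split; first exact: L2ZD.
move=> phi tp; rewrite (ipvZD mw)//; last exact: cgradL2.
rewrite (ipZD mw)//; last exact: testL2.
by rewrite hp// hq// opprD mulrN.
Qed.

Lemma wg_uniq f F G : wg f F -> wg f G -> {ae leb, forall x, w x -> F x = G x}.
Proof.
move=> [Lf [LF hF]] [_ [LG hG]].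
have H i : {ae leb, forall x, w x -> (cmp F i - cmp G i) x = 0}.
  apply: du_bois => //; first by apply: L2B; [exact: mw|exact: LF|exact: LG].
  move=> phi tp; rewrite (ipBl mw (LF i) (LG i) (testL2 tp)).
  by have := hF phi tp i; rewrite hG// => /oppr_inj ->; rewrite subrr.
have : {ae leb, forall x, forall i : 'I_d, w x -> (cmp F i - cmp G i) x = 0}.
  exact: filter_forall.
apply: filterS => x h wx; apply/rowP => i; apply/eqP; rewrite -subr_eq0.
by apply/eqP; exact: h.
Qed.

Lemma wd_uniq q f g : wd q f -> wd q g -> {ae leb, forall x, w x -> f x = g x}.
Proof.
move=> [Lq [Lf hf]] [_ [Lg hg]].
have : {ae leb, forall x, w x -> (f - g) x = 0}.
  apply: du_bois => //; first exact: L2B.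
  move=> phi tp; rewrite ipBl//; last exact: testL2.
  by have := hf phi tp; rewrite hg// => /oppr_inj ->; rewrite subrr.
by apply: filterS => x h wx; apply/eqP; rewrite -subr_eq0; apply/eqP; exact: h.
Qed.

Lemma wg_ipv f F G q : wg f F -> wg f G -> L2v w q -> ipv w q F = ipv w q G.
Proof.
move=> fF fG Lq; apply: ipv_ae => //; [exact: wg_L2v fF|exact: wg_L2v fG| |].
  exact: aeW.
exact: wg_uniq fF fG.
Qed.

Lemma wd_ip q f g h : wd q f -> wd q g -> L2 w h -> ip w h f = ip w h g.
Proof.
move=> qf qg Lh; apply: ip_ae => //; [exact: wd_L2 qf|exact: wd_L2 qg| |].
  exact: aeW.
exact: wd_uniq qf qg.
Qed.

Lemma wg_test phi : test_function w phi -> wg phi (cgrad phi).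
Proof.
move=> tp; split; first exact: testL2.
split; first exact: cgradL2.
move=> psi ts i; rewrite -/(cmp _ i) cgrad_cmp; exact: test_ibp tp ts.
Qed.

Lemma wd_cgrad phi : test_function w phi -> wd (cgrad phi) (\sum_i pderiv i (pderiv i phi)).
Proof.
move=> tp; split; first exact: cgradL2.
have L i : L2 w (pderiv i (pderiv i phi)) by apply: testdL2; exact: test_pderiv.
split; first by apply: L2_sum.
move=> psi ts; rewrite ipvE//; [|exact: cgradL2|exact: cgradL2].
rewrite ip_suml//; last exact: testL2.
rewrite -sumrN; apply: eq_bigr => i _; rewrite !cgrad_cmp.
apply: test_ibp ts; [exact: mw|exact: test_pderiv].
Qed.

(** Testing with these fields recovers one component of a weak gradient. *)
Lemma wd_test phi i : test_function w phi -> wd (fun x => phi x *: 'e_i) (pderiv i phi).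
Proof.
move=> tp.
have E j : cmp (fun x => phi x *: 'e_i) j = (i == j)%:R *: phi.
  apply/funext => x; rewrite /cmp !mxE eqxx /= eq_sym.
  by rewrite mulrC.
have Lq : L2v w (fun x => phi x *: 'e_i).
  by move=> j; rewrite -/(cmp _ j) E; apply: L2Z => //; exact: testL2.
split => //; split; first exact: testdL2.
move=> psi ts; rewrite ipvE//; last exact: cgradL2.
rewrite (bigD1 i)//= big1 ?addr0.
  by rewrite E eqxx scale1r cgrad_cmp; exact: test_ibp tp ts.
move=> j /negPf ji; rewrite E eq_sym ji scale0r ip0l//.
Qed.

Lemma wg_lim (fn : nat -> sfun) (Fn : nat -> vfun) f F : L2 w f -> L2v w F ->
  (forall n, wg (fn n) (Fn n)) ->
  ip w (f - fn n) (f - fn n) @[n --> \oo] --> (0 : R) ->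
  ipv w (F - Fn n) (F - Fn n) @[n --> \oo] --> (0 : R) -> wg f F.
Proof.
move=> Lf LF hn cf cF; split => //; split => // phi tp i.
have Lfn n : L2 w (fn n) by exact: wg_L2 (hn n).
have LFn n : L2v w (Fn n) by exact: wg_L2v (hn n).
have c1 := ip_lim mw Lf Lfn (testdL2 i tp) cf.
have c2 : ip w (cmp (Fn n) i) phi @[n --> \oo] --> ip w (cmp F i) phi.
  apply: ip_lim => //; [exact: LF|by move=> n; exact: LFn|exact: testL2|].
  apply: (@squeeze_cvgr _ _ _ _ (fun=> 0) (fun n => ipv w (F - Fn n) (F - Fn n))) => //.
    by apply: nearW => n; rewrite ip_ge0/= -cmpB; apply: ipv_cmp_le => //; exact: L2vB.
  exact: cvg_cst.
have : (fun n => - ip w (cmp (Fn n) i) phi) @ \oo --> - ip w (cmp F i) phi by apply: cvgN.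
rewrite (_ : (fun n => - ip w (cmp (Fn n) i) phi) = (fun n => ip w (fn n) (pderiv i phi))); last first.
  by apply/funext => n; have [_ [_ h]] := hn n; exact: (esym (h phi tp i)).
move/(cvg_lim (@Rhausdorff R)) <-; exact/esym/(cvg_lim (@Rhausdorff R)).
Qed.

Lemma wd_lim (qn : nat -> vfun) (rn : nat -> sfun) q r : L2v w q -> L2 w r ->
  (forall n, wd (qn n) (rn n)) ->
  ipv w (q - qn n) (q - qn n) @[n --> \oo] --> (0 : R) ->
  ip w (r - rn n) (r - rn n) @[n --> \oo] --> (0 : R) -> wd q r.
Proof.
move=> Lq Lr hn cq cr; split => //; split => // phi tp.
have Lqn n : L2v w (qn n) by exact: wd_L2v (hn n).
have Lrn n : L2 w (rn n) by exact: wd_L2 (hn n).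
have c1 := ipv_lim mw Lq Lqn (cgradL2 tp) cq.
have : (fun n => - ip w (rn n) phi) @ \oo --> - ip w r phi by apply: cvgN; exact: ip_lim (testL2 tp) cr.
rewrite (_ : (fun n => - ip w (rn n) phi) = (fun n => ipv w (qn n) (cgrad phi))); last first.
  by apply/funext => n; have [_ [_ h]] := hn n; exact: (esym (h phi tp)).
move/(cvg_lim (@Rhausdorff R)) <-; exact/esym/(cvg_lim (@Rhausdorff R)).
Qed.

(* [H10] with the weak gradient [F] as an argument instead of the one chosen by [grad]. *)
Definition h0 f F := wg f F /\ exists phi : sfun^nat,
  [/\ forall n, test_function w (phi n),
      ip w (f - phi n) (f - phi n) @[n --> \oo] --> (0 : R) &
      ipv w (F - cgrad (phi n)) (F - cgrad (phi n)) @[n --> \oo] --> (0 : R)].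

Lemma ipv_aed F G (phi : vfun) : L2v w F -> L2v w G -> L2v w phi ->
  {ae leb, forall x, w x -> F x = G x} -> ipv w (F - phi) (F - phi) = ipv w (G - phi) (G - phi).
Proof.
move=> LF LG Lp FG.
have FG' : {ae leb, forall x, w x -> (F - phi) x = (G - phi) x}.
  by move: FG; apply: filterS => x h /h e; rewrite !fctE e.
by apply: ipv_ae => //; exact: L2vB.
Qed.

Lemma H10P f : H10 w f <-> exists F, h0 f F.
Proof.
split.
  by move=> [Hf [phi [h1 h2 h3]]]; exists (grad w f); split; [exact: wg_grad|exists phi].
move=> [F [fF [phi [h1 h2 h3]]]].
have Hf : H1 w f by apply/H1P; exists F.
split => //; exists phi; split => //.
have fG := wg_grad Hf.
suff <- : (fun n => ipv w (F - cgrad (phi n)) (F - cgrad (phi n))) =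
  (fun n => ipv w (grad w f - cgrad (phi n)) (grad w f - cgrad (phi n))) by [].
apply/funext => n; apply: ipv_aed; [exact: wg_L2v fF|exact: wg_L2v fG|exact: cgradL2|exact: wg_uniq fF fG].
Qed.

Lemma h0_wg f F G : h0 f F -> wg f G -> h0 f G.
Proof.
move=> [fF [phi [h1 h2 h3]]] fG; split => //; exists phi; split => //.
suff <- : (fun n => ipv w (F - cgrad (phi n)) (F - cgrad (phi n))) =
  (fun n => ipv w (G - cgrad (phi n)) (G - cgrad (phi n))) by [].
apply/funext => n.
apply: ipv_aed; [exact: wg_L2v fF|exact: wg_L2v fG|exact: cgradL2|exact: wg_uniq fF fG].
Qed.

Lemma h0_test phi : test_function w phi -> h0 phi (cgrad phi).
Proof.
move=> tp; split; first exact: wg_test.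
exists (fun=> phi); split => //; rewrite subrr.
  by rewrite ip0l//; exact: cvg_cst.
by rewrite (ipv0l mw); [exact: cvg_cst|exact: L2v0].
Qed.

(** The parallelogram identity with the square of - k f + g dropped. *)
Lemma ip_sumsq_le (k : R) f g : L2 w f -> L2 w g ->
  ip w (k *: f + g) (k *: f + g) <= 2 * k ^+ 2 * ip w f f + 2 * ip w g g.
Proof.
move=> Lf Lg.
have E t := siB_expand (@L20 R d w) (L2ZD mw) (@ipC R d w) (ipZD mw) t Lf Lg.
by have := ip_ge0 w (- k *: f + g); rewrite !E sqrrN; lra.
Qed.

Lemma ipv_sumsq_le (k : R) p q : L2v w p -> L2v w q ->
  ipv w (k *: p + q) (k *: p + q) <= 2 * k ^+ 2 * ipv w p p + 2 * ipv w q q.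
Proof.
move=> Lp Lq.
have E t := siB_expand (@L2v0 R d w) (L2vZD mw) (@ipvC R d w) (ipvZD mw) t Lp Lq.
by have := ipv_ge0 w (- k *: p + q); rewrite !E sqrrN; lra.
Qed.

Lemma cgradZD k f g : test_function w f -> test_function w g ->
  cgrad (k *: f + g) = k *: cgrad f + cgrad g.
Proof.
move=> tf tg; apply/funext => x; apply/rowP => i; rewrite !mxE.
by rewrite (pderivZD k i tf tg).
Qed.

Lemma h0ZD k f F g G : h0 f F -> h0 g G -> h0 (k *: f + g) (k *: F + G).
Proof.
move=> [fF [phi [p1 p2 p3]]] [gG [psi [s1 s2 s3]]]; split; first exact: wgZD.
exists (fun n => k *: phi n + psi n); split; first by move=> n; exact: testZD.
- apply: (cvg0_comb (c := 2 * k ^+ 2) (e := 2) _ p2 s2) => n; rewrite ip_ge0/= opprD addrACA -scalerBr.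
  by apply: ip_sumsq_le; apply: L2B => //; [exact: wg_L2 fF|exact: testL2|exact: wg_L2 gG|exact: testL2].
- apply: (cvg0_comb (c := 2 * k ^+ 2) (e := 2) _ p3 s3) => n; rewrite ipv_ge0/= cgradZD// opprD addrACA -scalerBr.
  by apply: ipv_sumsq_le; apply: L2vB => //; [exact: wg_L2v fF|exact: cgradL2|exact: wg_L2v gG|exact: cgradL2].
Qed.

(** The definition of the weak divergence, passed to the limit along the test functions that
    approximate f. *)
Lemma green0 q r f F : wd q r -> h0 f F -> ipv w q F + ip w r f = 0.
Proof.
move=> qr [fF [phi [p1 p2 p3]]].
have Lq := wd_L2v qr; have Lr := wd_L2 qr.
have c1 : ipv w (cgrad (phi n)) q @[n --> \oo] --> ipv w F q.
  apply: ipv_lim => //; [exact: wg_L2v fF|by move=> n; exact: cgradL2].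
have c2 : ip w (phi n) r @[n --> \oo] --> ip w f r.
  apply: ip_lim => //; [exact: wg_L2 fF|by move=> n; exact: testL2].
have c3 : (fun n => ipv w (cgrad (phi n)) q + ip w (phi n) r) @ \oo --> ipv w F q + ip w f r.
  exact: cvgD c1 c2.
have E : (fun n => ipv w (cgrad (phi n)) q + ip w (phi n) r) = cst 0.
  by apply/funext => n /=; have [_ [_ h]] := qr; rewrite ipvC h// ipC addNr.
rewrite E in c3; have := cvg_lim (@Rhausdorff R) c3.
by rewrite lim_cst// => e; rewrite ipvC (ipC _ r) -e.
Qed.

(** Diagonal argument: for each n a test function within 1 / (n + 1) of fn n is picked. *)
Lemma h0_lim (fn : nat -> sfun) (Fn : nat -> vfun) f F : L2 w f -> L2v w F ->
  (forall n, h0 (fn n) (Fn n)) ->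
  ip w (f - fn n) (f - fn n) @[n --> \oo] --> (0 : R) ->
  ipv w (F - Fn n) (F - Fn n) @[n --> \oo] --> (0 : R) -> h0 f F.
Proof.
move=> Lf LF hn cf cF.
have fF : wg f F by apply: (wg_lim Lf LF _ cf cF) => n; case: (hn n).
split => //.
have H n : exists phi, [/\ test_function w phi, ip w (fn n - phi) (fn n - phi) <= n.+1%:R^-1 &
    ipv w (Fn n - cgrad phi) (Fn n - cgrad phi) <= n.+1%:R^-1].
  have [_ [phi [p1 p2 p3]]] := hn n.
  have e0 : 0 < n.+1%:R^-1 :> R by rewrite invr_gt0.
  move/cvgrPdist_le : p2 => /(_ _ e0) [n1 _ H1].
  move/cvgrPdist_le : p3 => /(_ _ e0) [n2 _ H2].
  exists (phi (maxn n1 n2)); split => //.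
    by have := H1 _ (leq_maxl n1 n2); rewrite /= sub0r normrN ger0_norm ?ip_ge0.
  by have := H2 _ (leq_maxr n1 n2); rewrite /= sub0r normrN ger0_norm ?ipv_ge0.
have [phi Hphi] := choice H.
have Lfn n : L2 w (fn n) by case: (hn n) => /wg_L2.
have LFn n : L2v w (Fn n) by case: (hn n) => /wg_L2v.
have ch : (fun n => n.+1%:R^-1 : R) @ \oo --> (0 : R) := @cvg_harmonic R.
exists phi; split; first by move=> n; case: (Hphi n).
- apply: (cvg0_comb (c := 2 * 1 ^+ 2) (e := 2) _ cf ch) => n; rewrite ip_ge0/=; have [t1 t2 t3] := Hphi n.
  rewrite (_ : f - phi n = 1 *: (f - fn n) + (fn n - phi n)); last by rewrite scale1r addrA subrK.
  apply: le_trans (ip_sumsq_le _ _ _) _; [exact: L2B|by apply: L2B => //; exact: testL2|].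
  by rewrite lerD2l ler_pM2l.
- apply: (cvg0_comb (c := 2 * 1 ^+ 2) (e := 2) _ cF ch) => n; rewrite ipv_ge0/=; have [t1 t2 t3] := Hphi n.
  rewrite (_ : F - cgrad (phi n) = 1 *: (F - Fn n) + (Fn n - cgrad (phi n))); last by rewrite scale1r addrA subrK.
  apply: le_trans (ipv_sumsq_le _ _ _) _; [exact: L2vB|by apply: L2vB => //; exact: cgradL2|].
  by rewrite lerD2l ler_pM2l.
Qed.

Lemma wg_eq f g F G : (forall x, w x -> f x = g x) -> (forall x, w x -> F x = G x) ->
  wg f F -> wg g G.
Proof.
move=> fg FG [Lf [LF h]]; split; first exact: eq_L2 Lf.
split; first exact: eq_L2v LF.
move=> phi tp i; rewrite -(@eq_ip _ _ w f g (pderiv i phi) (pderiv i phi))// h//; congr (- _).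
by apply: eq_ip => // x wx; rewrite FG.
Qed.

Lemma wg_ae f g F : L2 w g -> {ae leb, forall x, w x -> f x = g x} -> wg f F -> wg g F.
Proof.
move=> Lg fg [Lf [LF h]]; split => //; split => // phi tp i; rewrite -h//.
apply: ip_ae => //; [exact: testdL2|exact: testdL2| |exact: aeW].
by move: fg; apply: filterS => x e /e.
Qed.

Lemma h0_ae f g F : L2 w g -> {ae leb, forall x, w x -> f x = g x} -> h0 f F -> h0 g F.
Proof.
move=> Lg fg [fF [phi [p1 p2 p3]]]; split; first exact: wg_ae fg fF.
have Lf := wg_L2 fF.
exists phi; split => //.
suff <- : (fun n => ip w (f - phi n) (f - phi n)) = (fun n => ip w (g - phi n) (g - phi n)) by [].
apply/funext => n.
have fg' : {ae leb, forall x, w x -> (f - phi n) x = (g - phi n) x}.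
  by move: fg; apply: filterS => x e /e e'; rewrite !fctE e'.
by apply: ip_ae => //; apply: L2B => //; exact: testL2.
Qed.

Lemma wg0 : wg 0 0.
Proof.
split; first exact: L20.
split; first exact: L2v0.
by move=> phi tp i; rewrite -/(cmp 0 i) cmp_0 !ip0l// oppr0.
Qed.

Lemma h00 : h0 0 0.
Proof.
split; first exact: wg0.
exists (fun=> 0); split; first by move=> n; exact: test0.
  by rewrite subrr ip0l//; exact: cvg_cst.
rewrite (_ : cgrad 0 = 0); first by rewrite subrr (ipv0l mw); [exact: cvg_cst|exact: L2v0].
by apply/funext => x; apply/rowP => i; rewrite !mxE; exact: (congr1 (fun f => f x) (pderiv_cst 0 i)).
Qed.

Lemma wgZ k f F : wg f F -> wg (k *: f) (k *: F).
Proof. by move=> fF; rewrite -[k *: f]addr0 -[k *: F]addr0; apply: wgZD fF wg0. Qed.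
Lemma wgD f F g G : wg f F -> wg g G -> wg (f + g) (F + G).
Proof. by move=> fF gG; rewrite -[f]scale1r -[F]scale1r; exact: wgZD. Qed.
Lemma wgB f F g G : wg f F -> wg g G -> wg (f - g) (F - G).
Proof. by move=> fF gG; rewrite [f - g]addrC [F - G]addrC -[- g]scaleN1r -[- G]scaleN1r; exact: wgZD. Qed.
Lemma h0Z k f F : h0 f F -> h0 (k *: f) (k *: F).
Proof. by move=> fF; rewrite -[k *: f]addr0 -[k *: F]addr0; apply: h0ZD fF h00. Qed.
Lemma h0B f F g G : h0 f F -> h0 g G -> h0 (f - g) (F - G).
Proof. by move=> fF gG; rewrite [f - g]addrC [F - G]addrC -[- g]scaleN1r -[- G]scaleN1r; exact: h0ZD. Qed.

Lemma wd0 : wd 0 0.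
Proof.
split; first exact: L2v0.
split; first exact: L20.
by move=> phi tp; rewrite (ipv0l mw) ?ip0l ?oppr0//; exact: cgradL2.
Qed.
Lemma wdZ k p f : wd p f -> wd (k *: p) (k *: f).
Proof. by move=> fF; rewrite -[k *: p]addr0 -[k *: f]addr0; apply: wdZD fF wd0. Qed.
Lemma wdD p f q g : wd p f -> wd q g -> wd (p + q) (f + g).
Proof. by move=> fF gG; rewrite -[p]scale1r -[f]scale1r; exact: wdZD. Qed.

Lemma wd_eq p q f g : (forall x, w x -> p x = q x) -> (forall x, w x -> f x = g x) ->
  wd p f -> wd q g.
Proof.
move=> pq fg [Lp [Lf h]]; split; first exact: eq_L2v Lp.
split; first exact: eq_L2 Lf.
move=> phi tp; rewrite -(@eq_ipv _ _ w p q (cgrad phi) (cgrad phi))// h//.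
by congr (- _); exact: eq_ip.
Qed.

End sobolev_basics.

(** * Projection and representation in weighted triples of L2 functions *)

Section L2_triple.
Context {R : realType} {d : nat}.
Local Notation leb := (@lebesgue_row R d).
Local Notation sfun := ('rV[R]_d -> R).
Local Notation vfun := ('rV[R]_d -> 'rV[R]_d).
Variable w : set 'rV[R]_d.
Hypothesis mw : measurable w.
Local Notation E3 := ((sfun * vfun) * sfun)%type.
Implicit Types (f g h : sfun) (p q F G : vfun) (k : R) (x y z : E3).

(** A function, a field and a function: one format for the graph of the weak gradient, of the weak
    divergence, and of gradient and Laplacian together, so that a single projection lemma serves all
    of them. A vacant slot is filled with an arbitrary L2 function. *)
Definition D3 : set E3 := [set x | [/\ L2 w x.1.1, L2v w x.1.2 & L2 w x.2]].
Definition B3 (c1 c2 c3 : R) x y : R :=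
  c1 * ip w x.1.1 y.1.1 + c2 * ipv w x.1.2 y.1.2 + c3 * ip w x.2 y.2.

Variables c1 c2 c3 : R.
Hypotheses (c10 : 0 < c1) (c20 : 0 < c2) (c30 : 0 < c3).
Let B := B3 c1 c2 c3.

Let D30 : D3 0. Proof. by split; [exact: L20|exact: L2v0|exact: L20]. Qed.

Let D3ZD k x y : D3 x -> D3 y -> D3 (k *: x + y).
Proof. by move=> [? ? ?] [? ? ?]; split; [exact: L2ZD|exact: L2vZD|exact: L2ZD]. Qed.

Let B3C x y : B x y = B y x.
Proof. by rewrite /B /B3 (ipC _ y.1.1) (ipvC _ y.1.2) (ipC _ y.2). Qed.

Let B3ZD k x y z : D3 x -> D3 y -> D3 z -> B (k *: x + y) z = k * B x z + B y z.
Proof.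
move=> [? ? ?] [? ? ?] [? ? ?]; rewrite /B /B3.
rewrite (_ : (k *: x + y).1.1 = k *: x.1.1 + y.1.1)//.
rewrite (_ : (k *: x + y).1.2 = k *: x.1.2 + y.1.2)//.
rewrite (_ : (k *: x + y).2 = k *: x.2 + y.2)//.
by rewrite !(ipZD mw)// (ipvZD mw)//; ring.
Qed.

Let B3_ge0 x : D3 x -> 0 <= B x x.
Proof.
move=> _; rewrite /B /B3 !addr_ge0// mulr_ge0 ?ip_ge0 ?ipv_ge0//; exact: ltW.
Qed.

Let B3_lim (x : E3) (xn : nat -> E3) : D3 x -> (forall n, D3 (xn n)) ->
  (siN B (x - xn n) @[n --> \oo] --> (0 : R)) <->
  [/\ ip w (x.1.1 - (xn n).1.1) (x.1.1 - (xn n).1.1) @[n --> \oo] --> (0 : R),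
      ipv w (x.1.2 - (xn n).1.2) (x.1.2 - (xn n).1.2) @[n --> \oo] --> (0 : R) &
      ip w (x.2 - (xn n).2) (x.2 - (xn n).2) @[n --> \oo] --> (0 : R)].
Proof.
move=> Dx Dn.
have p1 n : 0 <= ip w (x.1.1 - (xn n).1.1) (x.1.1 - (xn n).1.1) by exact: ip_ge0.
have p2 n : 0 <= ipv w (x.1.2 - (xn n).1.2) (x.1.2 - (xn n).1.2) by exact: ipv_ge0.
have p3 n : 0 <= ip w (x.2 - (xn n).2) (x.2 - (xn n).2) by exact: ip_ge0.
have E n : B (x - xn n) (x - xn n) = c1 * ip w (x.1.1 - (xn n).1.1) (x.1.1 - (xn n).1.1) +
   c2 * ipv w (x.1.2 - (xn n).1.2) (x.1.2 - (xn n).1.2) +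
   c3 * ip w (x.2 - (xn n).2) (x.2 - (xn n).2) by [].
split.
- move=> cN.
  have cB : (fun n => B (x - xn n) (x - xn n)) @ \oo --> (0 : R).
    rewrite (_ : (fun n => _) = (fun n => siN B (x - xn n) * siN B (x - xn n))).
      by rewrite -[X in _ --> X](mulr0 0); exact: cvgM.
    apply/funext => n; rewrite -expr2 sqr_sqrtr// E !addr_ge0// mulr_ge0//; exact: ltW.
  split.
  + apply: (cvg0_comb (c := c1^-1) (e := 0) _ cB cB) => n.
    by rewrite p1 mul0r addr0 E -ler_pdivrMl ?invr_gt0// invrK -addrA lerDl addr_ge0// mulr_ge0// ltW.
  + apply: (cvg0_comb (c := c2^-1) (e := 0) _ cB cB) => n.
    by rewrite p2 mul0r addr0 E -ler_pdivrMl ?invr_gt0// invrK addrAC lerDr addr_ge0// mulr_ge0// ltW.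
  + apply: (cvg0_comb (c := c3^-1) (e := 0) _ cB cB) => n.
    by rewrite p3 mul0r addr0 E -ler_pdivrMl ?invr_gt0// invrK lerDr addr_ge0// mulr_ge0// ltW.
- move=> [h1 h2 h3].
  have cB : (fun n => B (x - xn n) (x - xn n)) @ \oo --> (0 : R).
    have c12 : (fun n => c1 * ip w (x.1.1 - (xn n).1.1) (x.1.1 - (xn n).1.1) +
       c2 * ipv w (x.1.2 - (xn n).1.2) (x.1.2 - (xn n).1.2)) @ \oo --> (0 : R).
      apply: (cvg0_comb (c := c1) (e := c2) _ h1 h2) => n.
      by rewrite lexx andbT addr_ge0// mulr_ge0// ltW.
    apply: (cvg0_comb (c := 1) (e := c3) _ c12 h3) => n.
    rewrite E mul1r lexx andbT !addr_ge0// mulr_ge0//; exact: ltW.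
  rewrite -[X in _ --> X](@sqrtr0 R); apply: continuous_cvg; first exact: sqrt_continuous.
  exact: cB.
Qed.

Let B3_complete : si_complete D3 B.
Proof.
move=> x Dx [K HK].
have Lx n : [/\ L2 w (x n).1.1, L2v w (x n).1.2 & L2 w (x n).2] by exact: Dx.
have bnd n : B (x n.+1 - x n) (x n.+1 - x n) <= (K * 2^-1 ^+ n) ^+ 2.
  have h0 : 0 <= B (x n.+1 - x n) (x n.+1 - x n).
    by rewrite /B /B3 !addr_ge0// mulr_ge0 ?ip_ge0 ?ipv_ge0//; exact: ltW.
  rewrite -(sqr_sqrtr h0); apply: lerXn2r (HK n).
    by rewrite nnegrE sqrtr_ge0.
  by rewrite nnegrE (le_trans _ (HK n))// sqrtr_ge0.
have K0 n : 0 <= K * 2^-1 ^+ n by apply: le_trans (HK n); exact: sqrtr_ge0.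
have fact (c t : R) n : 0 < c -> c * t <= (K * 2^-1 ^+ n) ^+ 2 ->
    Num.sqrt t <= (Num.sqrt c)^-1 * K * 2^-1 ^+ n.
  move=> c0 h; rewrite -mulrA ler_pdivlMl ?sqrtr_gt0// -sqrtrM; last exact: ltW.
  by apply: le_trans (ler_wsqrtr h) _; rewrite sqrtr_sqr ger0_norm.
have [f Lf cf] : exists2 u, L2 w u & siN (ip w) (u - (x n).1.1) @[n --> \oo] --> (0 : R).
  apply: L2_complete => //; first by move=> n; case: (Lx n).
  exists ((Num.sqrt c1)^-1 * K) => n; apply: fact => //.
  apply: le_trans (bnd n); rewrite /B /B3 -addrA lerDl addr_ge0// mulr_ge0 ?ip_ge0 ?ipv_ge0//; exact: ltW.
have [F LF cF] : exists2 u, L2v w u & siN (ipv w) (u - (x n).1.2) @[n --> \oo] --> (0 : R).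
  apply: L2v_complete => //; first by move=> n; case: (Lx n).
  exists ((Num.sqrt c2)^-1 * K) => n; apply: fact => //.
  apply: le_trans (bnd n); rewrite /B /B3 addrAC lerDr addr_ge0// mulr_ge0 ?ip_ge0 ?ipv_ge0//; exact: ltW.
have [h Lh ch] : exists2 u, L2 w u & siN (ip w) (u - (x n).2) @[n --> \oo] --> (0 : R).
  apply: L2_complete => //; first by move=> n; case: (Lx n).
  exists ((Num.sqrt c3)^-1 * K) => n; apply: fact => //.
  apply: le_trans (bnd n); rewrite /B /B3 lerDr addr_ge0// mulr_ge0 ?ip_ge0 ?ipv_ge0//; exact: ltW.
exists ((f, F), h); first by split.
apply/B3_lim => //=; split.
- rewrite (_ : (fun _ => _) = (fun n => siN (ip w) (f - (x n).1.1) * siN (ip w) (f - (x n).1.1))).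
    by rewrite -[X in _ --> X](mulr0 0); exact: cvgM.
  by apply/funext => n; rewrite -expr2 sqr_sqrtr// ip_ge0.
- rewrite (_ : (fun _ => _) = (fun n => siN (ipv w) (F - (x n).1.2) * siN (ipv w) (F - (x n).1.2))).
    by rewrite -[X in _ --> X](mulr0 0); exact: cvgM.
  by apply/funext => n; rewrite -expr2 sqr_sqrtr// ipv_ge0.
- rewrite (_ : (fun _ => _) = (fun n => siN (ip w) (h - (x n).2) * siN (ip w) (h - (x n).2))).
    by rewrite -[X in _ --> X](mulr0 0); exact: cvgM.
  by apply/funext => n; rewrite -expr2 sqr_sqrtr// ip_ge0.
Qed.

Lemma L2_cone_projection (C : set E3) (p1 : sfun) (p2 : vfun) (p3 : sfun) :
  C `<=` D3 -> C 0 -> (forall x y, C x -> C y -> C (x + y)) ->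
  (forall k x, 0 <= k -> C x -> C (k *: x)) ->
  L2 w p1 -> L2v w p2 -> L2 w p3 ->
  exists u, [/\ D3 u,
    exists2 xn : nat -> E3, forall n, C (xn n) &
     [/\ ip w (u.1.1 - (xn n).1.1) (u.1.1 - (xn n).1.1) @[n --> \oo] --> (0 : R),
      ipv w (u.1.2 - (xn n).1.2) (u.1.2 - (xn n).1.2) @[n --> \oo] --> (0 : R) &
      ip w (u.2 - (xn n).2) (u.2 - (xn n).2) @[n --> \oo] --> (0 : R)],
    forall g : (sfun * vfun) * sfun, C g -> ip w p1 g.1.1 + ipv w p2 g.1.2 + ip w p3 g.2 <= B3 c1 c2 c3 u g &
    ip w p1 u.1.1 + ipv w p2 u.1.2 + ip w p3 u.2 = B3 c1 c2 c3 u u].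
Proof.
move=> CD C0 CD2 CZ L1 L2_ L3.
(* Dividing by the weights turns the unweighted functional into the weighted product with p. *)
pose p : E3 := ((c1^-1 *: p1, c2^-1 *: p2), c3^-1 *: p3).
have Dp : D3 p by split; [exact: L2Z|exact: L2vZ|exact: L2Z].
have [u [Du [xn Cx cx] uge u0]] := cone_projection D30 D3ZD B3C B3ZD B3_ge0 B3_complete CD C0 CD2 CZ Dp.
have Ep (g : E3) : D3 g -> B p g = ip w p1 g.1.1 + ipv w p2 g.1.2 + ip w p3 g.2.
  move=> [g1 g2 g3]; rewrite /B /B3 /= !(ipZl mw)// (ipvZl mw)//.
  by rewrite !mulVKf// gt_eqF.
exists u; split => //.
- by exists xn => //; apply/(B3_lim Du) => // n; exact: CD.
- move=> g Cg; have Dg := CD _ Cg; rewrite -Ep// -subr_ge0.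
  by rewrite -/(B u g) -(siBBl B3ZD Du Dp Dg); exact: uge.
- rewrite -Ep//; apply/esym/eqP; rewrite -subr_eq0 -/(B u u).
  by rewrite -(siBBl B3ZD Du Dp Du) u0.
Qed.

Lemma L2_riesz (C : set E3) (p1 : sfun) (p2 : vfun) (p3 : sfun) :
  C `<=` D3 -> C 0 -> (forall k x y, C x -> C y -> C (k *: x + y)) ->
  (forall u (xn : nat -> E3), D3 u -> (forall n, C (xn n)) ->
     ip w (u.1.1 - (xn n).1.1) (u.1.1 - (xn n).1.1) @[n --> \oo] --> (0 : R) ->
     ipv w (u.1.2 - (xn n).1.2) (u.1.2 - (xn n).1.2) @[n --> \oo] --> (0 : R) ->
     ip w (u.2 - (xn n).2) (u.2 - (xn n).2) @[n --> \oo] --> (0 : R) -> C u) ->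
  L2 w p1 -> L2v w p2 -> L2 w p3 ->
  exists2 u, C u & forall g : (sfun * vfun) * sfun, C g ->
    ip w p1 g.1.1 + ipv w p2 g.1.2 + ip w p3 g.2 = B3 c1 c2 c3 u g.
Proof.
move=> CD C0 CZD Ccl L1 L2_ L3.
have CZ k x : C x -> C (k *: x) by move=> Cx; rewrite -[_ *: _]addr0; exact: CZD.
have CD2 x y : C x -> C y -> C (x + y) by move=> Cx Cy; rewrite -[x]scale1r; exact: CZD.
have [u [Du [xn Cx [h1 h2 h3]] uge u0]] :=
  L2_cone_projection CD C0 CD2 (fun k x _ => @CZ k x) L1 L2_ L3.
exists u; first exact: (Ccl u xn).
move=> g Cg; have [g1 g2 g3] := CD _ Cg; have [u1 u2 u3] := Du.
apply/eqP; rewrite eq_le uge//=.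
(* On a subspace the inequality at - g is the converse inequality at g. *)
have := uge _ (CZ (-1) _ Cg); rewrite /B3 /= !(ipZr mw)// !(ipvZr mw)//; lra.
Qed.

End L2_triple.

(** * Representation in H^1 and H^1_0, and their description by duality *)

Section H1_riesz.
Context {R : realType} {d : nat}.
Local Notation leb := (@lebesgue_row R d).
Local Notation sfun := ('rV[R]_d -> R).
Local Notation vfun := ('rV[R]_d -> 'rV[R]_d).
Variable w : set 'rV[R]_d.
Hypothesis ow : open w.
Let mw : measurable w := measurable_open ow.
Implicit Types (f g h : sfun) (p q F G : vfun) (k : R).

Lemma H1_riesz (p1 : sfun) p2 : L2 w p1 -> L2v w p2 -> exists f F, wg w f F /\
  forall g G, wg w g G -> ip w f g + ipv w F G = ip w p1 g + ipv w p2 G.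
Proof.
move=> L1 L2_; have L0 := L20 w.
pose C : set ((sfun * vfun) * sfun) := [set x | wg w x.1.1 x.1.2 /\ L2 w x.2].
have [u [Cu u2] Hu] : exists2 u, C u & forall g : (sfun * vfun) * sfun, C g ->
    ip w p1 g.1.1 + ipv w p2 g.1.2 + ip w 0 g.2 = B3 w 1 1 1 u g.
  apply: (L2_riesz mw ltr01 ltr01 ltr01) => //.
  - by move=> x [gx x2]; split => //; [exact: wg_L2 gx|exact: wg_L2v gx].
  - by split => //; exact: wg0.
  - by move=> k x y [gx x2] [gy y2]; split; [exact: wgZD|exact: L2ZD].
  - move=> u xn [Lu Lu1 Lu2] Cx h1 h2 h3; split => //.
    by apply: (wg_lim ow Lu Lu1 _ h1 h2) => n; case: (Cx n).
exists u.1.1, u.1.2; split => // g G gG.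
have := Hu ((g, G), 0) (conj gG L0); rewrite /B3 /= !ip0r//; lra.
Qed.

Lemma H10_riesz (p1 : sfun) p2 : L2 w p1 -> L2v w p2 -> exists f F, h0 w f F /\
  forall g G, h0 w g G -> ip w f g + ipv w F G = ip w p1 g + ipv w p2 G.
Proof.
move=> L1 L2_; have L0 := L20 w.
pose C : set ((sfun * vfun) * sfun) := [set x | h0 w x.1.1 x.1.2 /\ L2 w x.2].
have [u [Cu u2] Hu] : exists2 u, C u & forall g : (sfun * vfun) * sfun, C g ->
    ip w p1 g.1.1 + ipv w p2 g.1.2 + ip w 0 g.2 = B3 w 1 1 1 u g.
  apply: (L2_riesz mw ltr01 ltr01 ltr01) => //.
  - by move=> x [[gx _] x2]; split => //; [exact: wg_L2 gx|exact: wg_L2v gx].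
  - by split => //; exact: h00.
  - by move=> k x y [gx x2] [gy y2]; split; [exact: h0ZD|exact: L2ZD].
  - move=> u xn [Lu Lu1 Lu2] Cx h1 h2 h3; split => //.
    by apply: (h0_lim ow Lu Lu1 _ h1 h2) => n; case: (Cx n).
exists u.1.1, u.1.2; split => // g G gG.
have := Hu ((g, G), 0) (conj gG L0); rewrite /B3 /= !ip0r//; lra.
Qed.

Lemma wd_of_test q (r : sfun) : L2v w q -> L2 w r ->
  (forall phi, test_function w phi -> ip w r phi + ipv w q (cgrad phi) = 0) -> wd w q r.
Proof.
move=> Lq Lr h; split => //; split => // phi tp.
by apply/eqP; rewrite -addr_eq0 addrC h.
Qed.

Lemma sum0_ae f F : L2 w f -> L2v w F -> ip w f f + ipv w F F = 0 ->
  {ae leb, forall x, w x -> f x = 0} /\ {ae leb, forall x, w x -> F x = 0}.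
Proof.
move=> Lf LF h; have h1 := ip_ge0 w f; have h2 := ipv_ge0 w F.
by split; [apply: ip_eq0 => //|apply: ipv_eq0 => //]; lra.
Qed.

(* If z0 is the H^1-orthogonal projection of z on H^1_0 then div (grad (z - z0)) = z - z0,
   so that grad (z - z0) is an admissible field q, whence z = z0. *)
Lemma H10_char (z : sfun) (Z : vfun) : wg w z Z ->
  (forall q r, wd w q r -> ip w z r + ipv w Z q = 0) -> h0 w z Z.
Proof.
move=> zZ H; have Lz := wg_L2 zZ; have LZ := wg_L2v zZ.
have [z0 [Z0 [hz0 E]]] := H10_riesz Lz LZ.
have [gz0 _] := hz0; have Lz0 := wg_L2 gz0; have LZ0 := wg_L2v gz0.
have dq : wd w (Z - Z0) (z - z0).
  apply: wd_of_test; [exact: L2vB|exact: L2B|move=> phi tp].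
  rewrite (ipBl mw)//; last exact: testL2.
  rewrite (ipvBl mw)//; last exact: cgradL2.
  have := E _ _ (h0_test ow tp); lra.
have e1 := H _ _ dq; have e2 := green0 ow dq hz0.
have LB : L2 w (z - z0) by exact: L2B.
have LBv : L2v w (Z - Z0) by exact: L2vB.
have [a1 a2] : {ae leb, forall x, w x -> (z - z0) x = 0} /\ {ae leb, forall x, w x -> (Z - Z0) x = 0}.
  apply: sum0_ae => //; rewrite (ipBl mw)// (ipvBl mw)//.
  by move: e2; rewrite ipvC (ipC _ (z - z0)); lra.
apply: (h0_wg ow _ zZ) => //; apply: (h0_ae ow Lz _ hz0).
by move: a1; apply: filterS => x h /h /eqP; rewrite !fctE subr_eq0 => /eqP.
Qed.

(* The Riesz representative z of the functional satisfies div (grad z) = z and is thus an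
   admissible argument itself. *)
Lemma H1Delta_dense (r : sfun) p : L2 w r -> L2v w p ->
  (forall g G s, wg w g G -> wd w G s -> ip w r g + ipv w p G = 0) ->
  forall g G, wg w g G -> ip w r g + ipv w p G = 0.
Proof.
move=> Lr Lp H g G gG.
have [z [Z [gz E]]] := H1_riesz Lr Lp.
have Lz := wg_L2 gz; have LZ := wg_L2v gz.
have dZ : wd w Z z.
  apply: wd_of_test => // phi tp; rewrite E; last exact: wg_test.
  exact: (H _ _ _ (wg_test ow tp) (wd_cgrad ow tp)).
have := H _ _ _ gz dZ; rewrite -E// => z0.
have [a1 a2] := sum0_ae Lz LZ z0.
rewrite -E// (ip_ae mw Lz (L20 w) (wg_L2 gG) (wg_L2 gG) a1 (aeW _ (fun x _ => erefl))).
rewrite (ipv_ae mw LZ (@L2v0 _ _ w) (wg_L2v gG) (wg_L2v gG) a2 (aeW _ (fun x _ => erefl))).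
by rewrite ip0l// (ipv0l mw) ?addr0//; exact: wg_L2v gG.
Qed.

(* A very weak solution y is compared with the weak solution y0 in H^1_0 by testing with
   the solution v in H^1_0 of v - div (grad v) = y0 - y. *)
Lemma H10_of_very_weak (r : sfun) p (y : sfun) : L2 w r -> L2v w p -> L2 w y ->
  (forall g G s, wg w g G -> wd w G s -> ip w r g + ipv w p G + ip w y s = 0) ->
  exists2 Z, h0 w y Z & forall g G, wg w g G -> ip w r g + ipv w (p - Z) G = 0.
Proof.
move=> Lr Lp Ly H.
have [y0 [Z0 [hy0 E]]] := H10_riesz (L2D mw Lr Ly) Lp.
have [gy0 _] := hy0; have Ly0 := wg_L2 gy0; have LZ0 := wg_L2v gy0.
have Ld : L2 w (y0 - y) by exact: L2B.
have [v [V [hv Ev]]] := H10_riesz Ld (@L2v0 _ _ w).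
have [gv _] := hv; have Lv := wg_L2 gv; have LV := wg_L2v gv.
have dV : wd w V (v - (y0 - y)).
  apply: wd_of_test => //; [exact: L2B|move=> phi tp].
  have Lphi := testL2 ow tp; have Lcg := cgradL2 ow tp.
  rewrite (ipBl mw)//; have := Ev _ _ (h0_test ow tp).
  rewrite (ipv0l mw)//; lra.
have e1 := H _ _ _ gv dV; have e2 := E _ _ hv; have e3 := green0 ow dV hy0.
(* By e1 and e2 the sum of (y0, v) and (Z0, V) equals (y, y0 - y), and by e3 it equals (y0, y0 - y);
   the difference of the two values is the squared norm of y0 - y. *)
have yy0 : ip w (y0 - y) (y0 - y) = 0.
  have Ls : L2 w (v - (y0 - y)) by exact: L2B.
  move: e1 e2 e3; rewrite (ipDl mw)// (ipvC _ V).
  rewrite (ipC _ (v - (y0 - y))) (ipBr mw Lv Ld Ly) (ipBr mw Lv Ld Ly0) (ipBl mw Ly0 Ly Ld); lra.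
have a1 : {ae leb, forall x, w x -> y0 x = y x}.
  have := ip_eq0 mw Ld yy0; apply: filterS => x h /h /eqP.
  by rewrite !fctE subr_eq0 => /eqP.
have hy : h0 w y Z0 by exact: h0_ae a1 hy0.
exists Z0 => //; apply: H1Delta_dense => //; first exact: L2vB.
move=> g G s gG dG; have := H _ _ _ gG dG; have := green0 ow dG hy.
have LG := wg_L2v gG; rewrite (ipvBl mw)// (ipvC _ G) (ipC _ s); lra.
Qed.

End H1_riesz.

(** * Traces and meshes *)

Section restriction.
Context {R : realType} {d : nat}.
Local Notation leb := (@lebesgue_row R d).
Local Notation sfun := ('rV[R]_d -> R).
Local Notation vfun := ('rV[R]_d -> 'rV[R]_d).
Variables w w' : set 'rV[R]_d.
Hypotheses (mw : measurable w) (mw' : measurable w') (ww : w' `<=` w).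
Implicit Types (f g r : sfun) (p q F G : vfun).

Lemma L2_sub f : L2 w f -> L2 w' f.
Proof. by move=> [mf if2]; split; [exact: measurable_funS mf|exact: integrableS if2]. Qed.

Lemma L2v_sub q : L2v w q -> L2v w' q.
Proof. by move=> Lq i; apply: L2_sub; exact: Lq. Qed.

Lemma ip_restrict f g h : (forall x, w x -> h x = \1_w' x * f x) -> ip w h g = ip w' f g.
Proof.
move=> hE; rewrite /ip -[in RHS](setIidr ww) Rintegral_mkcondr.
apply: eq_Rintegral => x; rewrite inE => /hE ->; rewrite patchE indicE.
by case: (x \in w'); rewrite ?mul1r// !mul0r.
Qed.

Lemma L2_ext f : L2 w' f -> L2 w (fun x => \1_w' x * f x).
Proof.
move=> [mf if2]; split.
  apply: (@eq_measurable_fun _ _ _ _ _ (f \_ w')).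
    by move=> x _; rewrite patchE indicE; case: (x \in w'); rewrite ?mul1r ?mul0r.
  apply: measurable_funS measurableT _ _ => //.
  by apply/(measurable_restrictT _ mw').
have := if2; rewrite (integrable_mkcond _ mw') => i2.
have := integrableS measurableT mw (@subsetT _ _) i2.
apply: eq_integrable => // x _; rewrite patchE /= indicE.
by case: (x \in w') => /=; rewrite ?mul1r// mul0r expr0n.
Qed.

End restriction.

Section restriction_open.
Context {R : realType} {d : nat}.
Local Notation leb := (@lebesgue_row R d).
Local Notation sfun := ('rV[R]_d -> R).
Local Notation vfun := ('rV[R]_d -> 'rV[R]_d).
Variables w w' : set 'rV[R]_d.
Hypotheses (ow : open w) (ow' : open w') (ww : w' `<=` w).
Let mw := measurable_open ow.
Let mw' := measurable_open ow'.
Implicit Types (f g r : sfun) (p q F G : vfun).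

Lemma test_out phi x : test_function w' phi -> ~ w' x -> phi x = 0.
Proof. by move=> [_ [K [_ Kw K0]]] nx; apply: K0 => /Kw. Qed.

Lemma ip_test_sub f phi : test_function w' phi -> ip w f phi = ip w' f phi.
Proof.
move=> tp; rewrite ipC (ipC w'); apply: ip_restrict => // x wx; rewrite indicE.
have [xw|xw] := boolP (x \in w'); first by rewrite mul1r.
by rewrite mul0r (test_out tp)// => h; rewrite mem_set in xw.
Qed.

Lemma wg_sub f F : wg w f F -> wg w' f F.
Proof.
move=> [Lf [LF h]]; split; first exact: (L2_sub mw mw').
split; first exact: (L2v_sub mw mw').
move=> phi tp i; rewrite -!(ip_test_sub _)//; last exact: test_pderiv.
by apply: h; exact: test_sub tp.
Qed.

Lemma wd_sub q r : wd w q r -> wd w' q r.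
Proof.
move=> [Lq [Lr h]]; split; first exact: (L2v_sub mw mw').
split; first exact: (L2_sub mw mw').
move=> phi tp; have tp' := test_sub ww tp.
rewrite -ip_test_sub// -h// !ipvE//.
- by apply: eq_bigr => i _; rewrite cgrad_cmp ip_test_sub//; exact: test_pderiv.
- exact: (cgradL2 ow).
- exact: (L2v_sub mw mw').
- exact: (cgradL2 ow').
Qed.

End restriction_open.

(** * Traces and normal traces *)

Section traces.
Context {R : realType} {d : nat}.
Local Notation leb := (@lebesgue_row R d).
Local Notation sfun := ('rV[R]_d -> R).
Local Notation vfun := ('rV[R]_d -> 'rV[R]_d).
Variable w : set 'rV[R]_d.
Hypothesis ow : open w.
Let mw := measurable_open ow.
Implicit Types (f g r : sfun) (p q F G : vfun) (k : R).

Lemma wg_H1 f F : wg w f F -> H1 w f. Proof. by move=> h; apply/H1P; exists F. Qed.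
Lemma wd_Hdiv q r : wd w q r -> Hdiv w q. Proof. by move=> h; apply/HdivP; exists r. Qed.

Lemma H1ZD k f g : H1 w f -> H1 w g -> H1 w (k *: f + g).
Proof. by move=> /H1P[F hF] /H1P[G hG]; apply/H1P; exists (k *: F + G); exact: wgZD. Qed.
Lemma H1B f g : H1 w f -> H1 w g -> H1 w (f - g).
Proof. by move=> /H1P[F hF] /H1P[G hG]; apply/H1P; exists (F - G); exact: wgB. Qed.
Lemma H10ZD k f g : H10 w f -> H10 w g -> H10 w (k *: f + g).
Proof.
by move=> /(H10P ow)[F hF] /(H10P ow)[G hG]; apply/(H10P ow); exists (k *: F + G); exact: h0ZD.
Qed.
Lemma H10_0 : H10 w 0.
Proof. by apply/(H10P ow); exists 0; exact: h00. Qed.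
Lemma H10D f g : H10 w f -> H10 w g -> H10 w (f + g).
Proof. by move=> ? ?; rewrite -[f]scale1r; exact: H10ZD. Qed.
Lemma H10N f : H10 w f -> H10 w (- f).
Proof. by move=> h; have := H10ZD (-1) h H10_0; rewrite scaleN1r addr0. Qed.
Lemma H10B f g : H10 w f -> H10 w g -> H10 w (f - g).
Proof.
by move=> /(H10P ow)[F hF] /(H10P ow)[G hG]; apply/(H10P ow); exists (F - G); exact: (h0B ow hF hG). Qed.

Lemma mem_trace f : H1 w f -> trace w f f.
Proof. by move=> h; split => //; rewrite subrr; exact: H10_0. Qed.

Lemma trace_eqP f g : H1 w f -> H1 w g -> (trace w f = trace w g <-> H10 w (f - g)).
Proof.
move=> Hf Hg; split.
  by move=> e; have := mem_trace Hf; rewrite e => -[].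
move=> h; apply/seteqP; split => v [Hv hv]; (split; first exact: Hv).
  have -> : v - g = (v - f) + (f - g) by rewrite addrA subrK.
  exact: (H10D hv h).
have -> : v - f = (v - g) - (f - g) by rewrite opprB addrA subrK.
exact: (H10B hv h).
Qed.

Lemma Hhalf_trace f : H1 w f -> Hhalf w (trace w f).
Proof. by exists f. Qed.

(** A trace in H^{1/2} is a nonempty coset: it contains an H^1 function g with g - f in H^1_0,
    whence f = g - (g - f) is in H^1. *)
Lemma trace_H1 f : Hhalf w (trace w f) -> H1 w f.
Proof.
move=> [g Hg e]; have := mem_trace Hg; rewrite -e => -[_ [Hgf _]].
have -> : f = g - (g - f) by rewrite opprB addrC subrK.
exact: (H1B Hg Hgf).
Qed.

(** The value depends neither on the lift taken by [xget] nor on the selected derivatives: two lifts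
    differ by an element of H^1_0, on which [green0] gives 0. *)
Lemma normal_traceE q r f F : wd w q r -> wg w f F ->
  normal_trace w q (trace w f) = ipv w q F + ip w r f.
Proof.
move=> qr fF; have Hf := wg_H1 fF; rewrite /normal_trace asboolT; last exact: Hhalf_trace.
have : trace w f (xget 0 (trace w f)) by apply: (xgetPex 0); exists f; exact: mem_trace.
set f0 := xget 0 _; move=> [Hf0 h0f].
have Lq := wd_L2v qr; have Lr := wd_L2 qr.
have gf0 := wg_grad Hf0; have qd := wd_div (wd_Hdiv qr).
have [D hD] : exists D, h0 w (f0 - f) D by apply/(H10P ow).
have hD' := h0_wg ow hD (wgB ow gf0 fF).
have := green0 ow qr hD'.
have LF := wg_L2v fF; have LF0 := wg_L2v gf0; have Lf := wg_L2 fF; have Lf0 := wg_L2 gf0.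
rewrite (ipvBr mw)// (ipBr mw)// (ipC _ (div w q)) (wd_ip ow qd qr Lf0) (ipC _ f0); lra.
Qed.

Lemma normal_trace_out q (g : bvalue) : ~ Hhalf w g -> normal_trace w q g = 0.
Proof. by move=> h; rewrite /normal_trace asboolF. Qed.

Lemma normal_trace_ext p q r s : wd w p r -> wd w q s ->
  (forall f F, wg w f F -> ipv w p F + ip w r f = ipv w q F + ip w s f) ->
  normal_trace w p = normal_trace w q.
Proof.
move=> pr qs H; apply/funext => g; have [[f Hf ->]|ng] := pselect (Hhalf w g).
  have fF := wg_grad Hf.
  by rewrite (normal_traceE pr fF) (normal_traceE qs fF); exact: H.
by rewrite !normal_trace_out.
Qed.

Lemma comb_trace k f g : H1 w f -> H1 w g ->
  [set k *: a + b | a in trace w f & b in trace w g] = trace w (k *: f + g).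
Proof.
move=> Hf Hg; apply/seteqP; split => v.
  move=> [a [Ha ha] [b [Hb hb] <-]]; split; first exact: H1ZD.
  have -> : k *: a + b - (k *: f + g) = k *: (a - f) + (b - g).
    by rewrite scalerBr addrACA -opprD.
  exact: (H10ZD k ha hb).
move=> [Hv hv]; exists f; first exact: mem_trace.
exists (v - k *: f); last by rewrite addrC subrK.
split; last by rewrite -addrA -opprD.
by rewrite addrC -scaleNr; exact: H1ZD.
Qed.

Lemma normal_traceZD k p q r s : wd w p r -> wd w q s ->
  (fun g : bvalue => k * normal_trace w p g + normal_trace w q g) = normal_trace w (k *: p + q).
Proof.
move=> pr qs; apply/funext => g; have [[f Hf ->]|ng] := pselect (Hhalf w g); last first.
  by rewrite !normal_trace_out// mulr0 addr0.
have fF := wg_grad Hf.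
rewrite (normal_traceE pr fF) (normal_traceE qs fF) (normal_traceE (wdZD ow k pr qs) fF).
have LF := wg_L2v fF; have Lf := wg_L2 fF.
rewrite (ipvZD mw)//; [|exact: wd_L2v pr|exact: wd_L2v qs].
by rewrite (ipZD mw)//; [ring|exact: wd_L2 pr|exact: wd_L2 qs].
Qed.

End traces.

(** * Splitting integrals over a mesh and gluing across it *)

Section mesh.
Context {R : realType} {d : nat}.
Local Notation leb := (@lebesgue_row R d).
Local Notation sfun := ('rV[R]_d -> R).
Local Notation vfun := ('rV[R]_d -> 'rV[R]_d).
Variables (Omega : set 'rV[R]_d) (N : nat) (T : 'I_N -> set 'rV[R]_d).
Hypotheses (oO : open Omega) (oT : forall i, open (T i)) (TO : forall i, T i `<=` Omega)
  (dT : forall i j, i != j -> T i `&` T j = set0)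
  (nT : leb.-negligible (Omega `\` \bigcup_i T i)).
Let mO := measurable_open oO.
Let mT i := measurable_open (@oT i).
Implicit Types (f g r : sfun) (p q F G : vfun) (k : R).

Lemma sum_mesh (V : lmodType R) (h : 'I_N -> 'rV[R]_d -> V) i x : T i x ->
  \sum_j (\1_(T j) x : R) *: h j x = h i x.
Proof.
move=> Tx; rewrite (bigD1 i)//= indicE mem_set// scale1r big1 ?addr0// => j ji.
rewrite indicE memNset ?scale0r// => Tjx.
have : (T j `&` T i) x by []. by rewrite dT.
Qed.

Lemma pgradE f i x : T i x -> pgrad T f x = grad (T i) f x.
Proof. by move=> Tx; rewrite /pgrad (sum_mesh (fun j x => grad (T j) f x) Tx). Qed.
Lemma pdivE q i x : T i x -> Defs.pdiv T q x = div (T i) q x.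
Proof. by move=> Tx; exact: (sum_mesh (V := R^o) (fun j x => div (T j) q x) Tx). Qed.
Lemma plapE f i x : T i x -> plap T f x = lap (T i) f x.
Proof. by move=> Tx; exact: (sum_mesh (V := R^o) (fun j x => lap (T j) f x) Tx). Qed.

Lemma aemesh : {ae leb, forall x, Omega x -> exists i, T i x}.
Proof.
move: nT => [A [mA A0 sA]]; exists A; split => // x /= h; apply: sA.
have [Ox|nO] := pselect (Omega x); last by exfalso; apply: h.
split => // -[i _ Tx]; apply: h => _; by exists i.
Qed.

Lemma ip_mesh f g : L2 Omega f -> L2 Omega g -> ip Omega f g = \sum_i ip (T i) f g.
Proof.
move=> Lf Lg.
pose h i : sfun := fun x => \1_(T i) x * f x.
have Lh i : L2 Omega (h i) := (L2_ext mO (@mT i) (L2_sub mO (@mT i) (@TO i) Lf)).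
have -> : ip Omega f g = ip Omega (\sum_i h i) g.
  apply: ip_ae => //; [by apply: L2_sum| |exact: aeW].
  apply: filterS aemesh => x hx /hx [i Tx].
  by rewrite fct_sumE (sum_mesh (V := R^o) (fun _ => f) Tx).
rewrite ip_suml//; apply: eq_bigr => i _; exact: ip_restrict.
Qed.

Lemma ipv_mesh p q : L2v Omega p -> L2v Omega q -> ipv Omega p q = \sum_i ipv (T i) p q.
Proof.
move=> Lp Lq; rewrite ipvE//.
rewrite (eq_bigr (fun j => \sum_i ip (T i) (cmp p j) (cmp q j))); last first.
  by move=> j _; rewrite (ip_mesh (Lp j) (Lq j)).
rewrite exchange_big; apply: eq_bigr => i _; rewrite ipvE//; exact: (L2v_sub mO (@mT i) (@TO i)).
Qed.

Lemma L2_mesh (h : 'I_N -> sfun) : (forall i, L2 (T i) (h i)) ->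
  L2 Omega (fun x => \sum_i \1_(T i) x * h i x).
Proof.
move=> Lh; rewrite (_ : (fun _ => _) = \sum_i (fun x => \1_(T i) x * h i x)).
  by apply: L2_sum => // i _; exact: L2_ext.
by apply/funext => x; rewrite fct_sumE.
Qed.

Lemma L2v_mesh (h : 'I_N -> vfun) : (forall i, L2v (T i) (h i)) ->
  L2v Omega (fun x => \sum_i (\1_(T i) x : R) *: h i x).
Proof.
move=> Lh j; have := @L2_mesh (fun i => cmp (h i) j) (fun i => Lh i j).
apply: eq_L2 => // x _; rewrite summxE; apply: eq_bigr => i _.
by rewrite mxE.
Qed.

Lemma L2_pgrad f : (forall i, H1 (T i) f) -> L2v Omega (pgrad T f).
Proof. by move=> Hf; apply: L2v_mesh => i; exact: wg_L2v (wg_grad (Hf i)). Qed.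
Lemma L2_pdiv q : (forall i, Hdiv (T i) q) -> L2 Omega (Defs.pdiv T q).
Proof. by move=> Hq; apply: L2_mesh => i; exact: wd_L2 (wd_div (Hq i)). Qed.
Lemma L2_plap f : (forall i, Hdiv (T i) (grad (T i) f)) -> L2 Omega (plap T f).
Proof. by move=> Hq; apply: L2_mesh => i; exact: wd_L2 (wd_div (Hq i)). Qed.

Lemma wg_pgrad f i : H1 (T i) f -> wg (T i) f (pgrad T f).
Proof.
by move=> /wg_grad; apply: wg_eq => // x Tx; rewrite (pgradE f Tx).
Qed.
Lemma wd_pdiv q i : Hdiv (T i) q -> wd (T i) q (Defs.pdiv T q).
Proof.
by move=> /wd_div; apply: wd_eq => // x Tx; rewrite (pdivE q Tx).
Qed.
Lemma wd_plap f i : Hdiv (T i) (grad (T i) f) -> wd (T i) (pgrad T f) (plap T f).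
Proof.
by move=> /wd_div; apply: wd_eq => // x Tx; rewrite ?(pgradE f Tx) ?(plapE f Tx).
Qed.

(** The hypothesis says that on each element q has divergence r and zero normal trace, so no jump
    arises at the interfaces. It is applied to the restrictions of test functions of Omega, which
    need not vanish on the skeleton. *)
Lemma wd_glue q r : L2v Omega q -> L2 Omega r ->
  (forall i g G, wg (T i) g G -> ipv (T i) q G + ip (T i) r g = 0) -> wd Omega q r.
Proof.
move=> Lq Lr H; apply: wd_of_test => // phi tp.
have Lp := testL2 oO tp; have Lcp := cgradL2 oO tp.
rewrite ip_mesh// ipv_mesh// -big_split big1// => i _ /=.
rewrite addrC; apply: H.
exact: (wg_sub oO (@oT i) (@TO i) (wg_test oO tp)).
Qed.

Lemma cgrad_sum (I : Type) (s : seq I) (w : set 'rV[R]_d) (phi : I -> sfun) :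
  (forall i, test_function w (phi i)) ->
  cgrad (\sum_(i <- s) phi i) = \sum_(i <- s) cgrad (phi i).
Proof.
move=> tp; elim: s => [|i s IH].
  rewrite !big_nil; apply/funext => x; apply/rowP => i; rewrite !mxE.
  exact: (congr1 (fun f => f x) (pderiv_cst 0 i)).
rewrite !big_cons -IH -[phi i]scale1r -[cgrad (_ *: _)]scale1r.
by rewrite (cgradZD _ (tp i) (test_sum s tp)) !scale1r.
Qed.

(** Test functions of the elements add up to test functions of Omega, and on T i only the summand of
    T i survives. *)
Lemma h0_glue f F : L2 Omega f -> L2v Omega F -> (forall i, h0 (T i) f F) -> h0 Omega f F.
Proof.
move=> Lf LF H.
have Hi i : exists phi : sfun^nat,
  [/\ forall n, test_function (T i) (phi n),
      ip (T i) (f - phi n) (f - phi n) @[n --> \oo] --> (0 : R) &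
      ipv (T i) (F - cgrad (phi n)) (F - cgrad (phi n)) @[n --> \oo] --> (0 : R)].
  by case: (H i).
have [phi Hphi] := choice Hi.
pose Phi n : sfun := \sum_i phi i n.
have tpO i n : test_function Omega (phi i n).
  by apply: (test_sub (@TO i)); case: (Hphi i).
have tP n : test_function Omega (Phi n) by exact: test_sum.
have out i j n x : T i x -> j != i -> phi j n x = 0 /\ cgrad (phi j n) x = 0.
  move=> Tx ji; have nx : ~ T j x.
    move=> Tjx; have : (T j `&` T i) x by []. by rewrite dT.
  have tj : test_function (T j) (phi j n) by case: (Hphi j).
  split; first exact: test_out tj nx.
  by apply/rowP => l; rewrite !mxE; exact: test_out (test_pderiv l tj) nx.
have PhiE i n x : T i x -> Phi n x = phi i n x.
  move=> Tx; rewrite /Phi fct_sumE (bigD1 i)//= big1 ?addr0// => j ji.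
  by case: (out i j n x Tx ji).
have cPhiE i n x : T i x -> cgrad (Phi n) x = cgrad (phi i n) x.
  move=> Tx; rewrite /Phi (cgrad_sum _ (fun i => tpO i n)) fct_sumE (bigD1 i)//= big1 ?addr0// => j ji.
  by case: (out i j n x Tx ji).
have Ld n : L2 Omega (f - Phi n).
  exact: (L2B mO Lf (testL2 oO (tP n))).
have LD n : L2v Omega (F - cgrad (Phi n)).
  have Lc : L2v Omega (cgrad (Phi n)) := cgradL2 oO (tP n).
  exact: (L2vB mO LF Lc).
have c1 : ip Omega (f - Phi n) (f - Phi n) @[n --> \oo] --> (0 : R).
  rewrite (_ : (fun _ => _) = (fun n => \sum_i ip (T i) (f - phi i n) (f - phi i n))); last first.
    apply/funext => n; rewrite (ip_mesh (Ld n) (Ld n)).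
    by apply: eq_bigr => i _; apply: eq_ip => x Tx; rewrite !fctE (PhiE i).
  rewrite -[X in _ --> X](_ : \sum_(i < N) (0 : R) = 0); last by rewrite big1.
  apply: cvg_big => [|i _]; first exact: add_continuous.
  by case: (Hphi i).
have c2 : ipv Omega (F - cgrad (Phi n)) (F - cgrad (Phi n)) @[n --> \oo] --> (0 : R).
  rewrite (_ : (fun _ => _) = (fun n => \sum_i ipv (T i) (F - cgrad (phi i n)) (F - cgrad (phi i n)))); last first.
    apply/funext => n; rewrite (ipv_mesh (LD n) (LD n)).
    by apply: eq_bigr => i _; apply: eq_ipv => x Tx; rewrite !fctE (cPhiE i).
  rewrite -[X in _ --> X](_ : \sum_(i < N) (0 : R) = 0); last by rewrite big1.
  apply: cvg_big => [|i _]; first exact: add_continuous.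
  by case: (Hphi i).
split; last by exists Phi.
by apply: (wg_lim oO Lf LF _ c1 c2) => n; exact: wg_test.
Qed.

(** Two lifts differ on each element by a function of H^1_0 of that element, so by [h0_glue] they
    differ by a function of H^1_0 of Omega and have the same trace on Gamma. *)
Lemma restr_halfE uh f : lifts_half Omega T uh f -> restr_half Omega T uh = trace Omega f.
Proof.
move=> lf; rewrite /restr_half.
have : lifts_half Omega T uh (xget (cst 0) (lifts_half Omega T uh)) by apply: (xgetPex (cst 0)); exists f.
set g := xget _ _; move: lf => [Hf hf] [Hg hg].
apply/trace_eqP => //; apply/(H10P oO).
have fF := wg_grad Hf; have gG := wg_grad Hg; have gf := wgB oO gG fF.
exists (grad Omega g - grad Omega f); apply: h0_glue; [exact: wg_L2 gf|exact: wg_L2v gf|move=> i].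
have gfi := wg_sub oO (@oT i) (@TO i) gf.
have Hfi : H1 (T i) f := wg_H1 (wg_sub oO (@oT i) (@TO i) fF).
have Hgi : H1 (T i) g := wg_H1 (wg_sub oO (@oT i) (@TO i) gG).
have /(H10P (@oT i))[D hD] : H10 (T i) (g - f) by apply/(trace_eqP (@oT i) Hgi Hfi); rewrite -hf -hg.
exact: h0_wg hD gfi.
Qed.

(** Any H^1 function of Omega restricts to the elements, so the normal trace on Gamma is the sum of
    the pairings with the element traces, which all lifts share. *)
Lemma restr_mhalfE sh q r : wd Omega q r -> (forall i, sh i = normal_trace (T i) q) ->
  restr_mhalf Omega T sh = normal_trace Omega q.
Proof.
move=> qr sq; rewrite /restr_mhalf.
have : lifts_mhalf Omega T sh (xget (cst 0) (lifts_mhalf Omega T sh)).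
  by apply: (xgetPex (cst 0)); exists q; split => //; exact: wd_Hdiv qr.
set p := xget _ _; move=> [Hp hp]; have pd := wd_div Hp.
apply: (normal_trace_ext oO pd qr) => f F fF.
have Lf := wg_L2 fF; have LF := wg_L2v fF.
rewrite !ipv_mesh ?ip_mesh//; [|exact: wd_L2 qr|exact: wd_L2 pd|exact: wd_L2v qr|exact: wd_L2v pd].
rewrite -!big_split; apply: eq_bigr => i _ /=.
have sub := wg_sub oO (@oT i) (@TO i) fF.
rewrite -(normal_traceE (@oT i) (wd_sub oO (@oT i) (@TO i) pd) sub).
by rewrite -(normal_traceE (@oT i) (wd_sub oO (@oT i) (@TO i) qr) sub) -hp -sq.
Qed.

(** Green's formula on each element with the lift f; by the mesh splitting the sum becomes an
    integral over Omega. *)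
Lemma dual_halfE uh q f F : wg Omega f F -> (forall i, uh i = trace (T i) f) ->
  L2v Omega q -> (forall i, Hdiv (T i) q) ->
  dual_half T uh q = ipv Omega q F + ip Omega (Defs.pdiv T q) f.
Proof.
move=> fF hf Lq Hq; rewrite ipv_mesh ?ip_mesh//; [|exact: L2_pdiv|exact: wg_L2 fF|exact: wg_L2v fF].
rewrite -big_split; apply: eq_bigr => i _ /=; rewrite hf.
by apply: normal_traceE => //; [exact: wd_pdiv|exact: (wg_sub oO (@oT i) (@TO i) fF)].
Qed.

Lemma dual_half_pgradE uh v f F : wg Omega f F -> (forall i, uh i = trace (T i) f) ->
  (forall i, H1 (T i) v) -> (forall i, Hdiv (T i) (grad (T i) v)) ->
  dual_half T uh (pgrad T v) = ipv Omega (pgrad T v) F + ip Omega (plap T v) f.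
Proof.
move=> fF hf H1v Hv; rewrite ipv_mesh ?ip_mesh//; [|exact: L2_plap|exact: wg_L2 fF|exact: L2_pgrad|exact: wg_L2v fF].
rewrite -big_split; apply: eq_bigr => i _ /=; rewrite hf.
by apply: normal_traceE => //; [exact: wd_plap|exact: (wg_sub oO (@oT i) (@TO i) fF)].
Qed.

Lemma dual_mhalfE sh q r v : wd Omega q r -> (forall i, sh i = normal_trace (T i) q) ->
  L2 Omega v -> (forall i, H1 (T i) v) ->
  dual_mhalf T sh v = ipv Omega q (pgrad T v) + ip Omega r v.
Proof.
move=> qr hq Lv Hv; rewrite ipv_mesh ?ip_mesh//; [|exact: wd_L2 qr|exact: wd_L2v qr|exact: L2_pgrad].
rewrite -big_split; apply: eq_bigr => i _ /=; rewrite hq.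
by apply: normal_traceE => //; [exact: (wd_sub oO (@oT i) (@TO i) qr)|exact: wg_pgrad].
Qed.

End mesh.

Section mesh_of.
Context {R : realType} {d : nat}.
Local Notation leb := (@lebesgue_row R d).

(** A point of Omega that lies in no element lies in the closure of one of them, hence on one of
    finitely many null boundaries. *)
Lemma mesh_negligible (Omega : set 'rV[R]_d) N (T : 'I_N -> set 'rV[R]_d) :
  mesh_of Omega T -> leb.-negligible (Omega `\` \bigcup_i T i).
Proof.
move=> [h1 h2 h3 h4].
apply: (@negligibleS _ _ _ leb (\big[setU/set0]_(i < N) bdry (T i))).
  move=> x [Ox nT].
  have : closure Omega x by exact: subset_closure.
  rewrite h4 -bigcup_seq => -[i _ ci]; exists i => /=; first by rewrite mem_index_enum.
  split => //; move=> /interior_subset Tx; apply: nT; by exists i.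
apply: big_ind => [|A B nA nB|i _]; first exact: negligible_set0.
  exact: negligibleU.
by apply: negligible_bdry; case: (h1 i).
Qed.

End mesh_of.

(** * The trial-to-test operator *)

#[local] Opaque ip ipv.

(** * Real inequalities and the powers of eps *)

Section real_lemmas.
Context {R : realType}.
Implicit Types (a b c e k x y r : R).

Lemma le_of_sqr x y : 0 <= y -> x ^+ 2 <= y ^+ 2 -> x <= y.
Proof.
by move=> y0 h; have [//|xy] := leP x y; exfalso; move: h; apply/negP; rewrite -ltNge; nra.
Qed.

Lemma le_trans_eq x y a : x <= y -> y = a -> x <= a.
Proof. by move=> + <-. Qed.

Lemma cs_add x y a b c e : 0 <= a -> 0 <= b -> 0 <= c -> 0 <= e ->
  x ^+ 2 <= a * b -> y ^+ 2 <= c * e -> (x + y) ^+ 2 <= (a + c) * (b + e).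
Proof.
move=> a0 b0 c0 e0 hx hy.
have : 2 * (x * y) <= a * e + c * b.
  apply: le_of_sqr; first by rewrite addr_ge0// mulr_ge0.
  have h : x ^+ 2 * y ^+ 2 <= (a * b) * (c * e) by apply: ler_pM => //; exact: sqr_ge0.
  have := sqr_ge0 (a * e - c * b); nra.
nra.
Qed.

(** A Cauchy-Schwarz estimate in a form that is stable under sums and nonnegative weights, so that
    the estimate for a weighted sum of products is assembled term by term. *)
Definition cs_bound x a b := [/\ 0 <= a, 0 <= b & x ^+ 2 <= a * b].

Lemma cs_boundD x y a b c e : cs_bound x a b -> cs_bound y c e -> cs_bound (x + y) (a + c) (b + e).
Proof. by move=> [? ? ?] [? ? ?]; split; [exact: addr_ge0|exact: addr_ge0|exact: cs_add]. Qed.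

Lemma cs_boundZ k x a b : 0 <= k -> cs_bound x a b -> cs_bound (k * x) (k * a) (k * b).
Proof.
move=> k0 [a0 b0 h]; split; [exact: mulr_ge0|exact: mulr_ge0|].
rewrite exprMn (_ : k * a * (k * b) = k ^+ 2 * (a * b)); last by ring.
by rewrite ler_wpM2l ?sqr_ge0.
Qed.

Lemma pow4E r : 0 < r ->
  [/\ (r ^+ 4) `^ (1 / 4) = r, (r ^+ 4) `^ (1 / 2) = r ^+ 2,
      (r ^+ 4) `^ (3 / 4) = r ^+ 3 & (r ^+ 4) `^ (5 / 4) = r ^+ 5] /\
  [/\ (r ^+ 4) `^ (3 / 2) = r ^+ 6, (r ^+ 4) `^ (5 / 2) = r ^+ 10,
      (r ^+ 4) `^ (- (1 / 4)) = r^-1 & (r ^+ 4) `^ (- (1 / 2)) = r ^- 2].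
Proof.
move=> r0; have r0' := ltW r0.
have E x (n : nat) : 4 * x = n%:R -> (r ^+ 4) `^ x = r ^+ n.
  by move=> h; rewrite -powR_mulrn// -powRrM h powR_mulrn.
have e1 : (r ^+ 4) `^ (1 / 4) = r by rewrite (E _ 1%N) ?expr1//; lra.
have e2 : (r ^+ 4) `^ (1 / 2) = r ^+ 2 by apply: E; lra.
split; split => //; try by apply: E; lra.
- by rewrite powRN e1.
- by rewrite powRN e2.
Qed.

End real_lemmas.

Section cauchy.
Context {R : realType} {d : nat}.
Variable w : set 'rV[R]_d.
Hypothesis mw : measurable w.

Lemma ip_CS2 f g : L2 w f -> L2 w g -> ip w f g ^+ 2 <= ip w f f * ip w g g.
Proof.
move=> Lf Lg; have := ip_CS mw Lf Lg; rewrite /siN -sqrtrM ?ip_ge0// => h.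
rewrite -[X in X <= _]real_normK ?num_real// -[X in _ <= X]sqr_sqrtr; last first.
  by rewrite mulr_ge0// ip_ge0.
by rewrite ler_sqr ?nnegrE ?sqrtr_ge0 ?normr_ge0.
Qed.

Lemma ipv_CS2 p q : L2v w p -> L2v w q -> ipv w p q ^+ 2 <= ipv w p p * ipv w q q.
Proof.
move=> Lf Lg; have := ipv_CS mw Lf Lg; rewrite /siN -sqrtrM ?ipv_ge0// => h.
rewrite -[X in X <= _]real_normK ?num_real// -[X in _ <= X]sqr_sqrtr; last first.
  by rewrite mulr_ge0// ipv_ge0.
by rewrite ler_sqr ?nnegrE ?sqrtr_ge0 ?normr_ge0.
Qed.

End cauchy.

Section sobolev_more.
Context {R : realType} {d : nat}.
Local Notation leb := (@lebesgue_row R d).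
Local Notation sfun := ('rV[R]_d -> R).
Local Notation vfun := ('rV[R]_d -> 'rV[R]_d).
Variable w : set 'rV[R]_d.
Hypothesis ow : open w.
Let mw := measurable_open ow.

Lemma wd_ae (p q : vfun) (r : sfun) : L2v w q ->
  {ae leb, forall x, w x -> p x = q x} -> wd w p r -> wd w q r.
Proof.
move=> Lq pq pr; apply: wd_of_test => //; first exact: wd_L2 pr.
move=> phi tp; have Lc := cgradL2 ow tp.
rewrite -(ipv_ae mw (wd_L2v pr) Lq Lc Lc pq); last exact: aeW.
by move: pr => [_ [_ h]]; rewrite (h _ tp) addrN.
Qed.

Lemma h0_of_wd (z : sfun) (Z : vfun) : L2 w z -> L2v w Z ->
  (forall q r, wd w q r -> ipv w Z q + ip w z r = 0) -> h0 w z Z.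
Proof.
move=> Lz LZ H; apply: H10_char => //; last by move=> q r /H; rewrite addrC.
split => //; split => // phi tp i.
have h := wd_test ow i tp; have := H _ _ h.
rewrite ipvE//; last exact: wd_L2v h.
rewrite (bigD1 i)//= big1 ?addr0; last first.
  move=> j ji; have -> : cmp (fun x : 'rV_d => phi x *: 'e_i) j = 0.
    by apply/funext => x; rewrite /cmp /= !mxE /= (negbTE ji) mulr0.
  by rewrite (ip0r mw).
rewrite (_ : cmp (fun x : 'rV_d => phi x *: 'e_i) i = phi); last first.
  by apply/funext => x; rewrite /cmp /= !mxE !eqxx mulr1.
by move=> /eqP; rewrite addrC addr_eq0 => /eqP.
Qed.

End sobolev_more.

(** * The broken spaces and the test space V *)

Section piecewise.
Context {R : realType} {d : nat}.
Local Notation leb := (@lebesgue_row R d).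
Local Notation sfun := ('rV[R]_d -> R).
Local Notation vfun := ('rV[R]_d -> 'rV[R]_d).
Variables (Omega : set 'rV[R]_d) (N : nat) (T : 'I_N -> set 'rV[R]_d).
Hypotheses (oO : open Omega) (oT : forall i, open (T i)) (TO : forall i, T i `<=` Omega)
  (dT : forall i j, i != j -> T i `&` T j = set0)
  (nT : leb.-negligible (Omega `\` \bigcup_i T i)).
Let mO := measurable_open oO.
Let mT i := measurable_open (@oT i).
Implicit Types (f g : sfun) (p q F G : vfun) (k : R).
Local Notation IM := (ip_mesh oO oT TO dT nT).
Local Notation VM := (ipv_mesh oO oT TO dT nT).

Lemma ip_sub_le f i : L2 Omega f -> ip (T i) f f <= ip Omega f f.
Proof.
move=> Lf; rewrite (IM Lf Lf) (bigD1 i)//= lerDl sumr_ge0// => j _; exact: ip_ge0.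
Qed.

Lemma ipv_sub_le q i : L2v Omega q -> ipv (T i) q q <= ipv Omega q q.
Proof.
move=> Lf; rewrite (VM Lf Lf) (bigD1 i)//= lerDl sumr_ge0// => j _; exact: ipv_ge0.
Qed.

(** One field on Omega carries the derivatives of all elements, so pairings with it are integrals
    over Omega. *)
Definition pwg f F := [/\ L2 Omega f, L2v Omega F & forall i, wg (T i) f F].
Definition pwd q s := [/\ L2v Omega q, L2 Omega s & forall i, wd (T i) q s].

Lemma pwg_ipv f F G q : pwg f F -> pwg f G -> L2v Omega q -> ipv Omega q F = ipv Omega q G.
Proof.
move=> [Lf LF hF] [_ LG hG] Lq; rewrite (VM Lq LF) (VM Lq LG); apply: eq_bigr => i _.
exact: (wg_ipv (@oT i) (hF i) (hG i) (L2v_sub mO (mT i) (@TO i) Lq)).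
Qed.

Lemma pwd_ip q r s f : pwd q r -> pwd q s -> L2 Omega f -> ip Omega f r = ip Omega f s.
Proof.
move=> [Lq Lr hr] [_ Ls hs] Lf; rewrite (IM Lf Lr) (IM Lf Ls); apply: eq_bigr => i _.
exact: (wd_ip (@oT i) (hr i) (hs i) (L2_sub mO (mT i) (@TO i) Lf)).
Qed.

Lemma pwgZD k f F g G : pwg f F -> pwg g G -> pwg (k *: f + g) (k *: F + G).
Proof.
move=> [? ? hF] [? ? hG]; split; [exact: L2ZD|exact: L2vZD|move=> i].
exact: (wgZD (@oT i) k (hF i) (hG i)).
Qed.

Lemma pwdZD k p r q s : pwd p r -> pwd q s -> pwd (k *: p + q) (k *: r + s).
Proof.
move=> [? ? hF] [? ? hG]; split; [exact: L2vZD|exact: L2ZD|move=> i].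
exact: (wdZD (@oT i) k (hF i) (hG i)).
Qed.

Lemma pwg0 : pwg 0 0.
Proof. by split; [exact: L20|exact: L2v0|move=> i; exact: (wg0 (@oT i))]. Qed.
Lemma pwd0 : pwd 0 0.
Proof. by split; [exact: L2v0|exact: L20|move=> i; exact: (wd0 (@oT i))]. Qed.

Lemma cvg0_sub (a b : nat -> R) : (forall n, 0 <= a n <= b n) -> b @ \oo --> (0 : R) ->
  a @ \oo --> (0 : R).
Proof.
move=> h cb; apply: (@cvg0_comb _ 1 0 a b b) => // n.
by rewrite mul1r mul0r addr0; exact: h.
Qed.

Lemma pwg_lim (fn : nat -> sfun) (Fn : nat -> vfun) f F : L2 Omega f -> L2v Omega F ->
  (forall n, pwg (fn n) (Fn n)) ->
  ip Omega (f - fn n) (f - fn n) @[n --> \oo] --> (0 : R) ->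
  ipv Omega (F - Fn n) (F - Fn n) @[n --> \oo] --> (0 : R) -> pwg f F.
Proof.
move=> Lf LF hn c1 c2; split => // i.
apply: (@wg_lim _ _ _ (@oT i) fn Fn).
- exact: (L2_sub mO (mT i) (@TO i) Lf).
- exact: (L2v_sub mO (mT i) (@TO i) LF).
- by move=> n; case: (hn n).
- apply: cvg0_sub c1 => n; rewrite ip_ge0/=; apply: ip_sub_le.
  by apply: (L2B mO Lf); case: (hn n).
- apply: cvg0_sub c2 => n; rewrite ipv_ge0/=; apply: ipv_sub_le.
  by apply: (L2vB mO LF); case: (hn n).
Qed.

Lemma pwd_lim (qn : nat -> vfun) (sn : nat -> sfun) q s : L2v Omega q -> L2 Omega s ->
  (forall n, pwd (qn n) (sn n)) ->
  ipv Omega (q - qn n) (q - qn n) @[n --> \oo] --> (0 : R) ->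
  ip Omega (s - sn n) (s - sn n) @[n --> \oo] --> (0 : R) -> pwd q s.
Proof.
move=> Lf LF hn c1 c2; split => // i.
apply: (@wd_lim _ _ _ (@oT i) qn sn).
- exact: (L2v_sub mO (mT i) (@TO i) Lf).
- exact: (L2_sub mO (mT i) (@TO i) LF).
- by move=> n; case: (hn n).
- apply: cvg0_sub c1 => n; rewrite ipv_ge0/=; apply: ipv_sub_le.
  by apply: (L2vB mO Lf); case: (hn n).
- apply: cvg0_sub c2 => n; rewrite ip_ge0/=; apply: ip_sub_le.
  by apply: (L2B mO LF); case: (hn n).
Qed.

Definition ext i g : sfun := fun x => (\1_(T i) x : R) * g x.
Definition extv i G : vfun := fun x => (\1_(T i) x : R) *: G x.

Lemma cmp_extv i G j : cmp (extv i G) j = ext i (cmp G j).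
Proof. by apply/funext => x; rewrite /cmp /extv /ext mxE. Qed.

Lemma L2_exti i g : L2 (T i) g -> L2 Omega (ext i g).
Proof. exact: (L2_ext mO (mT i)). Qed.
Lemma L2v_exti i G : L2v (T i) G -> L2v Omega (extv i G).
Proof. by move=> LG j; have := L2_exti (LG j); rewrite -cmp_extv. Qed.

Lemma ip_exti i f g : ip Omega f (ext i g) = ip (T i) f g.
Proof. by rewrite ipC (ipC (T i)); exact: (ip_restrict (@TO i)). Qed.
Lemma ipv_exti i q G : L2v Omega q -> L2v (T i) G -> ipv Omega q (extv i G) = ipv (T i) q G.
Proof.
move=> Lq LG; rewrite (ipvE mO Lq (L2v_exti LG)) (ipvE (mT i) (L2v_sub mO (mT i) (@TO i) Lq) LG).
by apply: eq_bigr => j _; rewrite cmp_extv ip_exti.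
Qed.

Lemma ext_in i g x : T i x -> ext i g x = g x.
Proof. by move=> Tx; rewrite /ext indicE mem_set// mul1r. Qed.
Lemma extv_in i G x : T i x -> extv i G x = G x.
Proof. by move=> Tx; rewrite /extv indicE mem_set// scale1r. Qed.
Lemma ext_out i j g x : i != j -> T j x -> ext i g x = 0.
Proof.
move=> ij Tx; rewrite /ext indicE memNset ?mul0r// => Tix.
have : (T i `&` T j) x by []. by rewrite dT.
Qed.
Lemma extv_out i j G x : i != j -> T j x -> extv i G x = 0.
Proof.
move=> ij Tx; rewrite /extv indicE memNset ?scale0r// => Tix.
have : (T i `&` T j) x by []. by rewrite dT.
Qed.

Lemma pwg_ext i g G : wg (T i) g G -> pwg (ext i g) (extv i G).
Proof.
move=> gG; split; [exact: L2_exti (wg_L2 gG)|exact: L2v_exti (wg_L2v gG)|move=> j].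
have [<-|ij] := eqVneq i j.
  by apply: (wg_eq (@oT i) _ _ gG) => x Tx; rewrite ?ext_in ?extv_in.
by apply: (wg_eq (@oT j) _ _ (wg0 (@oT j))) => x Tx; rewrite ?(ext_out _ ij) ?(extv_out _ ij).
Qed.

Lemma pwd_ext i q s : wd (T i) q s -> pwd (extv i q) (ext i s).
Proof.
move=> gG; split; [exact: L2v_exti (wd_L2v gG)|exact: L2_exti (wd_L2 gG)|move=> j].
have [<-|ij] := eqVneq i j.
  by apply: (wd_eq (@oT i) _ _ gG) => x Tx; rewrite ?ext_in ?extv_in.
by apply: (wd_eq (@oT j) _ _ (wd0 (@oT j))) => x Tx; rewrite ?(ext_out _ ij) ?(extv_out _ ij).
Qed.

(** An element of V together with its four piecewise derivatives, held as independent L2 components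
    and tied together by [isv]. V thereby becomes a closed subspace of a product of L2 spaces, on
    which b(u, .) is an L2 pairing. *)
Record vdata := VData { vmu : sfun; vM : vfun; vtau : vfun; vD : sfun;
  vv : sfun; vV : vfun; vL : sfun }.

Definition L27 (y : vdata) : Prop :=
  [/\ L2 Omega (vmu y), L2v Omega (vM y), L2v Omega (vtau y) & L2 Omega (vD y)] /\
  [/\ L2 Omega (vv y), L2v Omega (vV y) & L2 Omega (vL y)].

Definition pair7 (x y : vdata) : R :=
  ip Omega (vmu x) (vmu y) + ipv Omega (vM x) (vM y)
  + (ipv Omega (vtau x) (vtau y) + ip Omega (vD x) (vD y))
  + (ip Omega (vv x) (vv y) + ipv Omega (vV x) (vV y) + ip Omega (vL x) (vL y)).

Definition isv (y : vdata) : Prop :=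
  [/\ pwg (vmu y) (vM y), pwd (vtau y) (vD y), pwg (vv y) (vV y) & pwd (vV y) (vL y)].

Definition test_of (y : vdata) : test := Test (vmu y) (vtau y) (vv y).
Definition data_of (x : test) : vdata := VData (te_mu x) (pgrad T (te_mu x)) (te_tau x)
  (Defs.pdiv T (te_tau x)) (te_v x) (pgrad T (te_v x)) (plap T (te_v x)).

Lemma data_ofK x : test_of (data_of x) = x. Proof. by case: x. Qed.

Lemma isv_L27 y : isv y -> L27 y.
Proof. by move=> [[? ? _] [? ? _] [? ? _] [? ? _]]. Qed.

Lemma isv_data x : spaceV Omega T x -> isv (data_of x).
Proof.
move=> [[L1 h1] [L2' h2] [L3 h3]]; split; split => //=.
- exact: L2_pgrad.
- by move=> i; exact: wg_pgrad.
- exact: L2_pdiv.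
- by move=> i; exact: wd_pdiv.
- by apply: L2_pgrad => // i; case: (h3 i).
- by move=> i; apply: wg_pgrad => //; case: (h3 i).
- by apply: L2_pgrad => // i; case: (h3 i).
- by apply: L2_plap => // i; case: (h3 i).
- by move=> i; apply: wd_plap => //; case: (h3 i).
Qed.

Lemma isv_space y : isv y -> spaceV Omega T (test_of y).
Proof.
move=> [[? ? h1] [? ? h2] [? ? h3] [? ? h4]]; split; split => //= i.
- exact: wg_H1 (h1 i).
- exact: wd_Hdiv (h2 i).
- have H := wg_H1 (h3 i); split => //.
  have g := wg_grad H; apply: (@wd_Hdiv _ _ _ _ (vL y)).
  apply: (wd_ae (@oT i) (wg_L2v g) _ (h4 i)).
  exact: (wg_uniq (@oT i) (h3 i) g).
Qed.

(** Replacing the recorded derivatives by the selected ones changes them on null sets only, which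
    the pairing does not see. *)
Lemma pair7_data y a : isv y -> L27 a -> pair7 a (data_of (test_of y)) = pair7 a y.
Proof.
move=> yv [[? ? ? ?] [? ? ?]]; have [a1 a2 a3 a4] := isv_data (isv_space yv).
have [b1 b2 b3 b4] := yv; rewrite /pair7.
rewrite (pwg_ipv a1 b1)// (pwd_ip a2 b2)// (pwg_ipv a3 b3)//.
congr (_ + (_ + _)).
have [_ _ h3] := a3; have [_ _ h3'] := b3; have [la lb h4] := a4; have [lc ld h4'] := b4.
have k1 : pwd (vV y) (plap T (vv y)).
  split; [exact: lc|exact: lb|move=> i].
  apply: (wd_ae (@oT i) (L2v_sub mO (mT i) (@TO i) lc) _ (h4 i)).
  exact: (wg_uniq (@oT i) (h3 i) (h3' i)).
by rewrite (pwd_ip k1 b4).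
Qed.

Lemma pair7C x y : pair7 x y = pair7 y x.
Proof.
rewrite /pair7 (ipC _ (vmu x)) (ipvC _ (vM x)) (ipvC _ (vtau x)) (ipC _ (vD x)) (ipC _ (vv x)).
by rewrite (ipvC _ (vV x)) (ipC _ (vL x)).
Qed.

Definition combd k (x y : vdata) : vdata := VData (k *: vmu x + vmu y) (k *: vM x + vM y)
  (k *: vtau x + vtau y) (k *: vD x + vD y) (k *: vv x + vv y) (k *: vV x + vV y)
  (k *: vL x + vL y).

Lemma isvZD k x y : isv x -> isv y -> isv (combd k x y).
Proof. by move=> [? ? ? ?] [? ? ? ?]; split; [exact: pwgZD|exact: pwdZD|exact: pwgZD|exact: pwdZD]. Qed.

Lemma pair7ZD k x y z : L27 x -> L27 y -> L27 z ->
  pair7 (combd k x y) z = k * pair7 x z + pair7 y z.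
Proof.
move=> [[? ? ? ?] [? ? ?]] [[? ? ? ?] [? ? ?]] [[? ? ? ?] [? ? ?]]; rewrite /pair7 /=.
by rewrite !(ipZD mO)// !(ipvZD mO)//; ring.
Qed.

Variable r : R.
Hypothesis r0 : 0 < r.

(* The Riesz isomorphism of V, expressed on the seven components of an element of V
   and its piecewise derivatives. *)
Definition wt (x : vdata) : vdata := VData (r ^- 4 *: vmu x) (vM x) (r ^- 2 *: vtau x)
  (vD x) (vv x) ((r ^+ 2 + r ^+ 4) *: vV x) (r ^+ 6 *: vL x).

Lemma L27_wt x : L27 x -> L27 (wt x).
Proof.
move=> [[? ? ? ?] [? ? ?]]; split; split => //=;
  by [exact: L2Z|exact: L2vZ].
Qed.

Lemma pair7_wtC x y : L27 x -> L27 y -> pair7 (wt x) y = pair7 x (wt y).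
Proof.
move=> [[? ? ? ?] [? ? ?]] [[? ? ? ?] [? ? ?]]; rewrite /pair7 /=.
by rewrite !(ipZl mO)// !(ipvZl mO)// !(ipZr mO)// !(ipvZr mO).
Qed.

Lemma ipVE x y : L27 (data_of x) -> L27 (data_of y) ->
  ipV Omega T (r ^+ 4) x y = pair7 (wt (data_of x)) (data_of y).
Proof.
move=> [[/= a1 a2 a3 a4] [/= a5 a6 a7]] [[/= b1 b2 b3 b4] [/= b5 b6 b7]]; rewrite /pair7 /ipV /=.
have [[_ -> _ _] [-> _ _ ->]] := pow4E r0.
rewrite (ipZl mO _ a1 b1) (ipvZl mO _ a3 b3) (ipvZl mO _ a6 b6) (ipZl mO _ a7 b7) !addrA.
reflexivity.
Qed.

Lemma pair7_wt_ge0 x : L27 x -> 0 <= pair7 (wt x) x.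
Proof.
move=> [[? ? ? ?] [? ? ?]]; rewrite /pair7 /= !(ipZl mO)// !(ipvZl mO)//.
by rewrite !addr_ge0 ?mulr_ge0 ?ip_ge0 ?ipv_ge0 ?invr_ge0 ?addr_ge0 ?exprn_ge0// ltW.
Qed.

Lemma pair7_CS2 x y : L27 x -> L27 y ->
  pair7 (wt x) y ^+ 2 <= pair7 (wt x) x * pair7 (wt y) y.
Proof.
move=> [[? ? ? ?] [? ? ?]] [[? ? ? ?] [? ? ?]].
have p4 : 0 <= r ^- 4 by rewrite invr_ge0 exprn_ge0// ltW.
have p2 : 0 <= r ^- 2 by rewrite invr_ge0 exprn_ge0// ltW.
have p24 : 0 <= r ^+ 2 + r ^+ 4 by rewrite addr_ge0 ?exprn_ge0// ltW.
have p6 : 0 <= r ^+ 6 by rewrite exprn_ge0// ltW.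
have h1 f g : L2 Omega f -> L2 Omega g -> cs_bound (ip Omega f g) (ip Omega f f) (ip Omega g g).
  by move=> ? ?; split; [exact: ip_ge0|exact: ip_ge0|exact: ip_CS2].
have h2 p q : L2v Omega p -> L2v Omega q -> cs_bound (ipv Omega p q) (ipv Omega p p) (ipv Omega q q).
  by move=> ? ?; split; [exact: ipv_ge0|exact: ipv_ge0|exact: ipv_CS2].
suff [] : cs_bound (pair7 (wt x) y) (pair7 (wt x) x) (pair7 (wt y) y) by [].
rewrite /pair7 /= !(ipZl mO)// !(ipvZl mO)//.
apply: cs_boundD; apply: cs_boundD; try apply: cs_boundD; try apply: cs_boundZ => //;
  by [exact: h1|exact: h2].
Qed.

(** The inner product of V has no terms mixing mu, tau and v, so the problem splits into three, each
    solved by [L2_riesz] on a graph. *)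
Lemma riesz_wt (a : vdata) : L27 a ->
  exists2 x, isv x & forall y, isv y -> pair7 (wt x) y = pair7 a y.
Proof.
move=> La; have [[A1 A2 A3 A4] [A5 A6 A7]] := La.
have o1 : 0 < (1 : R) by [].
have p4 : 0 < r ^- 4 by rewrite invr_gt0 exprn_gt0.
have p2 : 0 < r ^- 2 by rewrite invr_gt0 exprn_gt0.
have p24 : 0 < r ^+ 2 + r ^+ 4 by rewrite addr_gt0 ?exprn_gt0.
have p6 : 0 < r ^+ 6 by rewrite exprn_gt0.
have L0 := L20; have L0O : L2 Omega 0 by exact: L20.
pose C1 : set (sfun * vfun * sfun) := [set x | pwg x.1.1 x.1.2 /\ L2 Omega x.2].
(* Here the function slot holds the divergence and the field slot the field itself. *)
pose C2 : set (sfun * vfun * sfun) := [set x | pwd x.1.2 x.1.1 /\ L2 Omega x.2].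
pose C3 : set (sfun * vfun * sfun) := [set x | pwg x.1.1 x.1.2 /\ pwd x.1.2 x.2].
have [x1 [x1C _] x1E] : exists2 x, C1 x & forall z, C1 z ->
    ip Omega (vmu a) z.1.1 + ipv Omega (vM a) z.1.2 + ip Omega 0 z.2 = B3 Omega (r ^- 4) 1 1 x z.
  apply: (L2_riesz mO p4 o1 o1 _ _ _ _ A1 A2 L0O).
  - by move=> y [[? ? _] ?]; split.
  - by split; [exact: pwg0|].
  - by move=> k y z [h1 ?] [h2 ?]; split; [exact: pwgZD|exact: L2ZD].
  - move=> u xn [u1 u2 u3] Cn c1 c2 c3; split => //; apply: (pwg_lim u1 u2 _ c1 c2) => n.
    by case: (Cn n).
have [x2 [x2C _] x2E] : exists2 x, C2 x & forall z, C2 z ->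
    ip Omega (vD a) z.1.1 + ipv Omega (vtau a) z.1.2 + ip Omega 0 z.2 = B3 Omega 1 (r ^- 2) 1 x z.
  apply: (L2_riesz mO o1 p2 o1 _ _ _ _ A4 A3 L0O).
  - by move=> y [[? ? _] ?]; split.
  - by split; [exact: pwd0|].
  - by move=> k y z [h1 ?] [h2 ?]; split; [exact: pwdZD|exact: L2ZD].
  - move=> u xn [u1 u2 u3] Cn c1 c2 c3; split => //; apply: (pwd_lim u2 u1 _ c2 c1) => n.
    by case: (Cn n).
have [x3 [x3C x3C'] x3E] : exists2 x, C3 x & forall z, C3 z ->
    ip Omega (vv a) z.1.1 + ipv Omega (vV a) z.1.2 + ip Omega (vL a) z.2
      = B3 Omega 1 (r ^+ 2 + r ^+ 4) (r ^+ 6) x z.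
  apply: (L2_riesz mO o1 p24 p6 _ _ _ _ A5 A6 A7).
  - by move=> y [[? ? _] [? ? _]]; split.
  - by split; [exact: pwg0|exact: pwd0].
  - by move=> k y z [h1 ?] [h2 ?]; split; [exact: pwgZD|exact: pwdZD].
  - move=> u xn [u1 u2 u3] Cn c1 c2 c3; split.
      by apply: (pwg_lim u1 u2 _ c1 c2) => n; case: (Cn n).
    by apply: (pwd_lim u2 u3 _ c2 c3) => n; case: (Cn n).
exists (VData x1.1.1 x1.1.2 x2.1.2 x2.1.1 x3.1.1 x3.1.2 x3.2); first by split.
move=> y [y1 y2 y3 y4].
have := x1E (vmu y, vM y, 0) (conj y1 L0O).
have := x2E (vD y, vtau y, 0) (conj y2 L0O).
have := x3E (vv y, vV y, vL y) (conj y3 y4).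
have [? ? _] := y1; have [? ? _] := y2; have [? ? _] := y3; have [? ? _] := y4.
have [? ? _] := x1C; have [? ? _] := x2C; have [? ? _] := x3C; have [? ? _] := x3C'.
rewrite /B3 /pair7 /= !(ip0r mO)// !(ipZl mO)// !(ipvZl mO)//.
lra.
Qed.

End piecewise.

(** Turns the integrals into real variables, which leaves a purely algebraic goal. *)
Ltac gen_ip := repeat match goal with
  | |- context [ip ?w ?f ?g] => move: (ip w f g) => ?
  | |- context [ipv ?w ?f ?g] => move: (ipv w f g) => ? end.

Section trace_more.
Context {R : realType} {d : nat}.
Local Notation sfun := ('rV[R]_d -> R).
Local Notation vfun := ('rV[R]_d -> 'rV[R]_d).
Variable w : set 'rV[R]_d.
Hypothesis ow : open w.
Let mw := measurable_open ow.

Lemma trace_addh0 (f z : sfun) Z : H1 w f -> h0 w z Z -> trace w f = trace w (f + z).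
Proof.
move=> Hf hz; have Hz : H10 w z by apply/(H10P ow); exists Z.
have Hz1 : H1 w z by case: Hz.
have Hfz : H1 w (f + z) by have := H1ZD ow 1 Hf Hz1; rewrite scale1r.
apply/(trace_eqP ow Hf Hfz).
by rewrite opprD addrA subrr add0r; exact: (H10N ow).
Qed.

Lemma normal_trace_add0 (q p : vfun) (k : R) rq s : wd w q rq -> wd w p s ->
  (forall f F, wg w f F -> ipv w p F + ip w s f = 0) ->
  normal_trace w q = normal_trace w (q + k *: p).
Proof.
move=> qr ps h; have kps := wdZ ow k ps; have qk := wdD ow qr kps.
apply: (normal_trace_ext ow qr qk) => f F fF.
have Lf := wg_L2 fF; have LF := wg_L2v fF.
rewrite (ipvDl mw (wd_L2v qr) (wd_L2v kps) LF) (ipDl mw (wd_L2 qr) (wd_L2 kps) Lf).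
rewrite (ipvZl mw _ (wd_L2v ps) LF) (ipZl mw _ (wd_L2 ps) Lf).
have := h _ _ fF; gen_ip => e; have -> : forall a b c e' : R, c + e' = 0 -> a + k * c + (b + k * e') = a + b; last by exact: e.
  by move=> a b c e' ce; rewrite addrACA -mulrDr ce mulr0 addr0.
by [].
Qed.

End trace_more.

(** * The bilinear form b, liftings of skeleton data and Theta *)

Section forms.
Context {R : realType} {d : nat}.
Local Notation leb := (@lebesgue_row R d).
Local Notation sfun := ('rV[R]_d -> R).
Local Notation vfun := ('rV[R]_d -> 'rV[R]_d).
Variables (Omega : set 'rV[R]_d) (N : nat) (T : 'I_N -> set 'rV[R]_d).
Hypotheses (oO : open Omega) (oT : forall i, open (T i)) (TO : forall i, T i `<=` Omega)
  (dT : forall i j, i != j -> T i `&` T j = set0)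
  (nT : leb.-negligible (Omega `\` \bigcup_i T i)).
Let mO := measurable_open oO.
Let mT i := measurable_open (@oT i).
Variable r : R.
Hypothesis r0 : 0 < r.
Local Notation V7 := (@vdata R d).
Local Notation trial := (@trial R d N).
Implicit Types (u w : trial) (x y : V7) (k : R).
Local Notation pair7 := (pair7 Omega).
Local Notation L27 := (L27 Omega).
Local Notation isv := (isv Omega T).
Local Notation wt := (wt r).

Record lifting := Lift { lwa : sfun; lWa : vfun; lwb : sfun; lWb : vfun;
  lqa : vfun; lra : sfun; lqb : vfun; lrb : sfun }.
Implicit Types l : lifting.

Definition is_lift u l : Prop :=
  [/\ wg Omega (lwa l) (lWa l), wg Omega (lwb l) (lWb l),
      wd Omega (lqa l) (lra l) & wd Omega (lqb l) (lrb l)] /\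
  [/\ forall i, tr_ua u i = trace (T i) (lwa l), forall i, tr_ub u i = trace (T i) (lwb l),
      forall i, tr_sa u i = normal_trace (T i) (lqa l) &
      forall i, tr_sb u i = normal_trace (T i) (lqb l)].

Definition L2u u : Prop := [/\ L2 Omega (tr_u u), L2v Omega (tr_sigma u) & L2 Omega (tr_rho u)].

Lemma spaceU_lift u : spaceU Omega T u -> L2u u /\ exists l, is_lift u l.
Proof.
move=> [Lu [[wa [wa1 wa2]] [wb [wb1 wb2]] [qa [qa1 qa2]] [qb [qb1 qb2]] _]]; split => //.
exists (Lift wa (grad Omega wa) wb (grad Omega wb) qa (div Omega qa) qb (div Omega qb)).
by split; split => //=; [exact: wg_grad|exact: wg_grad|exact: wd_div|exact: wd_div].
Qed.

(* The coefficients of [b(u, .)] after integration by parts of the skeleton terms. *)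
Definition resid u l : V7 := VData (tr_rho u - lra l) (tr_sigma u - lqa l)
  (r^-1 *: tr_sigma u - lWa l) (tr_u u - lwa l) (tr_u u - r ^+ 3 *: lrb l)
  ((r ^+ 3 + r) *: tr_sigma u - r ^+ 3 *: lqb l - r ^+ 2 *: lWb l)
  (r ^+ 5 *: tr_rho u - r ^+ 2 *: lwb l).

Lemma resid_L27 u l : L2u u -> is_lift u l -> L27 (resid u l).
Proof.
move=> [L1 L2' L3] [[a1 a2 a3 a4] _].
have b1 := wg_L2 a1; have b2 := wg_L2 a2; have b3 := wd_L2 a3; have b4 := wd_L2 a4.
have c1 := wg_L2v a1; have c2 := wg_L2v a2; have c3 := wd_L2v a3; have c4 := wd_L2v a4.
split; split => /=.
- exact: L2B.
- exact: L2vB.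
- exact: (L2vB mO (L2vZ mO _ L2') c1).
- exact: L2B.
- exact: (L2B mO L1 (L2Z mO _ b4)).
- exact: (L2vB mO (L2vB mO (L2vZ mO _ L2') (L2vZ mO _ c4)) (L2vZ mO _ c2)).
- exact: (L2B mO (L2Z mO _ L3) (L2Z mO _ b2)).
Qed.

Lemma formb_data u l (x : test) : L2u u -> is_lift u l -> spaceV Omega T x ->
  formb Omega T (r ^+ 4) u x = pair7 (resid u l) (data_of T x).
Proof.
move=> Lu lu Vx; have := resid_L27 Lu lu.
move: Lu lu => [L1 L2' L3] [[a1 a2 a3 a4] [s1 s2 s3 s4]].
have [[/= d1 d2 d3 d4] [/= d5 d6 d7]] := isv_L27 (isv_data oO oT dT Vx).
move: Vx => [[m1 m2] [t1 t2] [v1 v2]].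
rewrite /formb (dual_mhalfE oO oT TO dT nT a3 s3 m1 m2).
rewrite (dual_mhalfE oO oT TO dT nT a4 s4 v1 (fun i => proj1 (v2 i))).
rewrite (dual_halfE oO oT TO dT nT a1 s1 t1 t2).
rewrite (dual_half_pgradE oO oT TO dT nT a2 s2 (fun i => proj1 (v2 i)) (fun i => proj2 (v2 i))).
have b1 := wg_L2 a1; have b2 := wg_L2 a2; have b3 := wd_L2 a3; have b4 := wd_L2 a4.
have c1 := wg_L2v a1; have c2 := wg_L2v a2; have c3 := wd_L2v a3; have c4 := wd_L2v a4.
have [[-> -> -> ->] [_ _ -> _]] := pow4E r0.
rewrite /pair7 /= => _.
rewrite (ipBl mO L3 b3 d1) (ipvBl mO L2' c3 d2) (ipvBl mO (L2vZ mO _ L2') c1 d3).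
rewrite (ipvZl mO _ L2' d3) (ipBl mO L1 b1 d4) (ipBl mO L1 (L2Z mO _ b4) d5) (ipZl mO _ b4 d5).
rewrite (ipvBl mO (L2vB mO (L2vZ mO _ L2') (L2vZ mO _ c4)) (L2vZ mO _ c2) d6).
rewrite (ipvBl mO (L2vZ mO _ L2') (L2vZ mO _ c4) d6) !(ipvZl mO _ _ d6)//.
rewrite (ipBl mO (L2Z mO _ L3) (L2Z mO _ b2) d7) !(ipZl mO _ _ d7)//.
rewrite (ipvC _ _ (lWa l)) (ipC _ _ (lwa l)) (ipvC _ _ (lWb l)) (ipC _ _ (lwb l)).
by gen_ip; ring.
Qed.

Lemma formbE u l y : L2u u -> is_lift u l -> isv y ->
  formb Omega T (r ^+ 4) u (test_of y) = pair7 (resid u l) y.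
Proof.
move=> Lu lu yv; rewrite (formb_data Lu lu (isv_space oT yv)).
by rewrite pair7_data//; exact: resid_L27.
Qed.

Lemma ipV_test x y : isv x -> isv y ->
  ipV Omega T (r ^+ 4) (test_of x) (test_of y) = pair7 (wt x) y.
Proof.
move=> xv yv; have Lx := isv_L27 xv; have Ly := isv_L27 yv.
have xv' := isv_data oO oT dT (isv_space oT xv); have Lx' := isv_L27 xv'.
have yv' := isv_data oO oT dT (isv_space oT yv); have Ly' := isv_L27 yv'.
rewrite (ipVE oO r0 Lx' Ly') (pair7_data oO oT TO dT nT yv (L27_wt oO r Lx')).
rewrite (pair7_wtC oO r Lx' Ly) pair7C (pair7_data oO oT TO dT nT xv (L27_wt oO r Ly)).
by rewrite pair7C -(pair7_wtC oO r Lx Ly).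
Qed.

Definition is_riesz u x : Prop := isv x /\
  forall y, isv y -> pair7 (wt x) y = formb Omega T (r ^+ 4) u (test_of y).

Lemma riesz_ex u : spaceU Omega T u -> exists x, is_riesz u x.
Proof.
move=> /spaceU_lift[Lu [l lu]].
have [x xv xE] := riesz_wt oO oT TO dT nT r0 (resid_L27 Lu lu).
by exists x; split => // y yv; rewrite xE// (formbE Lu lu yv).
Qed.

Lemma Theta_data u : spaceU Omega T u ->
  exists2 x, is_riesz u x & Theta Omega T (r ^+ 4) u = test_of x.
Proof.
move=> Uu; have [x [xv xE]] := riesz_ex Uu.
have ex : exists z, spaceV Omega T z /\ forall y : test, spaceV Omega T y ->
    ipV Omega T (r ^+ 4) z y = formb Omega T (r ^+ 4) u y.
  exists (test_of x); split; first exact: (isv_space oT).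
  move=> y /(isv_data oO oT dT) yv; rewrite -(data_ofK T y) ipV_test//; exact: xE.
have [V1 V2] := xgetPex (Test 0 0 0) ex; rewrite -/(Theta Omega T (r ^+ 4) u) in V1 V2.
have zv := isv_data oO oT dT V1.
exists (data_of T (Theta Omega T (r ^+ 4) u)); last by rewrite data_ofK.
split => // y yv; rewrite -ipV_test// data_ofK; apply: V2; exact: (isv_space oT).
Qed.

(** [combd (k - 1) x x] is the multiple k x. *)
Lemma isvZ k x : isv x -> isv (combd (k - 1) x x).
Proof. by move=> h; exact: isvZD. Qed.

Lemma ThetaB_data (beta : R) u : spaceU Omega T u ->
  exists2 x, is_riesz u x &
    ThetaB Omega T (r ^+ 4) beta u = test_of (combd (beta - 1) x x).
Proof.
move=> /Theta_data[x xr xE]; exists x => //; rewrite /ThetaB xE /test_of /combd /=.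
have E (E : lmodType R) (z : E) : beta *: z = (beta - 1) *: z + z.
  by rewrite scalerBl scale1r subrK.
by congr Test; exact: E.
Qed.

Lemma formb_ThetaB (beta : R) u w x : spaceU Omega T u -> spaceU Omega T w ->
  is_riesz u x ->
  exists2 z, is_riesz w z &
    formb Omega T (r ^+ 4) u (ThetaB Omega T (r ^+ 4) beta w) = beta * pair7 (wt x) z.
Proof.
move=> Uu Uw [xv xE]; have [z zr ->] := ThetaB_data beta Uw; exists z => //.
have [zv _] := zr; rewrite -xE; last exact: isvZ.
have Lz := isv_L27 zv; have Lx := isv_L27 xv.
rewrite pair7C (pair7ZD oO _ Lz Lz (L27_wt oO r Lx)) (pair7C _ z).
by rewrite mulrBl mul1r subrK.
Qed.

(** Representatives are determined only up to null sets and the choice of derivatives; their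
    pairings with other representatives are determined. *)
Lemma riesz_uniq u w x z : is_riesz u x -> is_riesz w z -> forall z', is_riesz w z' ->
  pair7 (wt x) z = pair7 (wt x) z'.
Proof.
move=> [xv xE] [zv zE] z' [zv' zE'].
have Lz := isv_L27 zv; have Lx := isv_L27 xv; have Lz' := isv_L27 zv'.
by rewrite !(pair7_wtC oO r Lx)// !(pair7C _ x) zE// zE'.
Qed.

Lemma normB_data u x : is_riesz u x ->
  normB Omega T (r ^+ 4) u = Num.sqrt (pair7 (wt x) x).
Proof.
move=> [xv xE]; have Lx := isv_L27 xv; have p0 := pair7_wt_ge0 oO r0 Lx.
set e := Num.sqrt _; have e0 : 0 <= e by exact: sqrtr_ge0.
have e2 : e ^+ 2 = pair7 (wt x) x by rewrite sqr_sqrtr.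
rewrite /normB; set S := [set `|_| | _ in _].
have ub : ubound S e.
  move=> _ [y [Vy ny] <-]; have yv := isv_data oO oT dT Vy; have Ly := isv_L27 yv.
  rewrite -(data_ofK T y) -(xE _ yv); apply: le_of_sqr => //; rewrite real_normK ?num_real// e2.
  apply: le_trans (pair7_CS2 oO r0 Lx Ly) _.
  rewrite -[leRHS]mulr1; apply: ler_wpM2l => //.
  rewrite -(ipVE oO r0 Ly Ly); move: ny; rewrite /normV => ny.
  have q0 : 0 <= ipV Omega T (r ^+ 4) y y by rewrite (ipVE oO r0 Ly Ly); exact: pair7_wt_ge0.
  by rewrite -(sqr_sqrtr q0) expr_le1// sqrtr_ge0.
(* The supremum is attained at k x, with k the inverse of the norm of x, or 1 if that norm is 0. *)
pose k := if e == 0 then 1 else e^-1.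
have [k0 ke kee] : [/\ 0 <= k, k * e <= 1 & k * e ^+ 2 = e].
  rewrite /k; have [->|ne] := eqVneq e 0; first by rewrite mulr0 expr0n mulr0; split.
  by rewrite invr_ge0 mulVf// expr2 mulKf.
pose y := combd (k - 1) x x.
have yv : isv y := isvZD oO oT (k - 1) xv xv; have Ly := isv_L27 yv.
have Lwx := L27_wt oO r Lx; have Lwy := L27_wt oO r Ly.
have E1 : pair7 (wt x) y = k * e ^+ 2.
  by rewrite pair7C (pair7ZD oO _ Lx Lx Lwx) (pair7C _ x) e2 mulrBl mul1r subrK.
have E2 : pair7 (wt y) y = k * (k * e ^+ 2).
  rewrite (pair7_wtC oO r Ly Ly) (pair7ZD oO _ Lx Lx Lwy) -(pair7_wtC oO r Lx Ly) E1.
  by rewrite mulrBl mul1r subrK.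
have Se : S e.
  exists (test_of y); last by rewrite -(xE _ yv) E1 kee ger0_norm.
  split; first exact: (isv_space oT).
  rewrite /normV ipV_test// E2 (_ : k * (k * e ^+ 2) = (k * e) ^+ 2); last by ring.
  by rewrite sqrtr_sqr ger0_norm// mulr_ge0.
apply/le_anti/andP; split; first by apply: ge_sup => //; exists e.
by apply: ub_le_sup => //; exists e.
Qed.

(* Testing with elements of V supported in a single T i shows that the defects
   [wt x - resid u l] are themselves liftings of zero skeleton data, so they can be absorbed
   into [l]. *)
Lemma strong_lift u x : spaceU Omega T u -> is_riesz u x ->
  exists2 l, is_lift u l & resid u l = wt x.
Proof.
move=> Uu [xv xE]; have [Lu [l lu]] := spaceU_lift Uu.
have Lx := isv_L27 xv; have Lr := resid_L27 Lu lu; have Lwx := L27_wt oO r Lx.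
pose a := combd (-1) (wt x) (resid u l).
have La : L27 a.
  move: Lr Lwx => [[? ? ? ?] [? ? ?]] [[? ? ? ?] [? ? ?]].
  by split; split; by [exact: L2ZD|exact: L2vZD].
have a0 y : isv y -> pair7 a y = 0.
  move=> yv; have Ly := isv_L27 yv.
  by rewrite (pair7ZD oO _ Lwx Lr Ly) (xE _ yv) (formbE Lu lu yv) mulN1r addNr.
have [[A1 A2 A3 A4] [A5 A6 A7]] := La.
(* Elements of the broken spaces on T i, extended by 0, are elements of V, so the orthogonality [a0]
   localizes to T i. *)
have Hmu i g G : wg (T i) g G -> ipv (T i) (vM a) G + ip (T i) (vmu a) g = 0.
  move=> gG; have gG' := pwg_ext oO oT dT gG.
  have := a0 (VData (ext T i g) (extv T i G) 0 0 0 0 0).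
  rewrite /pair7 /= (ip_exti TO) (ipv_exti oO oT TO A2 (wg_L2v gG)).
  rewrite !(ip0r mO) ?(ipv0r mO)// => h; rewrite addrC; move: h; rewrite !addr0; apply.
  by split => //=; [exact: (pwd0 Omega oT)|exact: (pwg0 Omega oT)|exact: (pwd0 Omega oT)].
have Hta i q s : wd (T i) q s -> ipv (T i) (vtau a) q + ip (T i) (vD a) s = 0.
  move=> gG; have gG' := pwd_ext oO oT dT gG.
  have := a0 (VData 0 0 (extv T i q) (ext T i s) 0 0 0).
  rewrite /pair7 /= (ip_exti TO) (ipv_exti oO oT TO A3 (wd_L2v gG)).
  rewrite !(ip0r mO) ?(ipv0r mO)// => h; move: h; rewrite !addr0 add0r; apply.
  by split => //=; [exact: (pwg0 Omega oT)|exact: (pwg0 Omega oT)|exact: (pwd0 Omega oT)].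
have Hv i g G s : wg (T i) g G -> wd (T i) G s ->
    ip (T i) (vv a) g + ipv (T i) (vV a) G + ip (T i) (vL a) s = 0.
  move=> gG Gs; have gG' := pwg_ext oO oT dT gG; have Gs' := pwd_ext oO oT dT Gs.
  have := a0 (VData 0 0 0 0 (ext T i g) (extv T i G) (ext T i s)).
  rewrite /pair7 /= !(ip_exti TO) (ipv_exti oO oT TO A6 (wg_L2v gG)).
  rewrite !(ip0r mO) ?(ipv0r mO)// => h; move: h; rewrite !addr0 add0r; apply.
  by split => //=; [exact: (pwg0 Omega oT)|exact: (pwd0 Omega oT)].
have Li i := L2_sub mO (mT i) (@TO i); have Lvi i := L2v_sub mO (mT i) (@TO i).
(* The components v, grad v and Lap v are coupled, so [vL a] solves only a very weak problem on T i;
   it is nevertheless in H^1_0 of T i, and its gradient Z carries part of the defect [vV a]. *)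
have Zex i : exists Z : vfun, h0 (T i) (vL a) Z /\ forall g G, wg (T i) g G ->
    ip (T i) (vv a) g + ipv (T i) (vV a - Z) G = 0.
  have [Z hZ1 hZ2] := H10_of_very_weak (@oT i) (Li i _ A5) (Lvi i _ A6) (Li i _ A7) (@Hv i).
  by exists Z.
have [Zi HZi] := choice Zex.
have Lzi i : L2v (T i) (Zi i) by have [/(h0_wg (@oT i)) h _] := HZi i; have [[_ []]] := (HZi i).1.
pose Z : vfun := fun z => \sum_i (\1_(T i) z : R) *: Zi i z.
have LZ : L2v Omega Z := L2v_mesh oO oT Lzi.
have ZE i z : T i z -> Z z = Zi i z by move=> Tz; exact: (sum_mesh dT Zi Tz).
have hZ i : h0 (T i) (vL a) Z.
  have [h _] := HZi i; apply: (h0_wg (@oT i) h); have [hw _] := h.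
  by apply: (wg_eq (@oT i) _ _ hw) => // z Tz; rewrite (ZE _ _ Tz).
have hY i g G : wg (T i) g G -> ipv (T i) (vV a - Z) G + ip (T i) (vv a) g = 0.
  move=> gG; have [_ h] := HZi i; rewrite -(h _ _ gG) addrC; congr (_ + _).
  by apply: eq_ipv => // z Tz; rewrite !fctE (ZE _ _ Tz).
have LVZ := L2vB mO A6 LZ.
have wdM := wd_glue oO oT TO dT nT A2 A1 Hmu.
have wdY := wd_glue oO oT TO dT nT LVZ A5 hY.
have hT i : h0 (T i) (vD a) (vtau a) := h0_of_wd (@oT i) (Li i _ A4) (Lvi i _ A3) (@Hta i).
have hT' := h0_glue oO oT TO dT nT A4 A3 hT.
have hZ' := h0_glue oO oT TO dT nT A7 LZ hZ.
have [[l1 l2 l3 l4] [s1 s2 s3 s4]] := lu.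
have rn : r != 0 by rewrite gt_eqF.
(* These corrections subtract a from [resid u l]. The powers of r undo the weights of the lifts, and
   [vV a] is split into Z, taken up by the lift of [tr_ub], and the rest, taken up by that of
   [tr_sb]. *)
exists (Lift (lwa l + vD a) (lWa l + vtau a) (lwb l + r ^- 2 *: vL a) (lWb l + r ^- 2 *: Z)
  (lqa l + 1 *: vM a) (lra l + 1 *: vmu a) (lqb l + r ^- 3 *: (vV a - Z)) (lrb l + r ^- 3 *: vv a)).
  split; split => /=.
  - exact: (wgD oO l1 hT'.1).
  - exact: (wgD oO l2 (wgZ oO _ hZ'.1)).
  - exact: (wdD oO l3 (wdZ oO _ wdM)).
  - exact: (wdD oO l4 (wdZ oO _ wdY)).
  - move=> i; rewrite s1; apply: (trace_addh0 (@oT i) _ (hT i)).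
    exact: wg_H1 (wg_sub oO (@oT i) (@TO i) l1).
  - move=> i; rewrite s2; apply: (trace_addh0 (@oT i) _ (h0Z (@oT i) _ (hZ i))).
    exact: wg_H1 (wg_sub oO (@oT i) (@TO i) l2).
  - move=> i; rewrite s3; apply: (normal_trace_add0 (@oT i) _ _ _ (@Hmu i)).
      exact: (wd_sub oO (@oT i) (@TO i) l3).
    exact: (wd_sub oO (@oT i) (@TO i) wdM).
  - move=> i; rewrite s4; apply: (normal_trace_add0 (@oT i) _ _ _ (@hY i)).
      exact: (wd_sub oO (@oT i) (@TO i) l4).
    exact: (wd_sub oO (@oT i) (@TO i) wdY).
rewrite /resid /wt /=.
congr VData; apply/funext => z; rewrite !fctE.
- by rewrite /GRing.scale /=; ring.
- by apply/rowP => j; rewrite !mxE; ring.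
- by apply/rowP => j; rewrite !mxE; ring.
- by rewrite /GRing.scale /=; ring.
- by rewrite /GRing.scale /=; field.
- by apply/rowP => j; rewrite !mxE; field.
- by rewrite /GRing.scale /=; field.
Qed.

End forms.

(** * Coercivity and norm bounds *)

Section real_bounds.
Context {R : realType}.
Implicit Types (a b c k m t v x y z r E : R).

Lemma sqr_le_norm x y : `|x| <= y -> x ^+ 2 <= y ^+ 2.
Proof. by move=> h; rewrite -real_normK ?num_real// lerXn2r ?nnegrE// (le_trans _ h). Qed.

Lemma young_le x a b c : 0 < c -> 0 <= a -> 0 <= b -> x ^+ 2 <= a * b -> 2 * x <= c^-1 * a + c * b.
Proof.
move=> c0 a0 b0 h; apply: le_of_sqr; first by rewrite addr_ge0// mulr_ge0// ?invr_ge0 ltW.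
have cn : c != 0 by rewrite gt_eqF.
have -> : (c^-1 * a + c * b) ^+ 2 = (c^-1 * a - c * b) ^+ 2 + 4 * (a * b) by field.
by have := sqr_ge0 (c^-1 * a - c * b); nra.
Qed.

(** Turns a bound valid for every lift into a bound by the infimum norm: when y exceeds c, the
    square root of (y - c) / k is a lower bound of S. *)
Lemma inf_sqr_ge (S : set R) y c k : S !=set0 -> 0 <= k -> (forall x, S x -> 0 <= x) ->
  (forall x, S x -> y <= c + k * x ^+ 2) -> y <= c + k * inf S ^+ 2.
Proof.
move=> S0; rewrite le_eqVlt => /predU1P[<- Sp h|k0 Sp h].
  by have [x Sx] := S0; rewrite mul0r; have := h x Sx; rewrite mul0r.
 have [yc|cy] := leP y c.
  by apply: (le_trans yc); rewrite lerDl mulr_ge0 ?sqr_ge0// ltW.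
set z := Num.sqrt ((y - c) / k).
have z2 : z ^+ 2 = (y - c) / k by rewrite sqr_sqrtr// divr_ge0 ?subr_ge0// ltW.
have zi : z <= inf S.
  apply: lb_le_inf => // x Sx; apply: le_of_sqr; first exact: Sp.
  by rewrite z2 ler_pdivrMr// lerBlDl mulrC; exact: h.
rewrite -lerBlDl mulrC -ler_pdivrMr// -z2 lerXn2r// nnegrE ?sqrtr_ge0//.
by apply: le_trans zi; exact: sqrtr_ge0.
Qed.

Lemma inf_sqr_le (S : set R) x : S x -> (forall x, S x -> 0 <= x) -> inf S ^+ 2 <= x ^+ 2.
Proof.
move=> Sx Sp; apply: lerXn2r; rewrite ?nnegrE; last 2 first.
- exact: Sp.
- by apply: ge_inf => //; exists 0 => y; exact: Sp.
by apply: lb_le_inf; [exists x|move=> y; exact: Sp].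
Qed.

Lemma le1Ml k x : 0 <= k <= 1 -> 0 <= x -> k * x <= x.
Proof. by move=> /andP[k0 k1] x0; rewrite ler_piMl. Qed.

Lemma cs_bound_mul x y : cs_bound (x * y) (x ^+ 2) (y ^+ 2).
Proof. by split; rewrite ?sqr_ge0// exprMn. Qed.

(** The square of a sum of at most four terms costs a factor 4; with 4 E for X^2 and E for the terms
    other than X, a and b this gives 16 E + 4 E. *)
Lemma sum7_bound (X a t m1 b v2 m E : R) : X ^+ 2 <= 4 * E ->
  t ^+ 2 + m1 ^+ 2 + v2 ^+ 2 + m ^+ 2 <= E ->
  (X + a + t + m1) ^+ 2 + (b + v2 + m) ^+ 2 <= 20 * (E + (a ^+ 2 + b ^+ 2)).
Proof.
move=> j1 j2.
have := sqr_ge0 (X - a); have := sqr_ge0 (X - t); have := sqr_ge0 (X - m1).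
have := sqr_ge0 (a - t); have := sqr_ge0 (a - m1); have := sqr_ge0 (t - m1).
have := sqr_ge0 (b - v2); have := sqr_ge0 (b - m); have := sqr_ge0 (v2 - m).
have := sqr_ge0 a; have := sqr_ge0 b; have := sqr_ge0 v2; have := sqr_ge0 m; lra.
Qed.

(** The constant 4 bounds the sums of Cauchy-Schwarz weights 1 + (1 + r^2) + r^4 and 1 + 1 + r^2 +
    r^2 for r <= 1. *)
Lemma jump_bound r (t v1 m1 X1 t1 v0 v2 m X0 : R) : 0 <= r <= 1 ->
  X1 ^+ 2 + X0 ^+ 2 <= X1 * (t + (1 + r ^+ 2) * v1 + r ^+ 2 * m1)
    + X0 * (t1 + v0 + r * v2 + r * m) ->
  X1 ^+ 2 + X0 ^+ 2 <= 4 * (m ^+ 2 + m1 ^+ 2 + t ^+ 2 + t1 ^+ 2 + v0 ^+ 2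
    + (1 + r ^+ 2) * v1 ^+ 2 + v2 ^+ 2).
Proof.
move=> /andP[r0 r1]; set p := t + _ + _; set q := t1 + _ + _ + _ => h.
have s0 : 0 <= r ^+ 2 by exact: sqr_ge0.
have s1 : r ^+ 2 <= 1 by rewrite expr_le1.
have s2 : r ^+ 2 * r ^+ 2 <= 1 by rewrite mulr_ile1.
have hpq : X1 ^+ 2 + X0 ^+ 2 <= p ^+ 2 + q ^+ 2.
  have := sqr_ge0 (X1 - p); have := sqr_ge0 (X0 - q); nra.
have hp : p ^+ 2 <= (1 + (1 + r ^+ 2) + r ^+ 2 * r ^+ 2) * (t ^+ 2 + (1 + r ^+ 2) * v1 ^+ 2 + m1 ^+ 2).
  have q1 : 0 <= 1 + r ^+ 2 by lra.
  suff [] : cs_bound p (1 + (1 + r ^+ 2) + r ^+ 2 * r ^+ 2)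
    (t ^+ 2 + (1 + r ^+ 2) * v1 ^+ 2 + m1 ^+ 2) by [].
  apply: cs_boundD; last first.
    by split; [rewrite mulr_ge0 ?sqr_ge0|exact: sqr_ge0|rewrite exprMn [(r ^+ 2) ^+ 2]expr2].
  apply: cs_boundD; first by split; rewrite ?sqr_ge0 ?mul1r.
  by split => //; [rewrite mulr_ge0 ?sqr_ge0|rewrite exprMn [(1 + r ^+ 2) ^+ 2]expr2 mulrA].
have hq : q ^+ 2 <= (1 + 1 + r ^+ 2 + r ^+ 2) * (t1 ^+ 2 + v0 ^+ 2 + v2 ^+ 2 + m ^+ 2).
  suff [] : cs_bound q (1 + 1 + r ^+ 2 + r ^+ 2) (t1 ^+ 2 + v0 ^+ 2 + v2 ^+ 2 + m ^+ 2) by [].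
  apply: cs_boundD; last by split; rewrite ?sqr_ge0// exprMn.
  apply: cs_boundD; last by split; rewrite ?sqr_ge0// exprMn.
  by apply: cs_boundD; split; rewrite ?sqr_ge0 ?mul1r.
have hp' : p ^+ 2 <= 4 * (t ^+ 2 + (1 + r ^+ 2) * v1 ^+ 2 + m1 ^+ 2).
  apply: (le_trans hp); apply: ler_wpM2r; last by lra.
  have v10 : 0 <= (1 + r ^+ 2) * v1 ^+ 2 by apply: mulr_ge0; [lra|exact: sqr_ge0].
  by have := sqr_ge0 t; have := sqr_ge0 m1; lra.
have hq' : q ^+ 2 <= 4 * (t1 ^+ 2 + v0 ^+ 2 + v2 ^+ 2 + m ^+ 2).
  apply: (le_trans hq); apply: ler_wpM2r; last by lra.
  by have := sqr_ge0 t1; have := sqr_ge0 v0; have := sqr_ge0 v2; have := sqr_ge0 m; lra.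
lra.
Qed.

(* 117 / 10 < 12 = 4 * 3 is the discriminant condition that makes beta >= 3 enough for
   coercivity. *)
Lemma cross_bound (X1 t m1 v2 m E : R) : X1 ^+ 2 <= 4 * E ->
  t ^+ 2 + m1 ^+ 2 + v2 ^+ 2 + m ^+ 2 <= E ->
  (X1 + t + m1) ^+ 2 + (v2 + m) ^+ 2 <= (117 / 10) * E.
Proof.
move=> h1 h2.
(* 1414 / 1000 approximates sqrt 2, the ratio of X1 to t + m1 in the extremal case, where the left
   side is (2 + sqrt 2)^2 E, just below 11.7 E. *)
have := sqr_ge0 (X1 - (1414 / 1000) * (t + m1)); have := sqr_ge0 (t - m1); have := sqr_ge0 (v2 - m).
have := sqr_ge0 v2; have := sqr_ge0 m; nra.
Qed.

(** The cross term is absorbed by 2.99 E2 + 0.99 M2, as 4 * 2.99 * 0.99 = 11.84 still exceeds 11.7.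
    What remains of 3 E2 + M2 is the margin 1/100. *)
Lemma coercive_real (E2 M2 Q : R) : 0 <= E2 -> 0 <= M2 ->
  (Q - M2) ^+ 2 <= (117 / 10) * (E2 * M2) -> (E2 + M2) / 100 <= 3 * E2 + Q.
Proof.
move=> e0 m0 h.
have : - (Q - M2) <= (299 / 100) * E2 + (99 / 100) * M2.
  apply: le_of_sqr; first by lra.
  rewrite sqrrN; apply: (le_trans h).
  have := sqr_ge0 ((299 / 100) * E2 - (99 / 100) * M2); have := mulr_ge0 e0 m0; nra.
lra.
Qed.

End real_bounds.

Section normed.
Context {R : realType} {d : nat}.
Local Notation sfun := ('rV[R]_d -> R).
Local Notation vfun := ('rV[R]_d -> 'rV[R]_d).
Variable w : set 'rV[R]_d.
Hypothesis mw : measurable w.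

Definition nrmv (q : vfun) : R := Num.sqrt (ipv w q q).

Lemma nrmv_ge0 q : 0 <= nrmv q. Proof. exact: sqrtr_ge0. Qed.
Lemma nrmv2 q : nrmv q ^+ 2 = ipv w q q.
Proof. by rewrite sqr_sqrtr// ipv_ge0. Qed.

Lemma ip_scale_le k f g : 0 <= k -> L2 w f -> L2 w g -> `|k * ip w f g| <= k * (nrm w f * nrm w g).
Proof.
move=> k0 Lf Lg; rewrite normrM (ger0_norm k0); apply: ler_wpM2l => //.
apply: le_of_sqr; first by rewrite mulr_ge0// nrm_ge0.
by rewrite real_normK ?num_real// exprMn !nrm2; exact: ip_CS2.
Qed.

Lemma ipv_scale_le k p q : 0 <= k -> L2v w p -> L2v w q ->
  `|k * ipv w p q| <= k * (nrmv p * nrmv q).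
Proof.
move=> k0 Lf Lg; rewrite normrM (ger0_norm k0); apply: ler_wpM2l => //.
apply: le_of_sqr; first by rewrite mulr_ge0// nrmv_ge0.
by rewrite real_normK ?num_real// exprMn !nrmv2; exact: ipv_CS2.
Qed.

End normed.

(** * Estimates for liftings whose residual is the weighted image of Theta u *)

Section core.
Context {R : realType} {d : nat}.
Local Notation leb := (@lebesgue_row R d).
Local Notation sfun := ('rV[R]_d -> R).
Local Notation vfun := ('rV[R]_d -> 'rV[R]_d).
Variables (Omega : set 'rV[R]_d).
Hypotheses (oO : open Omega).
Let mO := measurable_open oO.
Variable r : R.
Hypotheses (r0 : 0 < r) (r1 : r <= 1).
Variables (N : nat) (T : 'I_N -> set 'rV[R]_d) (u : @trial R d N) (l : @lifting R d) (x : @vdata R d).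
Hypotheses (Lu : L2u Omega u) (lu : is_lift Omega T u l) (Lx : L27 Omega x)
  (rx : resid r u l = wt r x).
Local Notation e := (lwa l - lwb l).
Local Notation E1 := (lWa l - lWb l).
Hypothesis he : h0 Omega e E1.
Local Notation "<< f , g >>" := (ip Omega f g) (format "<< f ,  g >>").
Local Notation "<<| f , g |>>" := (ipv Omega f g) (format "<<| f ,  g |>>").
Local Notation E2 := (pair7 Omega (wt r x) x).
Local Notation M2 := (r ^+ 2 * <<| lWb l, lWb l |>> + r ^- 2 * << lwb l, lwb l >>).

Let rn : r != 0. Proof. by rewrite gt_eqF. Qed.

Lemma rel_L2 : [/\ L2 Omega (lwa l), L2v Omega (lWa l), L2 Omega (lwb l) & L2v Omega (lWb l)] /\
  [/\ L2v Omega (lqa l), L2 Omega (lra l), L2v Omega (lqb l) & L2 Omega (lrb l)].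
Proof.
by move: lu => [[a1 a2 a3 a4] _]; split; split;
  [exact: wg_L2 a1|exact: wg_L2v a1|exact: wg_L2 a2|exact: wg_L2v a2|
   exact: wd_L2v a3|exact: wd_L2 a3|exact: wd_L2v a4|exact: wd_L2 a4].
Qed.

(* The seven relations [resid = wt], solved for the trial components and the two
   Hdiv lifts. *)
Lemma rel_fun :
  [/\ tr_u u = lwa l + vD x, tr_sigma u = r *: lWa l + r^-1 *: vtau x &
      tr_rho u = r ^- 3 *: lwb l + r *: vL x] /\
  [/\ lqa l = tr_sigma u - vM x, lra l = tr_rho u - r ^- 4 *: vmu x,
      lqb l = r ^- 3 *: ((r ^+ 3 + r) *: tr_sigma u
        + (- (r ^+ 2 + r ^+ 4) *: vV x + (- r ^+ 2) *: lWb l)) &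
      lrb l = r ^- 3 *: (tr_u u - vv x)].
Proof.
have := rx; rewrite /resid /wt => -[h1 h2 h3 h4 h5 h6 h7].
have H1 z := congr1 (fun f => f z) h1; have H2 z j := congr1 (fun f : vfun => f z 0 j) h2.
have H3 z j := congr1 (fun f : vfun => f z 0 j) h3; have H4 z := congr1 (fun f => f z) h4.
have H5 z := congr1 (fun f => f z) h5; have H6 z j := congr1 (fun f : vfun => f z 0 j) h6.
have H7 z := congr1 (fun f => f z) h7.
split; split; apply/funext => z; rewrite !fctE.
- by move: (H4 z); rewrite !fctE => <-; rewrite addrC subrK.
- apply/rowP => j; move: (H3 z j); rewrite !fctE !mxE => h.
  have -> : r^-1 * vtau x z 0 j = r * (r ^- 2 * vtau x z 0 j) by field.
  by rewrite -h; field.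
- move: (H7 z); rewrite !fctE /GRing.scale /= => h.
  have -> : r * vL x z = r ^- 5 * (r ^+ 6 * vL x z) by field.
  by rewrite -h; field.
- by apply/rowP => j; move: (H2 z j); rewrite !fctE !mxE => <-; ring.
- by move: (H1 z); rewrite !fctE => <-; ring.
- apply/rowP => j; move: (H6 z j); rewrite !fctE !mxE => h.
  by rewrite mulNr -h; field.
- move: (H5 z); rewrite !fctE /GRing.scale /= => <-; by field.
Qed.

(** Each term is the square of a norm with the scaling under which it enters the Cauchy-Schwarz
    estimates that follow. *)
Lemma E2E : E2 = (r ^- 2 * nrm Omega (vmu x)) ^+ 2 + nrmv Omega (vM x) ^+ 2
  + (r^-1 * nrmv Omega (vtau x)) ^+ 2 + nrm Omega (vD x) ^+ 2 + nrm Omega (vv x) ^+ 2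
  + (1 + r ^+ 2) * (r * nrmv Omega (vV x)) ^+ 2 + (r ^+ 3 * nrm Omega (vL x)) ^+ 2.
Proof.
move: Lx => [[a1 a2 a3 a4] [a5 a6 a7]]; rewrite /pair7 /=.
rewrite (ipZl mO _ a1 a1) (ipvZl mO _ a3 a3) (ipvZl mO _ a6 a6) (ipZl mO _ a7 a7).
by rewrite !exprMn !nrm2 !nrmv2; gen_ip; field.
Qed.

Lemma M2_ge0 : 0 <= M2.
Proof. by rewrite addr_ge0// mulr_ge0 ?ip_ge0 ?ipv_ge0 ?sqr_ge0// invr_ge0 sqr_ge0. Qed.

(* The jump of the two H^1 lifts lies in H^1_0, so it is orthogonal, by Green's formula, to
   both Hdiv lifts. *)
Lemma jump_eq : r ^+ 2 * <<| E1, E1 |>> + << e, e >> =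
  - <<| vtau x, E1 |>> + (r ^+ 2 + r ^+ 4) * <<| vV x, E1 |>> - r ^+ 3 * <<| vM x, E1 |>>
  - << vD x, e >> + << vv x, e >> + r ^+ 4 * << vL x, e >> - r^-1 * << vmu x, e >>.
Proof.
have [[k1 k2 k3] [k4 k5 k6 k7]] := rel_fun.
have [[b1 b2 b3 b4] _] := rel_L2; have [[a1 a2 a3 a4] [a5 a6 a7]] := Lx.
have [[_ _ l3 l4] _] := lu; have [c1 c2 c3] := Lu.
have Le : L2 Omega e := L2B mO b1 b3; have LE : L2v Omega E1 := L2vB mO b2 b4.
have := green0 oO l4 he; have := green0 oO l3 he.
rewrite k6 k7 k4 k5.
rewrite (ipvBl mO c2 a2 LE) (ipBl mO c3 (L2Z mO _ a1) Le) (ipZl mO _ a1 Le).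
have Lz1 := L2vZ mO (- (r ^+ 2 + r ^+ 4)) a6; have Lz2 := L2vZ mO (- r ^+ 2) b4.
rewrite (ipvZl mO _ (L2vZD mO _ c2 (L2vD mO Lz1 Lz2)) LE) (ipvZD mO _ c2 (L2vD mO Lz1 Lz2) LE).
rewrite (ipvDl mO Lz1 Lz2 LE) (ipvZl mO _ a6 LE) (ipvZl mO _ b4 LE).
rewrite (ipZl mO _ (L2B mO c1 a5) Le) (ipBl mO c1 a5 Le).
rewrite k1 k2 k3 (ipDl mO b1 a4 Le) (ipvZD mO _ b2 (L2vZ mO _ a3) LE) (ipvZl mO _ a3 LE).
rewrite (ipZD mO _ b3 (L2Z mO _ a7) Le) (ipZl mO _ a7 Le).
rewrite [in X in _ -> _ -> X = _](ipvBl mO b2 b4 LE) [in X in _ -> _ -> X = _](ipBl mO b1 b3 Le).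
gen_ip => G1 G2.
(* In this combination of the two Green identities the r^3 sigma terms cancel. What is left of
   sigma, u and rho contributes the gradients and values of both H^1 lifts, that is, the squared
   norms of their jump. *)
have := congr2 (fun a b => r ^+ 3 * (b - a)) G1 G2; rewrite subrr mulr0 => G.
apply/eqP; rewrite -subr_eq0 -[X in _ == X]G; apply/eqP.
by field.
Qed.

Lemma jump_le : r ^+ 2 * <<| E1, E1 |>> + << e, e >> <= 4 * E2.
Proof.
have [[b1 b2 b3 b4] _] := rel_L2; have [[a1 a2 a3 a4] [a5 a6 a7]] := Lx.
have Le : L2 Omega e := L2B mO b1 b3; have LE : L2v Omega E1 := L2vB mO b2 b4.
have r0' := ltW r0.
rewrite E2E.
have h1 : `|1 * <<| vtau x, E1 |>>| <= (r^-1 * nrmv Omega (vtau x)) * (r * nrmv Omega E1).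
  by apply: le_trans_eq (ipv_scale_le mO ler01 a3 LE) _; field.
have h2 : `|(r ^+ 2 + r ^+ 4) * <<| vV x, E1 |>>|
    <= (1 + r ^+ 2) * (r * nrmv Omega (vV x)) * (r * nrmv Omega E1).
  have k0 : 0 <= r ^+ 2 + r ^+ 4 by rewrite addr_ge0// exprn_ge0.
  by apply: le_trans_eq (ipv_scale_le mO k0 a6 LE) _; ring.
have h3 : `|r ^+ 3 * <<| vM x, E1 |>>| <= r ^+ 2 * nrmv Omega (vM x) * (r * nrmv Omega E1).
  have k0 : 0 <= r ^+ 3 by rewrite exprn_ge0.
  by apply: le_trans_eq (ipv_scale_le mO k0 a2 LE) _; ring.
have h4 := ip_scale_le mO ler01 a4 Le; have h5 := ip_scale_le mO ler01 a5 Le.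
have h6 : `|r ^+ 4 * << vL x, e >>| <= r * (r ^+ 3 * nrm Omega (vL x)) * nrm Omega e.
  have k0 : 0 <= r ^+ 4 by rewrite exprn_ge0.
  by apply: le_trans_eq (ip_scale_le mO k0 a7 Le) _; ring.
have h7 : `|r^-1 * << vmu x, e >>| <= r * (r ^- 2 * nrm Omega (vmu x)) * nrm Omega e.
  have k0 : 0 <= r^-1 by rewrite invr_ge0.
  by apply: le_trans_eq (ip_scale_le mO k0 a1 Le) _; field.
have := jump_eq.
move: h1 h2 h3 h4 h5 h6 h7; rewrite !ler_norml !mul1r.
move=> /andP[? ?] /andP[? ?] /andP[? ?] /andP[? ?] /andP[? ?] /andP[? ?] /andP[? ?] Eq.
rewrite -nrmv2 -nrm2 -exprMn; apply: jump_bound; first by rewrite r0' r1.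
rewrite exprMn nrmv2 nrm2 Eq; lra.
Qed.

(** The gradient of the lift wa is split into the jump and the gradient of wb. For phi = wb the two
    terms in wb then add up to M2, and all the others are pairings with the jump or with components
    of Theta u. *)
Lemma normal_form phi Phi : wg Omega phi Phi ->
  r * (<<| lqa l, Phi |>> + << lra l, phi >>) =
  r ^+ 2 * <<| E1, Phi |>> + r ^+ 2 * <<| lWb l, Phi |>> + <<| vtau x, Phi |>>
  - r * <<| vM x, Phi |>>
  + (r ^- 2 * << lwb l, phi >> + r ^+ 2 * << vL x, phi >> - r ^- 3 * << vmu x, phi >>).
Proof.
move=> pP; have Lp := wg_L2 pP; have LP := wg_L2v pP.
have [[k1 k2 k3] [k4 k5 k6 k7]] := rel_fun.
have [[b1 b2 b3 b4] _] := rel_L2; have [[a1 a2 a3 a4] [a5 a6 a7]] := Lx.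
have [c1 c2 c3] := Lu.
rewrite k4 k5 (ipvBl mO c2 a2 LP) (ipBl mO c3 (L2Z mO _ a1) Lp) (ipZl mO _ a1 Lp).
rewrite k2 k3 (ipvZD mO _ b2 (L2vZ mO _ a3) LP) (ipvZl mO _ a3 LP).
rewrite (ipZD mO _ b3 (L2Z mO _ a7) Lp) (ipZl mO _ a7 Lp) (ipvBl mO b2 b4 LP).
by gen_ip; field.
Qed.

Lemma normal_cross :
  (r * (<<| lqa l, lWb l |>> + << lra l, lwb l >>) - M2) ^+ 2 <= (117 / 10) * (E2 * M2).
Proof.
have [[_ wb _ _] _] := lu; rewrite (normal_form wb).
have [[b1 b2 b3 b4] _] := rel_L2; have [[a1 a2 a3 a4] [a5 a6 a7]] := Lx.
have LE : L2v Omega E1 := L2vB mO b2 b4.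
have r0' := ltW r0; have k2 : 0 <= r ^+ 2 by exact: sqr_ge0.
have k3 : 0 <= r ^- 3 by rewrite invr_ge0 exprn_ge0.
set X1 := r * nrmv Omega E1; set t := r^-1 * nrmv Omega (vtau x); set m1 := nrmv Omega (vM x).
set v2 := r ^+ 3 * nrm Omega (vL x); set m := r ^- 2 * nrm Omega (vmu x).
pose a := r * nrmv Omega (lWb l); pose b := r^-1 * nrm Omega (lwb l).
have eM : M2 = a ^+ 2 + b ^+ 2 by rewrite !exprMn nrmv2 nrm2 exprVn.
have h1 : `|r ^+ 2 * <<| E1, lWb l |>>| <= X1 * a.
  by apply: le_trans_eq (ipv_scale_le mO k2 LE b4) _; rewrite /X1 /a; ring.
have h2 : `|1 * <<| vtau x, lWb l |>>| <= t * a.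
  by apply: le_trans_eq (ipv_scale_le mO ler01 a3 b4) _; rewrite /t /a; field.
have h3 : `|r * <<| vM x, lWb l |>>| <= m1 * a.
  by apply: le_trans_eq (ipv_scale_le mO r0' a2 b4) _; rewrite /m1 /a; ring.
have h4 : `|r ^+ 2 * << vL x, lwb l >>| <= v2 * b.
  by apply: le_trans_eq (ip_scale_le mO k2 a7 b3) _; rewrite /v2 /b; field.
have h5 : `|r ^- 3 * << vmu x, lwb l >>| <= m * b.
  by apply: le_trans_eq (ip_scale_le mO k3 a1 b3) _; rewrite /m /b; field.
apply: (@le_trans _ _ (((X1 + t + m1) * a + (v2 + m) * b) ^+ 2)).
  apply: sqr_le_norm; move: h1 h2 h3 h4 h5; rewrite !ler_norml mul1r.
  by move=> /andP[? ?] /andP[? ?] /andP[? ?] /andP[? ?] /andP[? ?]; apply/andP; split; lra.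
have hc : (X1 + t + m1) ^+ 2 + (v2 + m) ^+ 2 <= (117 / 10) * E2.
  apply: cross_bound.
    by have := jump_le; rewrite -nrmv2 -exprMn; have := ip_ge0 Omega e; rewrite -/X1; lra.
  rewrite E2E -/t -/m1 -/v2 -/m; have := sqr_ge0 (nrm Omega (vD x)).
  have : 0 <= (1 + r ^+ 2) * (r * nrmv Omega (vV x)) ^+ 2 by rewrite mulr_ge0 ?sqr_ge0//; lra.
  by have := sqr_ge0 (nrm Omega (vv x)); lra.
rewrite [leRHS]mulrA eM; apply: (@le_trans _ _ (((X1 + t + m1) ^+ 2 + (v2 + m) ^+ 2) * (a ^+ 2 + b ^+ 2))).
  by have [] := cs_boundD (cs_bound_mul (X1 + t + m1) a) (cs_bound_mul (v2 + m) b).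
by apply: ler_wpM2r => //; rewrite addr_ge0// sqr_ge0.
Qed.

(** Here phi is arbitrary, so the terms in wb are estimated as well, which is how M2 enters the
    right side. *)
Lemma normal_bound phi Phi : wg Omega phi Phi ->
  (r * (<<| lqa l, Phi |>> + << lra l, phi >>)) ^+ 2
    <= 20 * (E2 + M2) * (r ^+ 2 * <<| Phi, Phi |>> + r ^- 2 * << phi, phi >>).
Proof.
move=> pP; rewrite (normal_form pP); have Lp := wg_L2 pP; have LP := wg_L2v pP.
have [[b1 b2 b3 b4] _] := rel_L2; have [[a1 a2 a3 a4] [a5 a6 a7]] := Lx.
have LE : L2v Omega E1 := L2vB mO b2 b4.
have r0' := ltW r0; have k2 : 0 <= r ^+ 2 by exact: sqr_ge0.
have k3 : 0 <= r ^- 3 by rewrite invr_ge0 exprn_ge0.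
have k2' : 0 <= r ^- 2 by rewrite invr_ge0 exprn_ge0.
set X1 := r * nrmv Omega E1; set t := r^-1 * nrmv Omega (vtau x); set m1 := nrmv Omega (vM x).
set v2 := r ^+ 3 * nrm Omega (vL x); set m := r ^- 2 * nrm Omega (vmu x).
pose a := r * nrmv Omega (lWb l); pose b := r^-1 * nrm Omega (lwb l).
pose f := r * nrmv Omega Phi; pose g := r^-1 * nrm Omega phi.
have eM : M2 = a ^+ 2 + b ^+ 2 by rewrite !exprMn nrmv2 nrm2 exprVn.
have eK : r ^+ 2 * <<| Phi, Phi |>> + r ^- 2 * << phi, phi >> = f ^+ 2 + g ^+ 2.
  by rewrite !exprMn nrmv2 nrm2 exprVn.
have h1 : `|r ^+ 2 * <<| E1, Phi |>>| <= X1 * f.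
  by apply: le_trans_eq (ipv_scale_le mO k2 LE LP) _; rewrite /X1 /f; ring.
have h2 : `|1 * <<| vtau x, Phi |>>| <= t * f.
  by apply: le_trans_eq (ipv_scale_le mO ler01 a3 LP) _; rewrite /t /f; field.
have h3 : `|r * <<| vM x, Phi |>>| <= m1 * f.
  by apply: le_trans_eq (ipv_scale_le mO r0' a2 LP) _; rewrite /m1 /f; ring.
have h4 : `|r ^+ 2 * << vL x, phi >>| <= v2 * g.
  by apply: le_trans_eq (ip_scale_le mO k2 a7 Lp) _; rewrite /v2 /g; field.
have h5 : `|r ^- 3 * << vmu x, phi >>| <= m * g.
  by apply: le_trans_eq (ip_scale_le mO k3 a1 Lp) _; rewrite /m /g; field.
have h6 : `|r ^+ 2 * <<| lWb l, Phi |>>| <= a * f.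
  by apply: le_trans_eq (ipv_scale_le mO k2 b4 LP) _; rewrite /a /f; ring.
have h7 : `|r ^- 2 * << lwb l, phi >>| <= b * g.
  by apply: le_trans_eq (ip_scale_le mO k2' b3 Lp) _; rewrite /b /g; field.
apply: (@le_trans _ _ (((X1 + a + t + m1) * f + (b + v2 + m) * g) ^+ 2)).
  apply: sqr_le_norm; move: h1 h2 h3 h4 h5 h6 h7; rewrite !ler_norml mul1r.
  by move=> /andP[? ?] /andP[? ?] /andP[? ?] /andP[? ?] /andP[? ?] /andP[? ?] /andP[? ?]; apply/andP; split; lra.
have hc : (X1 + a + t + m1) ^+ 2 + (b + v2 + m) ^+ 2 <= 20 * (E2 + M2).
  have j1 : X1 ^+ 2 <= 4 * E2.
    by have := jump_le; rewrite -nrmv2 -exprMn; have := ip_ge0 Omega e; rewrite -/X1; lra.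
  have j2 : t ^+ 2 + m1 ^+ 2 + v2 ^+ 2 + m ^+ 2 <= E2.
    rewrite E2E -/t -/m1 -/v2 -/m; have := sqr_ge0 (nrm Omega (vD x)).
    have : 0 <= (1 + r ^+ 2) * (r * nrmv Omega (vV x)) ^+ 2 by rewrite mulr_ge0 ?sqr_ge0//; lra.
    by have := sqr_ge0 (nrm Omega (vv x)); lra.
  by rewrite eM; exact: sum7_bound.
rewrite eK; apply: (@le_trans _ _ (((X1 + a + t + m1) ^+ 2 + (b + v2 + m) ^+ 2) * (f ^+ 2 + g ^+ 2))).
  by have [] := cs_boundD (cs_bound_mul (X1 + a + t + m1) f) (cs_bound_mul (b + v2 + m) g).
by apply: ler_wpM2r => //; rewrite addr_ge0// sqr_ge0.
Qed.

End core.

Lemma exprVn_ge0 (R : realType) (r : R) n : 0 <= r -> 0 <= r ^- n.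
Proof. by move=> r0; rewrite invr_ge0 exprn_ge0. Qed.

(** 29 is an upper bound of sqrt (20 * 41): the factor 20 comes from the bound of the normal trace,
    41 from the comparison of ex + mx with the energy. *)
Lemma bounded_real (R : realType) (a b nv nu g1 g2 p ex ez mx mz beta : R) : 3 <= beta ->
  p ^+ 2 <= ex * ez -> a ^+ 2 = ex + nu -> b ^+ 2 = ez + nv ->
  ex + mx <= 41 * a ^+ 2 -> ez + mz <= 41 * b ^+ 2 ->
  g1 ^+ 2 <= 20 * (ex + mx) * nv -> g2 ^+ 2 <= 20 * (ez + mz) * nu ->
  0 <= a -> 0 <= b -> 0 <= nu -> 0 <= nv -> 0 <= mx -> 0 <= mz -> 0 <= ex -> 0 <= ez ->
  `|beta * p + 1 / 2 * (g1 + g2)| <= (beta + 29) * a * b.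
Proof.
move=> b3 cs ea eb ha hb q1 q2 a0 b0 nu0 nv0 mx0 mz0 ex0 ez0.
have ab : 0 <= a * b by exact: mulr_ge0.
have j1 : `|p| <= a * b.
  apply: le_of_sqr => //; rewrite real_normK ?num_real//; apply: (le_trans cs).
  by rewrite exprMn ea eb; apply: ler_pM => //; lra.
have j (s t n A B : R) : s ^+ 2 <= 20 * t * n -> 0 <= A -> 0 <= B -> A * B = a * b ->
    0 <= t -> 0 <= n -> t <= 41 * A ^+ 2 -> n <= B ^+ 2 -> `|s| <= 29 * (a * b).
  move=> h A0 B0 <- t0 n0 t1 n1; apply: le_of_sqr; first by rewrite !mulr_ge0.
  rewrite real_normK ?num_real//; apply: (le_trans h).
  have : t * n <= 41 * A ^+ 2 * B ^+ 2 by apply: ler_pM.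
  by have := mulr_ge0 (sqr_ge0 A) (sqr_ge0 B); nra.
have k1 : `|g1| <= 29 * (a * b).
  by apply: (j _ _ _ _ _ q1 a0 b0) => //; [exact: addr_ge0|rewrite eb lerDr].
have k2 : `|g2| <= 29 * (a * b).
  by apply: (j _ _ _ _ _ q2 b0 a0) => //; [exact: mulrC|exact: addr_ge0|rewrite ea lerDr].
have k3 : `|beta * p| <= beta * (a * b) by rewrite normrM ger0_norm; [apply: ler_wpM2l => //; lra|lra].
rewrite -mulrA; move: k1 k2 k3; rewrite !ler_norml => /andP[? ?] /andP[? ?] /andP[? ?].
by apply/andP; split; lra.
Qed.

(** * The energy norm and the form a^s *)

Section energy.
Context {R : realType} {d : nat}.
Local Notation leb := (@lebesgue_row R d).
Local Notation sfun := ('rV[R]_d -> R).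
Local Notation vfun := ('rV[R]_d -> 'rV[R]_d).
Variables (Omega : set 'rV[R]_d) (N : nat) (T : 'I_N -> set 'rV[R]_d).
Hypotheses (oO : open Omega) (oT : forall i, open (T i)) (TO : forall i, T i `<=` Omega)
  (dT : forall i j, i != j -> T i `&` T j = set0)
  (nT : leb.-negligible (Omega `\` \bigcup_i T i)).
Let mO := measurable_open oO.
Variable r : R.
Hypotheses (r0 : 0 < r) (r1 : r <= 1).
Local Notation V7 := (@vdata R d).
Local Notation trial := (@trial R d N).
Local Notation lifting := (@lifting R d).
Implicit Types (u v w : trial) (x y z : V7) (k : R) (l : lifting).
Local Notation pair7 := (pair7 Omega).
Local Notation wt := (wt r).
Local Notation is_lift := (is_lift Omega T).
Local Notation is_riesz := (is_riesz Omega T r).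
Local Notation spaceU := (spaceU Omega T).
Local Notation E2 x := (pair7 (wt x) x).
Local Notation M2 l := (r ^+ 2 * ipv Omega (lWb l) (lWb l) + r ^- 2 * ip Omega (lwb l) (lwb l)).
Local Notation r4 := (exprn_ge0 4 (ltW r0)).
Local Notation rm2 := (exprVn_ge0 2 (ltW r0)).

Lemma gamma0a u l : is_lift u l -> gamma0 Omega T u = trace Omega (lwa l).
Proof.
move=> [[h _ _ _] [s _ _ _]]; by apply: (restr_halfE oO oT TO dT nT); split; [exact: wg_H1 h|exact: s].
Qed.

(** The coupling of the two traces on Gamma in [spaceU] lets gamma_0 u be read off from the lift of
    [tr_ub] as well. *)
Lemma gamma0b u l : spaceU u -> is_lift u l -> gamma0 Omega T u = trace Omega (lwb l).
Proof.
move=> [_ [_ _ _ _ e]] [[_ h _ _] [_ s _ _]]; rewrite /gamma0 e.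
by apply: (restr_halfE oO oT TO dT nT); split; [exact: wg_H1 h|exact: s].
Qed.

Lemma lift_jump u l : spaceU u -> is_lift u l -> h0 Omega (lwa l - lwb l) (lWa l - lWb l).
Proof.
move=> Uu lu; have := gamma0b Uu lu; rewrite (gamma0a lu); case: lu => -[h1 h2 _ _] _.
move/(trace_eqP oO (wg_H1 h1) (wg_H1 h2))/(H10P oO) => [E hE].
exact: (h0_wg oO hE (wgB oO h1 h2)).
Qed.

Lemma gammanE u l phi Phi : is_lift u l -> wg Omega phi Phi ->
  gamman Omega T u (trace Omega phi) = ipv Omega (lqa l) Phi + ip Omega (lra l) phi.
Proof.
move=> [[_ _ h _] [_ _ s _]] pP; rewrite /gamman (restr_mhalfE oO oT TO dT nT h s).
exact: (normal_traceE oO h pP).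
Qed.

#[local] Opaque gamma0 gamman.

Lemma Hhalf_norm_le f F g : wg Omega f F -> trace Omega f = g ->
  r ^- 2 * Hhalf_norm (r ^+ 4) Omega g ^+ 2 <= r ^+ 2 * ipv Omega F F + r ^- 2 * ip Omega f f.
Proof.
move=> fF tf; have Hf := wg_H1 fF; have gF := wg_grad Hf.
have LF := wg_L2v fF; have LG := wg_L2v gF.
have p0 : 0 <= ip Omega f f + r ^+ 4 * ipv Omega (grad Omega f) (grad Omega f).
  exact: (addr_ge0 (ip_ge0 _ _) (mulr_ge0 r4 (ipv_ge0 _ _))).
apply: (@le_trans _ _ (r ^- 2 * (ip Omega f f + r ^+ 4 * ipv Omega (grad Omega f) (grad Omega f)))).
  apply: (ler_wpM2l rm2); rewrite -[leRHS](sqr_sqrtr p0); apply: inf_sqr_le; first by exists f.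
  by move=> _ [g' _ <-]; exact: sqrtr_ge0.
rewrite (wg_ipv oO gF fF LG) ipvC (wg_ipv oO gF fF LF).
apply: le_trans_eq (lexx _) _.
by have rn := lt0r_neq0 r0; gen_ip; field.
Qed.

Lemma Hhalf_norm_ge (y c k : R) g : Hhalf Omega g -> 0 <= k ->
  (forall f F, wg Omega f F -> trace Omega f = g ->
     y <= c + k * (r ^+ 2 * ipv Omega F F + r ^- 2 * ip Omega f f)) ->
  y <= c + k * (r ^- 2 * Hhalf_norm (r ^+ 4) Omega g ^+ 2).
Proof.
move=> [f0 Hf0 ->] k0 h; rewrite mulrA; apply: inf_sqr_ge.
- by exists (Num.sqrt (ip Omega f0 f0 + r ^+ 4 * ipv Omega (grad Omega f0) (grad Omega f0))); exists f0.
- exact: (mulr_ge0 k0 rm2).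
- by move=> _ [f _ <-]; exact: sqrtr_ge0.
- move=> _ [f [Hf tf] <-]; rewrite sqr_sqrtr; last first.
    exact: (addr_ge0 (ip_ge0 _ _) (mulr_ge0 r4 (ipv_ge0 _ _))).
  apply: le_trans_eq (h _ _ (wg_grad Hf) tf) _.
  by have rn := lt0r_neq0 r0; gen_ip; field.
Qed.

Lemma Hhalf_gamma0 u : spaceU u -> Hhalf Omega (gamma0 Omega T u).
Proof.
move=> /spaceU_lift[_ [l lu]]; rewrite (gamma0a lu); apply: Hhalf_trace.
by case: lu => -[h _ _ _] _; exact: wg_H1 h.
Qed.

Lemma energyE u x : is_riesz u x -> energy Omega T (r ^+ 4) u ^+ 2 =
  E2 x + r ^- 2 * Hhalf_norm (r ^+ 4) Omega (gamma0 Omega T u) ^+ 2.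
Proof.
move=> ux; have [xv _] := ux; have Lx := isv_L27 xv.
have p0 := pair7_wt_ge0 oO r0 Lx; have [_ [_ _ _ e]] := pow4E r0.
rewrite /energy (normB_data oO oT TO dT nT r0 ux) e (sqr_sqrtr p0) sqr_sqrtr//.
exact: (addr_ge0 p0 (mulr_ge0 rm2 (sqr_ge0 _))).
Qed.

(** The data on which the core estimates rest: the representative x of Theta u, liftings l with
    residual [wt x], and the jump in H^1_0. *)
Definition strong u x l : Prop := [/\ is_riesz u x, L2u Omega u, is_lift u l,
  resid r u l = wt x & h0 Omega (lwa l - lwb l) (lWa l - lWb l)].

Lemma strong_ex u : spaceU u -> exists x l, strong u x l.
Proof.
move=> Uu; have [x ux] := riesz_ex oO oT TO dT nT r0 Uu.
have [l lu e] := strong_lift oO oT TO dT nT r0 Uu ux; exists x, l.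
by split; [exact: ux|exact: (proj1 Uu)|exact: lu|exact: e|exact: (lift_jump Uu lu)].
Qed.

Lemma energy_le u x l : spaceU u -> strong u x l ->
  energy Omega T (r ^+ 4) u ^+ 2 <= E2 x + M2 l.
Proof.
move=> Uu [ux Lu lu e h]; rewrite (energyE ux) lerD2l.
have [[_ hb _ _] _] := lu.
by apply: (Hhalf_norm_le hb); rewrite (gamma0b Uu lu).
Qed.

Lemma gamman_bound u x l v : spaceU u -> spaceU v -> strong u x l ->
  (r * gamman Omega T u (gamma0 Omega T v)) ^+ 2 <=
    20 * (E2 x + M2 l) * (r ^- 2 * Hhalf_norm (r ^+ 4) Omega (gamma0 Omega T v) ^+ 2).
Proof.
move=> Uu Uv [ux Lu lu e h]; have [xv _] := ux; have Lx := isv_L27 xv.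
have p0 := pair7_wt_ge0 oO r0 Lx; have m0 := M2_ge0 Omega r l.
rewrite -[leRHS]add0r; apply: Hhalf_norm_ge; first exact: Hhalf_gamma0.
  by apply: mulr_ge0; [exact: ler0n|exact: addr_ge0].
move=> f F fF <-; rewrite add0r (gammanE lu fF).
exact: (normal_bound oO r0 r1 Lu lu Lx e h fF).
Qed.

(** The energy contains an infimum over all lifts of gamma_0 u, M2 the norm of the particular lift
    wb. The boundary pairing mediates: up to a cross term it equals M2 when evaluated with wb, and
    evaluated with any other lift it has the same value and is bounded by [normal_bound]. *)
Lemma energy_ge u x l : spaceU u -> strong u x l ->
  E2 x + M2 l <= 41 * energy Omega T (r ^+ 4) u ^+ 2.
Proof.
move=> Uu su; have [ux Lu lu e h] := su; have [xv _] := ux; have Lx := isv_L27 xv.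
have p0 := pair7_wt_ge0 oO r0 Lx; have m0 := M2_ge0 Omega r l.
rewrite (energyE ux).
suff : M2 l <= 24 * E2 x + 40 * (r ^- 2 * Hhalf_norm (r ^+ 4) Omega (gamma0 Omega T u) ^+ 2).
  have : 0 <= r ^- 2 * Hhalf_norm (r ^+ 4) Omega (gamma0 Omega T u) ^+ 2.
    exact: (mulr_ge0 rm2 (sqr_ge0 _)).
  by move: (E2 x) (M2 l) p0 => ? ? ?; lra.
apply: Hhalf_norm_ge; [exact: Hhalf_gamma0|exact: ler0n|].
move=> f F fF tf; have [[_ hb _ _] _] := lu.
have E : ipv Omega (lqa l) F + ip Omega (lra l) f
    = ipv Omega (lqa l) (lWb l) + ip Omega (lra l) (lwb l).
  by rewrite -(gammanE lu fF) -(gammanE lu hb) tf (gamma0b Uu lu).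
have := normal_bound oO r0 r1 Lu lu Lx e h fF; rewrite E.
have := normal_cross oO r0 r1 Lu lu Lx e h.
have k0 : 0 <= r ^+ 2 * ipv Omega F F + r ^- 2 * ip Omega f f.
  exact: (addr_ge0 (mulr_ge0 (sqr_ge0 _) (ipv_ge0 _ _)) (mulr_ge0 rm2 (ip_ge0 _ _))).
move: (r * (_ + _)) (r ^+ 2 * ipv Omega F F + _) (E2 x) (M2 l) k0 p0 m0 => Q K e2 mm k0 e0 m0 q1 q2.
(* Means inequalities with shares chosen so that a1 and a2 together leave half of mm on the left;
   this yields 23.9 e2 + 40 K. *)
have a1 : - (Q - mm) <= 117 / 10 * e2 + mm / 4.
  apply: le_of_sqr; first by lra.
  by rewrite sqrrN; apply: (le_trans q1); have := sqr_ge0 (117 / 10 * e2 - mm / 4); nra.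
have a2 : Q <= (e2 + mm) / 4 + 20 * K.
  apply: le_of_sqr; first by lra.
  by apply: (le_trans q2); have := sqr_ge0 ((e2 + mm) / 4 - 20 * K); nra.
lra.
Qed.

Lemma formb_ThetaB_pair (beta : R) u w x z : spaceU u -> spaceU w -> is_riesz u x -> is_riesz w z ->
  formb Omega T (r ^+ 4) u (ThetaB Omega T (r ^+ 4) beta w) = beta * pair7 (wt x) z.
Proof.
move=> Uu Uw ux wz; have [z' wz' ->] := formb_ThetaB oO oT TO dT nT r0 beta Uu Uw ux.
by rewrite (riesz_uniq oO ux wz wz').
Qed.

Lemma formaE (beta : R) u w x z : spaceU u -> spaceU w -> is_riesz u x -> is_riesz w z ->
  forma Omega T (r ^+ 4) beta u w = beta * pair7 (wt x) z
    + 1 / 2 * (r * gamman Omega T u (gamma0 Omega T w) + r * gamman Omega T w (gamma0 Omega T u)).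
Proof.
move=> Uu Uw ux wz; rewrite /forma (formb_ThetaB_pair beta Uu Uw ux wz).
by have [[-> _ _ _] _] := pow4E r0; congr (_ + _); rewrite -mulrA mulrDr.
Qed.

Lemma forma_coercive (beta : R) u : 3 <= beta -> spaceU u ->
  energy Omega T (r ^+ 4) u ^+ 2 <= 100 * forma Omega T (r ^+ 4) beta u u.
Proof.
move=> b3 Uu; have [x [l su]] := strong_ex Uu; have := energy_le Uu su.
have [ux Lu lu e h] := su; have [xv _] := ux; have Lx := isv_L27 xv.
have p0 := pair7_wt_ge0 oO r0 Lx; have m0 := M2_ge0 Omega r l.
rewrite (formaE beta Uu Uu ux ux) (gamma0b Uu lu); have [[_ hb _ _] _] := lu.
rewrite (gammanE lu hb).
have := coercive_real p0 m0 (normal_cross oO r0 r1 Lu lu Lx e h).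
have : 3 * E2 x <= beta * E2 x by exact: ler_wpM2r.
move: (r * (_ + _)) (E2 x) (beta * _) (M2 l) (energy _ _ _ _ ^+ 2) => *; lra.
Qed.

Lemma forma_bounded (beta : R) u v : 3 <= beta -> spaceU u -> spaceU v ->
  `|forma Omega T (r ^+ 4) beta u v| <=
    (beta + 29) * energy Omega T (r ^+ 4) u * energy Omega T (r ^+ 4) v.
Proof.
move=> b3 Uu Uv; have [x [l su]] := strong_ex Uu; have [z [l' sv]] := strong_ex Uv.
have [ux _ _ _ _] := su; have [vz _ _ _ _] := sv.
have [xv _] := ux; have Lx := isv_L27 xv; have [zv _] := vz; have Lz := isv_L27 zv.
have px := pair7_wt_ge0 oO r0 Lx; have pz := pair7_wt_ge0 oO r0 Lz.
rewrite (formaE beta Uu Uv ux vz).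
have cs := pair7_CS2 oO r0 Lx Lz.
have eu := energyE ux; have ev := energyE vz.
have hu := energy_ge Uu su; have hv := energy_ge Uv sv.
have bu := gamman_bound Uu Uv su; have bv := gamman_bound Uv Uu sv.
have eu0 : 0 <= energy Omega T (r ^+ 4) u by exact: sqrtr_ge0.
have ev0 : 0 <= energy Omega T (r ^+ 4) v by exact: sqrtr_ge0.
have nu : 0 <= r ^- 2 * Hhalf_norm (r ^+ 4) Omega (gamma0 Omega T u) ^+ 2.
  exact: (mulr_ge0 rm2 (sqr_ge0 _)).
have nv : 0 <= r ^- 2 * Hhalf_norm (r ^+ 4) Omega (gamma0 Omega T v) ^+ 2.
  exact: (mulr_ge0 rm2 (sqr_ge0 _)).
have mu := M2_ge0 Omega r l; have mv := M2_ge0 Omega r l'.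
exact: (bounded_real b3 cs eu ev hu hv bu bv eu0 ev0 nu nv mu mv px pz).
Qed.

Definition combl k l l' : lifting := Lift (k *: lwa l + lwa l') (k *: lWa l + lWa l')
  (k *: lwb l + lwb l') (k *: lWb l + lWb l') (k *: lqa l + lqa l') (k *: lra l + lra l')
  (k *: lqb l + lqb l') (k *: lrb l + lrb l').

Lemma lift_comb k u v l l' : is_lift u l -> is_lift v l' -> is_lift (comb k u v) (combl k l l').
Proof.
move=> [[a1 a2 a3 a4] [s1 s2 s3 s4]] [[b1 b2 b3 b4] [t1 t2 t3 t4]]; split; split => /=.
- exact: wgZD.
- exact: wgZD.
- exact: wdZD.
- exact: wdZD.
- move=> i; rewrite /comb_half s1 t1; apply: (comb_trace (@oT i)).
    exact: wg_H1 (wg_sub oO (@oT i) (@TO i) a1).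
  exact: wg_H1 (wg_sub oO (@oT i) (@TO i) b1).
- move=> i; rewrite /comb_half s2 t2; apply: (comb_trace (@oT i)).
    exact: wg_H1 (wg_sub oO (@oT i) (@TO i) a2).
  exact: wg_H1 (wg_sub oO (@oT i) (@TO i) b2).
- move=> i; rewrite s3 t3.
  exact: (normal_traceZD (@oT i) k (wd_sub oO (@oT i) (@TO i) a3) (wd_sub oO (@oT i) (@TO i) b3)).
- move=> i; rewrite s4 t4.
  exact: (normal_traceZD (@oT i) k (wd_sub oO (@oT i) (@TO i) a4) (wd_sub oO (@oT i) (@TO i) b4)).
Qed.

Lemma L2u_comb k u v : L2u Omega u -> L2u Omega v -> L2u Omega (comb k u v).
Proof. by move=> [? ? ?] [? ? ?]; split; [exact: L2ZD|exact: L2vZD|exact: L2ZD]. Qed.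

Lemma spaceU_comb k u v : spaceU u -> spaceU v -> spaceU (comb k u v).
Proof.
move=> Uu Uv; have [Lu [l lu]] := spaceU_lift Uu; have [Lv [l' lv]] := spaceU_lift Uv.
have lc := lift_comb k lu lv; have [[h1 h2 h3 h4] [s1 s2 s3 s4]] := lc.
split; first exact: L2u_comb.
have lh1 : lifts_half Omega T (tr_ua (comb k u v)) (lwa (combl k l l')).
  by split => //; exact: wg_H1 h1.
have lh2 : lifts_half Omega T (tr_ub (comb k u v)) (lwb (combl k l l')).
  by split => //; exact: wg_H1 h2.
split.
- by exists (lwa (combl k l l')).
- by exists (lwb (combl k l l')).
- by exists (lqa (combl k l l')); split => //; exact: wd_Hdiv h3.
- by exists (lqb (combl k l l')); split => //; exact: wd_Hdiv h4.
rewrite (restr_halfE oO oT TO dT nT lh1) (restr_halfE oO oT TO dT nT lh2).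
apply/(trace_eqP oO (wg_H1 h1) (wg_H1 h2))/(H10P oO).
have hc := h0ZD oO k (lift_jump Uu lu) (lift_jump Uv lv).
exists (k *: (lWa l - lWb l) + (lWa l' - lWb l')); move: hc => /=.
by rewrite !scalerBr addrACA -opprD.
Qed.

Lemma formb_comb k u v (t : test) : spaceU u -> spaceU v -> spaceV Omega T t ->
  formb Omega T (r ^+ 4) (comb k u v) t
    = k * formb Omega T (r ^+ 4) u t + formb Omega T (r ^+ 4) v t.
Proof.
move=> Uu Uv Vt; have [Lu [l lu]] := spaceU_lift Uu; have [Lv [l' lv]] := spaceU_lift Uv.
rewrite (formb_data oO oT TO dT nT r0 (L2u_comb k Lu Lv) (lift_comb k lu lv) Vt).
rewrite (formb_data oO oT TO dT nT r0 Lu lu Vt) (formb_data oO oT TO dT nT r0 Lv lv Vt).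
have Lt := isv_L27 (isv_data oO oT dT Vt).
have -> : resid r (comb k u v) (combl k l l') = combd k (resid r u l) (resid r v l'); last first.
  exact: (pair7ZD oO k (resid_L27 oO r Lu lu) (resid_L27 oO r Lv lv) Lt).
rewrite /resid /combd /combl /=; congr VData; apply/funext => z; rewrite !fctE.
- by rewrite /GRing.scale /=; ring.
- by apply/rowP => j; rewrite !mxE; ring.
- by apply/rowP => j; rewrite !mxE; ring.
- by rewrite /GRing.scale /=; ring.
- by rewrite /GRing.scale /=; ring.
- by apply/rowP => j; rewrite !mxE; ring.
- by rewrite /GRing.scale /=; ring.
Qed.

Lemma ThetaB_space (beta : R) w : spaceU w -> spaceV Omega T (ThetaB Omega T (r ^+ 4) beta w).
Proof.
move=> /(ThetaB_data oO oT TO dT nT r0 beta)[x [xv _] ->].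
by apply: (isv_space oT); exact: isvZD.
Qed.

Lemma gamman_comb k u v w : spaceU u -> spaceU v -> spaceU w ->
  gamman Omega T (comb k u v) (gamma0 Omega T w) =
    k * gamman Omega T u (gamma0 Omega T w) + gamman Omega T v (gamma0 Omega T w).
Proof.
move=> Uu Uv Uw; have [Lu [l lu]] := spaceU_lift Uu; have [Lv [l' lv]] := spaceU_lift Uv.
have [Lw [l2 lw]] := spaceU_lift Uw; rewrite (gamma0a lw); have [[h _ _ _] _] := lw.
rewrite (gammanE (lift_comb k lu lv) h) (gammanE lu h) (gammanE lv h) /=.
have [[_ _ a _] _] := lu; have [[_ _ b _] _] := lv; have Lh := wg_L2 h; have LH := wg_L2v h.
rewrite (ipvZD mO _ (wd_L2v a) (wd_L2v b) LH) (ipZD mO _ (wd_L2 a) (wd_L2 b) Lh).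
by gen_ip; ring.
Qed.

Lemma gamma0_comb k u v w : spaceU u -> spaceU v -> spaceU w ->
  gamman Omega T w (gamma0 Omega T (comb k u v)) =
    k * gamman Omega T w (gamma0 Omega T u) + gamman Omega T w (gamma0 Omega T v).
Proof.
move=> Uu Uv Uw; have [Lu [l lu]] := spaceU_lift Uu; have [Lv [l' lv]] := spaceU_lift Uv.
have [Lw [l2 lw]] := spaceU_lift Uw.
have [[a _ _ _] _] := lu; have [[b _ _ _] _] := lv; have [[ab _ _ _] _] := lift_comb k lu lv.
rewrite (gamma0a lu) (gamma0a lv) (gamma0a (lift_comb k lu lv)).
apply: (etrans (gammanE lw ab)); apply: esym.
apply: (etrans (congr2 (fun s t => k * s + t) (gammanE lw a) (gammanE lw b))); rewrite /=.
have [[_ _ c _] _] := lw; have Lc := wd_L2 c; have LC := wd_L2v c.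
rewrite (ipvC _ _ (_ + _)) (ipvZD mO _ (wg_L2v a) (wg_L2v b) LC) (ipC _ _ (_ + _)) (ipZD mO _ (wg_L2 a) (wg_L2 b) Lc).
rewrite (ipvC _ (lWa l)) (ipvC _ (lWa l')) (ipC _ (lwa l)) (ipC _ (lwa l')).
by gen_ip; ring.
Qed.

#[local] Opaque formb.

Lemma formaC (beta : R) u w : spaceU u -> spaceU w ->
  forma Omega T (r ^+ 4) beta u w = forma Omega T (r ^+ 4) beta w u.
Proof.
move=> Uu Uw; have [x ux] := riesz_ex oO oT TO dT nT r0 Uu.
have [z wz] := riesz_ex oO oT TO dT nT r0 Uw.
rewrite (formaE beta Uu Uw ux wz) (formaE beta Uw Uu wz ux).
have Lx := isv_L27 ux.1; have Lz := isv_L27 wz.1.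
have E : pair7 (wt x) z = pair7 (wt z) x := etrans (pair7_wtC oO r Lx Lz) (pair7C Omega x (wt z)).
have S (p q g h : R) : p = q -> beta * p + 1 / 2 * (g + h) = beta * q + 1 / 2 * (h + g).
  by move=> ->; rewrite (addrC g).
exact: (S _ _ _ _ E).
Qed.

Lemma forma_comb (beta k : R) u v w : spaceU u -> spaceU v -> spaceU w ->
  forma Omega T (r ^+ 4) beta (comb k u v) w =
    k * forma Omega T (r ^+ 4) beta u w + forma Omega T (r ^+ 4) beta v w.
Proof.
move=> Uu Uv Uw; have f1 := formb_comb k Uu Uv (ThetaB_space beta Uw).
have g1 := gamman_comb k Uu Uv Uw; have g2 := gamma0_comb k Uu Uv Uw.
have S (f fu fv g gu gv h hu hv c : R) : f = k * fu + fv -> g = k * gu + gv -> h = k * hu + hv ->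
  f + c * (g + h) = k * (fu + c * (gu + hu)) + (fv + c * (gv + hv)).
  by move=> -> -> ->; ring.
exact: (S _ _ _ _ _ _ _ _ _ _ f1 g1 g2).
Qed.

End energy.

Section squares.
Context {R : realType} {d : nat}.
Local Notation sfun := ('rV[R]_d -> R).
Local Notation vfun := ('rV[R]_d -> 'rV[R]_d).
Variable w : set 'rV[R]_d.
Hypothesis ow : open w.
Let mw := measurable_open ow.

Lemma ipZZ (k : R) (f : sfun) : L2 w f -> ip w (k *: f) (k *: f) = k ^+ 2 * ip w f f.
Proof. by move=> Lf; rewrite (ipZl mw _ Lf (L2Z mw _ Lf)) (ipZr mw _ Lf Lf) mulrA. Qed.

Lemma ipvZZ (k : R) (q : vfun) : L2v w q -> ipv w (k *: q) (k *: q) = k ^+ 2 * ipv w q q.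
Proof. by move=> Lf; rewrite (ipvZl mw _ Lf (L2vZ mw _ Lf)) (ipvZr mw _ Lf Lf) mulrA. Qed.

Lemma ip_sqB (f g : sfun) : L2 w f -> L2 w g ->
  ip w (f - g) (f - g) <= 2 * ip w f f + 2 * ip w g g.
Proof.
move=> Lf Lg; have := ip_sumsq_le ow (-1) Lg Lf; rewrite scaleN1r (addrC (- g)) sqrrN expr1n mulr1.
by rewrite [X in _ <= X]addrC.
Qed.

Lemma ipv_sqB (p q : vfun) : L2v w p -> L2v w q ->
  ipv w (p - q) (p - q) <= 2 * ipv w p p + 2 * ipv w q q.
Proof.
move=> Lf Lg; have := ipv_sumsq_le ow (-1) Lg Lf; rewrite scaleN1r (addrC (- q)) sqrrN expr1n mulr1.
by rewrite [X in _ <= X]addrC.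
Qed.

Lemma ip_sqD (f g : sfun) : L2 w f -> L2 w g ->
  ip w (f + g) (f + g) <= 2 * ip w f f + 2 * ip w g g.
Proof. by move=> Lf Lg; have := ip_sumsq_le ow 1 Lf Lg; rewrite scale1r expr1n mulr1. Qed.

Lemma ipv_sqD (p q : vfun) : L2v w p -> L2v w q ->
  ipv w (p + q) (p + q) <= 2 * ipv w p p + 2 * ipv w q q.
Proof. by move=> Lf Lg; have := ipv_sumsq_le ow 1 Lf Lg; rewrite scale1r expr1n mulr1. Qed.

End squares.

(** * Scalar inequalities for the comparison of norms *)

Section real_norms.
Context {R : realType}.
Variable r : R.
Hypotheses (r0 : 0 < r) (r1 : r <= 1).

Lemma expr_le1_01 n : 0 <= r ^+ n <= 1.
Proof. by rewrite exprn_ge0 ?exprn_ile1// ltW. Qed.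

(** The scalar content of [trial_bounds]: the variables are squared L2 norms, and the inequalities
    between them come from [rel_fun] by squaring sums of two terms. Surplus powers of r are dropped
    because r <= 1. *)
Lemma trial_real (mu M ta D v V L ee eE ww wW aa aA uu ss pp qq rr yy zz tt E2 : R) :
  E2 = r ^- 4 * mu + M + r ^- 2 * ta + D + v + (r ^+ 2 + r ^+ 4) * V + r ^+ 6 * L ->
  r ^+ 2 * eE + ee <= 4 * E2 ->
  aa <= 2 * ee + 2 * ww -> aA <= 2 * eE + 2 * wW -> uu <= 2 * aa + 2 * D ->
  ss <= 2 * (r ^+ 2 * aA) + 2 * (r^-1 ^+ 2 * ta) ->
  pp <= 2 * ((r ^- 3) ^+ 2 * ww) + 2 * (r ^+ 2 * L) ->
  qq <= 2 * ss + 2 * M -> rr <= 2 * pp + 2 * ((r ^- 4) ^+ 2 * mu) ->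
  yy <= 2 * ((r ^+ 3 + r) ^+ 2 * ss) + 2 * zz ->
  zz <= 2 * ((- (r ^+ 2 + r ^+ 4)) ^+ 2 * V) + 2 * ((- r ^+ 2) ^+ 2 * wW) ->
  tt <= 2 * uu + 2 * v ->
  0 <= mu -> 0 <= M -> 0 <= ta -> 0 <= D -> 0 <= v -> 0 <= V -> 0 <= L -> 0 <= ww -> 0 <= wW ->
  0 <= ee -> 0 <= eE -> 0 <= ss -> 0 <= pp -> 0 <= aa -> 0 <= aA -> 0 <= qq -> 0 <= tt ->
  [/\ uu <= 20 * (E2 + (r ^+ 2 * wW + r ^- 2 * ww)),
      ss <= 20 * (E2 + (r ^+ 2 * wW + r ^- 2 * ww)) &
      r ^+ 4 * pp <= 4 * (E2 + (r ^+ 2 * wW + r ^- 2 * ww))] /\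
  [/\ r ^+ 6 * (aa + r ^+ 2 * aA) <= 12 * (E2 + (r ^+ 2 * wW + r ^- 2 * ww)),
      r ^+ 4 * (ww + r ^+ 2 * wW) <= E2 + (r ^+ 2 * wW + r ^- 2 * ww),
      r ^+ 6 * (qq + r ^+ 4 * rr) <= 52 * (E2 + (r ^+ 2 * wW + r ^- 2 * ww)) &
      r ^+ 10 * ((r ^- 3) ^+ 2 * yy + r ^+ 4 * ((r ^- 3) ^+ 2 * tt))
        <= 220 * (E2 + (r ^+ 2 * wW + r ^- 2 * ww))].
Proof.
move=> eE2 j f1 f2 f3 f4 f5 f6 f7 f8 f9 f10.
move=> mu0 M0 ta0 D0 v0 V0 L0 ww0 wW0 ee0 eE0 ss0 pp0 aa0 aA0 qq0 tt0.
have rn := lt0r_neq0 r0; have pr := expr_le1_01; have pw n := exprn_ge0 n (ltW r0).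
have B0 : 0 <= r ^- 2 * ww by rewrite mulr_ge0 ?invr_ge0.
have U0 : 0 <= r ^- 4 * mu by rewrite mulr_ge0 ?invr_ge0.
have T0 : 0 <= r ^- 2 * ta by rewrite mulr_ge0 ?invr_ge0.
have VV0 : 0 <= (r ^+ 2 + r ^+ 4) * V by rewrite mulr_ge0 ?addr_ge0.
have LL0 : 0 <= r ^+ 6 * L by rewrite mulr_ge0.
have A0 : 0 <= r ^+ 2 * wW by rewrite mulr_ge0.
have E0 : 0 <= r ^+ 2 * eE by rewrite mulr_ge0.
have hw : ww <= r ^- 2 * ww.
  have e : r ^+ 2 * (r ^- 2 * ww) = ww by field.
  by rewrite -[leLHS]e; exact: (le1Ml (pr 2%N) B0).
have h2 : r ^+ 2 * aA <= 2 * (r ^+ 2 * eE) + 2 * (r ^+ 2 * wW).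
  by have := ler_wpM2l (pw 2%N) f2; lra.
have h4 : ss <= 2 * (r ^+ 2 * aA) + 2 * (r ^- 2 * ta) by rewrite -exprVn.
have h5 : r ^+ 4 * pp <= 2 * (r ^- 2 * ww) + 2 * (r ^+ 6 * L).
  by apply: le_trans_eq (ler_wpM2l (pw 4%N) f5) _; field.
have h6 : r ^+ 6 * qq <= qq by exact: le1Ml.
have pp4 : 0 <= r ^+ 4 * pp by rewrite mulr_ge0.
have h7 : r ^+ 6 * (r ^+ 4 * rr) <= 2 * (r ^+ 4 * pp) + 2 * (r ^- 4 * mu).
  rewrite mulrA; apply: le_trans (ler_wpM2l (mulr_ge0 (pw 6%N) (pw 4%N)) f7) _.
  rewrite (_ : _ * (_ + _) = 2 * (r ^+ 6 * (r ^+ 4 * pp)) + 2 * (r ^+ 6 * (r ^- 4 * mu))); last by field.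
  by have := le1Ml (pr 6%N) pp4; have := le1Ml (pr 6%N) U0; lra.
have h8 : r ^+ 10 * ((r ^- 3) ^+ 2 * yy) <= 8 * ss + 8 * ((r ^+ 2 + r ^+ 4) * V) + 4 * (r ^+ 2 * wW).
  rewrite (_ : _ * (_ * yy) = r ^+ 4 * yy); last by field.
  have f89 : yy <= 2 * ((r ^+ 3 + r) ^+ 2 * ss)
      + 2 * (2 * ((- (r ^+ 2 + r ^+ 4)) ^+ 2 * V) + 2 * ((- r ^+ 2) ^+ 2 * wW)) by lra.
  apply: le_trans (ler_wpM2l (pw 4%N) f89) _.
  rewrite (_ : _ * (_ + _) = 2 * (r ^+ 10 * ss) + 4 * (r ^+ 8 * ss) + 2 * (r ^+ 6 * ss)
    + 4 * (r ^+ 6 * ((r ^+ 2 + r ^+ 4) * V)) + 4 * (r ^+ 8 * ((r ^+ 2 + r ^+ 4) * V))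
    + 4 * (r ^+ 6 * (r ^+ 2 * wW))); last by ring.
  have := le1Ml (pr 10%N) ss0; have := le1Ml (pr 8%N) ss0; have := le1Ml (pr 6%N) ss0.
  have := le1Ml (pr 6%N) VV0; have := le1Ml (pr 8%N) VV0; have := le1Ml (pr 6%N) A0; lra.
have h9 : r ^+ 10 * (r ^+ 4 * ((r ^- 3) ^+ 2 * tt)) <= tt.
  by rewrite (_ : _ * (_ * _) = r ^+ 8 * tt); [exact: le1Ml|field].
have h10 : r ^+ 6 * (aa + r ^+ 2 * aA) <= aa + r ^+ 2 * aA.
  by apply: le1Ml => //; rewrite addr_ge0// mulr_ge0.
have h11 : r ^+ 4 * (ww + r ^+ 2 * wW) <= ww + r ^+ 2 * wW.
  by apply: le1Ml => //; rewrite addr_ge0// mulr_ge0.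
rewrite !mulrDr.
move: h10 h11; rewrite !mulrDr => h10 h11.
move: eE2 j f1 f3 f6 f10 hw h2 h4 h5 h6 h7 h8 h9 h10 h11 B0 U0 T0 VV0 LL0 A0 E0.
move: (r ^- 2 * ww) (r ^- 4 * mu) (r ^- 2 * ta) ((r ^+ 2 + r ^+ 4) * V) (r ^+ 6 * L).
move: (r ^+ 2 * wW) (r ^+ 2 * eE) (r ^+ 2 * aA) (r ^+ 4 * pp) (r ^+ 6 * qq) (r ^+ 6 * (_ * rr)).
move: (r ^+ 10 * (_ * yy)) (r ^+ 10 * (_ * _)) (r ^+ 6 * aa) (r ^+ 4 * ww) => *.
by split; split; lra.
Qed.

Lemma lift_real (a1 a2 a3 a4 a5 a6 a7 z uu ss pp aa aA ww wW qq rr bb cc E2 n : R) :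
  E2 <= r ^+ 4 * a1 + a2 + r ^+ 2 * a3 + a4 + a5 + (r ^+ 2 + r ^+ 4)^-1 * a6 + r ^- 6 * a7 ->
  n <= r ^+ 2 * wW + r ^- 2 * ww ->
  a1 <= 2 * pp + 2 * rr -> a2 <= 2 * ss + 2 * qq -> a3 <= 2 * (r^-1 ^+ 2 * ss) + 2 * aA ->
  a4 <= 2 * uu + 2 * aa -> a5 <= 2 * uu + 2 * ((r ^+ 3) ^+ 2 * cc) ->
  a6 <= 2 * z + 2 * ((r ^+ 2) ^+ 2 * wW) ->
  z <= 2 * ((r ^+ 3 + r) ^+ 2 * ss) + 2 * ((r ^+ 3) ^+ 2 * bb) ->
  a7 <= 2 * ((r ^+ 5) ^+ 2 * pp) + 2 * ((r ^+ 2) ^+ 2 * ww) ->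
  0 <= a6 -> 0 <= uu -> 0 <= ss -> 0 <= pp -> 0 <= aa -> 0 <= aA -> 0 <= ww -> 0 <= wW ->
  0 <= qq -> 0 <= rr -> 0 <= bb -> 0 <= cc ->
  E2 + n <= 20 * (uu + ss + r ^+ 4 * pp) + 20 * (aa + r ^+ 2 * aA)
    + 20 * r ^- 2 * (ww + r ^+ 2 * wW) + 20 * (qq + r ^+ 4 * rr) + 20 * r ^+ 2 * (bb + r ^+ 4 * cc).
Proof.
move=> hE hn h1 h2 h3 h4 h5 h6 hz h7 a60 uu0 ss0 pp0 aa0 aA0 ww0 wW0 qq0 rr0 bb0 cc0.
have rn := lt0r_neq0 r0; have pr := expr_le1_01; have pw n' := exprn_ge0 n' (ltW r0).
have g1 : r ^+ 4 * a1 <= 2 * (r ^+ 4 * pp) + 2 * (r ^+ 4 * rr).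
  by have := ler_wpM2l (pw 4%N) h1; lra.
have g3 : r ^+ 2 * a3 <= 2 * ss + 2 * (r ^+ 2 * aA).
  by apply: le_trans_eq (ler_wpM2l (pw 2%N) h3) _; field.
have g6 : (r ^+ 2 + r ^+ 4)^-1 * a6 <= r ^- 2 * a6.
  apply: ler_wpM2r => //; rewrite lef_pV2 ?posrE ?addr_gt0 ?exprn_gt0//.
  by rewrite lerDl.
have p2 : 0 <= r ^- 2 by rewrite invr_ge0.
have p6 : 0 <= r ^- 6 by rewrite invr_ge0.
have g6' : r ^- 2 * a6 <= 16 * ss + 4 * (r ^+ 2 * bb) + 2 * wW.
  have h6' : a6 <= 2 * (2 * ((r ^+ 3 + r) ^+ 2 * ss) + 2 * ((r ^+ 3) ^+ 2 * bb))
     + 2 * ((r ^+ 2) ^+ 2 * wW) by lra.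
  apply: le_trans (ler_wpM2l p2 h6') _.
  rewrite [leLHS](_ : _ = 4 * (r ^+ 4 * ss) + 8 * (r ^+ 2 * ss) + 4 * ss + 4 * (r ^+ 2 * (r ^+ 2 * bb))
    + 2 * (r ^+ 2 * wW)); last by field.
  have bb2 : 0 <= r ^+ 2 * bb by rewrite mulr_ge0.
  have := le1Ml (pr 4%N) ss0; have := le1Ml (pr 2%N) ss0; have := le1Ml (pr 2%N) bb2.
  by have := le1Ml (pr 2%N) wW0; lra.
have g7 : r ^- 6 * a7 <= 2 * (r ^+ 4 * pp) + 2 * (r ^- 2 * ww).
  by apply: le_trans_eq (ler_wpM2l p6 h7) _; field.
have g5 : a5 <= 2 * uu + 2 * (r ^+ 2 * (r ^+ 4 * cc)) by apply: le_trans h5 _; lra.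
have gn : n <= wW + r ^- 2 * ww by have := le1Ml (pr 2%N) wW0; lra.
have -> : 20 * r ^- 2 * (ww + r ^+ 2 * wW) = 20 * (r ^- 2 * ww) + 20 * wW by field.
have -> : 20 * r ^+ 2 * (bb + r ^+ 4 * cc) = 20 * (r ^+ 2 * bb) + 20 * (r ^+ 2 * (r ^+ 4 * cc)) by ring.
have x1 : 0 <= r ^- 2 * ww by rewrite mulr_ge0.
have x2 : 0 <= r ^+ 2 * bb by rewrite mulr_ge0.
have x3 : 0 <= r ^+ 2 * (r ^+ 4 * cc) := mulr_ge0 (pw 2%N) (mulr_ge0 (pw 4%N) cc0).
have x4 : 0 <= r ^+ 2 * aA by rewrite mulr_ge0.
have x5 : 0 <= r ^+ 4 * pp by rewrite mulr_ge0.
have x6 : 0 <= r ^+ 4 * rr by rewrite mulr_ge0.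
move: hE g1 g3 g6 g6' g7 g5 gn x1 x2 x3 x4 x5 x6.
move: (r ^+ 4 * a1) (r ^+ 2 * a3) (_ * a6) (r ^- 6 * a7) (r ^- 2 * a6) (r ^- 2 * ww) (r ^+ 2 * bb).
move: (r ^+ 2 * (r ^+ 4 * cc)) (r ^+ 2 * aA) (r ^+ 4 * pp) (r ^+ 4 * rr) => *; lra.
Qed.

End real_norms.

Section core_norms.
Context {R : realType} {d : nat}.
Local Notation leb := (@lebesgue_row R d).
Variables (Omega : set 'rV[R]_d).
Hypotheses (oO : open Omega).
Let mO := measurable_open oO.
Variable r : R.
Hypotheses (r0 : 0 < r) (r1 : r <= 1).
Variables (N : nat) (T : 'I_N -> set 'rV[R]_d) (u : @trial R d N) (l : @lifting R d) (x : @vdata R d).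
Hypotheses (Lu : L2u Omega u) (lu : is_lift Omega T u l) (Lx : L27 Omega x).
Local Notation E2 := (pair7 Omega (wt r x) x).
Local Notation M2 := (r ^+ 2 * ipv Omega (lWb l) (lWb l) + r ^- 2 * ip Omega (lwb l) (lwb l)).

Lemma trial_bounds : resid r u l = wt r x ->
  h0 Omega (lwa l - lwb l) (lWa l - lWb l) ->
  [/\ ip Omega (tr_u u) (tr_u u) <= 20 * (E2 + M2),
      ipv Omega (tr_sigma u) (tr_sigma u) <= 20 * (E2 + M2) &
      r ^+ 4 * ip Omega (tr_rho u) (tr_rho u) <= 4 * (E2 + M2)] /\
  [/\ r ^+ 6 * (ip Omega (lwa l) (lwa l) + r ^+ 2 * ipv Omega (lWa l) (lWa l)) <= 12 * (E2 + M2),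
      r ^+ 4 * (ip Omega (lwb l) (lwb l) + r ^+ 2 * ipv Omega (lWb l) (lWb l)) <= E2 + M2,
      r ^+ 6 * (ipv Omega (lqa l) (lqa l) + r ^+ 4 * ip Omega (lra l) (lra l)) <= 52 * (E2 + M2) &
      r ^+ 10 * (ipv Omega (lqb l) (lqb l) + r ^+ 4 * ip Omega (lrb l) (lrb l)) <= 220 * (E2 + M2)].
Proof.
move=> rx he; have rn := lt0r_neq0 r0.
have [[k1 k2 k3] [k4 k5 k6 k7]] := rel_fun r0 rx.
have [[b1 b2 b3 b4] _] := rel_L2 lu; have [[a1 a2 a3 a4] [a5 a6 a7]] := Lx.
have [c1 c2 c3] := Lu.
have j := jump_le oO r0 r1 Lu lu Lx rx he.
have eE : E2 = r ^- 4 * ip Omega (vmu x) (vmu x) + ipv Omega (vM x) (vM x)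
    + r ^- 2 * ipv Omega (vtau x) (vtau x) + ip Omega (vD x) (vD x) + ip Omega (vv x) (vv x)
    + (r ^+ 2 + r ^+ 4) * ipv Omega (vV x) (vV x) + r ^+ 6 * ip Omega (vL x) (vL x).
  rewrite /pair7 /= (ipZl mO _ a1 a1) (ipvZl mO _ a3 a3) (ipvZl mO _ a6 a6) (ipZl mO _ a7 a7).
  by rewrite !addrA.
have f1 : ip Omega (lwa l) (lwa l) <= 2 * ip Omega (lwa l - lwb l) (lwa l - lwb l) + 2 * ip Omega (lwb l) (lwb l).
  by have := ip_sqD oO (L2B mO b1 b3) b3; rewrite subrK.
have f2 : ipv Omega (lWa l) (lWa l) <= 2 * ipv Omega (lWa l - lWb l) (lWa l - lWb l) + 2 * ipv Omega (lWb l) (lWb l).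
  by have := ipv_sqD oO (L2vB mO b2 b4) b4; rewrite subrK.
have f3 := ip_sqD oO b1 a4; rewrite -k1 in f3.
have f4 := ipv_sqD oO (L2vZ mO r b2) (L2vZ mO r^-1 a3).
rewrite -k2 (ipvZZ oO _ b2) (ipvZZ oO _ a3) in f4.
have f5 := ip_sqD oO (L2Z mO (r ^- 3) b3) (L2Z mO r a7).
rewrite -k3 (ipZZ oO _ b3) (ipZZ oO _ a7) in f5.
have f6 := ipv_sqB oO c2 a2; rewrite -k4 in f6.
have f7 := ip_sqB oO c3 (L2Z mO (r ^- 4) a1); rewrite -k5 (ipZZ oO _ a1) in f7.
have Lz1 := L2vZ mO (- (r ^+ 2 + r ^+ 4)) a6; have Lz2 := L2vZ mO (- r ^+ 2) b4.
have f8 := ipv_sqD oO (L2vZ mO (r ^+ 3 + r) c2) (L2vD mO Lz1 Lz2).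
have f9 := ipv_sqD oO Lz1 Lz2.
have f10 := ip_sqB oO c1 a5.
have f11 : ipv Omega (lqb l) (lqb l) = (r ^- 3) ^+ 2 * ipv Omega
    ((r ^+ 3 + r) *: tr_sigma u + (- (r ^+ 2 + r ^+ 4) *: vV x + - r ^+ 2 *: lWb l))
    ((r ^+ 3 + r) *: tr_sigma u + (- (r ^+ 2 + r ^+ 4) *: vV x + - r ^+ 2 *: lWb l)).
  by rewrite k6 (ipvZZ oO) //; exact: (L2vD mO (L2vZ mO _ c2) (L2vD mO Lz1 Lz2)).
have f12 : ip Omega (lrb l) (lrb l) = (r ^- 3) ^+ 2 * ip Omega (tr_u u - vv x) (tr_u u - vv x).
  by rewrite k7 (ipZZ oO)//; exact: (L2B mO c1 a5).
rewrite (ipvZZ oO _ c2) in f8; rewrite (ipvZZ oO _ a6) (ipvZZ oO _ b4) in f9.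
rewrite f11 f12; apply: (trial_real r0 r1 eE j f1 f2 f3 f4 f5 f6 f7 f8 f9 f10);
  by [exact: ip_ge0|exact: ipv_ge0].
Qed.

End core_norms.

Section norms.
Context {R : realType} {d : nat}.
Local Notation leb := (@lebesgue_row R d).
Local Notation sfun := ('rV[R]_d -> R).
Local Notation vfun := ('rV[R]_d -> 'rV[R]_d).
Variables (Omega : set 'rV[R]_d) (N : nat) (T : 'I_N -> set 'rV[R]_d).
Hypotheses (oO : open Omega).
Variable r : R.
Hypotheses (r0 : 0 < r).
Local Notation r2 := (sqr_ge0 r).
Local Notation r4 := (exprn_ge0 4 (ltW r0)).

Lemma HhalfS_norm_le (uh : 'I_N -> @bvalue R d) f F : wg Omega f F -> (forall i, uh i = trace (T i) f) ->
  HhalfS_norm Omega T (r ^+ 4) uh ^+ 2 <= ip Omega f f + r ^+ 2 * ipv Omega F F.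
Proof.
move=> fF uf; have Hf := wg_H1 fF; have gF := wg_grad Hf.
have LF := wg_L2v fF; have LG := wg_L2v gF.
rewrite /HhalfS_norm; have [[_ -> _ _] _] := pow4E r0.
have p0 := addr_ge0 (ip_ge0 Omega f) (mulr_ge0 r2 (ipv_ge0 Omega (grad Omega f))).
apply: (@le_trans _ _ (Num.sqrt (ip Omega f f + r ^+ 2 * ipv Omega (grad Omega f) (grad Omega f)) ^+ 2)).
  by apply: inf_sqr_le; [exists f|move=> _ [g' _ <-]; exact: sqrtr_ge0].
by rewrite (sqr_sqrtr p0) (wg_ipv oO gF fF LG) ipvC (wg_ipv oO gF fF LF).
Qed.

Lemma HmhalfS_norm_le (sh : 'I_N -> @bvalue R d -> R) q s : wd Omega q s ->
  (forall i, sh i = normal_trace (T i) q) ->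
  HmhalfS_norm Omega T (r ^+ 4) sh ^+ 2 <= ipv Omega q q + r ^+ 4 * ip Omega s s.
Proof.
move=> qs uf; have Hq := wd_Hdiv qs; have dq := wd_div Hq.
have Ls := wd_L2 qs; have Ld := wd_L2 dq.
rewrite /HmhalfS_norm.
have p0 := addr_ge0 (ipv_ge0 Omega q) (mulr_ge0 r4 (ip_ge0 Omega (div Omega q))).
apply: (@le_trans _ _ (Num.sqrt (ipv Omega q q + r ^+ 4 * ip Omega (div Omega q) (div Omega q)) ^+ 2)).
  by apply: inf_sqr_le; [exists q|move=> _ [g' _ <-]; exact: sqrtr_ge0].
by rewrite (sqr_sqrtr p0) (wd_ip oO dq qs Ld) ipC (wd_ip oO dq qs Ls).
Qed.

Lemma HhalfS_norm_ge (y c k : R) (uh : 'I_N -> @bvalue R d) : HhalfS Omega T uh -> 0 <= k ->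
  (forall f F, wg Omega f F -> (forall i, uh i = trace (T i) f) ->
     y <= c + k * (ip Omega f f + r ^+ 2 * ipv Omega F F)) ->
  y <= c + k * HhalfS_norm Omega T (r ^+ 4) uh ^+ 2.
Proof.
move=> [f0 hf0] k0 h; rewrite /HhalfS_norm; have [[_ -> _ _] _] := pow4E r0.
apply: inf_sqr_ge => //.
- by exists (Num.sqrt (ip Omega f0 f0 + r ^+ 2 * ipv Omega (grad Omega f0) (grad Omega f0))); exists f0.
- by move=> _ [f _ <-]; exact: sqrtr_ge0.
move=> _ [f [Hf uf] <-]; rewrite sqr_sqrtr; first exact: (h _ _ (wg_grad Hf) uf).
exact: (addr_ge0 (ip_ge0 Omega f) (mulr_ge0 r2 (ipv_ge0 Omega (grad Omega f)))).
Qed.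

Lemma HmhalfS_norm_ge (y c k : R) (sh : 'I_N -> @bvalue R d -> R) : HmhalfS Omega T sh -> 0 <= k ->
  (forall q s, wd Omega q s -> (forall i, sh i = normal_trace (T i) q) ->
     y <= c + k * (ipv Omega q q + r ^+ 4 * ip Omega s s)) ->
  y <= c + k * HmhalfS_norm Omega T (r ^+ 4) sh ^+ 2.
Proof.
move=> [f0 hf0] k0 h; rewrite /HmhalfS_norm.
apply: inf_sqr_ge => //.
- by exists (Num.sqrt (ipv Omega f0 f0 + r ^+ 4 * ip Omega (div Omega f0) (div Omega f0))); exists f0.
- by move=> _ [f _ <-]; exact: sqrtr_ge0.
move=> _ [f [Hf uf] <-]; rewrite sqr_sqrtr; first exact: (h _ _ (wd_div Hf) uf).
exact: (addr_ge0 (ipv_ge0 Omega f) (mulr_ge0 r4 (ip_ge0 Omega (div Omega f)))).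
Qed.

End norms.

(** * Comparison of the energy with the norms of U *)

Section comparison.
Context {R : realType} {d : nat}.
Local Notation leb := (@lebesgue_row R d).
Local Notation sfun := ('rV[R]_d -> R).
Local Notation vfun := ('rV[R]_d -> 'rV[R]_d).
Variables (Omega : set 'rV[R]_d) (N : nat) (T : 'I_N -> set 'rV[R]_d).
Hypotheses (oO : open Omega) (oT : forall i, open (T i)) (TO : forall i, T i `<=` Omega)
  (dT : forall i j, i != j -> T i `&` T j = set0)
  (nT : leb.-negligible (Omega `\` \bigcup_i T i)).
Let mO := measurable_open oO.
Variable r : R.
Hypotheses (r0 : 0 < r) (r1 : r <= 1).
Implicit Types (u : @trial R d N) (x : @vdata R d) (l : @lifting R d).

(** The seven constants of [trial_bounds] add up to 329, and 41 * 329 = 13489 is below 130^2. *)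
Lemma normU1_le u : spaceU Omega T u -> 1 / 130 * normU1 Omega T (r ^+ 4) u <= energy Omega T (r ^+ 4) u.
Proof.
move=> Uu; have [x [l su]] := strong_ex oO oT TO dT nT r0 Uu.
have := energy_ge oO oT TO dT nT r0 r1 Uu su.
have [ux Lu lu e h] := su; have [xv _] := ux; have Lx := isv_L27 xv.
have [[q1 q2 q3] [q4 q5 q6 q7]] := trial_bounds oO r0 r1 Lu lu Lx e h.
have [[w1 w2 w3 w4] [s1 s2 s3 s4]] := lu.
have n1 := HhalfS_norm_le oO r0 w1 s1; have n2 := HhalfS_norm_le oO r0 w2 s2.
have n3 := HmhalfS_norm_le oO r0 w3 s3; have n4 := HmhalfS_norm_le oO r0 w4 s4.
have pw n := exprn_ge0 n (ltW r0).
have m1 := le_trans (ler_wpM2l (pw 6%N) n1) q4; have m2 := le_trans (ler_wpM2l (pw 4%N) n2) q5.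
have m3 := le_trans (ler_wpM2l (pw 6%N) n3) q6; have m4 := le_trans (ler_wpM2l (pw 10%N) n4) q7.
have e0 : 0 <= energy Omega T (r ^+ 4) u by exact: sqrtr_ge0.
move=> hS; apply: le_of_sqr => //.
have [_ [E1 E3 _ _]] := pow4E r0.
rewrite exprMn /normU1 E1 E3 sqr_sqrtr; last first.
  do 4 (apply: addr_ge0; last exact: (mulr_ge0 (pw _) (sqr_ge0 _))).
  exact: (addr_ge0 (addr_ge0 (ip_ge0 _ _) (ipv_ge0 _ _)) (mulr_ge0 (pw _) (ip_ge0 _ _))).
move: q1 q2 q3 m1 m2 m3 m4 hS; clear.
move: (pair7 _ _ _ + _) (_ * HhalfS_norm _ _ _ _ ^+ 2) (_ * HhalfS_norm _ _ _ _ ^+ 2).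
move=> S Na Nb; move: (_ * HmhalfS_norm _ _ _ _ ^+ 2) (_ * HmhalfS_norm _ _ _ _ ^+ 2).
move=> Ma Mb; gen_ip => *; nra.
Qed.

(** With arbitrary lifts, |Bu|^2 is the pairing of the residual with the data of Theta u. Young's
    inequality with the weights of V absorbs half of |Bu|^2 and leaves the residual in the dual
    weights; the lift of [tr_ub] bounds the trace term. *)
Lemma energy_lift_le u l : spaceU Omega T u -> is_lift Omega T u l ->
  energy Omega T (r ^+ 4) u ^+ 2 <=
    20 * (ip Omega (tr_u u) (tr_u u) + ipv Omega (tr_sigma u) (tr_sigma u)
      + r ^+ 4 * ip Omega (tr_rho u) (tr_rho u))
    + 20 * (ip Omega (lwa l) (lwa l) + r ^+ 2 * ipv Omega (lWa l) (lWa l))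
    + 20 * r ^- 2 * (ip Omega (lwb l) (lwb l) + r ^+ 2 * ipv Omega (lWb l) (lWb l))
    + 20 * (ipv Omega (lqa l) (lqa l) + r ^+ 4 * ip Omega (lra l) (lra l))
    + 20 * r ^+ 2 * (ipv Omega (lqb l) (lqb l) + r ^+ 4 * ip Omega (lrb l) (lrb l)).
Proof.
move=> Uu lu; have [x ux] := riesz_ex oO oT TO dT nT r0 Uu; have [xv xE] := ux.
have Lu : L2u Omega u := proj1 Uu; have Lx := isv_L27 xv; have LA := resid_L27 oO r Lu lu.
rewrite (energyE oO oT TO dT nT r0 ux).
have [[_ hb _ _] _] := lu.
have hn := Hhalf_norm_le oO r0 hb (esym (gamma0b oO oT TO dT nT Uu lu)).
have e1 : pair7 Omega (wt r x) x = pair7 Omega (resid r u l) x.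
  by rewrite (xE _ xv) (formbE oO oT TO dT nT r0 Lu lu xv).
have eE : pair7 Omega (wt r x) x = r ^- 4 * ip Omega (vmu x) (vmu x) + ipv Omega (vM x) (vM x)
    + r ^- 2 * ipv Omega (vtau x) (vtau x) + ip Omega (vD x) (vD x) + ip Omega (vv x) (vv x)
    + (r ^+ 2 + r ^+ 4) * ipv Omega (vV x) (vV x) + r ^+ 6 * ip Omega (vL x) (vL x).
  have [[a1 _ a3 _] [_ a6 a7]] := Lx.
  rewrite /pair7 /= (ipZl mO _ a1 a1) (ipvZl mO _ a3 a3) (ipvZl mO _ a6 a6) (ipZl mO _ a7 a7).
  by rewrite !addrA.
have pg n : 0 < r ^+ n by rewrite exprn_gt0.
have pV n : 0 < r ^- n by rewrite invr_gt0 exprn_gt0.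
have Y (c : R) f g : 0 < c -> L2 Omega f -> L2 Omega g ->
    2 * ip Omega f g <= c^-1 * ip Omega f f + c * ip Omega g g.
  by move=> c0 Lf Lg; apply: young_le => //; [exact: ip_ge0|exact: ip_ge0|exact: ip_CS2].
have Yv (c : R) f g : 0 < c -> L2v Omega f -> L2v Omega g ->
    2 * ipv Omega f g <= c^-1 * ipv Omega f f + c * ipv Omega g g.
  by move=> c0 Lf Lg; apply: young_le => //; [exact: ipv_ge0|exact: ipv_ge0|exact: ipv_CS2].
have [[c1 c2 c3] [[b1 b2 b3 b4] [b5 b6 b7 b8]]] := conj Lu (rel_L2 lu).
have hE : pair7 Omega (wt r x) x <= r ^+ 4 * ip Omega (vmu (resid r u l)) (vmu (resid r u l))
    + ipv Omega (vM (resid r u l)) (vM (resid r u l))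
    + r ^+ 2 * ipv Omega (vtau (resid r u l)) (vtau (resid r u l))
    + ip Omega (vD (resid r u l)) (vD (resid r u l)) + ip Omega (vv (resid r u l)) (vv (resid r u l))
    + (r ^+ 2 + r ^+ 4)^-1 * ipv Omega (vV (resid r u l)) (vV (resid r u l))
    + r ^- 6 * ip Omega (vL (resid r u l)) (vL (resid r u l)).
  move: LA Lx => [[A1 A2 A3 A4] [A5 A6 A7]] [[a1 a2 a3 a4] [a5 a6 a7]].
  have := Y _ _ _ (pV 4%N) A1 a1; have := Yv _ _ _ ltr01 A2 a2; have := Yv _ _ _ (pV 2%N) A3 a3.
  have := Y _ _ _ ltr01 A4 a4; have := Y _ _ _ ltr01 A5 a5.
  have := Yv _ _ _ (addr_gt0 (pg 2%N) (pg 4%N)) A6 a6; have := Y _ _ _ (pg 6%N) A7 a7.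
  rewrite !invrK !invr1 !mul1r.
  have e2 := e1; rewrite {2}/pair7 in e2; move: e2 eE.
  move: (pair7 Omega (wt r x) x) => E2.
  move: (r ^- 4 * _) (r ^- 2 * _) ((_ + _) * _) (r ^+ 6 * _).
  move: (r ^+ 4 * _) (r ^+ 2 * _) (_^-1 * ipv _ _ _) (r ^- 6 * _).
  gen_ip; move=> *; lra.
have Lz := L2vZ mO (r ^+ 3 + r) c2; have Lz3 := L2vZ mO (r ^+ 3) b7; have Lz2 := L2vZ mO (r ^+ 2) b4.
have h3 := ipv_sqB oO (L2vZ mO r^-1 c2) b2; rewrite (ipvZZ oO _ c2) in h3.
have h5 := ip_sqB oO c1 (L2Z mO (r ^+ 3) b8); rewrite (ipZZ oO _ b8) in h5.
have h6 := ipv_sqB oO (L2vB mO Lz Lz3) Lz2; rewrite (ipvZZ oO _ b4) in h6.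
have hz := ipv_sqB oO Lz Lz3; rewrite (ipvZZ oO _ c2) (ipvZZ oO _ b7) in hz.
have h7 := ip_sqB oO (L2Z mO (r ^+ 5) c3) (L2Z mO (r ^+ 2) b3).
rewrite (ipZZ oO _ c3) (ipZZ oO _ b3) in h7.
apply: (lift_real r0 r1 hE hn (ip_sqB oO c3 b6) (ipv_sqB oO c2 b5) h3 (ip_sqB oO c1 b1) h5 h6 hz h7);
  by [exact: ip_ge0|exact: ipv_ge0].
Qed.

(** The four lifts in [energy_lift_le] are independent of each other, so the infima are taken one at
    a time. The factor 5 comes from 20 <= 25. *)
Lemma energy_normU2 u : spaceU Omega T u -> energy Omega T (r ^+ 4) u <= 5 * normU2 Omega T (r ^+ 4) u.
Proof.
move=> Uu; have [_ [h1 h2 h3 h4 _]] := Uu.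
have k2 : 0 <= 20 * r ^+ 2 by rewrite mulr_ge0 ?sqr_ge0.
have k2' : 0 <= 20 * r ^- 2 by rewrite mulr_ge0 ?invr_ge0 ?sqr_ge0.
have k20 : (0 : R) <= 20 by exact: ler0n.
set y := energy Omega T (r ^+ 4) u.
pose c0 := 20 * (ip Omega (tr_u u) (tr_u u) + ipv Omega (tr_sigma u) (tr_sigma u)
      + r ^+ 4 * ip Omega (tr_rho u) (tr_rho u)).
pose Na := HhalfS_norm Omega T (r ^+ 4) (tr_ua u) ^+ 2.
pose Nb := HhalfS_norm Omega T (r ^+ 4) (tr_ub u) ^+ 2.
pose Ma := HmhalfS_norm Omega T (r ^+ 4) (tr_sa u) ^+ 2.
pose Mb := HmhalfS_norm Omega T (r ^+ 4) (tr_sb u) ^+ 2.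
pose W f F := ip Omega f f + r ^+ 2 * ipv Omega F F.
pose Q q s := ipv Omega q q + r ^+ 4 * ip Omega s s.
(* These rearrangements bring to the end the summand that is minimized next. *)
have AC1 (e c a b q s : R) : e <= c + a + b + q + s -> e <= (c + b + q + s) + a by lra.
have AC2 (e c a b q s : R) : e <= (c + b + q + s) + a -> e <= (c + a + q + s) + b by lra.
have AC3 (e c a b q s : R) : e <= (c + a + q + s) + b -> e <= (c + a + b + s) + q by lra.
have AC4 (e c a b q s : R) : e <= (c + a + b + s) + q -> e <= (c + a + b + q) + s by lra.
have t1 fb Fb qa sa qb sb : wg Omega fb Fb -> (forall i, tr_ub u i = trace (T i) fb) ->
  wd Omega qa sa -> (forall i, tr_sa u i = normal_trace (T i) qa) ->
  wd Omega qb sb -> (forall i, tr_sb u i = normal_trace (T i) qb) ->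
  y ^+ 2 <= (c0 + 20 * r ^- 2 * W fb Fb + 20 * Q qa sa + 20 * r ^+ 2 * Q qb sb) + 20 * Na.
  move=> g1 g2 g3 g4 g5 g6; apply: (HhalfS_norm_ge r0 h1 k20) => f F g7 g8.
  have lu : is_lift Omega T u (Lift f F fb Fb qa sa qb sb) by exact: (conj (And4 g7 g1 g3 g5) (And4 g8 g2 g4 g6)).
  exact: (AC1 _ _ _ _ _ _ (energy_lift_le Uu lu)).
have t2 qa sa qb sb : 
  wd Omega qa sa -> (forall i, tr_sa u i = normal_trace (T i) qa) ->
  wd Omega qb sb -> (forall i, tr_sb u i = normal_trace (T i) qb) ->
  y ^+ 2 <= (c0 + 20 * Na + 20 * Q qa sa + 20 * r ^+ 2 * Q qb sb) + 20 * r ^- 2 * Nb.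
  move=> g3 g4 g5 g6; apply: (HhalfS_norm_ge r0 h2 k2') => f F g1 g2.
  exact: (AC2 _ _ _ _ _ _ (t1 _ _ _ _ _ _ g1 g2 g3 g4 g5 g6)).
have t3 qb sb :
  wd Omega qb sb -> (forall i, tr_sb u i = normal_trace (T i) qb) ->
  y ^+ 2 <= (c0 + 20 * Na + 20 * r ^- 2 * Nb + 20 * r ^+ 2 * Q qb sb) + 20 * Ma.
  move=> g5 g6; apply: (HmhalfS_norm_ge r0 h3 k20) => q s g3 g4.
  exact: (AC3 _ _ _ _ _ _ (t2 _ _ _ _ g3 g4 g5 g6)).
have t4 : y ^+ 2 <= (c0 + 20 * Na + 20 * r ^- 2 * Nb + 20 * Ma) + 20 * r ^+ 2 * Mb.
  apply: (HmhalfS_norm_ge r0 h4 k2) => q s g5 g6.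
  exact: (AC4 _ _ _ _ _ _ (t3 _ _ g5 g6)).
have [[_ E1 _ _] [_ _ _ E3]] := pow4E r0.
apply: le_of_sqr; first by rewrite mulr_ge0// sqrtr_ge0.
have P : 0 <= ip Omega (tr_u u) (tr_u u) + ipv Omega (tr_sigma u) (tr_sigma u)
      + r ^+ 4 * ip Omega (tr_rho u) (tr_rho u) + Na + r ^- 2 * Nb + Ma + r ^+ 2 * Mb.
  have pw n := exprn_ge0 n (ltW r0); have pV := exprVn_ge0 2 (ltW r0).
  have P0 := addr_ge0 (addr_ge0 (ip_ge0 Omega (tr_u u)) (ipv_ge0 Omega (tr_sigma u)))
    (mulr_ge0 (pw 4%N) (ip_ge0 Omega (tr_rho u))).
  apply: (addr_ge0 _ (mulr_ge0 (pw 2%N) (sqr_ge0 _))); apply: (addr_ge0 _ (sqr_ge0 _)).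
  by apply: (addr_ge0 _ (mulr_ge0 pV (sqr_ge0 _))); exact: (addr_ge0 P0 (sqr_ge0 _)).
have eN : normU2 Omega T (r ^+ 4) u ^+ 2 = ip Omega (tr_u u) (tr_u u)
      + ipv Omega (tr_sigma u) (tr_sigma u)
      + r ^+ 4 * ip Omega (tr_rho u) (tr_rho u) + Na + r ^- 2 * Nb + Ma + r ^+ 2 * Mb.
  by rewrite /normU2 E1 E3; exact: sqr_sqrtr P.
rewrite exprMn eN; apply: (le_trans t4); rewrite /c0; move: P; clear t1 t2 t3 t4 eN.
move: (r ^+ 4 * _) (r ^- 2 * Nb) (r ^+ 2 * Mb) (mulrA 20 (r ^- 2) Nb) (mulrA 20 (r ^+ 2) Mb).
move=> p1 p2 p3 <- <-; gen_ip; move: Na Ma => *; lra.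
Qed.

End comparison.

(** * The Signorini problem *)

Section signorini.
Context {R : realType} {d : nat}.
Local Notation leb := (@lebesgue_row R d).
Local Notation sfun := ('rV[R]_d -> R).
Local Notation vfun := ('rV[R]_d -> 'rV[R]_d).
Variable w : set 'rV[R]_d.
Hypothesis ow : open w.
Let mw := measurable_open ow.

Lemma lipschitzI (c : R) (f : sfun) : (forall x y, `|f x - f y| <= c * `|x - y|) -> c.-lipschitz f.
Proof. by move=> h [x y] _; exact: h. Qed.

Lemma lipschitz_comb (k c c' : R) (f g : sfun) : 0 <= k -> c.-lipschitz f -> c'.-lipschitz g ->
  (k * c + c').-lipschitz (k *: f + g).
Proof.
move=> k0 hf hg; apply: lipschitzI => x y.
have h1 : `|f x - f y| <= c * `|x - y| by exact: (hf (x, y)).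
have h2 : `|g x - g y| <= c' * `|x - y| by exact: (hg (x, y)).
have -> : (k *: f + g) x - (k *: f + g) y = k * (f x - f y) + (g x - g y).
  by rewrite !fctE /GRing.scale /=; ring.
apply: (le_trans (ler_normD _ _)); rewrite normrM (ger0_norm k0) mulrDl -mulrA.
by apply: lerD => //; apply: ler_wpM2l.
Qed.

Lemma normal_trace_CS q s f F : wd w q s -> wg w f F ->
  normal_trace w q (trace w f) ^+ 2 <= (ipv w q q + ip w s s) * (ip w f f + ipv w F F).
Proof.
move=> qs fF; rewrite (normal_traceE ow qs fF) [ip w f f + _]addrC.
have Lf := wg_L2 fF; have LF := wg_L2v fF; have Lq := wd_L2v qs; have Ls := wd_L2 qs.
apply: cs_add; [exact: ipv_ge0|exact: ipv_ge0|exact: ip_ge0|exact: ip_ge0|exact: ipv_CS2|exact: ip_CS2].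
Qed.

Lemma Hhalf_norm1_le f F : wg w f F -> Hhalf_norm 1 w (trace w f) ^+ 2 <= ip w f f + ipv w F F.
Proof.
move=> fF; have Hf := wg_H1 fF; have gF := wg_grad Hf.
have LF := wg_L2v fF; have LG := wg_L2v gF.
have p0 : 0 <= ip w f f + 1 * ipv w (grad w f) (grad w f).
  exact: (addr_ge0 (ip_ge0 _ _) (mulr_ge0 ler01 (ipv_ge0 _ _))).
apply: (@le_trans _ _ (Num.sqrt (ip w f f + 1 * ipv w (grad w f) (grad w f)) ^+ 2)).
  by apply: inf_sqr_le; [exists f|move=> _ [g' _ <-]; exact: sqrtr_ge0].
by rewrite (sqr_sqrtr p0) mul1r (wg_ipv ow gF fF LG) ipvC (wg_ipv ow gF fF LF).
Qed.

Lemma Hhalf_norm1_ge0 g : 0 <= Hhalf_norm 1 w g.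
Proof.
rewrite /Hhalf_norm; set S := image _ _.
have [->|/set0P S0] := eqVneq S set0; first by rewrite inf0.
by apply: lb_le_inf => // _ [f _ <-]; exact: sqrtr_ge0.
Qed.

Lemma Hmhalf_normal_trace q s : wd w q s -> Hmhalf w (normal_trace w q).
Proof.
move=> qs; split.
- move=> f g k Hf Hg; have fF := wg_grad Hf; have gG := wg_grad Hg.
  apply: (etrans (normal_traceE ow qs (wgZD ow k fF gG))); apply: esym.
  apply: (etrans (congr2 (fun a b => k * a + b) (normal_traceE ow qs fF) (normal_traceE ow qs gG))).
  have Lq := wd_L2v qs; have Ls := wd_L2 qs.
  rewrite (ipvC _ q (_ + _)) (ipvZD mw _ (wg_L2v fF) (wg_L2v gG) Lq).
  rewrite (ipC _ s (_ + _)) (ipZD mw _ (wg_L2 fF) (wg_L2 gG) Ls).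
  rewrite (ipvC _ (grad w f)) (ipvC _ (grad w g)) (ipC _ f) (ipC _ g); gen_ip; ring.
- have c0 : 0 <= ipv w q q + ip w s s := addr_ge0 (ipv_ge0 _ _) (ip_ge0 _ _).
  exists (Num.sqrt (ipv w q q + ip w s s)) => g Hg.
  apply: le_of_sqr; first exact: (mulr_ge0 (sqrtr_ge0 _) (Hhalf_norm1_ge0 g)).
  rewrite real_normK ?num_real// exprMn (sqr_sqrtr c0) -[leRHS]add0r.
  have [f0 Hf0 gE] := Hg.
  apply: inf_sqr_ge => //.
  + by exists (Num.sqrt (ip w f0 f0 + 1 * ipv w (grad w f0) (grad w f0))); exists f0.
  + by move=> _ [f _ <-]; exact: sqrtr_ge0.
  + move=> _ [f [Hf <-] <-]; rewrite add0r mul1r sqr_sqrtr; last first.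
      exact: (addr_ge0 (ip_ge0 _ _) (ipv_ge0 _ _)).
    exact: (normal_trace_CS qs (wg_grad Hf)).
- by move=> g ng; exact: normal_trace_out.
Qed.

(** Convergence of lifts in H^1 implies weak convergence of their traces, which is the notion of
    limit in [Hhalf_ge0]. *)
Lemma Hmhalf_cvg (s : @bvalue R d -> R) (fn : nat -> sfun) (Fn : nat -> vfun) f F :
  Hmhalf w s -> wg w f F -> (forall n, wg w (fn n) (Fn n)) ->
  ip w (f - fn n) (f - fn n) @[n --> \oo] --> (0 : R) ->
  ipv w (F - Fn n) (F - Fn n) @[n --> \oo] --> (0 : R) ->
  s (trace w (fn n)) @[n --> \oo] --> s (trace w f).
Proof.
move=> [slin [C sC] _] fF fnF c1 c2.
have hd n : s (trace w f) - s (trace w (fn n)) = s (trace w (f - fn n)).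
  have := slin (fn n) f (-1) (wg_H1 (fnF n)) (wg_H1 fF).
  have -> : -1 *: fn n + f = f - fn n by rewrite scaleN1r addrC.
  by move=> E; have S (a b c : R) : c = -1 * b + a -> a - b = c; [move=> ->; ring|exact: S].
have hb n : 0 <= (s (trace w f) - s (trace w (fn n))) ^+ 2 <=
    C ^+ 2 * ip w (f - fn n) (f - fn n) + C ^+ 2 * ipv w (F - Fn n) (F - Fn n).
  rewrite sqr_ge0 /= hd -mulrDr; have D := wgB ow fF (fnF n).
  apply: le_trans (ler_wpM2l (sqr_ge0 C) (Hhalf_norm1_le D)).
  rewrite -exprMn; apply: sqr_le_norm; apply: sC; exact: (Hhalf_trace (wg_H1 D)).
have c0 := cvg0_comb hb c1 c2.
apply/cvgrPdist_lt => e e0.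
have e2 : 0 < e ^+ 2 by rewrite exprn_gt0.
have /cvgrPdist_lt/(_ _ e2) := c0; apply: filterS => n; rewrite sub0r normrN ger0_norm ?sqr_ge0// => h.
rewrite ltNge; apply/negP => he; move: h; apply/negP; rewrite -leNgt.
rewrite -[leRHS](real_normK (num_real _)).
by apply: (@lerXn2r R) => //; rewrite nnegrE// ltW.
Qed.

(** Functions with the boundary values of a Lipschitz function that is nonnegative on the boundary.
    The cone is not closed; limits of its elements have traces that are nonnegative in the sense of
    [Hhalf_ge0]. *)
Definition cone_lip : set (sfun * vfun * sfun) := [set y | [/\ wg w y.1.1 y.1.2, L2 w y.2 &
  exists phi : sfun, [/\ exists c : R, c.-lipschitz phi, forall z, bdry w z -> 0 <= phi z,
    H1 w phi & H10 w (y.1.1 - phi)]]].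

Lemma cone_lip_h0 f F h : h0 w f F -> L2 w h -> cone_lip (f, F, h).
Proof.
move=> hf Lh; split => /=; [by case: hf|exact: Lh|exists 0; split].
- by exists (0 : R); apply: lipschitzI => a b; rewrite subrr normr0 mul0r.
- by [].
- exact: wg_H1 (wg0 ow).
- by rewrite subr0; apply/(H10P ow); exists F.
Qed.

Lemma cone_lip_comb k x y : 0 <= k -> cone_lip x -> cone_lip y -> cone_lip (k *: x + y).
Proof.
move=> k0 [hx Lx [p [[c lp] bp Hp dp]]] [hy Ly [q [[c' lq] bq Hq dq]]].
split; [exact: wgZD|exact: L2ZD|exists (k *: p + q); split].
- by exists (k * c + c'); exact: lipschitz_comb.
- by move=> z bz; rewrite !fctE; apply: addr_ge0; [apply: mulr_ge0 => //; exact: bp|exact: bq].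
- exact: H1ZD.
- have := H10ZD ow k dp dq; congr (H10 w _).
  by rewrite scalerBr addrACA -opprD.
Qed.

Lemma solves_SP_ex (eps : R) (f : sfun) : 0 < eps -> L2 w f -> exists u, solves_SP w eps f u.
Proof.
move=> e0 Lf; have o1 : 0 < (1 : R) by [].
have L0 : L2 w 0 by exact: L20.
have L0v : L2v w 0 by exact: L2v0.
have CD : cone_lip `<=` D3 w by move=> y [h L _]; split; [exact: wg_L2 h|exact: wg_L2v h|exact: L].
have C0 : cone_lip 0 := cone_lip_h0 (h00 ow) L0.
have CA x y : cone_lip x -> cone_lip y -> cone_lip (x + y).
  by move=> hx hy; have := cone_lip_comb ler01 hx hy; rewrite scale1r.
have CZ k x : 0 <= k -> cone_lip x -> cone_lip (k *: x).
  by move=> k0 hx; have := cone_lip_comb k0 hx C0; rewrite addr0.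
have [[[u U] h] [[/= Lu LU Lh] [xn xnC [/= c1 c2 c3]] I1 I2]] :=
  L2_cone_projection mw o1 e0 o1 CD C0 CA CZ Lf L0v L0.
have uU : wg w u U by apply: (wg_lim ow Lu LU _ c1 c2) => n; case: (xnC n).
(* The functional vanishes on the third slot, so the third component of the projection is null. *)
have hh : ip w h h = 0.
  have q : ip w f 0 + ipv w 0 0 + ip w 0 (- h) <= 1 * ip w u 0 + eps * ipv w U 0 + 1 * ip w h (- h).
    exact: (I1 (0, 0, - h) (cone_lip_h0 (h00 ow) (L2N mw Lh))).
  have e1 : ip w f 0 = 0 by exact: ip0r.
  have e2 : ipv w 0 0 = 0 by exact: ipv0r.
  have e3 : ip w 0 (- h) = 0 by exact: ip0l.
  have e4 : ip w u 0 = 0 by exact: ip0r.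
  have e5 : ipv w U 0 = 0 by exact: ipv0r.
  have e6 : ip w h (- h) = - ip w h h by exact: ipNr.
  have S (a1 a2 a3 b1 b2 b3 c : R) : a1 = 0 -> a2 = 0 -> a3 = 0 -> b1 = 0 -> b2 = 0 -> b3 = - c ->
    0 <= c -> a1 + a2 + a3 <= 1 * b1 + eps * b2 + 1 * b3 -> c = 0.
    by move=> -> -> -> -> -> -> c0; rewrite mulr0 => H; apply/eqP; rewrite eq_le c0 andbT; lra.
  exact: (S _ _ _ _ _ _ _ e1 e2 e3 e4 e5 e6 (ip_ge0 w h) q).
have hg g : L2 w g -> ip w h g = 0.
  move=> Lg; have := ip_CS2 mw Lh Lg; rewrite hh mul0r => h1.
  by apply/eqP; rewrite -sqrf_eq0 eq_le h1 sqr_ge0.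
have J1 g G : cone_lip (g, G, 0) -> ip w f g <= ip w u g + eps * ipv w U G.
  move=> Cg; have [/= gG _ _] := Cg; have LG := wg_L2v gG.
  have q : ip w f g + ipv w 0 G + ip w 0 0 <= 1 * ip w u g + eps * ipv w U G + 1 * ip w h 0.
    exact: (I1 (g, G, 0) Cg).
  have e1 : ipv w 0 G = 0 by rewrite ipvC; exact: ipv0r.
  have e2 : ip w 0 0 = 0 by exact: ip0r.
  have e3 : ip w h 0 = 0 by exact: ip0r.
  have S (a b c a2 a3 b3 : R) : a2 = 0 -> a3 = 0 -> b3 = 0 ->
    a + a2 + a3 <= 1 * b + c + 1 * b3 -> a <= b + c by move=> -> -> ->; lra.
  exact: (S _ _ _ _ _ _ e1 e2 e3 q).
have J2 : ip w f u = ip w u u + eps * ipv w U U.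
  have q : ip w f u + ipv w 0 U + ip w 0 h = 1 * ip w u u + eps * ipv w U U + 1 * ip w h h by exact: I2.
  have e1 : ipv w 0 U = 0 by rewrite ipvC; exact: ipv0r.
  have e2 : ip w 0 h = 0 by exact: ip0l.
  have S (a b c a2 a3 b3 : R) : a2 = 0 -> a3 = 0 -> b3 = 0 ->
    a + a2 + a3 = 1 * b + c + 1 * b3 -> a = b + c by move=> -> -> ->; lra.
  exact: (S _ _ _ _ _ _ e1 e2 hh q).
(* The equation dictates the divergence of the gradient: D stands for (u - f) / eps. *)
pose D : sfun := eps^-1 *: (u - f).
have LD : L2 w D by apply: L2Z => //; exact: L2B.
have en : eps != 0 by rewrite gt_eqF.
have Dg g : L2 w g -> eps * ip w D g = ip w u g - ip w f g.
  by move=> Lg; rewrite (ipZl mw _ (L2B mw Lu Lf) Lg) mulrA divff// mul1r (ipBl mw Lu Lf Lg).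
have UD : wd w U D.
  apply: wd_of_test => // phi tp.
  have hp := h0_test ow tp; have Lp := testL2 ow tp; have Lc := cgradL2 ow tp.
  have q1 := J1 _ _ (cone_lip_h0 hp L0).
  have := J1 _ _ (cone_lip_h0 (h0Z ow (-1) hp) L0).
  rewrite (ipZr mw _ Lf Lp) (ipZr mw _ Lu Lp) (ipvZr mw _ Lc LU) => q2.
  have := Dg _ Lp => q3; apply: (mulfI en); rewrite mulr0 mulrDr q3.
  by apply/eqP; rewrite eq_le; apply/andP; split; move: q1 q2; gen_ip => *; lra.
have gu := wg_grad (wg_H1 uU).
have gD : wd w (grad w u) D := wd_ae ow (wg_L2v gu) (wg_uniq ow uU gu) UD.
(* eps times the normal trace is the defect in the variational inequality: its sign on the cone and
   its vanishing at u are the two remaining Signorini conditions. *)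
have NT g G : wg w g G -> eps * normal_trace w (grad w u) (trace w g) = eps * ipv w U G + ip w u g - ip w f g.
  move=> gG; rewrite (normal_traceE ow gD gG) mulrDr (Dg _ (wg_L2 gG)).
  by rewrite ipvC (wg_ipv ow gu uU (wg_L2v gG)) ipvC addrA.
exists u; split.
- by split; [exact: wg_H1 uU|exact: wd_Hdiv gD].
- have dd := wd_div (wd_Hdiv gD); have := wd_uniq ow dd gD.
  apply: filterS => z hz wz; rewrite /lap (hz wz) /D !fctE /GRing.scale /=.
  by field.
- split; first exact: Hhalf_trace (wg_H1 uU).
  (* The Lipschitz functions with the traces of the minimizing sequence are the approximants that
     nonnegativity of the trace of u requires. *)
  have [phi Hphi] := choice (fun n => let: And3 _ _ e := xnC n in e).
  exists phi, (fun n => trace w (phi n)); split.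
  + move=> n; have [[c lc] _ _ _] := Hphi n; exists c => z _; exact: lc.
  + by move=> n; case: (Hphi n).
  + move=> n; have [[c lc] _ _ _] := Hphi n; exists (phi n); first by exists c.
    by split.
  + move=> s Hs.
    have E n : trace w (phi n) = trace w (xn n).1.1.
      have [hx _ _] := xnC n; have [_ _ Hp dp] := Hphi n.
      by apply/esym/(trace_eqP ow (wg_H1 hx) Hp).
    rewrite (_ : (fun _ => _) = (fun n => s (trace w (xn n).1.1))); last first.
      by apply/funext => n; rewrite E.
    apply: (Hmhalf_cvg Hs uU _ c1 c2) => n; by case: (xnC n).
- move=> g [_ [phi [v [lphi pphi lv cv]]]].
  have Hs := Hmhalf_normal_trace gD.
  apply: (cvgr_to_ge (cv _ Hs)); apply: nearW => n.
  have [g0 [k lg] [gb vE]] := lv n; rewrite vE.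
  (* A Lipschitz function that were not in H^1 would have a trace outside H^{1/2}, where
     functionals vanish by convention. *)
  have [Hg|nHg] := pselect (H1 w g0); last first.
    by rewrite normal_trace_out// => /(trace_H1 ow).
  have gG := wg_grad Hg.
  rewrite -(pmulr_rge0 _ e0) (NT _ _ gG); have := J1 g0 (grad w g0).
  suff Cg : cone_lip (g0, grad w g0, 0) by move=> /(_ Cg); gen_ip => *; lra.
  split => //=; exists g0; split => //.
  + by exists k.
  + by move=> z bz; rewrite gb ?inE//; exact: pphi.
  + by rewrite subrr; exact: H10_0.
- by apply: (mulfI en); rewrite (NT _ _ uU) mulr0 J2; gen_ip => *; ring.
Qed.

(** Needed because uniqueness for (VI) holds up to null sets. Almost equal functions have the same
    set of weak gradients, so [grad] selects the same one, and they have the same trace. *)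
Lemma solves_SP_ae (eps : R) (f u v : sfun) : L2 w v -> {ae leb, forall z, w z -> u z = v z} ->
  solves_SP w eps f u -> solves_SP w eps f v.
Proof.
move=> Lv uv [[Hu Hd] h1 h2 h3 h4]; have Lu : L2 w u by case: Hu.
have gE : weak_grad w u = weak_grad w v.
  apply/funext => G; rewrite /weak_grad; apply/propext; split => -[LG hG]; split => // phi tp i;
  rewrite -(hG _ tp i); have Lp := testdL2 ow i tp.
    by apply: (ip_ae mw Lv Lu Lp Lp); [apply: filterS uv => z h wz; rewrite h|exact: aeW].
  by apply: (ip_ae mw Lu Lv Lp Lp); [exact: uv|exact: aeW].
have grE : grad w u = grad w v by rewrite /grad gE.
have Hv : H1 w v by split => //; case: Hu => _; rewrite gE.
have h1' : {ae leb, forall z, w z -> - eps * div w (grad w u) z + v z = f z}.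
  by apply: filterS2 uv h1 => z h k wz; rewrite -(h wz) -(k wz).
have tE : trace w u = trace w v.
  apply/(trace_eqP ow Hu Hv)/(H10P ow); exists 0.
  apply: (h0_ae ow (L2B mw Lu Lv) _ (h00 ow)).
  by apply: filterS uv => z h wz; rewrite !fctE (h wz) subrr.
rewrite grE in Hd h1' h3 h4; rewrite tE in h2 h4.
split; [by split|exact: h1'|exact: h2|exact: h3|exact: h4].
Qed.

End signorini.

Lemma comb_ge0_real (R : realType) (c x y z a b : R) : 0 <= c -> x = -1 * z + a ->
  y = -1 * z + b -> z = 0 -> 0 <= a -> 0 <= b -> 0 <= c * (y + x).
Proof. by move=> c1 -> -> -> a0 b0; apply: mulr_ge0 => //; lra. Qed.

(** With d = u - t, adding the variational inequality of t at u to that of u at t gives a(d, d) <=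
    0, since the two values of F cancel. *)
Lemma comb_le0_real (R : realType) (dd td ud du tu uu ud' d'u F1 F2 b1 b2 : R) :
  F1 <= td -> F2 <= ud' -> F1 = -1 * b1 + b2 -> F2 = -1 * b2 + b1 -> dd = -1 * td + ud ->
  ud = du -> du = -1 * tu + uu -> ud' = d'u -> d'u = -1 * uu + tu -> 100 * dd <= 0.
Proof. by move=> *; lra. Qed.

(** * Equivalence of (SP) and (VI), and uniqueness *)

Section variational.
Context {R : realType} {d : nat}.
Local Notation leb := (@lebesgue_row R d).
Local Notation sfun := ('rV[R]_d -> R).
Local Notation vfun := ('rV[R]_d -> 'rV[R]_d).
Variables (Omega : set 'rV[R]_d) (N : nat) (T : 'I_N -> set 'rV[R]_d).
Hypotheses (oO : open Omega) (oT : forall i, open (T i)) (TO : forall i, T i `<=` Omega)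
  (dT : forall i j, i != j -> T i `&` T j = set0)
  (nT : leb.-negligible (Omega `\` \bigcup_i T i)).
Let mO := measurable_open oO.
Variable r : R.
Hypotheses (r0 : 0 < r) (r1 : r <= 1).
Implicit Types (u v w t : @trial R d N) (x : @vdata R d) (l : @lifting R d) (f : sfun).
Local Notation eps := (r ^+ 4).

Definition trial_lift (u : sfun) : @lifting R d := let s := r *: grad Omega u in
  Lift u (grad Omega u) u (grad Omega u) s (div Omega s) s (div Omega s).

Lemma trial_of_lift (u0 : sfun) : H1 Omega u0 -> Hdiv Omega (grad Omega u0) ->
  [/\ is_lift Omega T (trial_of Omega T eps u0) (trial_lift u0),
      L2u Omega (trial_of Omega T eps u0) & spaceU Omega T (trial_of Omega T eps u0)].
Proof.
move=> Hu Hd; have uU := wg_grad Hu; have UL := wd_div Hd.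
have [[e _ _ _] _] := pow4E r0; rewrite /trial_of e.
have sL := wdZ oO r UL; have sd := wd_div (wd_Hdiv sL).
have L : L2u Omega (trial_of Omega T eps u0).
  rewrite /trial_of e; split; [exact: wg_L2 uU|exact: wd_L2v sd|exact: wd_L2 sd].
rewrite /trial_of e in L; split; [by split; split|exact: L|split; first exact: L].
by split => //; [exists u0|exists u0|exists (r *: grad Omega u0)|exists (r *: grad Omega u0)];
  split => //; exact: wd_Hdiv sd.
Qed.

(** With the exact solution as its own lift, five of the seven residual components vanish; by the
    differential equation the other two are f and - r^2 f, the coefficients of L. *)
Lemma trial_of_formb f (u0 : sfun) (y : test) : L2 Omega f -> solves_SP Omega eps f u0 -> spaceV Omega T y ->
  formb Omega T eps (trial_of Omega T eps u0) y = formL Omega T eps f y.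
Proof.
move=> Lf [[Hu Hd] eqn _ _ _] Vy; have [lt Lt _] := trial_of_lift Hu Hd.
have uU := wg_grad Hu; have UL := wd_div Hd; have rn := lt0r_neq0 r0.
have sL := wdZ oO r UL; have sd := wd_div (wd_Hdiv sL); have Ls := wd_L2 sd.
have [[_ Lm Lt' _] [Lv Lg Lp]] := isv_L27 (isv_data oO oT dT Vy); rewrite /= in Lm Lt' Lv Lg Lp.
have Lu := wg_L2 uU.
have ae : {ae leb, forall z, Omega z -> div Omega (r *: grad Omega u0) z = r^-3 * (u0 z - f z)}.
  have := wd_uniq oO sd sL; move: eqn; apply: filterS2 => z h k wz; rewrite (k wz) -(h wz).
  by rewrite /lap !fctE /GRing.scale /=; field.
rewrite (formb_data oO oT TO dT nT r0 Lt lt Vy).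
have [[e1 e2 _ _] _] := pow4E r0.
have z0 (g : sfun) : g - g = 0 := subrr g.
rewrite /pair7 /resid /trial_of /trial_lift /= e1 !subrr.
have -> : r^-1 *: (r *: grad Omega u0) - grad Omega u0 = 0.
  by rewrite scalerA mulVf// scale1r subrr.
have -> : (r ^+ 3 + r) *: (r *: grad Omega u0) - r ^+ 3 *: (r *: grad Omega u0)
    - r ^+ 2 *: grad Omega u0 = 0.
  by rewrite !scalerA -!scalerBl (_ : _ - _ - _ = 0) ?scale0r//; ring.
have E0 q : L2v Omega q -> ipv Omega 0 q = 0 by move=> Lq; rewrite ipvC; exact: ipv0r.
rewrite !(ip0l mO) (E0 _ Lm) (E0 _ Lt') (E0 _ Lg).
have LA : L2 Omega (u0 - r ^+ 3 *: div Omega (r *: grad Omega u0)).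
  exact: (L2B mO Lu (L2Z mO _ Ls)).
have LB : L2 Omega (r ^+ 5 *: div Omega (r *: grad Omega u0) - r ^+ 2 *: u0).
  exact: (L2B mO (L2Z mO _ Ls) (L2Z mO _ Lu)).
have Lmf := L2Z mO (- r ^+ 2) Lf.
have aW (g : sfun) : {ae leb, forall z, Omega z -> g z = g z} by exact: aeW.
rewrite (ip_ae mO LA Lf Lv Lv _ (aW _)); last first.
  apply: filterS ae => z h wz; rewrite !fctE (h wz) /GRing.scale /=; by field.
rewrite (ip_ae mO LB Lmf Lp Lp _ (aW _)); last first.
  apply: filterS ae => z h wz; rewrite !fctE (h wz) /GRing.scale /=; by field.
rewrite (ipZl mO _ Lf Lp) /formL e2 (ipBr mO Lv (L2Z mO _ Lp) Lf) (ipZr mO _ Lf Lp).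
by gen_ip; ring.
Qed.

Lemma trial_of_VI (beta : R) f (u0 : sfun) : L2 Omega f -> solves_SP Omega eps f u0 ->
  solves_VI Omega T eps beta f (trial_of Omega T eps u0).
Proof.
move=> Lf SP; have [[Hu Hd] eqn g0 gn nt] := SP; have [lt Lt Ut] := trial_of_lift Hu Hd.
have uU := wg_grad Hu; have UL := wd_div Hd; have sL := wdZ oO r UL.
set t := trial_of Omega T eps u0 in lt Lt Ut *.
have G0 : gamma0 Omega T t = trace Omega u0 by rewrite (gamma0a oO oT TO dT nT lt).
have GN h H : wg Omega h H -> gamman Omega T t (trace Omega h)
    = r * normal_trace Omega (grad Omega u0) (trace Omega h).
  move=> hH; rewrite (gammanE oO oT TO dT nT lt hH) (normal_traceE oO UL hH) /=.
  have sd := wd_div (wd_Hdiv sL).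
  have LH := wg_L2v hH; have Lh := wg_L2 hH.
  rewrite (ipC _ (div Omega _)) (wd_ip oO sd sL Lh) ipC (ipvZl mO _ (wd_L2v UL) LH).
  by rewrite (ipZl mO _ (wd_L2 UL) Lh) mulrDr.
have GNge g : Hhalf_ge0 Omega g -> 0 <= gamman Omega T t g.
  move=> gp; have [[h Hh gE] _] := gp; rewrite gE (GN _ _ (wg_grad Hh)).
  by apply: mulr_ge0; [exact: ltW|rewrite -gE; exact: gn].
split; first by split; [exact: Ut|rewrite G0|exact: GNge].
move=> w [Uw w0 wn].
have Ud : spaceU Omega T (comb (-1) t w) := spaceU_comb oO oT TO dT nT (-1) Ut Uw.
have VB := ThetaB_space oO oT TO dT nT r0 beta Ud.
rewrite /formF -(trial_of_formb Lf SP VB) /forma -/t lerDl.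
have h1 := gamman_comb oO oT TO dT nT (-1) Ut Uw Ut.
have h2 := gamma0_comb oO oT TO dT nT (-1) Ut Uw Ut.
have h3 : gamman Omega T t (gamma0 Omega T t) = 0 by rewrite G0 (GN _ _ uU) nt mulr0.
have q1 := GNge _ w0; have q2 : 0 <= gamman Omega T w (gamma0 Omega T t) by rewrite G0; exact: wn.
have c0 : 0 <= 1 / 2 * eps `^ (1 / 4) := mulr_ge0 (divr_ge0 ler01 (ler0n _ 2)) (powR_ge0 _ _).
exact: (comb_ge0_real c0 h1 h2 h3 q2 q1).
Qed.

Lemma energy0_formb u (y : test) : spaceU Omega T u -> energy Omega T eps u ^+ 2 <= 0 ->
  spaceV Omega T y -> formb Omega T eps u y = 0.
Proof.
move=> Uu e0 Vy; have [x [l su]] := strong_ex oO oT TO dT nT r0 Uu.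
have := energy_ge oO oT TO dT nT r0 r1 Uu su; have [ux _ _ _ _] := su.
have [xv xE] := ux; have Lx := isv_L27 xv; have yv := isv_data oO oT dT Vy; have Ly := isv_L27 yv.
have m0 := M2_ge0 Omega r l; have p0 := pair7_wt_ge0 oO r0 Lx.
have := pair7_CS2 oO r0 Lx Ly; rewrite (xE _ yv) data_ofK => cs h.
have z : pair7 Omega (wt r x) x = 0 by apply/eqP; rewrite eq_le p0 andbT; lra.
move: cs; rewrite z mul0r => cs.
by apply/eqP; rewrite -sqrf_eq0 eq_le cs sqr_ge0.
Qed.

Lemma ae0_sub (f : sfun) i : {ae leb, forall z, Omega z -> f z = 0} -> {ae leb, forall z, T i z -> f z = 0}.
Proof. by apply: filterS => z h /(@TO i). Qed.

Lemma trace_comb_eq (W : set 'rV[R]_d) (a b z : sfun) : open W -> H1 W a -> H1 W b -> H1 W z ->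
  {ae leb, forall y, W y -> z y = 0} -> trace W z = trace W (-1 *: a + b) -> trace W a = trace W b.
Proof.
move=> oW Ha Hb Hz z0 /(trace_eqP oW Hz (H1ZD oW (-1) Ha Hb)) h.
have hz : H10 W z.
  apply/(H10P oW); exists 0; apply: (h0_ae oW _ _ (h00 oW)); first by case: Hz.
  by apply: filterS z0 => y hy wy; rewrite (hy wy).
apply/(trace_eqP oW Ha Hb); have := H10B oW h hz.
by rewrite (_ : _ - _ - z = a - b)//; rewrite scaleN1r opprD opprK addrAC subrr add0r.
Qed.

(** Zero energy makes E2 + M2 vanish, and with it, by [trial_bounds], all L2 components and all
    lifts of the difference. The skeleton components then agree because traces and normal traces of
    null lifts are zero. *)
Lemma energy0_eqU u v : spaceU Omega T u -> spaceU Omega T v ->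
  energy Omega T eps (comb (-1) u v) ^+ 2 <= 0 -> eqU Omega u v.
Proof.
move=> Uu Uv e0; have Ud := spaceU_comb oO oT TO dT nT (-1) Uu Uv.
have [Lu0 [l1 lu]] := spaceU_lift Uu; have [Lv0 [l2 lv]] := spaceU_lift Uv.
have [x [l sd]] := strong_ex oO oT TO dT nT r0 Ud.
have S0 : pair7 Omega (wt r x) x + (r ^+ 2 * ipv Omega (lWb l) (lWb l) + r ^- 2 * ip Omega (lwb l) (lwb l)) <= 0.
  by have := energy_ge oO oT TO dT nT r0 r1 Ud sd; lra.
have [ux Lu ld e h] := sd; have [xv _] := ux; have Lx := isv_L27 xv.
have [[q1 q2 q3] [q4 q5 q6 q7]] := trial_bounds oO r0 r1 Lu ld Lx e h.
have lc := lift_comb oO oT TO (-1) lu lv.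
have pz n (a : R) c : 0 < c -> 0 <= a -> r ^+ n * a <= c * (pair7 Omega (wt r x) x +
    (r ^+ 2 * ipv Omega (lWb l) (lWb l) + r ^- 2 * ip Omega (lwb l) (lwb l))) -> a = 0.
  move=> c0 a0 ha; apply/eqP; rewrite eq_le a0 andbT -(@pmulr_rle0 _ (r ^+ n)) ?exprn_gt0//.
  by apply: (le_trans ha); rewrite pmulr_rle0.
have sum0 (a b k : R) : 0 <= a -> 0 < k -> 0 <= b -> a + k * b = 0 -> a = 0 /\ b = 0.
  move=> a0 k0 b0 ab; have kb := mulr_ge0 (ltW k0) b0.
  have a00 : a = 0 by apply/eqP; rewrite eq_le a0 andbT; lra.
  by split => //; apply: (mulfI (lt0r_neq0 k0)); rewrite mulr0; lra.
have [[w1 w2 w3 w4] [s1 s2 s3 s4]] := ld; have [[w1' w2' w3' w4'] [s1' s2' s3' s4']] := lc.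
have [[b1 b2 b3 b4] [b5 b6 b7 b8]] := rel_L2 ld; have [c1 c2 c3] := Lu.
have pos n : 0 < r ^+ n by rewrite exprn_gt0.
have z1 : ip Omega (tr_u (comb (-1) u v)) (tr_u (comb (-1) u v)) = 0.
  by apply: (pz 0%N _ 20) => //; [exact: ip_ge0|rewrite expr0 mul1r].
have z2 : ipv Omega (tr_sigma (comb (-1) u v)) (tr_sigma (comb (-1) u v)) = 0.
  by apply: (pz 0%N _ 20) => //; [exact: ipv_ge0|rewrite expr0 mul1r].
have z3 := pz 4%N _ 4 ltac:(by []) (ip_ge0 _ _) q3.
have z4 := pz 6%N _ 12 ltac:(by []) (addr_ge0 (ip_ge0 _ _) (mulr_ge0 (sqr_ge0 _) (ipv_ge0 _ _))) q4.
have q5' : r ^+ 4 * (ip Omega (lwb l) (lwb l) + r ^+ 2 * ipv Omega (lWb l) (lWb l)) <=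
   1 * (pair7 Omega (wt r x) x + (r ^+ 2 * ipv Omega (lWb l) (lWb l) + r ^- 2 * ip Omega (lwb l) (lwb l))).
  by rewrite mul1r.
have z5 := pz 4%N _ 1 ltac:(by []) (addr_ge0 (ip_ge0 _ _) (mulr_ge0 (sqr_ge0 _) (ipv_ge0 _ _))) q5'.
have z6 := pz 6%N _ 52 ltac:(by []) (addr_ge0 (ipv_ge0 _ _) (mulr_ge0 (ltW (pos 4%N)) (ip_ge0 _ _))) q6.
have z7 := pz 10%N _ 220 ltac:(by []) (addr_ge0 (ipv_ge0 _ _) (mulr_ge0 (ltW (pos 4%N)) (ip_ge0 _ _))) q7.
have [z41 _] := sum0 _ _ _ (ip_ge0 _ _) (pos 2%N) (ipv_ge0 _ _) z4.
have [z51 _] := sum0 _ _ _ (ip_ge0 _ _) (pos 2%N) (ipv_ge0 _ _) z5.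
have [z61 z62] := sum0 _ _ _ (ipv_ge0 _ _) (pos 4%N) (ip_ge0 _ _) z6.
have [z71 z72] := sum0 _ _ _ (ipv_ge0 _ _) (pos 4%N) (ip_ge0 _ _) z7.
have nt0 q s i : wd Omega q s -> ipv Omega q q = 0 -> ip Omega s s = 0 ->
    forall g, normal_trace (T i) q g = 0.
  move=> qs qq ss g; have [[f0 Hf ->]|ng] := pselect (Hhalf (T i) g); last exact: normal_trace_out.
  have qi := wd_sub oO (@oT i) (@TO i) qs; have fF := wg_grad Hf.
  have := normal_trace_CS (@oT i) qi fF.
  have := ip_sub_le oO oT TO dT nT i (wd_L2 qs); have := ipv_sub_le oO oT TO dT nT i (wd_L2v qs).
  rewrite qq ss => h1 h2.
  have -> : ipv (T i) q q = 0 by apply/eqP; rewrite eq_le h1 ipv_ge0.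
  have -> : ip (T i) s s = 0 by apply/eqP; rewrite eq_le h2 ip_ge0.
  by rewrite addr0 mul0r => cs; apply/eqP; rewrite -sqrf_eq0 eq_le cs sqr_ge0.
have H1i a A i : wg Omega a A -> H1 (T i) a by move=> /(wg_sub oO (@oT i) (@TO i)) /wg_H1.
have [[g1 g2 g3 g4] [p1 p2 p3 p4]] := lu; have [[g1' g2' g3' g4'] [p1' p2' p3' p4']] := lv.
split; split.
- apply: filterS (ip_eq0 mO c1 z1) => z hz wz; have := hz wz; rewrite /= !fctE scaleN1r.
  by move=> /eqP; rewrite addrC subr_eq0 => /eqP.
- apply: filterS (ipv_eq0 mO c2 z2) => z hz wz; have := hz wz; rewrite /= !fctE scaleN1r.
  by move=> /eqP; rewrite addrC subr_eq0 => /eqP.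
- apply: filterS (ip_eq0 mO c3 z3) => z hz wz; have := hz wz; rewrite /= !fctE scaleN1r.
  by move=> /eqP; rewrite addrC subr_eq0 => /eqP.
- apply/funext => i; rewrite p1 p1'.
  have E := etrans (esym (s1 i)) (s1' i).
  exact: (trace_comb_eq (@oT i) (H1i _ _ i g1) (H1i _ _ i g1') (H1i _ _ i w1)
    (@ae0_sub _ i (ip_eq0 mO b1 z41)) E).
- apply/funext => i; rewrite p2 p2'.
  have E := etrans (esym (s2 i)) (s2' i).
  exact: (trace_comb_eq (@oT i) (H1i _ _ i g2) (H1i _ _ i g2') (H1i _ _ i w2)
    (@ae0_sub _ i (ip_eq0 mO b3 z51)) E).
- apply/funext => i; apply/funext => g; have := nt0 _ _ i w3 z61 z62 g; rewrite -s3 /= !fctE scaleN1r.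
  by move=> /eqP; rewrite addrC subr_eq0 => /eqP.
- apply/funext => i; apply/funext => g; have := nt0 _ _ i w4 z71 z72 g; rewrite -s4 /= !fctE scaleN1r.
  by move=> /eqP; rewrite addrC subr_eq0 => /eqP.
Qed.

Lemma formb_ThetaBC (beta : R) u w : spaceU Omega T u -> spaceU Omega T w ->
  formb Omega T eps u (ThetaB Omega T eps beta w) = formb Omega T eps w (ThetaB Omega T eps beta u).
Proof.
move=> Uu Uw; have [x ux] := riesz_ex oO oT TO dT nT r0 Uu.
have [z wz] := riesz_ex oO oT TO dT nT r0 Uw.
apply: (etrans (formb_ThetaB_pair oO oT TO dT nT r0 beta Uu Uw ux wz)); apply: esym.
apply: (etrans (formb_ThetaB_pair oO oT TO dT nT r0 beta Uw Uu wz ux)); congr (_ * _).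
have Lx := isv_L27 ux.1; have Lz := isv_L27 wz.1.
exact: (etrans (pair7_wtC oO r Lz Lx) (pair7C Omega z (wt r x))).
Qed.

#[local] Opaque formb forma energy.

Lemma VI_energy0 (beta : R) f (u0 : sfun) u : 3 <= beta -> L2 Omega f -> solves_SP Omega eps f u0 ->
  solves_VI Omega T eps beta f u ->
  energy Omega T eps (comb (-1) (trial_of Omega T eps u0) u) ^+ 2 <= 0.
Proof.
move=> b3 Lf SP [Ku VIu]; have [Kt VIt] := trial_of_VI beta Lf SP.
set t := trial_of Omega T eps u0 in Kt VIt *.
have Ut : spaceU Omega T t by case: Kt. have Uu : spaceU Omega T u by case: Ku.
have Ud := spaceU_comb oO oT TO dT nT (-1) Ut Uu; have Ud' := spaceU_comb oO oT TO dT nT (-1) Uu Ut.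
have i1 := VIt _ Ku; have i2 := VIu _ Kt.
apply: le_trans (forma_coercive oO oT TO dT nT r0 r1 b3 Ud) _.
(* Theta is a selection up to null sets, so the linearity of F comes from swapping arguments: F(w) =
   b(t, Theta_beta w) = b(w, Theta_beta t), which is linear in w. *)
have F w : spaceU Omega T w -> formF Omega T eps beta f w
    = formb Omega T eps w (ThetaB Omega T eps beta t).
  move=> Uw; rewrite /formF -(trial_of_formb Lf SP (ThetaB_space oO oT TO dT nT r0 beta Uw)).
  exact: (formb_ThetaBC beta Ut Uw).
have VB := ThetaB_space oO oT TO dT nT r0 beta Ut.
have f1 := formb_comb oO oT TO dT nT r0 (-1) Ut Uu VB.
have f2 := formb_comb oO oT TO dT nT r0 (-1) Uu Ut VB.
have a1 := forma_comb oO oT TO dT nT r0 beta (-1) Ut Uu Ud.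
have a2 := formaC oO oT TO dT nT r0 beta Uu Ud.
have a3 := forma_comb oO oT TO dT nT r0 beta (-1) Ut Uu Uu.
have a4 := formaC oO oT TO dT nT r0 beta Uu Ud'.
have a5 := forma_comb oO oT TO dT nT r0 beta (-1) Uu Ut Uu.
have g1 := etrans (F _ Ud) f1; have g2 := etrans (F _ Ud') f2.
exact: (comb_le0_real i1 i2 g1 g2 a1 a2 a3 a4 a5).
Qed.

End variational.

Theorem theorem12 (R : realType) :
  (exists C1 : R, 0 < C1 /\
     forall beta : R, 3 <= beta ->
     exists C2 : R, 0 < C2 /\
     forall (d : nat) (Omega : set 'rV[R]_d) (N : nat)
       (T : 'I_N -> set 'rV[R]_d) (eps : R),
     d = 2%N \/ d = 3%N ->
     simply_connected_lipschitz_domain Omega -> mesh_of Omega T ->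
     0 < eps <= 1 ->
     let a := forma Omega T eps beta in
     let nrm := energy Omega T eps in
     [/\ forall (k : R) u v w,
           spaceU Omega T u -> spaceU Omega T v -> spaceU Omega T w ->
           a (comb k u v) w = k * a u w + a v w /\
           a w (comb k u v) = k * a w u + a w v,
         forall u, spaceU Omega T u -> nrm u ^+ 2 <= C1 * a u u &
         forall u v, spaceU Omega T u -> spaceU Omega T v ->
           `|a u v| <= C2 * nrm u * nrm v])
  /\
  (forall (d : nat) (Omega : set 'rV[R]_d),
     d = 2%N \/ d = 3%N ->
     simply_connected_lipschitz_domain Omega ->
     exists c C : R, [/\ 0 < c, 0 < C &
     forall (N : nat) (T : 'I_N -> set 'rV[R]_d) (eps : R),
     mesh_of Omega T -> 0 < eps <= 1 ->
     forall u, spaceU Omega T u ->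
       c * normU1 Omega T eps u <= energy Omega T eps u /\
       energy Omega T eps u <= C * normU2 Omega T eps u])
  /\
  (forall (d : nat) (Omega : set 'rV[R]_d) (N : nat)
     (T : 'I_N -> set 'rV[R]_d) (eps beta : R) (f : 'rV[R]_d -> R),
   d = 2%N \/ d = 3%N ->
   simply_connected_lipschitz_domain Omega -> mesh_of Omega T ->
   0 < eps <= 1 -> 3 <= beta -> L2 Omega f ->
   let VI := solves_VI Omega T eps beta f in
   let SP := solves_SP Omega eps f in
   [/\ (exists u, VI u) /\ (forall u v, VI u -> VI v -> eqU Omega u v),
       forall u, SP u -> VI (trial_of Omega T eps u),
       forall u, VI u -> SP (tr_u u) &
       forall u, VI u -> forall w, spaceU Omega T w ->
         formb Omega T eps u (ThetaB Omega T eps beta w)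
         = formF Omega T eps beta f w]).
Proof.
have root (eps : R) : 0 < eps <= 1 -> exists r : R, [/\ 0 < r, r <= 1 & eps = r ^+ 4].
  move=> /andP[e0 e1]; exists (eps `^ (1 / 4)); split.
  - exact: powR_gt0.
  - have h : 0 <= (1 / 4 : R) by rewrite divr_ge0.
    have := @ge0_ler_powR R (1 / 4) h eps 1; rewrite !nnegrE (ltW e0) ler01 powR1; exact.
  - rewrite -powR_mulrn ?powR_ge0// -powRrM (_ : 1 / 4 * 4%:R = 1) ?powRr1//; first exact: ltW.
    by field.
have mesh d (Omega : set 'rV[R]_d) N (T : 'I_N -> set 'rV[R]_d) :
    simply_connected_lipschitz_domain Omega -> mesh_of Omega T ->
    [/\ open Omega, forall i, open (T i), forall i, T i `<=` Omega,
        forall i j, i != j -> T i `&` T j = set0 &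
        (@lebesgue_row R d).-negligible (Omega `\` \bigcup_i T i)].
  move=> [_ [oO _ _] _] m; have [h1 h2 h3 _] := m; split => //; last exact: mesh_negligible.
  by move=> i; have [_ []] := h1 i.
split; [|split].
(* 100 is the inverse of the margin in [coercive_real], 29 the constant of [bounded_real]. *)
- exists 100; split => // beta b3; exists (beta + 29); split; first by lra.
  move=> d Omega N T eps _ dO mT /root[r [r0 r1 ->]] a nrm.
  have [oO oT TO dT nT] := mesh _ _ _ _ dO mT; split.
  + move=> k u v w Uu Uv Uw; rewrite /a.
    have e1 := forma_comb oO oT TO dT nT r0 beta k Uu Uv Uw.
    split; first exact: e1.
    have e2 := formaC oO oT TO dT nT r0 beta Uw (spaceU_comb oO oT TO dT nT k Uu Uv).
    have e3 := formaC oO oT TO dT nT r0 beta Uu Uw; have e4 := formaC oO oT TO dT nT r0 beta Uv Uw.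
    apply: (etrans e2); apply: (etrans e1); exact: (congr2 (fun s t => k * s + t) e3 e4).
  + by move=> u Uu; exact: (forma_coercive oO oT TO dT nT r0 r1 b3 Uu).
  + by move=> u v Uu Uv; exact: (forma_bounded oO oT TO dT nT r0 r1 b3 Uu Uv).
- move=> d Omega _ dO; exists (1 / 130), 5; split => // N T eps mT /root[r [r0 r1 ->]] u Uu.
  have [oO oT TO dT nT] := mesh _ _ _ _ dO mT; split.
    exact: (normU1_le oO oT TO dT nT r0 r1 Uu).
  exact: (energy_normU2 oO oT TO dT nT r0 r1 Uu).
- move=> d Omega N T eps beta f _ dO mT /root[r [r0 r1 ->]] b3 Lf VI SP.
  have [oO oT TO dT nT] := mesh _ _ _ _ dO mT.
  have [u0 SP0] := solves_SP_ex oO (exprn_gt0 4 r0) Lf.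
  have VI0 : VI (trial_of Omega T (r ^+ 4) u0) by exact: (trial_of_VI oO oT TO dT nT r0 beta Lf SP0).
  have Ut : spaceU Omega T (trial_of Omega T (r ^+ 4) u0) by case: VI0 => -[].
  (* Every solution of (VI) is at energy distance 0 from the one built from (SP); the remaining
     claims are transferred along this. *)
  have E u : VI u -> energy Omega T (r ^+ 4) (comb (-1) (trial_of Omega T (r ^+ 4) u0) u) ^+ 2 <= 0.
    by move=> VIu; exact: (VI_energy0 oO oT TO dT nT r0 r1 b3 Lf SP0 VIu).
  have VU u : VI u -> spaceU Omega T u by move=> [[]].
  have Q u : VI u -> eqU Omega (trial_of Omega T (r ^+ 4) u0) u.
    by move=> VIu; exact: (energy0_eqU oO oT TO dT nT r0 r1 Ut (VU _ VIu) (E _ VIu)).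
  split.
  + split; first by exists (trial_of Omega T (r ^+ 4) u0).
    move=> u v /Q[[a1 a2 a3] [a4 a5 a6 a7]] /Q[[b1 b2 b3'] [b4 b5 b6 b7]].
    split; split; try (by apply: etrans (esym _) _; eassumption).
    * by apply: filterS2 a1 b1 => z h k wz; rewrite -(h wz) -(k wz).
    * by apply: filterS2 a2 b2 => z h k wz; rewrite -(h wz) -(k wz).
    * by apply: filterS2 a3 b3' => z h k wz; rewrite -(h wz) -(k wz).
  + by move=> u SPu; exact: (trial_of_VI oO oT TO dT nT r0 beta Lf SPu).
  + move=> u VIu; have [[L1 _ _] _] := VU _ VIu; have [[a1 _ _] _] := Q _ VIu.
    exact: (solves_SP_ae oO L1 a1 SP0).
  + move=> u VIu w Uw.
    have VB := ThetaB_space oO oT TO dT nT r0 beta Uw.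
    rewrite /formF -(trial_of_formb oO oT TO dT nT r0 Lf SP0 VB).
    have := energy0_formb oO oT TO dT nT r0 r1
      (spaceU_comb oO oT TO dT nT (-1) Ut (VU _ VIu)) (E _ VIu) VB.
    rewrite (formb_comb oO oT TO dT nT r0 (-1) Ut (VU _ VIu) VB) mulN1r => /eqP.
    by rewrite addrC subr_eq0 => /eqP.
Qed.
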